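(* Let $s\le t$ be positive integers and let $A$ be a commutative Noetherian ring such that the localization of $A$ at every maximal ideal is a complete intersection. Let $A[\mathbf X]=A[X_{ij}\mid 1\le i\le s,\ 1\le j\le t]$ be a polynomial ring over $A$ and let $I_s(\mathbf X)$ be the ideal of $A[\mathbf X]$ generated by the $s\times s$ minors of the $s\times t$ matrix $\mathbf X=(X_{ij})$. If $2s\le t+1$, then the determinantal ring $A[\mathbf X]/I_s(\mathbf X)$ satisfies (SAC).
   Context: All rings are commutative Noetherian with identity, not necessarily local. A ring $R$ satisfies (SAC) if for each finitely generated $R$-module $M$: whenever $\mathrm{Ext}_R^i(M,R)=0$ for all $i>0$ and $\mathrm{Ext}_R^i(M,M)=0$ for all sufficiently large $i$, one has $\mathrm{Ext}_R^i(M,M)=0$ for all $i>0$. A Noetherian local ring is a complete intersection if its completion is isomorphic to a regular local ring modulo an ideal generated by a regular sequence. *)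

(* Defs.v *)
(* Ideals are Prop-valued; boolp turns them into the boolean predicates required
   by the MathComp quotient constructions. *)
From HB Require Import structures.
From mathcomp Require Import all_boot all_order all_algebra.
From mathcomp Require Import generic_quotient ring_quotient.
From mathcomp Require Import boolp.
From mathcomp Require Import mpoly.
From mathcomp Require Import ring.

Set Implicit Arguments.
Unset Strict Implicit.
Unset Printing Implicit Defensive.

Import GRing.Theory.

Local Open Scope quotient_scope.
Local Open Scope ring_scope.

#[local] Obligation Tactic := idtac.

Record ideal (R : comPzRingType) := Ideal {
  ideal_mem :> R -> Prop;
  ideal_0 : ideal_mem 0;
  ideal_D : forall x y, ideal_mem x -> ideal_mem y -> ideal_mem (x + y);
  ideal_M : forall a x, ideal_mem x -> ideal_mem (a * x)
}.

Section Ideals.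
Variable R : comPzRingType.
Implicit Types (I J : ideal R) (S : R -> Prop) (s : seq R).

Definition ideal_sub I J : Prop := forall x, I x -> J x.
Definition ideal_eq I J : Prop := forall x, I x <-> J x.

Program Definition ideal_gen S : ideal R :=
  @Ideal R (fun x => forall J, (forall y, S y -> J y) -> J x) _ _ _.
Next Obligation. by move=> S J _; apply: ideal_0. Qed.
Next Obligation. by move=> S x y Sx Sy J SJ; apply: ideal_D; auto. Qed.
Next Obligation. by move=> S a x Sx J SJ; apply: ideal_M; auto. Qed.

Definition ideal_span s : ideal R := ideal_gen (fun x => x \in s).

Definition unit_ideal : ideal R :=
  @Ideal R (fun=> True) I (fun _ _ _ _ => I) (fun _ _ _ => I).

Definition ideal_mul I J : ideal R :=
  ideal_gen (fun z => exists x y, [/\ I x, J y & z = x * y]).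

Definition ideal_pow I n : ideal R := iter n (ideal_mul I) unit_ideal.

Definition prime_ideal I : Prop :=
  ~ I 1 /\ forall x y, I (x * y) -> I x \/ I y.

Definition maximal_ideal I : Prop :=
  ~ I 1 /\ forall J, ideal_sub I J -> ~ J 1 -> ideal_sub J I.

Lemma maximal_prime I : maximal_ideal I -> prime_ideal I.
Proof.
move=> [I1 maxI]; split=> // x y Ixy; have [Ix|nIx] := pselect (I x); first by left.
pose IX z := exists a b, I b /\ z = a * x + b.
have K0 : IX 0 by exists 0, 0; split; [exact: ideal_0 | rewrite mul0r addr0].
have KD z w : IX z -> IX w -> IX (z + w).
  move=> [a [b [Ib ->]]] [c [d [Id ->]]]; exists (a + c), (b + d).
  by split; [exact: ideal_D | rewrite mulrDl addrACA].
have KM c z : IX z -> IX (c * z).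
  move=> [a [b [Ib ->]]]; exists (c * a), (c * b).
  by split; [exact: ideal_M | rewrite mulrDr mulrA].
pose K := @Ideal R IX K0 KD KM.
have [[a [b [Ib one_eq]]]|nK1] := pselect (K 1).
  right; rewrite -[y]mulr1 one_eq mulrDr; apply: ideal_D; last exact: ideal_M.
  by rewrite mulrCA [y * x]mulrC; apply: ideal_M.
case: nIx; apply: (maxI K _ nK1).
- by move=> z Iz; exists 0, z; rewrite mul0r add0r.
- by exists 1, 0; rewrite mul1r addr0; split=> //; apply: ideal_0.
Qed.

Definition noetherian : Prop := forall I, exists s, ideal_eq I (ideal_span s).

Definition local_ring_at I : Prop :=
  maximal_ideal I /\ forall J, maximal_ideal J -> ideal_eq J I.

(* A strict chain of prime ideals of length [n], i.e. with [n.+1] terms; the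
   values [p i] for [i > n] are irrelevant. *)
Definition prime_chain (p : nat -> ideal R) (n : nat) : Prop :=
  (forall i, (i <= n)%N -> prime_ideal (p i)) /\
  (forall i, (i < n)%N ->
     ideal_sub (p i) (p i.+1) /\ ~ ideal_sub (p i.+1) (p i)).

Definition krull_dim_eq (d : nat) : Prop :=
  (exists p, prime_chain p d) /\ forall n p, prime_chain p n -> (n <= d)%N.

(* Regular: the maximal ideal is generated by [dim R] elements. *)
Definition regular_local_ring : Prop :=
  noetherian /\ exists m, local_ring_at m /\
    exists s, krull_dim_eq (size s) /\ ideal_eq m (ideal_span s).

Definition regular_sequence s : Prop :=
  ~ ideal_span s 1 /\
  forall i, (i < size s)%N -> forall y,
    ideal_span (take i s) (s`_i * y) -> ideal_span (take i s) y.

End Ideals.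

Arguments noetherian R : clear implicits.
Arguments krull_dim_eq R d : clear implicits.
Arguments regular_local_ring R : clear implicits.

Definition ring_iso (R R' : comPzRingType) : Prop :=
  exists f : {rmorphism R -> R'}, bijective f.

(* [{ideal_quot _}] is a ring only for proper ideals; here the zero ring is
   allowed, so the ring structure is put on the additive quotient directly. *)
Section Quotient.
Variables (R : comPzRingType) (I : ideal R).

Definition ideal_pred : pred R := fun x => `[< I x >].

Lemma ideal_pred_zmod : zmod_closed ideal_pred.
Proof.
split; first by apply/asboolP; exact: ideal_0.
move=> x y /asboolP Ix /asboolP Iy; apply/asboolP; apply: ideal_D => //.
by rewrite -mulN1r; apply: ideal_M.
Qed.

HB.instance Definition _ := GRing.isZmodClosed.Build R ideal_pred ideal_pred_zmod.

Definition ideal_zmod : zmodClosed R := GRing.ZmodClosed.clone R ideal_pred _.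

Definition quotient : Type := {ideal_quot ideal_zmod}.

HB.instance Definition _ := GRing.Zmodule.on quotient.
HB.instance Definition _ := EqQuotient.on quotient.

Definition quotient_one : quotient := \pi_quotient 1.
Definition quotient_mul := lift_op2 quotient *%R.

Lemma quotientE (x y : R) : (\pi_quotient x = \pi_quotient y) <-> I (x - y).
Proof.
split=> [/eqP|Ixy]; first by rewrite -Quotient.idealrBE => /asboolP.
by apply/eqP; rewrite -Quotient.idealrBE; apply/asboolP.
Qed.

Lemma pi_quotientM x y :
  quotient_mul (\pi_quotient x) (\pi_quotient y) = \pi_quotient (x * y).
Proof.
unlock quotient_mul; apply: esym; apply/quotientE; set x' := repr _; set y' := repr _.
have Ix : I (x - x') by apply/quotientE; rewrite reprK.
have Iy : I (y - y') by apply/quotientE; rewrite reprK.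
have -> : x * y - x' * y' = y * (x - x') + x' * (y - y').
  by rewrite !mulrBr addrA [y * x]mulrC [y * x']mulrC subrK.
by apply: ideal_D; apply: ideal_M.
Qed.

Lemma quotient_mulA : associative quotient_mul.
Proof.
by move=> x y z; rewrite -[x]reprK -[y]reprK -[z]reprK !pi_quotientM mulrA.
Qed.

Lemma quotient_mulC : commutative quotient_mul.
Proof. by move=> x y; rewrite -[x]reprK -[y]reprK !pi_quotientM mulrC. Qed.

Lemma quotient_mul1 : left_id quotient_one quotient_mul.
Proof. by move=> x; rewrite -[x]reprK pi_quotientM mul1r. Qed.

Lemma pi_quotientB x y : \pi_quotient (x - y) = \pi_quotient x - \pi_quotient y.
Proof. exact: (raddfB \pi_{ideal_quot ideal_zmod}). Qed.

Lemma quotient_mulDl : left_distributive quotient_mul +%R.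
Proof.
move=> x y z; rewrite -[x]reprK -[y]reprK -[z]reprK.
have piD u v : \pi_quotient (u + v) = \pi_quotient u + \pi_quotient v.
  exact: (raddfD \pi_{ideal_quot ideal_zmod}).
by rewrite -piD !pi_quotientM -piD mulrDl.
Qed.

HB.instance Definition _ := GRing.Zmodule_isComPzRing.Build quotient
  quotient_mulA quotient_mulC quotient_mul1 quotient_mulDl.

End Quotient.

Record mult_set (R : comPzRingType) := MultSet {
  mult_mem :> R -> Prop;
  mult_1 : mult_mem 1;
  mult_M : forall x y, mult_mem x -> mult_mem y -> mult_mem (x * y)
}.

Program Definition prime_compl (R : comPzRingType) (p : ideal R)
  (hp : prime_ideal p) : mult_set R := @MultSet R (fun x => ~ p x) _ _.
Next Obligation. by move=> R p []. Qed.
Next Obligation. by move=> R p [_ hp] x y /= npx npy /hp[]. Qed.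

Section Localization.
Variables (R : comPzRingType) (S : mult_set R).

Definition denominator : Type := {s : R | `[< S s >]}.
HB.instance Definition _ := SubChoice.on denominator.

Definition mk_den s (Ss : S s) : denominator := exist _ s (asboolT Ss).
Definition den (s : denominator) : R := val s.
Lemma denP s : S (den s).
Proof. by apply/asboolP; exact: (valP s). Qed.

Definition den_one : denominator := mk_den (mult_1 S).
Definition den_mul (s t : denominator) : denominator :=
  mk_den (mult_M (denP s) (denP t)).

Lemma den1 : den den_one = 1. Proof. by []. Qed.
Lemma denM s t : den (den_mul s t) = den s * den t. Proof. by []. Qed.
Local Opaque den.

Definition frac : Type := (R * denominator)%type.
HB.instance Definition _ := Choice.on frac.
Implicit Types x y z : frac.

Definition frac_rel x y : bool :=
  `[< exists2 u, S u & u * (x.1 * den y.2) = u * (y.1 * den x.2) >].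

Lemma frac_rel_equiv : equiv_class_of frac_rel.
Proof.
split=> [x|x y|y x z].
- by apply/asboolP; exists 1 => //; exact: mult_1.
- by apply/asboolP/asboolP => -[u Su e]; exists u.
- move=> /asboolP[u Su e] /asboolP[v Sv f]; apply/asboolP.
  exists (u * v * den y.2); first by do !apply: mult_M => //; exact: denP.
  have -> : u * v * den y.2 * (x.1 * den z.2) =
            v * den z.2 * (u * (x.1 * den y.2)) by ring.
  have -> : u * v * den y.2 * (z.1 * den x.2) =
            u * den x.2 * (v * (z.1 * den y.2)) by ring.
  by rewrite e -f; ring.
Qed.

Canonical frac_equiv := EquivRelPack frac_rel_equiv.
Canonical frac_encModRel := defaultEncModRel frac_rel.

Definition localization : Type := {eq_quot frac_rel}.
HB.instance Definition _ := Choice.on localization.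
HB.instance Definition _ := EqQuotient.on localization.

Definition frac_zero : frac := (0, den_one).
Definition frac_one : frac := (1, den_one).
Definition frac_opp x : frac := (- x.1, x.2).
Definition frac_add x y : frac :=
  (x.1 * den y.2 + y.1 * den x.2, den_mul x.2 y.2).
Definition frac_mul x y : frac := (x.1 * y.1, den_mul x.2 y.2).

Definition loc_zero : localization := \pi_localization frac_zero.
Definition loc_one : localization := \pi_localization frac_one.
Definition loc_opp := lift_op1 localization frac_opp.
Definition loc_add := lift_op2 localization frac_add.
Definition loc_mul := lift_op2 localization frac_mul.

Lemma localizationE x y : \pi_localization x = \pi_localization y <->
  exists2 u, S u & u * (x.1 * den y.2) = u * (y.1 * den x.2).
Proof.
split=> [/eqP|e]; first by rewrite piE => /asboolP.
by apply/eqP; rewrite piE; apply/asboolP.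
Qed.

Lemma loc_eq x y : x.1 * den y.2 = y.1 * den x.2 ->
  \pi_localization x = \pi_localization y.
Proof. by move=> e; apply/localizationE; exists 1; [exact: mult_1 | rewrite e]. Qed.

Lemma loc_reprP x : exists2 u, S u &
  u * (x.1 * den (repr (\pi_localization x)).2) =
  u * ((repr (\pi_localization x)).1 * den x.2).
Proof. by apply/localizationE; rewrite reprK. Qed.

Lemma pi_loc_opp x : loc_opp (\pi_localization x) =
  \pi_localization (frac_opp x).
Proof.
unlock loc_opp; have [u Su e] := loc_reprP x; apply/localizationE; exists u => //=.
by rewrite !mulNr !mulrN e.
Qed.

Lemma pi_loc_add x y : loc_add (\pi_localization x) (\pi_localization y) =
  \pi_localization (frac_add x y).
Proof.
unlock loc_add; have [u Su e] := loc_reprP x; have [v Sv f] := loc_reprP y.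
move: e f; set x' := repr _; set y' := repr _ => e f.
apply/localizationE; exists (u * v); first exact: mult_M.
rewrite /= !denM.
have -> : u * v * ((x'.1 * den y'.2 + y'.1 * den x'.2) * (den x.2 * den y.2)) =
  v * den y'.2 * den y.2 * (u * (x'.1 * den x.2)) +
  u * den x'.2 * den x.2 * (v * (y'.1 * den y.2)) by ring.
by rewrite -e -f; ring.
Qed.

Lemma pi_loc_mul x y : loc_mul (\pi_localization x) (\pi_localization y) =
  \pi_localization (frac_mul x y).
Proof.
unlock loc_mul; have [u Su e] := loc_reprP x; have [v Sv f] := loc_reprP y.
move: e f; set x' := repr _; set y' := repr _ => e f.
apply/localizationE; exists (u * v); first exact: mult_M.
rewrite /= !denM.
have -> : u * v * (x'.1 * y'.1 * (den x.2 * den y.2)) =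
  (u * (x'.1 * den x.2)) * (v * (y'.1 * den y.2)) by ring.
by rewrite -e -f; ring.
Qed.

Definition pi_loc := (pi_loc_opp, pi_loc_add, pi_loc_mul).

Lemma loc_addA : associative loc_add.
Proof.
move=> a b c; rewrite -[a]reprK -[b]reprK -[c]reprK !pi_loc.
by apply: loc_eq; rewrite /= ?denM ?den1; ring.
Qed.

Lemma loc_addC : commutative loc_add.
Proof.
move=> a b; rewrite -[a]reprK -[b]reprK !pi_loc.
by apply: loc_eq; rewrite /= ?denM ?den1; ring.
Qed.

Lemma loc_add0 : left_id loc_zero loc_add.
Proof.
by move=> a; rewrite -[a]reprK !pi_loc; apply: loc_eq; rewrite /= ?denM ?den1; ring.
Qed.

Lemma loc_addN : left_inverse loc_zero loc_opp loc_add.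
Proof.
by move=> a; rewrite -[a]reprK !pi_loc; apply: loc_eq; rewrite /= ?denM ?den1; ring.
Qed.

HB.instance Definition _ :=
  GRing.isZmodule.Build localization loc_addA loc_addC loc_add0 loc_addN.

Lemma loc_mulA : associative loc_mul.
Proof.
move=> a b c; rewrite -[a]reprK -[b]reprK -[c]reprK !pi_loc.
by apply: loc_eq; rewrite /= ?denM ?den1; ring.
Qed.

Lemma loc_mulC : commutative loc_mul.
Proof.
move=> a b; rewrite -[a]reprK -[b]reprK !pi_loc.
by apply: loc_eq; rewrite /= ?denM ?den1; ring.
Qed.

Lemma loc_mul1 : left_id loc_one loc_mul.
Proof.
by move=> a; rewrite -[a]reprK !pi_loc; apply: loc_eq; rewrite /= ?denM ?den1; ring.
Qed.

Lemma loc_mulDl : left_distributive loc_mul +%R.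
Proof.
move=> a b c; change (loc_mul (loc_add a b) c = loc_add (loc_mul a c) (loc_mul b c)).
rewrite -[a]reprK -[b]reprK -[c]reprK !pi_loc.
by apply: loc_eq; rewrite /= ?denM ?den1; ring.
Qed.

HB.instance Definition _ := GRing.Zmodule_isComPzRing.Build localization
  loc_mulA loc_mulC loc_mul1 loc_mulDl.

End Localization.

Definition localization_at (R : comPzRingType) (p : ideal R)
  (hp : prime_ideal p) : comPzRingType := localization (prime_compl hp).

Section Completion.
Variables (R : comPzRingType) (I : ideal R).

Definition quotient_prod : Type := forall n, quotient (ideal_pow I n).
HB.instance Definition _ := Choice.on quotient_prod.
Implicit Types x y z : quotient_prod.

Definition qprod_zero : quotient_prod := fun=> 0.
Definition qprod_one : quotient_prod := fun=> 1.
Definition qprod_opp x : quotient_prod := fun n => - x n.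
Definition qprod_add x y : quotient_prod := fun n => x n + y n.
Definition qprod_mul x y : quotient_prod := fun n => x n * y n.

Lemma qprod_addA : associative qprod_add.
Proof. by move=> x y z; apply: functional_extensionality_dep => n; apply: addrA. Qed.
Lemma qprod_addC : commutative qprod_add.
Proof. by move=> x y; apply: functional_extensionality_dep => n; apply: addrC. Qed.
Lemma qprod_add0 : left_id qprod_zero qprod_add.
Proof. by move=> x; apply: functional_extensionality_dep => n; apply: add0r. Qed.
Lemma qprod_addN : left_inverse qprod_zero qprod_opp qprod_add.
Proof. by move=> x; apply: functional_extensionality_dep => n; apply: addNr. Qed.

HB.instance Definition _ :=
  GRing.isZmodule.Build quotient_prod qprod_addA qprod_addC qprod_add0 qprod_addN.

Lemma qprod_mulA : associative qprod_mul.
Proof. by move=> x y z; apply: functional_extensionality_dep => n; apply: mulrA. Qed.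
Lemma qprod_mulC : commutative qprod_mul.
Proof. by move=> x y; apply: functional_extensionality_dep => n; apply: mulrC. Qed.
Lemma qprod_mul1 : left_id qprod_one qprod_mul.
Proof. by move=> x; apply: functional_extensionality_dep => n; apply: mul1r. Qed.
Lemma qprod_mulDl : left_distributive qprod_mul +%R.
Proof. by move=> x y z; apply: functional_extensionality_dep => n; apply: mulrDl. Qed.

HB.instance Definition _ := GRing.Zmodule_isComPzRing.Build quotient_prod
  qprod_mulA qprod_mulC qprod_mul1 qprod_mulDl.

(* The completion is the inverse limit of the rings [R / I^n]: [x n.+1] maps to
   [x n] under [R / I^n.+1 -> R / I^n] iff they have a common representative. *)
Definition coherent : pred quotient_prod := fun x =>
  `[< forall n, exists r : R,
     x n = \pi_(quotient (ideal_pow I n)) r /\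
     x n.+1 = \pi_(quotient (ideal_pow I n.+1)) r >].

Lemma coherent_subring : subring_closed coherent.
Proof.
split=> [|x y /asboolP cx /asboolP cy|x y /asboolP cx /asboolP cy];
  apply/asboolP => n; first by exists 1.
- have [[r [xr xr']] [s [ys ys']]] := (cx n, cy n); exists (r - s).
  by rewrite !pi_quotientB -xr -xr' -ys -ys'.
- have [[r [xr xr']] [s [ys ys']]] := (cx n, cy n); exists (r * s).
  by rewrite -!pi_quotientM -xr -xr' -ys -ys'.
Qed.

HB.instance Definition _ :=
  GRing.isSubringClosed.Build quotient_prod coherent coherent_subring.

Definition completion : Type := {x : quotient_prod | coherent x}.
HB.instance Definition _ := SubChoice.on completion.
HB.instance Definition _ :=
  GRing.SubChoice_isSubComPzRing.Build quotient_prod coherent completion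
    coherent_subring.

End Completion.

Definition complete_intersection (R : comPzRingType) : Prop :=
  noetherian R /\ exists m : ideal R, local_ring_at m /\
    exists Q : comPzRingType, regular_local_ring Q /\
      exists s : seq Q, regular_sequence s /\
        ring_iso (completion m) (quotient (ideal_span s)).

Section Ext.
Variable R : comPzRingType.

Definition projective (P : lmodType R) : Prop :=
  forall (X Y : lmodType R) (g : {linear X -> Y}) (f : {linear P -> Y}),
    (forall y, exists x, g x = y) ->
    exists h : {linear P -> X}, forall p, g (h p) = f p.

Definition finitely_generated (M : lmodType R) : Prop :=
  exists n (g : 'I_n -> M), forall x, exists a : 'I_n -> R,
    x = \sum_(i < n) a i *: g i.

Record projective_resolution (M : lmodType R) := ProjectiveResolution {
  res_mod : nat -> lmodType R;
  res_diff : forall n, {linear res_mod n.+1 -> res_mod n};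
  res_aug : {linear res_mod 0 -> M};
  res_projective : forall n, projective (res_mod n);
  res_aug_surj : forall x, exists y, res_aug y = x;
  res_exact0 : forall y, res_aug y = 0 <-> exists z, res_diff 0 z = y;
  res_exactS : forall n y,
    res_diff n y = 0 <-> exists z, res_diff n.+1 z = y
}.

Section Cohomology.
Variables (M N : lmodType R) (P : projective_resolution M).

Definition cocycle i (f : {linear res_mod P i -> N}) : Prop :=
  forall x, f (res_diff P i x) = 0.

Definition coboundary i : {linear res_mod P i -> N} -> Prop :=
  match i with
  | 0 => fun f => forall x, f x = 0
  | j.+1 => fun f =>
      exists g : {linear res_mod P j -> N}, forall x, f x = g (res_diff P j x)
  end.

End Cohomology.

(* [Ext^i(M, N) = 0]: the [i]-th cohomology of [Hom(P, N)] vanishes, where [P]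
   is a projective resolution of [M]; the choice of [P] is immaterial. *)
Definition Ext_eq0 i (M N : lmodType R) : Prop :=
  exists P : projective_resolution M,
    forall f : {linear res_mod P i -> N}, cocycle f -> coboundary f.

Definition SAC : Prop := forall M : lmodType R, finitely_generated M ->
  (forall i, (0 < i)%N -> Ext_eq0 i M R^o) ->
  (exists n, forall i, (n <= i)%N -> Ext_eq0 i M M) ->
  forall i, (0 < i)%N -> Ext_eq0 i M M.

End Ext.

Arguments SAC R : clear implicits.

Section Determinantal.

(* [d] is a [k]-minor of [X]: rows [f 0 < ... < f (k-1)], columns
   [g 0 < ... < g (k-1)]. *)
Definition minor_of (R : comPzRingType) (s t k : nat) (X : 'M[R]_(s, t))
  (d : R) : Prop :=
  exists (f : 'I_k -> 'I_s) (g : 'I_k -> 'I_t),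
    [/\ {homo f : i j / (i < j)%N}, {homo g : i j / (i < j)%N}
      & d = \det (mxsub f g X)].

Variable A : comNzRingType.

(* [mxvec_index] is the bijection ['I_s * 'I_t -> 'I_(s * t)] numbering the
   indeterminates. *)
Definition generic_mx (s t : nat) : 'M[{mpoly A[s * t]}]_(s, t) :=
  \matrix_(i < s, j < t) 'X_(mxvec_index i j).

Definition determinantal_ideal (s t k : nat) : ideal {mpoly A[s * t]} :=
  ideal_gen (minor_of k (generic_mx s t)).

Definition determinantal_ring (s t k : nat) : comPzRingType :=
  quotient (determinantal_ideal s t k).

End Determinantal.

(* Main.v *)
(** (SAC) holds in the strong form that [M] itself is projective. Projectivity of [M] can
    be tested after the faithfully flat base changes from [A] to the completions of its
    localizations, so [A] becomes a ring [K] presented by a regular ring [Q] of finite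
    global dimension modulo a regular sequence. Where an entry of [X] is invertible, a
    Schur complement replaces [(s, t)] by [(s - 1, t - 1)], which preserves [2 s <= t + 1];
    by induction the entries may be assumed to lie in the Jacobson radical. With
    [n = t - s + 1], the linear forms comparing [X] with a Toeplitz matrix in [n] variables
    [y] are then a regular sequence modulo [I_s], because the maximal minors are linearly
    independent, and modulo these forms [I_s] becomes [(y)^s]. The graded pieces of
    [R / (y)^s] for the powers of [(y)] are free over the complete intersection [R / (y)],
    and [s <= n] makes their ranks grow so fast that comparing the lengths of the groups
    [Ext^i(M, M / (y)^k M)] at a minimal prime of their support forces
    [Ext^i(M, M / y M) = 0] for large [i]. Over a complete intersection this makes
    [M / y M], and hence [M], projective. *)

From HB Require Import structures.
Require Import Defs.
From mathcomp Require Import all_boot all_order all_algebra.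
From mathcomp Require Import fingroup perm algC generic_quotient ring_quotient boolp mpoly ring zify.

Set Implicit Arguments.
Unset Strict Implicit.
Unset Printing Implicit Defensive.

Import GRing.Theory.
Local Open Scope quotient_scope.
Local Open Scope ring_scope.

(** * Matrices over a ring as presentations of modules *)

(** A module is a matrix up to its row space, a resolution is a sequence of matrices, and flatness
    is a statement on linear equations; every passage between rings is then about solvability of
    linear systems. The bound [2 s <= t + 1] says [s <= n] and enters through one count: in [n]
    variables there are [C(n + s - 2, n)] monomials of degree below [s - 1] and
    [C(n + s - 2, n - 1)] of degree [s - 1], and the latter are more numerous exactly when [s <= n].
    As Ext(M, M) vanishes, copies of Ext^(i+1)(M, M / y M) indexed by the second set are covered by
    Ext^i(M, M / (y)^(s-1) M), which is built from copies of Ext^i(M, M / y M) indexed by the first: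
    the length would drop forever. Independence of the minors is an interpolation statement. For one
    special matrix the minors vanish at [C(t, n)] points, one for each factor of degree [n] of a
    split polynomial of degree [t]; this is the number of monomials of degree below [s] in [y], and
    the points interpolate. Hensel lifting spreads this to all matrices over the algebraic numbers;
    integrality of normal forms carries it to every [A]. *)

Lemma addmxE (R : comPzRingType) m n (A B : 'M[R]_(m, n)) i j :
  (A + B) i j = A i j + B i j.
Proof. by rewrite mxE. Qed.

Lemma oppmxE (R : comPzRingType) m n (A : 'M[R]_(m, n)) i j : (- A) i j = - A i j.
Proof. by rewrite mxE. Qed.

Lemma zeromxE (R : comPzRingType) m n i j : (0 : 'M[R]_(m, n)) i j = 0.
Proof. by rewrite mxE. Qed.

Lemma scalemxE (R : comPzRingType) m n a (A : 'M[R]_(m, n)) i j :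
  (a *: A) i j = a * A i j.
Proof. by rewrite mxE. Qed.

(* Identities between linear combinations of matrices, products being atoms. *)
Ltac mxlin := apply/matrixP => ? ?; rewrite ?(addmxE, oppmxE, zeromxE, scalemxE); ring.

Section MatrixExactness.
Variable R : comPzRingType.

(** Matrices act on row vectors from the right: [D] presents the rows modulo its row space, and
    [inrows X D] says that the rows of [X] vanish in that module. *)
Definition inrows k m n (X : 'M[R]_(k, n)) (D : 'M[R]_(m, n)) : Prop :=
  exists W : 'M_(k, m), X = W *m D.

Definition exactm p m n (D' : 'M[R]_(p, m)) (D : 'M[R]_(m, n)) : Prop :=
  D' *m D = 0 /\ forall v : 'rV_m, v *m D = 0 -> inrows v D'.

(* [coker D] is projective. *)
Definition splitm m n (D : 'M[R]_(m, n)) : Prop := exists E, D *m E *m D = D.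

Lemma row_choice (T : Type) k m (P : 'I_k -> 'rV[T]_m -> Prop) :
  (forall i, exists w, P i w) -> exists W : 'M[T]_(k, m), forall i, P i (row i W).
Proof.
move=> h; have [f hf] := choice h.
exists (\matrix_(i, j) f i 0 j) => i.
suff -> : row i (\matrix_(i, j) f i 0 j) = f i by [].
by apply/rowP => j; rewrite !mxE.
Qed.

Lemma inrowsP k m n (X : 'M[R]_(k, n)) (D : 'M[R]_(m, n)) :
  (forall i, inrows (row i X) D) -> inrows X D.
Proof.
move=> h; have [W hW] := row_choice h.
by exists W; apply/row_matrixP => i; rewrite row_mul.
Qed.

Lemma inrows_row k m n (X : 'M[R]_(k, n)) (D : 'M[R]_(m, n)) i :
  inrows X D -> inrows (row i X) D.
Proof. by case=> W ->; exists (row i W); rewrite row_mul. Qed.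

Lemma inrows0 k m n (D : 'M[R]_(m, n)) : inrows (0 : 'M_(k, n)) D.
Proof. by exists 0; rewrite mul0mx. Qed.

Lemma inrowsD k m n (X Y : 'M[R]_(k, n)) (D : 'M[R]_(m, n)) :
  inrows X D -> inrows Y D -> inrows (X + Y) D.
Proof. by case=> W -> [V ->]; exists (W + V); rewrite mulmxDl. Qed.

Lemma inrowsN k m n (X : 'M[R]_(k, n)) (D : 'M[R]_(m, n)) :
  inrows X D -> inrows (- X) D.
Proof. by case=> W ->; exists (- W); rewrite mulNmx. Qed.

Lemma inrowsZ k m n a (X : 'M[R]_(k, n)) (D : 'M[R]_(m, n)) :
  inrows X D -> inrows (a *: X) D.
Proof. by case=> W ->; exists (a *: W); rewrite -scalemxAl. Qed.

Lemma inrowsM l k m n (Y : 'M[R]_(l, k)) (X : 'M[R]_(k, n)) (D : 'M[R]_(m, n)) :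
  inrows X D -> inrows (Y *m X) D.
Proof. by case=> W ->; exists (Y *m W); rewrite mulmxA. Qed.

Lemma inrows_mul l m n (Y : 'M[R]_(l, m)) (D : 'M[R]_(m, n)) : inrows (Y *m D) D.
Proof. by exists Y. Qed.

Lemma inrows_refl m n (D : 'M[R]_(m, n)) : inrows D D.
Proof. by exists 1%:M; rewrite mul1mx. Qed.

Lemma inrows_trans k m l n (X : 'M[R]_(k, n)) (D : 'M[R]_(m, n)) (D' : 'M[R]_(l, n)) :
  inrows X D -> inrows D D' -> inrows X D'.
Proof. by case=> W -> hD; apply: inrowsM. Qed.

Lemma exact_mul0 p m n (D' : 'M[R]_(p, m)) (D : 'M[R]_(m, n)) :
  exactm D' D -> D' *m D = 0.
Proof. by case. Qed.

Lemma exact_inrows p m n k (D' : 'M[R]_(p, m)) (D : 'M[R]_(m, n)) (X : 'M_(k, m)) :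
  exactm D' D -> X *m D = 0 -> inrows X D'.
Proof.
move=> [_ h] XD; apply: inrowsP => i; apply: h.
by rewrite -row_mul XD; apply/rowP => j; rewrite !mxE.
Qed.

Lemma inrows_mul0 p m n k (D' : 'M[R]_(p, m)) (D : 'M[R]_(m, n)) (X : 'M_(k, m)) :
  exactm D' D -> inrows X D' -> X *m D = 0.
Proof. by case=> e _ [W ->]; rewrite -mulmxA e mulmx0. Qed.

Record cpx := Cpx {
  dim : nat -> nat;
  dif : forall i, 'M[R]_(dim i.+1, dim i)
}.

Definition exactc (C : cpx) := forall i, exactm (dif C i.+1) (dif C i).

Definition shift (C : cpx) : cpx :=
  @Cpx (fun i => dim C i.+1) (fun i => dif C i.+1).

Lemma exact_shift C : exactc C -> exactc (shift C).
Proof. by move=> h i; apply: (h i.+1). Qed.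

(* For exact [C], [ext0 C i E] says [Ext^(i+1)(coker d_0, coker E) = 0] and
   [extR C i] says [Ext^(i+1)(coker d_0, R) = 0]. *)
Definition ext0 (C : cpx) i e q (E : 'M[R]_(e, q)) : Prop :=
  forall f : 'M_(dim C i.+1, q), inrows (dif C i.+1 *m f) E ->
    exists g, inrows (f - dif C i *m g) E.

Definition extR (C : cpx) i : Prop :=
  forall q (f : 'M_(dim C i.+1, q)), dif C i.+1 *m f = 0 ->
    exists g, f = dif C i *m g.

(* (SAC) for [coker d_0], with the conclusion strengthened to projectivity. *)
Definition strongSAC : Prop := forall C : cpx, exactc C -> (forall i, extR C i) ->
  (exists n, forall i, (n <= i)%N -> ext0 C i (dif C 0)) -> splitm (dif C 0).

(** Finite projective dimension as soon as the high self-extensions vanish, with no assumption on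
    the dual: this is the form that passes from [Q] to [Q / f]. *)
Definition eventuallySplit : Prop := forall C : cpx, exactc C ->
  (exists n, forall i, (n <= i)%N -> ext0 C i (dif C 0)) ->
  exists d, splitm (dif C d).

Definition injdim_le (d : nat) : Prop := forall C : cpx, exactc C ->
  forall i, (d <= i)%N -> extR C i.

Definition gldim_le (d : nat) : Prop := forall C : cpx, exactc C -> splitm (dif C d).

Definition cons_cpx n (C : cpx) (D : 'M[R]_(dim C 0, n)) : cpx :=
  @Cpx (fun i => if i is j.+1 then dim C j else n)
    (fun i => match i return 'M[R]_(dim C i, if i is j.+1 then dim C j else n) with
              | 0 => D | j.+1 => dif C j end).

Lemma exact_cons n (C : cpx) (D : 'M[R]_(dim C 0, n)) :
  exactc C -> exactm (dif C 0) D -> exactc (cons_cpx D).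
Proof. by move=> h h0 [|i]; [exact: h0 | exact: h]. Qed.

(** The defect [1 - D E] kills [D], hence factors through [D']; this gives the contracting homotopy
    [1 = D E + H D'], which in turn splits [D']. *)
Lemma splitm_next p m n (D' : 'M[R]_(p, m)) (D : 'M[R]_(m, n)) :
  exactm D' D -> splitm D ->
  splitm D' /\ exists E H, 1%:M = D *m E + H *m D'.
Proof.
move=> ex [E hE].
have [H hH] : inrows (1%:M - D *m E) D'.
  by apply: exact_inrows ex _; rewrite mulmxBl mul1mx hE subrr.
split; last by exists E, H; rewrite -hH addrC subrK.
by exists H; rewrite -mulmxA -hH mulmxBr mulmx1 mulmxA (exact_mul0 ex) mul0mx subr0.
Qed.

Lemma split_dif C d : exactc C -> splitm (dif C d) ->
  forall i, (d <= i)%N -> splitm (dif C i).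
Proof.
move=> ex h i /subnK <-; elim: (i - d)%N => // k IH.
by have [] := splitm_next (ex (k + d)%N) IH.
Qed.

Lemma split_ext0 C d : exactc C -> splitm (dif C d) ->
  forall i e q (E : 'M_(e, q)), (d <= i)%N -> ext0 C i E.
Proof.
move=> ex h i e q E di f hf.
have [_ [G [H hG]]] := splitm_next (ex i) (split_dif ex h di).
exists (G *m f); rewrite -{1}[f]mul1mx hG mulmxDl mulmxA addrAC addrN add0r.
by rewrite -mulmxA; apply: inrowsM.
Qed.

(** The coefficients [coker d_(i+1)] are the image of [d_i], and the identity matrix is the
    tautological cocycle with values there; bounding it amounts to a retraction onto that image. *)
Lemma ext0_split C i : exactc C -> ext0 C i (dif C i.+1) -> splitm (dif C i).
Proof.
move=> ex h; have [|g [W hg]] := h 1%:M; first by rewrite mulmx1; apply: inrows_refl.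
exists g; apply/eqP; rewrite eq_sym -subr_eq0 -{1}[dif C i]mul1mx -mulmxBl hg.
by rewrite -mulmxA (exact_mul0 (ex i)) mulmx0.
Qed.

Lemma gldim_ext0 d C i e q (E : 'M_(e, q)) :
  gldim_le d -> exactc C -> (d <= i)%N -> ext0 C i E.
Proof. by move=> h ex di; apply: (split_ext0 ex (h C ex)). Qed.

Lemma gldim_injdim d : gldim_le d -> injdim_le d.
Proof.
move=> h C ex i di q f hf.
have [|g [W]] := gldim_ext0 (E := (0 : 'M_(0, q))) h ex di (f := f).
  by rewrite hf; apply: inrows0.
by rewrite mulmx0 => /eqP; rewrite subr_eq0 => /eqP ->; exists g.
Qed.

(* A splitting of [d_(i+1)] propagates down as long as the dual complex is exact. *)
Lemma split_down C i : exactc C -> extR C i -> splitm (dif C i.+1) -> splitm (dif C i).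
Proof.
move=> ex h [E hE].
have [|g hg] := h _ (1%:M - E *m dif C i.+1).
  by rewrite mulmxBr mulmx1 mulmxA hE subrr.
by exists g; rewrite -hg mulmxBl mul1mx -mulmxA (exact_mul0 (ex i)) mulmx0 subr0.
Qed.

Lemma split_down0 C d : exactc C -> (forall i, extR C i) ->
  splitm (dif C d) -> splitm (dif C 0).
Proof. by move=> ex h; elim: d => // d IH /(split_down ex (h d)). Qed.

(* If [c : C1 -> C2] is a chain map inducing [0] on cokernels, it is null-homotopic. *)
Lemma chain_null (C1 C2 : cpx) (c : forall i, 'M[R]_(dim C1 i, dim C2 i)) :
  exactc C2 -> (forall i, dif C1 i.+1 *m dif C1 i = 0) ->
  (forall i, dif C1 i *m c i = c i.+1 *m dif C2 i) ->
  forall (k : nat) (d : 'M[R]_(dim C1 0, k)) (h0 : 'M_(k, dim C2 0)) (h1 : 'M_(_, _)),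
  dif C1 0 *m d = 0 -> c 0%N = d *m h0 + h1 *m dif C2 0 ->
  forall i, exists h h', c i.+1 = dif C1 i *m h + h' *m dif C2 i.+1.
Proof.
move=> ex dd cm k d h0 h1 dd0 c0.
have step i m (D : 'M_(dim C1 i, m)) (h : 'M_(m, dim C2 i)) h' :
    dif C1 i *m D = 0 -> c i = D *m h + h' *m dif C2 i ->
    exists h0 h'0, c i.+1 = dif C1 i *m h0 + h'0 *m dif C2 i.+1.
  move=> D0 e; have [W hW] : inrows (c i.+1 - dif C1 i *m h') (dif C2 i.+1).
    apply: exact_inrows (ex i) _.
    by rewrite mulmxBl -cm e mulmxDr mulmxA D0 mul0mx add0r mulmxA subrr.
  by exists h', W; rewrite -hW addrC subrK.
elim=> [|i [h [h' IH]]]; first exact: step dd0 c0.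
exact: step (dd i) IH.
Qed.

Lemma chain_lift (C1 C2 : cpx) (u0 : 'M[R]_(dim C1 0, dim C2 0)) :
  exactc C2 -> (forall i, dif C1 i.+1 *m dif C1 i = 0) ->
  inrows (dif C1 0 *m u0) (dif C2 0) ->
  exists c : forall i, 'M[R]_(dim C1 i, dim C2 i), c 0%N = u0 /\
    forall i, dif C1 i *m c i = c i.+1 *m dif C2 i.
Proof.
move=> ex dd h0.
(* Each choice depends on the previous one, so a map that can be continued is carried as an element
   of a sigma type. *)
pose good i (u : 'M[R]_(dim C1 i, dim C2 i)) := inrows (dif C1 i *m u) (dif C2 i).
have step i (u : {u | good i u}) : exists v : {v | good i.+1 v},
    dif C1 i *m sval u = sval v *m dif C2 i.
  case: u => u [v hv] /=.
  suff gv : good i.+1 v by exists (exist _ v gv).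
  apply: exact_inrows (ex i) _.
  by rewrite -mulmxA -hv mulmxA dd mul0mx.
pose F i := projT1 (choice (step i)); have hF i := projT2 (choice (step i)).
pose s := nat_rect (fun i => {u | good i u}) (exist _ u0 h0) F.
by exists (fun i => sval (s i)); split=> // i; apply: hF.
Qed.

(* [C] and [C'] resolve isomorphic modules, so they compute the same [Ext]. *)
Lemma ext0_compare (C C' : cpx) (u0 : 'M[R]_(dim C 0, dim C' 0)) v0 :
  exactc C -> exactc C' ->
  inrows (dif C 0 *m u0) (dif C' 0) -> inrows (dif C' 0 *m v0) (dif C 0) ->
  inrows (u0 *m v0 - 1%:M) (dif C 0) ->
  forall i e q (E : 'M_(e, q)), ext0 C' i E -> ext0 C i E.
Proof.
move=> ex ex' hu hv huv i e q E ext' f hf.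
have [u [eu cu]] := chain_lift ex' (fun i => (ex i).1) hu.
have [v [ev cv]] := chain_lift ex (fun i => (ex' i).1) hv.
have [h1 hh1] := huv.
have cm j : dif C j *m (u j *m v j - 1%:M) = (u j.+1 *m v j.+1 - 1%:M) *m dif C j.
  by rewrite mulmxBr mulmxBl mulmxA cu -!mulmxA cv mul1mx mulmx1.
have [] := chain_null ex (fun i => (ex i).1) cm (k := 0) (d := 0) (h0 := 0) (h1 := h1) _ _ i.
- by rewrite mulmx0.
- by rewrite mulmx0 add0r eu ev hh1.
move=> h [h' hh].
have [|g [W hW]] := ext' (v i.+1 *m f).
  by rewrite mulmxA cv -mulmxA; apply: inrowsM.
exists (u i *m g - h *m f).
have -> : f - dif C i *m (u i *m g - h *m f) =
   u i.+1 *m (v i.+1 *m f - dif C' i *m g) - h' *m (dif C i.+1 *m f).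
  have := congr1 (mulmx^~ f) hh; rewrite mulmxBl mulmxDl mul1mx => e1.
  rewrite !mulmxBr [u _ *m (dif _ _ *m _)]mulmxA -cu [h' *m _]mulmxA.
  rewrite [u i.+1 *m (v i.+1 *m f)]mulmxA -[u i.+1 *m v i.+1 *m f](subrK f) e1.
  by rewrite !mulmxA; mxlin.
by rewrite hW; apply: inrowsD; [apply/inrowsM/inrows_mul | apply/inrowsN/inrowsM].
Qed.

End MatrixExactness.

(** * Noetherian rings *)

Section Noetherian.
Variable R : comPzRingType.

Record submod (V : lmodType R) := Submod {
  sub_mem :> V -> Prop;
  sub_0 : sub_mem 0;
  sub_D : forall x y, sub_mem x -> sub_mem y -> sub_mem (x + y);
  sub_Z : forall a x, sub_mem x -> sub_mem (a *: x)
}.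

Lemma sub_N (V : lmodType R) (P : submod V) x : P x -> P (- x).
Proof. by rewrite -scaleN1r; apply: sub_Z. Qed.

Lemma sub_B (V : lmodType R) (P : submod V) x y : P x -> P y -> P (x - y).
Proof. by move=> Px Py; apply: sub_D => //; apply: sub_N. Qed.

Lemma sub_sum (V : lmodType R) (P : submod V) (I : Type) (r : seq I) (Q : pred I) F :
  (forall i, Q i -> P (F i)) -> P (\sum_(i <- r | Q i) F i).
Proof. by move=> h; elim/big_ind: _; [exact: sub_0 | exact: sub_D |]. Qed.

Definition lspan (V : lmodType R) n (g : 'I_n -> V) (x : V) : Prop :=
  exists a : 'I_n -> R, x = \sum_i a i *: g i.

Lemma lspan0 (V : lmodType R) n (g : 'I_n -> V) : lspan g 0.
Proof. by exists (fun=> 0); rewrite big1 // => i _; rewrite scale0r. Qed.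

Lemma lspanD (V : lmodType R) n (g : 'I_n -> V) x y :
  lspan g x -> lspan g y -> lspan g (x + y).
Proof.
move=> [a ->] [b ->]; exists (fun i => a i + b i).
by rewrite -big_split; apply: eq_bigr => i _; rewrite scalerDl.
Qed.

Lemma lspanZ (V : lmodType R) n (g : 'I_n -> V) c x : lspan g x -> lspan g (c *: x).
Proof.
move=> [a ->]; exists (fun i => c * a i).
by rewrite scaler_sumr; apply: eq_bigr => i _; rewrite scalerA.
Qed.

Lemma lspan_gen (V : lmodType R) n (g : 'I_n -> V) i : lspan g (g i).
Proof.
exists (fun j => (j == i)%:R); rewrite (bigD1 i) //= eqxx scale1r.
by rewrite big1 ?addr0 // => j /negbTE ->; rewrite scale0r.
Qed.

Definition fgsub (V : lmodType R) (P : submod V) : Prop :=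
  exists n (g : 'I_n -> V), (forall i, P (g i)) /\ forall x, P x -> lspan g x.

Lemma ideal_N (I : ideal R) x : I x -> I (- x).
Proof. by rewrite -mulN1r; apply: ideal_M. Qed.

Lemma ideal_B (I : ideal R) x y : I x -> I y -> I (x - y).
Proof. by move=> Ix Iy; apply: ideal_D => //; apply: ideal_N. Qed.

Lemma ideal_Mr (I : ideal R) x a : I x -> I (x * a).
Proof. by rewrite mulrC; apply: ideal_M. Qed.

Lemma ideal_sum (I : ideal R) (J : Type) (r : seq J) (Q : pred J) F :
  (forall i, Q i -> I (F i)) -> I (\sum_(i <- r | Q i) F i).
Proof. by move=> h; elim/big_ind: _; [exact: ideal_0 | exact: ideal_D |]. Qed.

Lemma ideal_spanE (s : seq R) x :
  ideal_span s x <-> exists a : 'I_(size s) -> R, x = \sum_i a i * s`_i.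
Proof.
split=> [h|[a ->] J sJ].
  apply: (h (@Ideal R (fun x => exists a : 'I_(size s) -> R, x = \sum_i a i * s`_i)
    (lspan0 (V := R^o) _) (lspanD (V := R^o) (g := _)) (lspanZ (V := R^o) (g := _)))).
  move=> y ys /=; have lt : (index y s < size s)%N by rewrite index_mem.
  have := lspan_gen (V := R^o) (fun i : 'I_(size s) => s`_i) (Ordinal lt).
  by rewrite /= nth_index.
by apply: ideal_sum => i _; apply/ideal_M/sJ/mem_nth.
Qed.

Lemma ideal_span_mem (s : seq R) x : x \in s -> ideal_span s x.
Proof. by move=> xs J; apply. Qed.

Lemma ideal_span_sub (s : seq R) (J : ideal R) :
  (forall x, x \in s -> J x) -> ideal_sub (ideal_span s) J.
Proof. by move=> h x; apply. Qed.

Lemma ideal_gen_sub (S : R -> Prop) (J : ideal R) :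
  (forall x, S x -> J x) -> ideal_sub (ideal_gen S) J.
Proof. by move=> h x; apply. Qed.

Hypothesis noeth : noetherian R.

(** Induction on [n]: the coefficients that the last generator takes on [P] form an ideal;
    subtracting lifts of its finitely many generators brings an element of [P] into the span of the
    first generators. *)
Lemma noeth_fgsub (V : lmodType R) n (g : 'I_n -> V) (P : submod V) :
  (forall x, P x -> lspan g x) -> fgsub P.
Proof.
elim: n g P => [|n IH] g P hP.
  by exists 0, g; split=> [[]|] //.
pose gl i := g (widen_ord (leqnSn n) i).
pose I0 a := exists b : 'I_n -> R, P (a *: g ord_max + \sum_i b i *: gl i).
have I00 : I0 0.
  exists (fun=> 0); rewrite scale0r add0r big1 => [|i _]; first exact: sub_0.
  by rewrite scale0r.
have I0D x y : I0 x -> I0 y -> I0 (x + y).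
  move=> [b Pb] [c Pc]; exists (fun i => b i + c i).
  have -> : (x + y) *: g ord_max + \sum_i (b i + c i) *: gl i =
    (x *: g ord_max + \sum_i b i *: gl i) + (y *: g ord_max + \sum_i c i *: gl i).
    rewrite scalerDl [RHS]addrACA; congr (_ + _).
    by rewrite -big_split; apply: eq_bigr => i _; rewrite scalerDl.
  exact: sub_D.
have I0Z a x : I0 x -> I0 (a * x).
  move=> [b Pb]; exists (fun i => a * b i).
  have -> : (a * x) *: g ord_max + \sum_i (a * b i) *: gl i =
    a *: (x *: g ord_max + \sum_i b i *: gl i).
    rewrite scalerDr scalerA scaler_sumr; congr (_ + _).
    by apply: eq_bigr => i _; rewrite scalerA.
  exact: sub_Z.
have [s hs] := noeth (Ideal I00 I0D I0Z).
have hsl (l : 'I_(size s)) : exists p, P p /\ exists b : 'I_n -> R,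
    p = s`_l *: g ord_max + \sum_i b i *: gl i.
  have [b Pb] : I0 s`_l by apply/hs/ideal_span_mem/mem_nth.
  by exists (s`_l *: g ord_max + \sum_i b i *: gl i); split => //; exists b.
have [p hp] := choice hsl.
have P'D x y : (P x /\ lspan gl x) -> (P y /\ lspan gl y) -> P (x + y) /\ lspan gl (x + y).
  by move=> [? ?] [? ?]; split; [apply: sub_D | apply: lspanD].
have P'Z a x : (P x /\ lspan gl x) -> P (a *: x) /\ lspan gl (a *: x).
  by move=> [? ?]; split; [apply: sub_Z | apply: lspanZ].
have [k [h [Ph hh]]] := IH gl (Submod (conj (sub_0 P) (lspan0 gl)) P'D P'Z) (fun _ => @proj2 _ _).
pose G (j : 'I_(size s + k)) := match split j with inl l => p l | inr i => h i end.
exists (size s + k)%N, G; split=> [j|x Px].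
  by rewrite /G; case: (split j) => l; [case: (hp l) | case: (Ph l)].
have [a xE] := hP _ Px.
have I0x : I0 (a ord_max).
  exists (fun i => a (widen_ord (leqnSn n) i)).
  by have := Px; rewrite {1}xE big_ord_recr addrC.
have [c cE] := (ideal_spanE _ _).1 ((hs _).1 I0x).
pose y := x - \sum_l c l *: p l.
have [b bE] : lspan h y.
  apply: hh; split; first by apply: sub_B => //; apply: sub_sum => l _; apply/sub_Z; case: (hp l).
  have [b hb] := choice (fun l => (hp l).2).
  have -> : y = \sum_i a (widen_ord (leqnSn n) i) *: gl i -
      \sum_l c l *: \sum_i b l i *: gl i.
    rewrite /y xE big_ord_recr /= cE scaler_suml -addrA; congr (_ + _).
    rewrite -!sumrN -big_split; apply: eq_bigr => l _ /=.
    by rewrite hb scalerDr opprD scalerA addrA subrr add0r.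
  apply: lspanD; first by exists (fun i => a (widen_ord (leqnSn n) i)).
  rewrite -scaleN1r; apply: lspanZ; elim/big_ind: _ => [||l _]; [exact: lspan0|exact: lspanD|].
  by apply: lspanZ; exists (b l).
exists (fun j => match split j with inl l => c l | inr i => b i end).
rewrite big_split_ord /= -[x](subrK (\sum_l c l *: p l)) -/y bE addrC.
by congr (_ + _); apply: eq_bigr => i _; rewrite /G ?(unsplitK (inl i)) ?(unsplitK (inr i)).
Qed.

Lemma lspan_rV m (v : 'rV[R]_m) : lspan (fun i => delta_mx 0 i) v.
Proof. by exists (fun i => v 0 i); rewrite {1}[v]row_sum_delta. Qed.

Lemma noeth_rV m (P : submod 'rV[R]_m) : exists k (D : 'M[R]_(k, m)),
  forall v, P v <-> inrows v D.
Proof.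
have [k [g [Pg hg]]] := noeth_fgsub (g := fun i : 'I_m => delta_mx 0 i) (P := P) (fun x _ => lspan_rV x).
have e i : row i (\matrix_(i, j) g i 0 j) = g i by apply/rowP => j; rewrite !mxE.
exists k, (\matrix_(i, j) g i 0 j) => v; split=> [/hg [a ->]|[W ->]].
  exists (\row_i a i); rewrite mulmx_sum_row; apply: eq_bigr => i _.
  by rewrite e mxE.
by rewrite mulmx_sum_row; apply: sub_sum => i _; rewrite e; apply: sub_Z.
Qed.

Lemma syz_exists m n (D : 'M[R]_(m, n)) : exists p, exists D' : 'M[R]_(p, m), exactm D' D.
Proof.
have P0 : (0 : 'rV[R]_m) *m D = 0 by rewrite mul0mx.
have PD (x y : 'rV[R]_m) : x *m D = 0 -> y *m D = 0 -> (x + y) *m D = 0.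
  by move=> ex ey; rewrite mulmxDl ex ey addr0.
have PZ a (x : 'rV[R]_m) : x *m D = 0 -> (a *: x) *m D = 0.
  by move=> ex; rewrite -scalemxAl ex scaler0.
have [k [D' hD']] := noeth_rV (Submod P0 PD PZ).
exists k, D'; split=> [|v /hD' //]; apply/row_matrixP => i; rewrite row_mul row0.
by apply/hD'/inrows_row/inrows_refl.
Qed.

Definition syz m n (D : 'M[R]_(m, n)) : {p & 'M[R]_(p, m)} :=
  let: exist p h := cid (syz_exists D) in existT _ p (sval (cid h)).

Lemma syz_exact m n (D : 'M[R]_(m, n)) : exactm (projT2 (syz D)) D.
Proof. by rewrite /syz; case: (cid _) => p h /=; apply: (svalP (cid h)). Qed.

Record stage := Stage { st_r : nat; st_c : nat; st_m : 'M[R]_(st_r, st_c) }.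

Definition next (s : stage) : stage := Stage (projT2 (syz (st_m s))).

Definition resol m n (D : 'M[R]_(m, n)) : cpx R :=
  @Cpx R (fun i => st_c (iter i next (Stage D))) (fun i => st_m (iter i next (Stage D))).

Lemma resol_exact m n (D : 'M[R]_(m, n)) : exactc (resol D).
Proof. by move=> i; apply: syz_exact. Qed.

Lemma noeth_max (Q : ideal R -> Prop) I : Q I -> exists J, [/\ Q J, ideal_sub I J &
  forall K, Q K -> ideal_sub J K -> ideal_sub K J].
Proof.
move=> QI; apply: contrapT => no.
have step (J : {J | Q J /\ ideal_sub I J}) : exists K : {J | Q J /\ ideal_sub I J},
    ideal_sub (sval J) (sval K) /\ ~ ideal_sub (sval K) (sval J).
  case: J => J [QJ IJ] /=; apply: contrapT => noK; apply: no; exists J; split=> // K QK JK.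
  apply: contrapT => nKJ; apply: noK.
  by exists (exist _ K (conj QK (fun x Ix => JK x (IJ x Ix)))).
have [f hf] := choice step.
pose J i := sval (iter i f (exist _ I (conj QI (fun x h => h)))).
have Jsub i j : (i <= j)%N -> ideal_sub (J i) (J j).
  move=> /subnK <-; elim: (j - i)%N => // k IH x /IH.
  by rewrite addSn /J iterS; apply: (hf _).1.
pose U x := exists i, J i x.
have U0 : U 0 by exists 0; apply: ideal_0.
have UD x y : U x -> U y -> U (x + y).
  move=> [i ix] [j jy]; exists (maxn i j); apply: ideal_D.
    by apply: Jsub ix; apply: leq_maxl.
  by apply: Jsub jy; apply: leq_maxr.
have UM a x : U x -> U (a * x) by move=> [i ix]; exists i; apply: ideal_M.
have [s hs] := noeth (Ideal U0 UD UM).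
have [N hN] : exists N, forall x, x \in s -> J N x.
  have : forall x, x \in s -> U x by move=> x /ideal_span_mem /hs.
  elim: (s) => [|x r IH] h; first by exists 0.
  have [|N hN] := IH; first by move=> y yr; apply: h; rewrite inE yr orbT.
  have [i ix] := h x (mem_head _ _).
  exists (maxn i N) => y; rewrite inE => /orP[/eqP ->|/hN].
    by apply: Jsub ix; apply: leq_maxl.
  by apply: Jsub; apply: leq_maxr.
apply: (hf (iter N f (exist _ I (conj QI (fun x h => h))))).2 => x xJ.
have : U x by exists N.+1.
by move=> /hs; apply: ideal_span_sub hN x.
Qed.

End Noetherian.

Lemma noeth_surj (R R' : comPzRingType) (f : {rmorphism R -> R'}) :
  (forall y, exists x, f x = y) -> noetherian R -> noetherian R'.
Proof.
move=> surj nR I.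
have I0 : I (f 0) by rewrite rmorph0; apply: ideal_0.
have ID x y : I (f x) -> I (f y) -> I (f (x + y)) by rewrite rmorphD; apply: ideal_D.
have IM a x : I (f x) -> I (f (a * x)) by rewrite rmorphM; apply: ideal_M.
have [s hs] := nR (Ideal I0 ID IM); exists (map f s) => y; split.
  have [x <-] := surj y => /hs /ideal_spanE [a ->]; rewrite rmorph_sum.
  apply: ideal_sum => i _; rewrite rmorphM; apply/ideal_M/ideal_span_mem/map_f.
  exact: mem_nth.
by apply: ideal_span_sub => z /mapP [x xs ->]; apply/hs/ideal_span_mem.
Qed.

(** * Flat base change and localization *)

Lemma surj_lift (R R' S : comPzRingType) (p : {rmorphism R -> R'}) (f : {rmorphism R -> S}) :
  (forall y, exists x, p x = y) -> (forall x, p x = 0 -> f x = 0) ->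
  exists g : {rmorphism R' -> S}, forall x, g (p x) = f x.
Proof.
move=> surj ker; have [s hs] := choice surj.
pose g y := f (s y).
have gE x : g (p x) = f x.
  apply/eqP; rewrite -subr_eq0 -rmorphB; apply/eqP/ker.
  by rewrite rmorphB hs subrr.
have gB : {morph g : x y / x - y}.
  by move=> x y; rewrite -{1}[x]hs -{1}[y]hs -rmorphB gE rmorphB.
have gM : {morph g : x y / x * y}.
  by move=> x y; rewrite -{1}[x]hs -{1}[y]hs -rmorphM gE rmorphM.
have g1 : g 1 = 1 by rewrite -(rmorph1 p) gE rmorph1.
pose i1 := GRing.isZmodMorphism.Build R' S g gB.
pose i2 := GRing.isMultiplicative.Build R' S g (conj gM g1).
by exists (HB.pack_for {rmorphism R' -> S} g i1 i2).
Qed.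

Section QuotientMap.
Variables (R : comPzRingType) (I : ideal R).

Definition qpi (x : R) : quotient I := \pi_(quotient I) x.

Lemma qpi_B : {morph qpi : x y / x - y}. Proof. exact: pi_quotientB. Qed.

Lemma qpi_M : multiplicative qpi.
Proof. by split=> // x y; rewrite /qpi -pi_quotientM. Qed.

HB.instance Definition _ := GRing.isZmodMorphism.Build R (quotient I) qpi qpi_B.
HB.instance Definition _ := GRing.isMultiplicative.Build R (quotient I) qpi qpi_M.

Lemma qpi_surj y : exists x, qpi x = y.
Proof. by exists (repr y); rewrite /qpi reprK. Qed.

Lemma qpi_eq0 x : qpi x = 0 <-> I x.
Proof. by rewrite -(rmorph0 qpi) /qpi quotientE subr0. Qed.

End QuotientMap.

Section Flat.
Variables (R S : comPzRingType) (phi : {rmorphism R -> S}).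

(* Flatness through linear equations: solutions over [S] of a homogeneous system with
   coefficients in [R] are [S]-combinations of solutions over [R]. *)
Definition flat : Prop := forall m n (D : 'M[R]_(m, n)) (v : 'rV[S]_m),
  v *m map_mx phi D = 0 ->
  exists k, exists2 W : 'M[R]_(k, m), W *m D = 0 & inrows v (map_mx phi W).

Definition mapc (C : cpx R) : cpx S := @Cpx S (dim C) (fun i => map_mx phi (dif C i)).

Lemma flat_exactm p m n (D' : 'M[R]_(p, m)) (D : 'M[R]_(m, n)) :
  flat -> exactm D' D -> exactm (map_mx phi D') (map_mx phi D).
Proof.
move=> fl ex; split=> [|v vD]; first by rewrite -map_mxM (exact_mul0 ex) map_mx0.
have [k [W WD hv]] := fl _ _ _ _ vD; apply: inrows_trans hv _; have [V ->] := exact_inrows ex WD.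
by exists (map_mx phi V); rewrite map_mxM.
Qed.

Lemma flat_exactc C : flat -> exactc C -> exactc (mapc C).
Proof. by move=> fl ex i; apply: flat_exactm fl (ex i). Qed.

(** After vectorization the equation is one homogeneous system in the pair [(f, h)]; flatness writes
    its solutions through solutions over [R], of which only the [f] component is kept. *)
Lemma flat_pair l m q e (D : 'M[R]_(l, m)) (E : 'M[R]_(e, q))
    (f : 'M[S]_(m, q)) (h : 'M[S]_(l, e)) : flat ->
  map_mx phi D *m f = h *m map_mx phi E ->
  exists k (F : 'I_k -> 'M[R]_(m, q)) (c : 'I_k -> S),
    (forall j, inrows (D *m F j) E) /\ f = \sum_j c j *: map_mx phi (F j).
Proof.
move=> fl e0.
pose L1 := lin_mulmx D : 'M[R]_(m * q, l * q).
pose L2 := lin_mulmxr E : 'M[R]_(l * e, l * q).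
pose M := col_mx L1 (- L2).
have m1 : map_mx phi L1 = lin_mulmx (map_mx phi D).
  by apply: map_lin_mx => X; rewrite map_mxM.
have m2 : map_mx phi L2 = lin_mulmxr (map_mx phi E).
  by apply: map_lin_mx => X; rewrite /mulmxr map_mxM.
have [] := fl _ _ M (row_mx (mxvec f) (mxvec h)).
  rewrite map_col_mx mul_row_col map_mxN m1 m2 mulmxN !mul_vec_lin /= e0.
  by rewrite /mulmxr subrr.
move=> k [W WM [c cE]].
exists k, (fun j => vec_mx (lsubmx (row j W))), (fun j => c 0 j); split=> [j|].
  exists (vec_mx (rsubmx (row j W))); apply: (can_inj mxvecK).
  have : row j W *m M = 0 by rewrite -row_mul WM row0.
  rewrite -[row j W in X in X -> _]hsubmxK mul_row_col mulmxN => /eqP; rewrite subr_eq0.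
  rewrite -[lsubmx _ in X in X -> _]vec_mxK -[rsubmx _ in X in X -> _]vec_mxK.
  by rewrite !mul_vec_lin => /eqP.
apply: (can_inj mxvecK); rewrite linear_sum /=.
have := congr1 (@lsubmx _ _ _ _) cE; rewrite row_mxKl => ->.
rewrite mulmx_sum_row linear_sum /=; apply: eq_bigr => j _.
by rewrite !linearZ /=; congr (_ *: _); rewrite map_vec_mx vec_mxK map_lsubmx map_row.
Qed.

Lemma inrows_sumZ k m n e (c : 'I_k -> S) (X : 'I_k -> 'M[S]_(m, n)) (E : 'M_(e, n)) :
  (forall j, inrows (X j) E) -> inrows (\sum_j c j *: X j) E.
Proof.
move=> h; apply: (big_ind (fun x => inrows x E)) => [|x y|j _]; [exact: inrows0 | exact: inrowsD | exact: inrowsZ].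
Qed.

Lemma inrows_map k m n (X : 'M[R]_(k, n)) (E : 'M[R]_(m, n)) :
  inrows X E -> inrows (map_mx phi X) (map_mx phi E).
Proof. by case=> W ->; exists (map_mx phi W); rewrite map_mxM. Qed.

Lemma flat_ext0 C i e q (E : 'M[R]_(e, q)) :
  flat -> ext0 C i E -> ext0 (mapc C) i (map_mx phi E).
Proof.
move=> fl h f [H /= hf].
have [k [F [c [hF ->]]]] := flat_pair fl hf.
have [G hG] := choice (fun j => h (F j) (hF j)).
exists (\sum_j c j *: map_mx phi (G j)); rewrite mulmx_sumr -sumrB.
have -> : \sum_j (c j *: map_mx phi (F j) - dif (mapc C) i *m (c j *: map_mx phi (G j))) =
  \sum_j c j *: map_mx phi (F j - dif C i *m G j).
  by apply: eq_bigr => j _; rewrite map_mxB map_mxM scalerBr scalemxAr.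
by apply: inrows_sumZ => j; apply: inrows_map.
Qed.

Lemma flat_extR C i : flat -> extR C i -> extR (mapc C) i.
Proof.
move=> fl h q f hf.
(* With the empty matrix of relations the coefficients are free, and [ext0] becomes [extR]. *)
have [] := @flat_ext0 C i 0 q 0 fl _ f.
- move=> g [W]; rewrite mulmx0 => hg; have [k ->] := h q g hg.
  by exists k; rewrite subrr; apply: inrows0.
- by rewrite hf; apply: inrows0.
- by move=> g [W]; rewrite map_mx0 mulmx0 => /eqP; rewrite subr_eq0 => /eqP ->; exists g.
Qed.

(** Solvability comes back from [S] up to a multiplier in [T]: [T = {1}] for faithfully flat maps,
    the set of denominators for localizations. *)
Definition descends (T : R -> Prop) : Prop := forall m n (D : 'M[R]_(m, n)) (b : 'rV[R]_n),
  inrows (map_mx phi b) (map_mx phi D) -> exists2 a, T a & inrows (a *: b) D.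

Definition splitup (T : R -> Prop) m n (D : 'M[R]_(m, n)) : Prop :=
  exists2 a, T a & exists E, D *m E *m D = a *: D.

(** The equation [D X D = D] is linear in [X], so it is a system to which descent applies. *)
Lemma descends_split T m n (D : 'M[R]_(m, n)) :
  descends T -> splitm (map_mx phi D) -> splitup T D.
Proof.
move=> de [E hE].
pose L := lin_mx (fun X : 'M[R]_(n, m) => D *m X *m D).
have lin : linear (fun X : 'M[R]_(n, m) => D *m X *m D).
  by move=> a X Y; rewrite mulmxDr mulmxDl -scalemxAr -scalemxAl.
pose f : {linear _ -> _} := HB.pack (fun X : 'M[R]_(n, m) => D *m X *m D)
  (GRing.isLinear.Build _ _ _ _ _ lin).
have lin' : linear (fun X : 'M[S]_(n, m) => map_mx phi D *m X *m map_mx phi D).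
  by move=> a X Y; rewrite mulmxDr mulmxDl -scalemxAr -scalemxAl.
pose f' : {linear _ -> _} := HB.pack (fun X : 'M[S]_(n, m) => map_mx phi D *m X *m map_mx phi D)
  (GRing.isLinear.Build _ _ _ _ _ lin').
have mf : map_mx phi (lin_mx f) = lin_mx f'.
  by apply: map_lin_mx => X; rewrite /= !map_mxM.
have [|a Ta [W hW]] := de _ _ (lin_mx f) (mxvec D).
  exists (mxvec E); rewrite mf mul_vec_lin /= hE.
  by rewrite map_mxvec.
exists a => //; exists (vec_mx W); apply: (can_inj mxvecK).
by rewrite linearZ /= hW -[W in RHS]vec_mxK mul_vec_lin.
Qed.

(** Characterizes localizations up to isomorphism, so that it covers the concrete construction and,
    with [T = {1}], ring isomorphisms. *)
Definition is_loc (T : R -> Prop) : Prop :=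
  [/\ forall s, T s -> exists t, phi s * t = 1,
      forall x, exists a s, T s /\ phi s * x = phi a &
      forall a, phi a = 0 -> exists2 s, T s & s * a = 0].

Section Loc.
Variable T : mult_set R.
Hypothesis loc : is_loc T.

Lemma loc_common m n (v : 'M[S]_(m, n)) :
  exists2 s, T s & exists w, phi s *: v = map_mx phi w.
Proof.
have [_ den _] := loc.
have h (ij : 'I_m * 'I_n) : exists b : R * R, T b.2 /\ phi b.2 * v ij.1 ij.2 = phi b.1.
  by have [a [s [Ts e]]] := den (v ij.1 ij.2); exists (a, s).
have [b hb] := choice h.
exists (\prod_(ij : 'I_m * 'I_n) (b ij).2).
  elim/big_ind: _ => [||i _]; [exact: mult_1 | exact: mult_M | exact: (hb i).1].
exists (\matrix_(i, j) ((\prod_(k | k != (i, j)) (b k).2) * (b (i, j)).1)).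
apply/matrixP => i j; rewrite !mxE (bigD1 (i, j)) //= rmorphM rmorphM mulrAC.
by rewrite (hb (i, j)).2 mulrC.
Qed.

Lemma loc_ker m n (w : 'M[R]_(m, n)) :
  map_mx phi w = 0 -> exists2 s, T s & s *: w = 0.
Proof.
have [_ _ ker] := loc => e.
have h (ij : 'I_m * 'I_n) : exists s, T s /\ s * w ij.1 ij.2 = 0.
  have [|s Ts es] := ker (w ij.1 ij.2); last by exists s.
  by have := congr1 (fun M : 'M__ => M ij.1 ij.2) e; rewrite !mxE.
have [s hs] := choice h.
exists (\prod_ij s ij).
  elim/big_ind: _ => [||i _]; [exact: mult_1 | exact: mult_M | exact: (hs i).1].
apply/matrixP => i j; rewrite !mxE (bigD1 (i, j)) //= mulrAC.
by rewrite (hs (i, j)).2 mul0r.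
Qed.

Lemma loc_unit s : T s -> exists t, phi s * t = 1.
Proof. by case: loc => h _ _; apply: h. Qed.

Lemma loc_flat : flat.
Proof.
move=> m n D v vD; have [s Ts [w hw]] := loc_common v.
have [|s' Ts' e] := loc_ker (w := w *m D).
  by rewrite map_mxM -hw -scalemxAl vD scaler0.
exists 1, (s' *: w); first by rewrite -scalemxAl.
have [t ht] := loc_unit (mult_M Ts Ts').
exists (t%:M); rewrite mul_scalar_mx map_mxZ -hw !scalerA.
by rewrite -mulrA -rmorphM [s' * s]mulrC [t * _]mulrC ht scale1r.
Qed.

Lemma loc_descends : descends T.
Proof.
move=> m n D b [v hv]; have [s Ts [w hw]] := loc_common v.
have [|s' Ts' e] := loc_ker (w := s *: b - w *m D).
  by rewrite map_mxB map_mxZ hv map_mxM -hw -scalemxAl subrr.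
exists (s' * s); first exact: mult_M.
exists (s' *: w); apply/eqP; rewrite -scalemxAl -scalerA -subr_eq0 -scalerBr.
by apply/eqP.
Qed.

Lemma loc_noeth : noetherian R -> noetherian S.
Proof.
move=> nR I.
have I0 : I (phi 0) by rewrite rmorph0; apply: ideal_0.
have ID x y : I (phi x) -> I (phi y) -> I (phi (x + y)) by rewrite rmorphD; apply: ideal_D.
have IM a x : I (phi x) -> I (phi (a * x)) by rewrite rmorphM; apply: ideal_M.
have [s hs] := nR (Ideal I0 ID IM); exists (map phi s) => y; split; last first.
  by apply: ideal_span_sub => z /mapP [x xs ->]; apply/hs/ideal_span_mem.
have [_ den _] := loc; have [a [b [Tb e]]] := den y => Iy.
have [t ht] := loc_unit Tb.
have -> : y = t * phi a by rewrite -e mulrA [t * _]mulrC ht mul1r.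
have /hs /ideal_spanE [c ->] : I (phi a) by rewrite -e; apply: ideal_M.
apply: ideal_M; rewrite rmorph_sum; apply: ideal_sum => i _.
by rewrite rmorphM; apply/ideal_M/ideal_span_mem/map_f/mem_nth.
Qed.

End Loc.
End Flat.

Lemma flat_comp (R S U : comPzRingType) (f : {rmorphism R -> S}) (g : {rmorphism S -> U}) :
  flat f -> flat g -> flat (g \o f).
Proof.
move=> ff fg m n D v; rewrite map_mx_comp => vD; have [k [W WD hv]] := fg _ _ _ _ vD.
have h i : exists p, exists2 V : 'M[R]_(p, m), V *m D = 0 & inrows (row i W) (map_mx f V).
  by apply: ff; rewrite -row_mul WD row0.
have {h} : exists p, exists2 V : 'M[R]_(p, m), V *m D = 0 & inrows W (map_mx f V).
  elim: k W h {WD hv} => [|k IH] W h.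
    by exists 0, 0; rewrite ?mul0mx //; exists 0; apply/matrixP => -[].
  have [p [V VD [X hX]]] := h ord0.
  have [|p' [V' VD' [X' hX']]] := IH (row' ord0 W).
    move=> i; have -> : row i (row' ord0 W) = row (lift ord0 i) W by apply/rowP => l; rewrite !mxE.
    exact: h.
  exists (p + p')%N, (col_mx V V'); first by rewrite mul_col_mx VD VD' col_mx0.
  apply: inrowsP => i; rewrite map_col_mx.
  case: (unliftP ord0 i) => [j|] ->.
    have -> : row (lift ord0 j) W = row j (row' ord0 W) by apply/rowP => l; rewrite !mxE.
    by rewrite hX' row_mul; exists (row_mx 0 (row j X')); rewrite mul_row_col mul0mx add0r.
  by rewrite hX; exists (row_mx X 0); rewrite mul_row_col mul0mx addr0.
move=> [p [V VD hW]]; exists p, V => //.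
rewrite (map_mx_comp f g V); exact: inrows_trans hv (inrows_map g hW).
Qed.

(** * Quotients by a regular element of the Jacobson radical *)

Definition nzd (R : comPzRingType) (theta : R) : Prop := forall x, theta * x = 0 -> x = 0.

Definition in_jac (R : comPzRingType) (theta : R) : Prop :=
  forall a, exists b, (1 + a * theta) * b = 1.

Definition mod_elt (R R' : comPzRingType) (p : {rmorphism R -> R'}) (theta : R) : Prop :=
  (forall y, exists x, p x = y) /\ (forall x, p x = 0 <-> exists c, x = c * theta).

Lemma nzd_mx (R : comPzRingType) (theta : R) m n (X : 'M[R]_(m, n)) :
  nzd theta -> theta *: X = 0 -> X = 0.
Proof.
move=> reg e; apply/matrixP => i j; rewrite mxE; apply: reg.
by rewrite -scalemxE e mxE.
Qed.

Lemma surj_mx (R R' : comPzRingType) (p : {rmorphism R -> R'}) m n (X : 'M[R']_(m, n)) :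
  (forall y, exists x, p x = y) -> exists Y, map_mx p Y = X.
Proof.
move=> surj; have [s hs] := choice surj.
by exists (map_mx s X); apply/matrixP => i j; rewrite !mxE.
Qed.

Section ModElt.
Variables (R R' : comPzRingType) (p : {rmorphism R -> R'}) (theta : R).
Hypothesis mod_theta : mod_elt p theta.

Lemma mod_lift m n (X : 'M[R']_(m, n)) : exists Y, map_mx p Y = X.
Proof. by apply: surj_mx; case: mod_theta. Qed.

Lemma mod_ker m n (X : 'M[R]_(m, n)) : map_mx p X = 0 -> exists Y, X = theta *: Y.
Proof.
move=> e; have [_ ker] := mod_theta.
have h (ij : 'I_m * 'I_n) : exists c, X ij.1 ij.2 = c * theta.
  by apply/ker; have := congr1 (fun M : 'M__ => M ij.1 ij.2) e; rewrite !mxE.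
have [c hc] := choice h.
exists (\matrix_(i, j) c (i, j)); apply/matrixP => i j.
by rewrite !mxE (hc (i, j)) mulrC.
Qed.

Lemma mod_theta0 : p theta = 0.
Proof. by have [_ ker] := mod_theta; apply/ker; exists 1; rewrite mul1r. Qed.

Lemma mod_eq m n (X Y : 'M[R]_(m, n)) :
  map_mx p X = map_mx p Y -> exists Z, X = Y + theta *: Z.
Proof.
move=> e; have [|Z hZ] := @mod_ker _ _ (X - Y); first by rewrite map_mxB e subrr.
by exists Z; rewrite -hZ addrC subrK.
Qed.

Lemma mod_inrows k m n (X : 'M[R]_(k, n)) (D : 'M[R]_(m, n)) :
  inrows (map_mx p X) (map_mx p D) -> exists W Z, X = W *m D + theta *: Z.
Proof.
case=> V hV; have [W hW] := mod_lift V.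
have [|Z hZ] := @mod_eq _ _ X (W *m D); first by rewrite hV map_mxM hW.
by exists W, Z.
Qed.

(** The determinant is 1 modulo [theta], hence a unit, and the adjugate provides the inverse. *)
Lemma inv_mx n (K : 'M[R]_n) : in_jac theta ->
  exists X, X *m (1%:M - theta *: K) = 1%:M /\ (1%:M - theta *: K) *m X = 1%:M.
Proof.
move=> jac; set M := _ - _.
have [c hc] : exists c, \det M - 1 = c * theta.
  have [_ ker] := mod_theta; apply/ker.
  by rewrite rmorphB rmorph1 -det_map_mx map_mxB map_mxZ mod_theta0 scale0r subr0 map_mx1 det1 subrr.
have [b hb] := jac c.
have db : \det M * b = 1 by rewrite -hb -hc addrC subrK.
exists (b *: \adj M); split.
  by rewrite -scalemxAl mul_adj_mx scale_scalar_mx mulrC db.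
by rewrite -scalemxAr mul_mx_adj scale_scalar_mx mulrC db.
Qed.

Hypothesis reg : nzd theta.

(* A projective module over [R/theta] lifts: [1 - theta K] is invertible on the row space
   of [D], so the approximate splitting [E] can be corrected. *)
Lemma split_lift q m n (D' : 'M[R]_(q, m)) (D : 'M[R]_(m, n)) : in_jac theta ->
  exactm D' D -> (forall k (K : 'M_(k, n)), inrows (theta *: K) D -> inrows K D) ->
  splitm (map_mx p D) -> splitm D.
Proof.
move=> jac ex tf [E' hE']; have [E hE] := mod_lift E'.
have [|K hK] := @mod_eq _ _ D (D *m E *m D); first by rewrite !map_mxM hE.
have tK : theta *: K = (1%:M - D *m E) *m D by rewrite mulmxBl mul1mx [X in _ = X - _]hK addrAC subrr add0r.
have [|K1 hK1] := tf _ K; first by rewrite tK; apply: inrows_mul.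
have DK : D' *m K = 0.
  apply: (nzd_mx reg); rewrite scalemxAr tK mulmxA mulmxBr mulmx1 mulmxBl (exact_mul0 ex).
  by rewrite mulmxA (exact_mul0 ex) !mul0mx subrr.
(* [D'] intertwines [K1] with [K2], hence also the inverses of [1 - theta K1] and [1 - theta K2];
   the error left at the end is then a multiple of [D'], which dies against [D]. *)
have [K2 hK2] : inrows (D' *m K1) D'.
  by apply: exact_inrows ex _; rewrite -mulmxA -hK1.
have [X [XM MX]] := inv_mx K1 jac; have [Y [YM MY]] := inv_mx K2 jac.
have YD : D' *m X = Y *m D'.
  have e : D' *m (1%:M - theta *: K1) = (1%:M - theta *: K2) *m D'.
    by rewrite mulmxBr mulmxBl mulmx1 mul1mx -scalemxAr -scalemxAl hK2.
  by rewrite -[LHS]mul1mx -YM -mulmxA [_ *m (D' *m X)]mulmxA -e -mulmxA MX mulmx1.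
have [U hU] : inrows (D *m E - (1%:M - theta *: K1)) D'.
  apply: exact_inrows ex _.
  rewrite mulmxBl [in X in _ - X]mulmxBl mul1mx -scalemxAl -hK1 tK mulmxBl mul1mx.
  by mxlin.
exists (E *m X).
have -> : D *m (E *m X) = 1%:M + U *m Y *m D'.
  by rewrite mulmxA -[D *m E](subrK (1%:M - theta *: K1)) hU mulmxDl MX -!mulmxA YD addrC.
by rewrite mulmxDl mul1mx -!mulmxA (exact_mul0 ex) !mulmx0 addr0.
Qed.

(** The row space of [D'] is the kernel of [D], and the values of [D] lie in a free module, where
    [theta] is regular. *)
Lemma torsion_free m' m n k (D' : 'M[R]_(m', m)) (D : 'M[R]_(m, n)) (K : 'M[R]_(k, m)) :
  exactm D' D -> inrows (theta *: K) D' -> inrows K D'.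
Proof.
move=> ex h; apply: (exact_inrows ex); apply: (nzd_mx reg).
by rewrite scalemxAl (inrows_mul0 ex h).
Qed.

(** The shift matters: [coker d_0] may have [theta]-torsion, but its syzygy embeds in a free module,
    so the resolution of the syzygy stays exact modulo [theta]. *)
Lemma exact_mod (C : cpx R) : exactc C -> exactc (mapc p (shift C)).
Proof.
move=> ex i; split=> [|v' e]; first by rewrite -map_mxM (exact_mul0 (ex i.+1)) map_mx0.
have [v hv] := mod_lift v'; move: e; rewrite -hv -map_mxM => /mod_ker [k hk].
have [w hw] : inrows k (dif C i.+1).
  by apply: torsion_free (ex i) _; rewrite -hk; apply: inrows_mul.
have [w' hw'] : inrows (v - theta *: w) (dif C i.+2).
  by apply: exact_inrows (ex i.+1) _; rewrite mulmxBl -scalemxAl -hw -hk subrr.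
exists (map_mx p w'); rewrite -map_mxM -hw' map_mxB map_mxZ mod_theta0.
by rewrite scale0r subr0.
Qed.

Lemma gldim_mod d : in_jac theta -> gldim_le R' d -> gldim_le R d.+1.
Proof.
move=> jac gd C ex; apply: (split_lift jac (ex d.+1)).
  by move=> k K; apply: torsion_free.
exact: (gd _ (exact_mod ex)).
Qed.

(** Long exact sequence of multiplication by [theta]: a cocycle modulo [theta] lifts to [f] with
    [d f = theta k]; the next Ext bounds [k] by some [g], and [f - theta g] is a true cocycle. *)
Lemma extR_mod (C : cpx R) i : exactc C -> (forall i, extR C i) -> extR (mapc p (shift C)) i.
Proof.
move=> ex h q f' e; have [f hf] := mod_lift f'.
move: e; rewrite -hf -map_mxM => /mod_ker [k /= hk].
have [|g hg] := h i.+2 _ k.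
  apply: (nzd_mx reg); rewrite scalemxAr -hk mulmxA.
  by rewrite (exact_mul0 (ex _)) mul0mx.
have [|g' hg'] := h i.+1 _ (f - theta *: g).
  by rewrite mulmxBr hk -scalemxAr -hg subrr.
exists (map_mx p g'); rewrite /= -map_mxM -hg' map_mxB map_mxZ mod_theta0.
by rewrite scale0r subr0.
Qed.

(** In [0 -> Omega M -> F -> M -> 0] with [F] free, the vanishing of Ext(M, F) moves that of Ext(M,
    M) one degree up, to the coefficients [Omega M = coker d_1]. *)
Lemma ext0_syz (C : cpx R) i : exactc C -> (forall i, extR C i) -> ext0 C i (dif C 0) ->
  ext0 C i.+1 (dif C 1).
Proof.
move=> ex h h0 f hf.
have [|g hg] := h i.+1 _ (f *m dif C 0); first by rewrite mulmxA (inrows_mul0 (ex 0) hf).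
have [|g' [W hW]] := h0 g; first by rewrite -hg; apply: inrows_mul.
exists W; apply: exact_inrows (ex 0) _.
rewrite mulmxBl hg -mulmxA -hW mulmxBr mulmxA (exact_mul0 (ex _)) mul0mx subr0.
by rewrite subrr.
Qed.

(** The coefficients [N = coker d_1] have no [theta]-torsion, so Ext with values in [N / theta N]
    sits between two consecutive groups with values in [N]; [h1] supplies both. *)
Lemma ext0_mod (C : cpx R) i : exactc C -> (forall i, extR C i) ->
  (forall j, (i <= j)%N -> ext0 C j.+1 (dif C 1)) ->
  ext0 (mapc p (shift C)) i (dif (mapc p (shift C)) 0).
Proof.
move=> ex h h1 f' e; have [f hf] := mod_lift f'.
move: e; rewrite -hf -map_mxM => /mod_inrows [W [Z /= hZ]].
have [|g [V hV]] := h1 i.+1 (leqnSn _) Z.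
  apply: torsion_free (ex 0) _.
  have -> : theta *: (dif C i.+3 *m Z) = - (dif C i.+3 *m W) *m dif C 1.
    have := congr1 (mulmx (dif C i.+3)) hZ.
    rewrite mulmxA (exact_mul0 (ex _)) mul0mx mulmxDr mulmxA -scalemxAr => /esym/eqP.
    by rewrite addr_eq0 mulNmx => /eqP ->; rewrite opprK.
  exact: inrows_mul.
have [|g' [V' hV']] := h1 i (leqnn _) (f - theta *: g).
  exists (W + theta *: V); rewrite mulmxBr hZ mulmxDl -[in RHS]scalemxAl -hV scalerBr -scalemxAr.
  by mxlin.
exists (map_mx p g'), (map_mx p V'); rewrite -!map_mxM -hV' !map_mxB map_mxZ mod_theta0.
by rewrite scale0r subr0.
Qed.

(** The argument runs on the syzygy, which is torsion free: reduce modulo [theta], lift the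
    splitting back, and return to the module by [split_down]. *)
Lemma strongSAC_mod : in_jac theta -> strongSAC R' -> strongSAC R.
Proof.
move=> jac sac C ex h [n hn].
have h1 j : (n <= j)%N -> ext0 C j.+1 (dif C 1).
  by move=> nj; apply: ext0_syz => //; apply: hn.
apply: (split_down ex (h 0)); apply: (split_lift jac (ex 1%N)).
  by move=> k K; apply: torsion_free.
apply: (sac _ (exact_mod ex)); first by move=> i; apply: extR_mod.
exists n => i ni; apply: ext0_mod => // j ij; apply: h1.
exact: leq_trans ij.
Qed.

End ModElt.

(** * The degree two operator of a hypersurface *)

Section DegreeTwoOperator.
Variable R : comPzRingType.

Fixpoint shift2 k (C : cpx R) : cpx R :=
  if k is k'.+1 then shift2 k' (shift (shift C)) else C.

Lemma shift2S k C : shift2 k (shift (shift C)) = shift (shift (shift2 k C)).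
Proof. by elim: k C => //= k IH C; rewrite IH. Qed.

Lemma shift2_exact k C : exactc C -> exactc (shift2 k C).
Proof. by elim: k C => //= k IH C ex; apply/IH/exact_shift/exact_shift. Qed.

Lemma shift2_ext0 k C n e q (E : 'M_(e, q)) : (forall i, (n <= i)%N -> ext0 C i E) ->
  forall i, (n <= i + k)%N -> ext0 (shift2 k C) i E.
Proof.
elim: k C n => [|k IH] C n h i; first by rewrite addn0; apply: h.
rewrite addnS => ni; apply: (IH _ n.-1) => [j nj|]; last by lia.
by apply: (h j.+2); lia.
Qed.

Lemma shift2_split k C d : splitm (dif (shift2 k C) d) -> exists d', splitm (dif C d').
Proof. by elim: k C d => [|k IH] C d h; [exists d | have [d'] := IH _ _ h; exists d'.+2]. Qed.

(* The operator [x] of degree two on [Ext(coker d_0, coker E)] is surjective in high degrees. *)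
Definition onto_from (C : cpx R) (x : forall i, 'M[R]_(dim C i.+2, dim C i)) d : Prop :=
  forall j e q (E : 'M[R]_(e, q)) (f : 'M[R]_(dim C j.+2, q)), (d <= j)%N ->
  inrows (dif C j.+2 *m f) E -> exists b a,
    inrows (dif C j *m b) E /\ inrows (f - x j *m b - dif C j.+1 *m a) E.

(** [c] is the [k]-fold composite of the operators [x], and surjectivity in high degrees composes as
    well. *)
Lemma shift2_chain k (C : cpx R) (x : forall i, 'M[R]_(dim C i.+2, dim C i)) d :
  (forall i, dif C i.+2 *m x i = x i.+1 *m dif C i) -> onto_from x d ->
  exists c : forall i, 'M[R]_(dim (shift2 k C) i, dim C i),
    (forall i, dif (shift2 k C) i *m c i = c i.+1 *m dif C i) /\
    forall j e q (E : 'M[R]_(e, q)) (f : 'M[R]_(dim (shift2 k C) j.+1, q)), (d <= j)%N ->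
      inrows (dif (shift2 k C) j.+1 *m f) E -> exists b a,
      inrows (dif C j.+1 *m b) E /\ inrows (f - c j.+1 *m b - dif (shift2 k C) j *m a) E.
Proof.
elim: k C x => [|k IH] C x cm onto.
  exists (fun i => 1%:M); split=> [i|j e q E f dj hf]; first by rewrite mulmx1 mul1mx.
  exists f, 0; split=> //; rewrite mul1mx mulmx0 subrr subr0; exact: inrows0.
have [||c [cc hc]] := IH (shift (shift C)) (fun i => x i.+2).
- by move=> i; apply: cm.
- by move=> j e q E f dj hf; apply: (onto j.+2) => //; apply: leq_trans dj _; lia.
exists (fun i => c i *m x i); split=> [i|j e q E f dj hf].
  by rewrite mulmxA cc -!mulmxA cm.
have [b [a [hb ha]]] := hc j e q E f dj hf.
have [b' [a' [hb' ha']]] := onto j.+1 e q E b (leqW dj) hb.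
exists b', (a + c j *m a'); split=> //.
have -> : f - c j.+1 *m x j.+1 *m b' - dif (shift2 k.+1 C) j *m (a + c j *m a') =
  (f - c j.+1 *m b - dif (shift2 k.+1 C) j *m a) +
  c j.+1 *m (b - x j.+1 *m b' - dif C j.+2 *m a').
  rewrite /= mulmxDr [dif _ _ *m (c j *m a')]mulmxA (cc j) !mulmxBr !mulmxA /=.
  by mxlin.
by apply: inrowsD => //; apply: inrowsM.
Qed.

(** The power [x^(n+1)] defines a class in Ext^(2n+2)(M, M), which is zero, so it is null-homotopic;
    yet it is onto on every high Ext. High Ext groups therefore vanish for all coefficients, and a
    syzygy is projective. *)
Lemma split_of_operator (C : cpx R) (x : forall i, 'M[R]_(dim C i.+2, dim C i)) d n :
  exactc C -> (forall i, dif C i.+2 *m x i = x i.+1 *m dif C i) -> onto_from x d ->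
  (forall i, (n <= i)%N -> ext0 C i (dif C 0)) -> exists d', splitm (dif C d').
Proof.
move=> ex cm onto hn.
have [c [cc hc]] := shift2_chain n.+1 cm onto.
have ex1 := shift2_exact n.+1 ex.
have null : exists k' (D : 'M_(dim (shift2 n.+1 C) 0, k')) g h,
    dif (shift2 n.+1 C) 0 *m D = 0 /\ c 0%N = D *m g + h *m dif C 0.
  have : inrows (dif (shift2 n.+1 C) 0 *m c 0%N) (dif C 0) by rewrite cc; apply: inrows_mul.
  move: (c 0%N); rewrite /= shift2S /= => X hX.
  (* [c 0] is a cocycle of degree [2 n + 2] with values in [coker d_0], hence a coboundary there. *)
  have [|g [h hg]] := shift2_ext0 (k := n) hn (i := 1) _ hX; first by lia.
  exists _, (dif (shift2 n C) 1), g, h; split; last by rewrite -hg addrC subrK.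
  exact: exact_mul0 (shift2_exact n ex 1%N).
have [k' [D [g [h [D0 c0]]]]] := null.
have homot := chain_null ex (fun i => (ex1 i).1) cc D0 c0.
apply: (@shift2_split n.+1 _ d); apply: ext0_split => // f hf.
have [b [a [hb ha]]] := hc _ _ _ _ f (leqnn d) hf.
have [u [u' hu]] := homot d.
exists (u *m b + a).
have -> : f - dif (shift2 n.+1 C) d *m (u *m b + a) =
  (f - c d.+1 *m b - dif (shift2 n.+1 C) d *m a) + u' *m (dif C d.+1 *m b).
  by rewrite hu mulmxDl mulmxDr !mulmxA; mxlin.
by apply: inrowsD => //; apply: inrowsM.
Qed.

End DegreeTwoOperator.

(** * Change of rings along [Q -> Q / f] *)

Section Hypersurface.
Variables (Q R : comPzRingType) (p : {rmorphism Q -> R}) (f : Q).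
Hypotheses (mod_f : mod_elt p f) (reg : nzd f).

Section Lifted.
Variable C : cpx R.
Hypothesis ex : exactc C.
Variables (Dt : forall i, 'M[Q]_(dim C i.+1, dim C i))
  (x : forall i, 'M[Q]_(dim C i.+2, dim C i)).
Hypotheses (hDt : forall i, map_mx p (Dt i) = dif C i)
  (hx : forall i, Dt i.+1 *m Dt i = f *: x i).

Lemma x_comm i : Dt i.+2 *m x i = x i.+1 *m Dt i.
Proof.
apply/eqP; rewrite -subr_eq0; apply/eqP/(nzd_mx reg).
by rewrite scalerBr scalemxAr -hx scalemxAl -hx mulmxA subrr.
Qed.

(* The Shamash-Eisenbud resolution over [Q] of the module resolved by [C] over [Q/f]. *)
Definition eis : cpx Q := @Cpx Q
  (fun i => if i is j.+1 then dim C j.+1 + dim C j else dim C 0)%N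
  (fun i => match i return 'M[Q]_((dim C i.+1 + dim C i)%N,
                if i is j.+1 then (dim C j.+1 + dim C j)%N else dim C 0) with
   | 0 => col_mx (Dt 0) f%:M
   | j.+1 => block_mx (Dt j.+1) (- x j) f%:M (- Dt j)
   end).

Lemma eis_row i q (a : 'M[Q]_(q, dim C i.+2)) b :
  row_mx a b *m dif eis i.+1 = row_mx (a *m Dt i.+1 + f *: b) (- (a *m x i) - b *m Dt i).
Proof. by rewrite /= mul_row_block mulmxN mul_mx_scalar mulmxN. Qed.

Lemma eis_row0 q (a : 'M[Q]_(q, dim C 1)) b :
  row_mx a b *m dif eis 0 = a *m Dt 0 + f *: b.
Proof. by rewrite /= mul_row_col mul_mx_scalar. Qed.

(** Modulo [f], [a] is a cycle of the exact complex [C], so it is a boundary up to a multiple of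
    [f]; cancelling [f] then determines [b]. *)
Lemma eis_exact_aux i q (a : 'M[Q]_(q, dim C i.+1)) (b : 'M[Q]_(q, dim C i)) :
  a *m Dt i + f *: b = 0 ->
  exists w c, a = w *m Dt i.+1 + f *: c /\ b = - (w *m x i) - c *m Dt i.
Proof.
move=> e.
have [W [Z hW]] : exists W Z, a = W *m Dt i.+1 + f *: Z.
  apply: (mod_inrows mod_f); rewrite hDt; apply: exact_inrows (ex i) _.
  by rewrite -hDt -map_mxM (eqP (introT eqP (canRL (addrK _) e))) sub0r map_mxN map_mxZ
    (mod_theta0 mod_f) scale0r oppr0.
exists W, Z; split=> //; apply/eqP; rewrite -subr_eq0; apply/eqP/(nzd_mx reg).
rewrite !scalerBr scalerN scalemxAr -hx scalemxAl -[RHS]e hW mulmxDl mulmxA.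
by mxlin.
Qed.

Lemma eis_exact : exactc eis.
Proof.
case=> [|i]; split.
- rewrite /= mul_block_col !mulNmx !mul_mx_scalar !mul_scalar_mx -hx.
  by rewrite !subrr col_mx0.
- move=> v; rewrite -[v]hsubmxK eis_row0 => /eis_exact_aux [w [c [-> ->]]].
  by exists (row_mx w c); rewrite eis_row.
- rewrite /= mulmx_block !mulmxN !mulNmx !mul_mx_scalar !mul_scalar_mx !opprK.
  by rewrite -!hx x_comm !subrr !addNr block_mx0.
- move=> v; rewrite -[v]hsubmxK eis_row => e.
  have e1 : lsubmx v *m Dt i.+1 + f *: rsubmx v = 0.
    by have := congr1 lsubmx e; rewrite row_mxKl => ->; rewrite linear0.
  have [w [c [-> ->]]] := eis_exact_aux e1.
  by exists (row_mx w c); rewrite eis_row.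
Qed.

Lemma eis_col i q (a : 'M[Q]_(dim C i.+1, q)) (b : 'M[Q]_(dim C i, q)) :
  dif eis i.+1 *m col_mx a b = col_mx (Dt i.+1 *m a - x i *m b) (f *: a - Dt i *m b).
Proof. by rewrite /= mul_block_col !mulNmx mul_scalar_mx. Qed.

(** Rees's shift from Ext_R^j(M, R) to Ext_Q^(j+1)(M, Q): a lifted cocycle [g] satisfies
    [Dt g = f a], and the pair [(a, g)] is a cocycle of [eis]. *)
Lemma eis_extR i : extR eis i.+1 -> extR C i.
Proof.
move=> h q g' e; have [g hg] := mod_lift mod_f g'.
move: e; rewrite -hg -hDt -map_mxM => /(mod_ker mod_f) [a ha].
have [|z hz] := h q (col_mx a g).
  rewrite eis_col ha subrr.
  suff -> : Dt i.+2 *m a - x i.+1 *m g = 0 by rewrite col_mx0.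
  by apply: (nzd_mx reg); rewrite scalerBr scalemxAr -ha scalemxAl -hx mulmxA subrr.
exists (- map_mx p (dsubmx z)).
have := congr1 dsubmx hz; rewrite -[z]vsubmxK eis_col !col_mxKd => ->.
by rewrite map_mxB map_mxZ (mod_theta0 mod_f) scale0r sub0r map_mxM hDt mulmxN.
Qed.

Lemma inrows_colf k e q (E : 'M[Q]_(e, q)) (X : 'M[Q]_(k, q)) :
  inrows X (col_mx E f%:M) <-> inrows (map_mx p X) (map_mx p E).
Proof.
split=> [[W ->]|/(mod_inrows mod_f) [W [Z ->]]].
  rewrite -[W]hsubmxK mul_row_col mul_mx_scalar map_mxD map_mxZ (mod_theta0 mod_f).
  by rewrite scale0r addr0 map_mxM; apply: inrows_mul.
by exists (row_mx W Z); rewrite mul_row_col mul_mx_scalar.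
Qed.

Lemma inrows_col_mx k l m n (X : 'M[Q]_(k, n)) (Y : 'M[Q]_(l, n)) (E : 'M[Q]_(m, n)) :
  inrows (col_mx X Y) E <-> inrows X E /\ inrows Y E.
Proof.
split=> [[W]|[[W ->] [V ->]]]; last by exists (col_mx W V); rewrite mul_col_mx.
by rewrite -[W]vsubmxK mul_col_mx => /eq_col_mx [-> ->]; split; apply: inrows_mul.
Qed.

(** Ext_Q^i(M, M) lies between Ext_R^i(M, M) and Ext_R^(i-1)(M, M), which costs one degree: [ps] is
    bounded first, and [ph] is corrected by [x g] before being bounded. *)
Lemma eis_ext0 n : (forall i, (n <= i)%N -> ext0 C i (dif C 0)) ->
  forall i, (n < i)%N -> ext0 eis i (dif eis 0).
Proof.
move=> hn [//|j] nj F; rewrite -[F]vsubmxK eis_col; set ph := usubmx F; set ps := dsubmx F.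
move=> /inrows_col_mx [/inrows_colf h1 /inrows_colf h2]; move: h1 h2.
rewrite !map_mxB map_mxZ (mod_theta0 mod_f) scale0r sub0r !map_mxM !hDt => h1 h2.
have [|g' hg'] := hn j nj (map_mx p ps); first by have := inrowsN h2; rewrite opprK.
have [g eg] := mod_lift mod_f g'.
have [|a' ha'] := hn j.+1 (leqW nj) (map_mx p (ph - x j *m g)).
  rewrite map_mxB mulmxBr map_mxM mulmxA -hDt -!map_mxM x_comm !map_mxM -mulmxA !hDt eg.
  have -> : dif C j.+2 *m map_mx p ph - map_mx p (x j.+1) *m (dif C j *m g') =
     (dif C j.+2 *m map_mx p ph - map_mx p (x j.+1) *m map_mx p ps) +
     map_mx p (x j.+1) *m (map_mx p ps - dif C j *m g').
    by rewrite mulmxBr; mxlin.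
  by apply: inrowsD => //; apply: inrowsM.
have [a ea] := mod_lift mod_f a'.
exists (col_mx a (- g)); rewrite eis_col opp_col_mx add_col_mx; apply/inrows_col_mx; split.
  apply/inrows_colf; move: ha'; rewrite -ea -[dif C j.+1]hDt -map_mxM -map_mxB hDt.
  by congr (inrows (map_mx p _) _); rewrite mulmxN; mxlin.
apply/inrows_colf; move: hg'; rewrite -eg -[dif C j]hDt -map_mxM -map_mxB hDt.
have -> : ps - (f *: a - Dt j *m - g) = (ps - Dt j *m g) - f *: a.
  by rewrite mulmxN; mxlin.
by rewrite [map_mx p (_ - f *: a)]map_mxB map_mxZ (mod_theta0 mod_f) scale0r subr0.
Qed.

(** The cokernel of [x] on Ext_R embeds in Ext_Q, which vanishes in high degrees: a cocycle extended
    by zero is bounded over [Q], and the second component of the bounding cochain is, up to sign,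
    its preimage under [x]. *)
Lemma eis_onto d : splitm (dif eis d) -> onto_from (fun i => map_mx p (x i)) d.
Proof.
move=> sp j e q E' ph' dj; have [E <-] := mod_lift mod_f E'; have [ph <-] := mod_lift mod_f ph'.
move=> hph.
have [|z] := split_ext0 eis_exact sp (E := col_mx E f%:M) (leqW dj) (f := col_mx ph 0).
  rewrite eis_col !mulmx0 !subr0; apply/inrows_col_mx; split; apply/inrows_colf.
    by rewrite map_mxM hDt.
  by rewrite map_mxZ (mod_theta0 mod_f) scale0r; apply: inrows0.
rewrite -[z]vsubmxK eis_col opp_col_mx add_col_mx => /inrows_col_mx [].
set a := usubmx z; set b := dsubmx z; move=> /inrows_colf h1 /inrows_colf h2.
exists (- map_mx p b), (map_mx p a); split.
  move: h2; rewrite sub0r opprB map_mxB map_mxZ (mod_theta0 mod_f) scale0r subr0.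
  by rewrite map_mxM hDt mulmxN; apply: inrowsN.
move: h1; rewrite !map_mxB !map_mxM !hDt mulmxN.
by congr (inrows _ _); mxlin.
Qed.

End Lifted.

Lemma lifted_data (C : cpx R) : exactc C -> exists
    (Dt : forall i, 'M[Q]_(dim C i.+1, dim C i)) (x : forall i, 'M[Q]_(dim C i.+2, dim C i)),
  (forall i, map_mx p (Dt i) = dif C i) /\ (forall i, Dt i.+1 *m Dt i = f *: x i).
Proof.
move=> ex.
pose Dt i := sval (cid (mod_lift mod_f (dif C i))).
have hDt i : map_mx p (Dt i) = dif C i := svalP (cid (mod_lift mod_f (dif C i))).
have hx i : exists x, Dt i.+1 *m Dt i = f *: x.
  by apply: (mod_ker mod_f); rewrite map_mxM !hDt (exact_mul0 (ex i)).
by exists Dt, (fun i => sval (cid (hx i))); split=> // i; apply: (svalP (cid (hx i))).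
Qed.

Lemma hypersurface_injdim d : injdim_le Q d.+1 -> injdim_le R d.
Proof.
move=> h C ex i di; have [Dt [x [hDt hx]]] := lifted_data ex.
exact: (@eis_extR _ _ _ hDt hx i (h _ (eis_exact ex hDt hx) i.+1 di)).
Qed.

Lemma hypersurface_split : eventuallySplit Q -> eventuallySplit R.
Proof.
move=> h C ex [n hn]; have [Dt [x [hDt hx]]] := lifted_data ex.
have [|d sp] := h _ (eis_exact ex hDt hx).
  by exists n.+1; apply: eis_ext0.
apply: (split_of_operator ex _ (eis_onto ex hDt hx sp) hn) => i.
by rewrite -!hDt -!map_mxM x_comm.
Qed.

End Hypersurface.

(** * Lengths at a minimal prime of the support *)

Lemma finset_ind (I : finType) (P : {set I} -> Prop) :
  P set0 -> (forall i (s : {set I}), i \notin s -> P s -> P (i |: s)) -> forall s, P s.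
Proof.
move=> h0 hS s; elim: {s}#|s| {-2}s (eqxx #|s|) => [|n IH] s.
  by rewrite cards_eq0 => /eqP ->.
move=> /eqP sn; have [i si] : exists i, i \in s by apply/card_gt0P; rewrite sn.
rewrite -(setD1K si); apply: hS; first by rewrite setD11.
by apply: IH; move: sn; rewrite (cardsD1 i) si add1n => -[->].
Qed.

Section LengthAtPrime.
Variables (R : comPzRingType) (p : ideal R).
Hypothesis prime_p : prime_ideal p.

Section OneModule.
Variable V : lmodType R.
Implicit Types U W A B : submod V.

Definition sub_le U W : Prop := forall x, U x -> W x.

(* [(W/U)_p <> 0] when [U <= W]. *)
Definition pstrict U W : Prop := exists2 w, W w & forall a, ~ p a -> ~ U (a *: w).

(* The localization at [p] of [W/U] has length at least [m]. *)
Fixpoint lenge m U W : Prop :=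
  if m is m'.+1 then exists B, [/\ sub_le U B, pstrict U B & lenge m' B W] else sub_le U W.

Definition lenle m U W : Prop := ~ lenge m.+1 U W.

Lemma np1 : ~ p 1. Proof. by case: prime_p. Qed.

Lemma npM a b : ~ p a -> ~ p b -> ~ p (a * b).
Proof. by move=> na nb; case: prime_p => _ h /h []. Qed.

Lemma pstrict_mono U U' W W' : sub_le U' U -> sub_le W W' -> pstrict U W -> pstrict U' W'.
Proof.
move=> hU hW [w Ww h]; exists w; first exact: hW.
by move=> a na /hU; apply: h.
Qed.

Lemma lenge_sub m U W : lenge m U W -> sub_le U W.
Proof. by elim: m U => //= m IH U [B [UB _ /IH BW]] x /UB /BW. Qed.

Lemma lenge_monol m U U' W : sub_le U' U -> lenge m U W -> lenge m U' W.
Proof.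
case: m => [|m] /= h; first by move=> UW x /h /UW.
by move=> [B [UB st l]]; exists B; split=> //; [move=> x /h /UB | apply: pstrict_mono st].
Qed.

Lemma lenge_monor m U W W' : sub_le W W' -> lenge m U W -> lenge m U W'.
Proof.
move=> h; elim: m U => /= [|m IH] U; first by move=> UW x /UW /h.
by move=> [B [UB st /IH l]]; exists B.
Qed.

Lemma lenge_le m k U W : (k <= m)%N -> lenge m U W -> lenge k U W.
Proof.
move=> /subnK <-; elim: (m - k)%N U => // d IH U /= [B [UB _ /IH]].
exact: lenge_monol.
Qed.

Lemma lenge_cat m k U B W : lenge m U B -> lenge k B W -> lenge (m + k) U W.
Proof.
elim: m U => /= [|m IH] U; first by move=> UB; apply: lenge_monol.
by move=> [A [UA st l]] /(IH _ l); exists A.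
Qed.

Definition cap A B : submod V.
Proof.
apply: (@Submod _ _ (fun x => A x /\ B x)).
- by split; apply: sub_0.
- by move=> x y [? ?] [? ?]; split; apply: sub_D.
- by move=> a x [? ?]; split; apply: sub_Z.
Defined.

Definition sum A B : submod V.
Proof.
apply: (@Submod _ _ (fun x => exists a b, [/\ A a, B b & x = a + b])).
- by exists 0, 0; rewrite addr0; split=> //; apply: sub_0.
- move=> x y [a [b [Aa Bb ->]]] [c [d [Ac Bd ->]]].
  by exists (a + c), (b + d); rewrite addrACA; split=> //; apply: sub_D.
- move=> r x [a [b [Aa Bb ->]]]; exists (r *: a), (r *: b).
  by rewrite scalerDr; split=> //; apply: sub_Z.
Defined.

Lemma sum_l A B : sub_le A (sum A B).
Proof. by move=> x Ax; exists x, 0; rewrite addr0; split=> //; apply: sub_0. Qed.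

Lemma sum_r A B : sub_le B (sum A B).
Proof. by move=> x Bx; exists 0, x; rewrite add0r; split=> //; apply: sub_0. Qed.

Lemma sum_le A B W : sub_le A W -> sub_le B W -> sub_le (sum A B) W.
Proof. by move=> hA hB x [a [b [/hA Wa /hB Wb ->]]]; apply: sub_D. Qed.

(** If both induced inclusions were equalities at [p], then [a w = x + u] with [x] in [A] and [u] in
    both [B] and [U], and a further multiplier outside [p] would carry [u], hence [w], into [A]. *)
Lemma pstrict_modular U A B : sub_le A B -> pstrict A B ->
  pstrict (cap A U) (cap B U) \/ pstrict (sum A U) (sum B U).
Proof.
move=> AB [w Bw h]; apply: contrapT => /not_orP [n1 n2].
have [a [na [x [u [Ax Uu e]]]]] : exists a, ~ p a /\ sum A U (a *: w).
  apply: contrapT => no; apply: n2; exists w; first exact: sum_l.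
  by move=> a na s; apply: no; exists a.
have [b [nb [Ab _]]] : exists b, ~ p b /\ cap A U (b *: u).
  apply: contrapT => no; apply: n1; exists u.
    split=> //; have -> : u = a *: w - x by rewrite e addrC addKr.
    by apply: sub_B; [apply: sub_Z | apply: AB].
  by move=> b nb s; apply: no; exists b.
apply: (h (b * a)); first exact: npM.
by rewrite -scalerA e scalerDr; apply: sub_D => //; apply: sub_Z.
Qed.

(** Each strict step of a chain remains strict after intersecting with [B] or after adding [B]; the
    two induced chains run from [U] to [B] and from [B] to [W]. *)
Lemma lenge_split m U B W : sub_le U B -> sub_le B W -> lenge m U W ->
  exists a b, [/\ lenge a U B, lenge b B W & (m <= a + b)%N].
Proof.
move=> UB BW l.
suff [a [b [la lb mab]]] : exists a b,
    [/\ lenge a (cap U B) B, lenge b (sum U B) W & (m <= a + b)%N].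
  exists a, b; split=> //; last by apply: lenge_monol lb; apply: sum_r.
  by apply: lenge_monol la => x Ux; split=> //; apply: UB.
elim: m U {UB} l => /= [|m IH] U.
  by move=> UW; exists 0, 0; split=> //; [move=> x [] | apply: sum_le].
move=> [A [UA st l]]; have [a [b [la lb mab]]] := IH A l.
have c1 : sub_le (cap U B) (cap A B) by move=> x [/UA].
have c2 : sub_le (sum U B) (sum A B).
  by apply: sum_le; [move=> x /UA; apply: sum_l | apply: sum_r].
case: (pstrict_modular B UA st) => st'.
  exists a.+1, b; split; [by exists (cap A B) | exact: lenge_monol lb | by rewrite addSn].
exists a, b.+1; split; [exact: lenge_monol la | by exists (sum A B) | by rewrite addnS].
Qed.

Lemma lenle_add m k U B W : sub_le U B -> sub_le B W ->
  lenle m U B -> lenle k B W -> lenle (m + k) U W.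
Proof.
move=> UB BW hm hk /(lenge_split UB BW) [a [b [la lb]]].
case: (ltnP m a) => [lt|le]; first by case: hm; apply: lenge_le la.
case: (ltnP k b) => [lt|le']; first by case: hk; apply: lenge_le lb.
by rewrite ltnNge leq_add.
Qed.

Lemma len_exact m U W : sub_le U W -> lenle m U W -> exists k, lenge k U W /\ lenle k U W.
Proof.
move=> UW; elim: m => [|m IH] h; first by exists 0.
by have [l|/IH //] := pselect (lenge m.+1 U W); exists m.+1.
Qed.

Lemma lenge1 U W : sub_le U W -> pstrict U W -> lenge 1 U W.
Proof. by move=> UW st; exists W; split=> // x. Qed.

Lemma lenle0 U W : ~ pstrict U W -> lenle 0 U W.
Proof. by move=> h [B [UB st /= BW]]; apply/h/(pstrict_mono _ BW st). Qed.

(** [W / U] is a quotient of [R / p], which at [p] becomes a field. *)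
Lemma lenle_cyclic U W x : (forall y, W y -> exists u c, U u /\ y = u + c *: x) ->
  (forall a, p a -> U (a *: x)) -> lenle 1 U W.
Proof.
move=> gen px [A [UA [w Aw hw] [B [AB [y By hy] BW]]]].
have [u [c [Uu e]]] := gen w (BW _ (AB _ Aw)).
have nc : ~ p c.
  move=> pc; apply: (hw 1); first exact: np1.
  by rewrite scale1r e; apply: sub_D => //; apply: px.
have [u' [c' [Uu' e']]] := gen y (BW _ By).
apply: (hy c nc); rewrite e' scalerDr; apply: sub_D; first exact/sub_Z/UA.
have -> : c *: (c' *: x) = c' *: (w - u).
  by rewrite e addrAC subrr add0r !scalerA mulrC.
by apply/sub_Z/sub_B => //; apply: UA.
Qed.

Lemma lenle_gen n (g : 'I_n -> V) U W : sub_le U W -> (forall i, W (g i)) ->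
  (forall y, W y -> exists u z, [/\ U u, lspan g z & y = u + z]) ->
  (forall a y, p a -> W y -> U (a *: y)) -> lenle n U W.
Proof.
elim: n g W => [|n IH] g W UW Wg gen pW.
  apply: lenle0 => -[w /gen [u [z [Uu [a ->] ->]]] h].
  by apply: (h 1 np1); rewrite scale1r big_ord0 addr0.
pose g' i := g (widen_ord (leqnSn n) i).
pose S : submod V := Submod (lspan0 g') (@lspanD _ _ _ g') (@lspanZ _ _ _ g').
have SW : sub_le (sum U S) W.
  apply: sum_le => // x [a ->]; apply: sub_sum => i _; exact/sub_Z/Wg.
rewrite -addn1; apply: (@lenle_add _ _ U (sum U S) W) => //; first exact: sum_l.
  apply: (IH g') => //; first exact: sum_l.
  - move=> i; apply: sum_r; exact: lspan_gen.
  - by move=> a y pa /SW; apply: pW.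
apply: (@lenle_cyclic _ _ (g ord_max)) => [y /gen [u [z [Uu [a ->] ->]]]|a pa].
  exists (u + \sum_i a (widen_ord (leqnSn n) i) *: g' i), (a ord_max).
  rewrite big_ord_recr /= addrA; split=> //.
  by exists u, (\sum_i a (widen_ord (leqnSn n) i) *: g' i); split=> //; exists (fun i => a (widen_ord (leqnSn n) i)).
by apply/sum_l/pW => //; apply: Wg.
Qed.

Definition prods k (x : R) : Prop := exists2 r : seq R, size r = k &
  (forall a, a \in r -> p a) /\ x = \prod_(a <- r) a.

(** At [p] the element [c] is a unit, so [W / U] is killed by [p^k]; the layers of its filtration by
    powers of [p] are finitely generated and killed by [p]. *)
Lemma len_finite k c U W : (forall P : submod V, fgsub P) -> sub_le U W -> ~ p c ->
  (forall a y, prods k a -> W y -> U ((c * a) *: y)) -> exists m, lenle m U W.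
Proof.
move=> fg UW nc; elim: k W UW => [|k IH] W UW h.
  exists 0; apply: lenle0 => -[w Ww hw]; apply: (hw c nc).
  by have := h 1 w; rewrite mulr1; apply => //; exists [::] => //; rewrite big_nil.
pose pW x := exists n (a : 'I_n -> R) (y : 'I_n -> V),
  (forall i, p (a i) /\ W (y i)) /\ x = \sum_i a i *: y i.
have pW0 : pW 0 by exists 0, (fun=> 0), (fun=> 0); split; [case | rewrite big_ord0].
have pWD x y : pW x -> pW y -> pW (x + y).
  move=> [n [a [u [hn ->]]]] [m [b [v [hm ->]]]].
  exists (n + m)%N, (fun j => match split j with inl i => a i | inr i => b i end).
  exists (fun j => match split j with inl i => u i | inr i => v i end).
  split; first by move=> i; case: (split i).
  rewrite big_split_ord /=.
  by congr (_ + _); apply: eq_bigr => i _; rewrite ?(unsplitK (inl i)) ?(unsplitK (inr i)).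
have pWZ r x : pW x -> pW (r *: x).
  move=> [n [a [u [hn ->]]]]; exists n, a, (fun i => r *: u i); split.
    by move=> i; have [pa Wu] := hn i; split=> //; apply: sub_Z.
  by rewrite scaler_sumr; apply: eq_bigr => i _; rewrite !scalerA mulrC.
pose PW := Submod pW0 pWD pWZ.
have PWW : sub_le PW W.
  by move=> x [n [a [u [hn ->]]]]; apply: sub_sum => i _; apply: sub_Z; case: (hn i).
have [m hm] : exists m, lenle m U (sum U PW).
  apply: IH; first exact: sum_l.
  move=> a y ka [u [z [Uu [n [b [v [hn ->]]]] ->]]].
  rewrite scalerDr; apply: sub_D; first exact: sub_Z.
  rewrite scaler_sumr; apply: sub_sum => i _; rewrite scalerA -mulrA.
  have [pb Wv] := hn i; apply: h => //; have [r sr [rp ->]] := ka.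
  exists (rcons r (b i)); first by rewrite size_rcons sr.
  split; last by rewrite -cats1 big_cat big_seq1.
  by move=> x; rewrite mem_rcons inE => /orP[/eqP ->|/rp].
have [n [g [Wg hg]]] := fg W.
exists (m + n)%N; apply: (lenle_add _ _ hm); first exact: sum_l.
  exact: sum_le.
apply: (lenle_gen (g := g)) => //; first exact: sum_le.
  move=> y /hg Sy; exists 0, y; rewrite add0r; split=> //.
  by exists 0, 0; rewrite addr0; split=> //; apply: sub_0.
move=> a y pa Wy; apply: sum_r; exists 1%N, (fun=> a), (fun=> y).
by rewrite big_ord1; split.
Qed.

End OneModule.

(** Transports chains through an operator on submodules that need not be induced by a linear map;
    the conditions are only asked between [U] and [W]. *)
Lemma lenge_map (V V' : lmodType R) (F : submod V -> submod V') (U W : submod V) m :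
  (forall A B, sub_le U A -> sub_le A B -> sub_le B W -> sub_le (F A) (F B)) ->
  (forall A B, sub_le U A -> sub_le A B -> sub_le B W -> pstrict A B -> pstrict (F A) (F B)) ->
  lenge m U W -> lenge m (F U) (F W).
Proof.
elim: m U => /= [|m IH] U mono st; first by move=> UW; apply: mono => // x.
move=> [B [UB sB lB]]; have BW := lenge_sub lB.
exists (F B); split; [exact: mono | exact: st |].
by apply: IH lB => A A' BA AA' A'W; [apply: mono | apply: st] => // x /UB /BA.
Qed.

Section Power.
Variables (V : lmodType R) (I : finType).

(** Interpolates between [U^I] and [W^I], so that the length of a power is computed one coordinate
    at a time. *)
Definition mixed (s : {set I}) (U W : submod V) : submod {ffun I -> V}.
Proof.
apply: (@Submod _ _ (fun f : {ffun I -> V} => forall i : I, if i \in s then W (f i) else U (f i))).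
- by move=> i; rewrite ffunE; case: ifP => _; apply: sub_0.
- by move=> f g hf hg i; rewrite ffunE; move: (hf i) (hg i); case: ifP => _; apply: sub_D.
- by move=> a f hf i; rewrite ffunE; move: (hf i); case: ifP => _; apply: sub_Z.
Defined.

Definition power (W : submod V) := mixed setT W W.

Definition upd (s : {set I}) (i : I) (U W A : submod V) : submod {ffun I -> V}.
Proof.
apply: (@Submod _ _ (fun f : {ffun I -> V} => A (f i) /\
  forall j : I, j != i -> if j \in s then W (f j) else U (f j))).
- by split=> [|j _]; rewrite ffunE; last case: ifP => _; apply: sub_0.
- move=> f g [fi hf] [gi hg]; split=> [|j ji]; rewrite ffunE; first exact: sub_D.
  by move: (hf j ji) (hg j ji); case: ifP => _; apply: sub_D.
- move=> a f [fi hf]; split=> [|j ji]; rewrite ffunE; first exact: sub_Z.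
  by move: (hf j ji); case: ifP => _; apply: sub_Z.
Defined.

Definition single (i : I) (x : V) : {ffun I -> V} := [ffun j => if j == i then x else 0].

Definition slice (i : I) (B : submod {ffun I -> V}) : submod V.
Proof.
apply: (@Submod _ _ (fun x => B (single i x))).
- suff -> : single i 0 = 0 by apply: sub_0.
  by apply/ffunP => j; rewrite !ffunE if_same.
- move=> x y hx hy; suff -> : single i (x + y) = single i x + single i y by apply: sub_D.
  by apply/ffunP => j; rewrite !ffunE; case: ifP; rewrite ?addr0.
- move=> a x hx; suff -> : single i (a *: x) = a *: single i x by apply: sub_Z.
  by apply/ffunP => j; rewrite !ffunE; case: ifP; rewrite ?scaler0.
Defined.

Lemma mixed_le (s s' : {set I}) U W : sub_le U W -> s \subset s' ->
  sub_le (mixed s U W) (mixed s' U W).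
Proof.
move=> UW ss f hf i; move: (hf i); case: ifP => [/(subsetP ss) -> //|_].
by case: ifP => // _ /UW.
Qed.

Lemma lenge_mixed1 m (s : {set I}) (i : I) U W : sub_le U W -> i \notin s -> lenge m U W ->
  lenge m (mixed s U W) (mixed (i |: s) U W).
Proof.
move=> UW nis l.
have : lenge m (upd s i U W U) (upd s i U W W).
  apply: lenge_map l => A B UA AB BW; first by move=> f [/AB fi hf].
  move=> [w Bw hw]; exists (single i w).
    split=> [|j /negbTE ji]; rewrite ffunE ?eqxx //= ji.
    by case: ifP => _; apply: sub_0.
  by move=> a na [] ; rewrite !ffunE eqxx => /(hw a na).
move=> l'; apply: lenge_monol (lenge_monor _ l').
  move=> f hf; split=> [|j _]; last exact: hf.
  by have := hf i; rewrite (negbTE nis).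
move=> f [fi hf] j; rewrite in_setU1; case: eqP => [-> //|/eqP ji] /=; exact: hf.
Qed.

(** Every intermediate submodule contains what lies off the coordinate [i], so it is determined by
    its slice there. *)
Lemma lenle_mixed1 m (s : {set I}) (i : I) U W : sub_le U W -> i \notin s -> lenle m U W ->
  lenle m (mixed s U W) (mixed (i |: s) U W).
Proof.
move=> UW nis h l; apply: h.
have dec A (f : {ffun I -> V}) : sub_le (mixed s U W) A -> mixed (i |: s) U W f ->
    A (f - single i (f i)).
  move=> sA hf; apply: sA => j; rewrite !ffunE.
  case: eqP => [->|/eqP ji]; first by rewrite subrr (negbTE nis); apply: sub_0.
  by have := hf j; rewrite in_setU1 (negbTE ji) subr0.
have : lenge m.+1 (slice i (mixed s U W)) (slice i (mixed (i |: s) U W)).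
  apply: lenge_map l => A B sA AB BsI; first by move=> x /AB.
  move=> [f Bf hf]; exists (f i).
    have := sub_B Bf (AB _ (dec _ f sA (BsI _ Bf))); by rewrite opprB addrC subrK.
  move=> a na h; apply: (hf a na).
  have -> : a *: f = single i (a *: f i) + a *: (f - single i (f i)).
    apply/ffunP => j; rewrite !ffunE; case: eqP => [->|_]; first by rewrite subrr scaler0 addr0.
    by rewrite subr0 add0r.
  by apply: sub_D => //; apply/sub_Z/dec => //; apply: BsI.
move=> l'; apply: lenge_monol (lenge_monor _ l') => x.
  move=> Ux j; rewrite ffunE; case: eqP => [->|_]; first by rewrite (negbTE nis).
  by case: ifP => _; apply: sub_0.
by move=> /(_ i); rewrite ffunE eqxx setU11.
Qed.

Lemma lenge_mixed m (s : {set I}) U W : sub_le U W -> lenge m U W ->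
  lenge (#|s| * m) (mixed set0 U W) (mixed s U W).
Proof.
move=> UW l; elim/finset_ind: s => [|i s nis IH].
  by rewrite cards0 mul0n /= => f.
by rewrite cardsU1 nis mulnDl mul1n addnC; apply: lenge_cat IH (lenge_mixed1 UW nis l).
Qed.

Lemma lenle_mixed m (s : {set I}) U W : sub_le U W -> lenle m U W ->
  lenle (#|s| * m) (mixed set0 U W) (mixed s U W).
Proof.
move=> UW l; elim/finset_ind: s => [|i s nis IH].
  by rewrite cards0; apply: lenle0 => -[f /= hf /(_ 1 np1)]; rewrite scale1r; apply.
rewrite cardsU1 nis mulnDl mul1n addnC.
apply: lenle_add IH (lenle_mixed1 UW nis l); apply: mixed_le => //.
  exact: sub0set.
exact: subsetU1.
Qed.

Lemma mixed0E U W f : mixed set0 U W f <-> power U f.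
Proof. by split=> h i; have := h i; rewrite /= in_set0 in_setT. Qed.

Lemma mixedTE U W f : mixed setT U W f <-> power W f.
Proof. by split=> h i; have := h i; rewrite /= in_setT. Qed.

Lemma lenge_power m U W : lenge m U W -> lenge (#|I| * m) (power U) (power W).
Proof.
move=> l; rewrite -cardsT; have l' := lenge_mixed setT (lenge_sub l) l.
by apply: lenge_monol (lenge_monor _ l') => f; [move/mixed0E|move/mixedTE].
Qed.

Lemma lenle_power m U W : sub_le U W -> lenle m U W -> lenle (#|I| * m) (power U) (power W).
Proof.
move=> UW h l; have := lenle_mixed (s := [set: I]) UW h; rewrite cardsT; apply.
by apply: lenge_monol (lenge_monor _ l) => f hf; [apply: (mixed0E U W f).1 | apply/mixedTE].
Qed.

End Power.
End LengthAtPrime.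

(** * Rings filtered by ideals with free graded pieces *)

Lemma fg_mx (R : comPzRingType) : noetherian R -> forall m n (P : submod 'M[R]_(m, n)), fgsub P.
Proof.
move=> nR m n P.
apply: (noeth_fgsub nR (g := fun k : 'I_(m * n) => vec_mx (delta_mx 0 k))) => x _.
have [a e] := lspan_rV (mxvec x); exists a.
by rewrite -[x]mxvecK {1}e linear_sum; apply: eq_bigr => i _; rewrite linearZ.
Qed.

Lemma prods_split (R : comPzRingType) (J : ideal R) a b x : prods J (a + b) x ->
  exists u v, [/\ prods J a u, prods J b v & x = u * v].
Proof.
move=> [r sr [rJ ->]]; exists (\prod_(x <- take a r) x), (\prod_(x <- drop a r) x); split.
- exists (take a r); first by rewrite size_takel // sr leq_addr.
  by split=> // y /mem_take; apply: rJ.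
- exists (drop a r); first by rewrite size_drop sr addKn.
  by split=> // y /mem_drop; apply: rJ.
- by rewrite -big_cat cat_take_drop.
Qed.

(** Products of [L] elements lie in [N + (x)] by induction on the generators, so products of [M L]
    elements lie in [N + (x^M)], and [x^M] is in [N]. *)
Lemma prods_nil (R : comPzRingType) (N : ideal R) (r : seq R) :
  (forall x, x \in r -> exists m, N (x ^+ m)) ->
  exists L, forall x, prods (ideal_span r) L x -> N x.
Proof.
elim: r => [|x r IH] h.
  exists 1%N => y [[|z [|? ?]] // _ [hz ->]]; rewrite big_seq1.
  by have /ideal_spanE [a ->] := hz z (mem_head _ _); rewrite big_ord0; apply: ideal_0.
have [|L hL] := IH; first by move=> y yr; apply: h; rewrite inE yr orbT.
have [M hM] := h x (mem_head _ _).
have h1 y : prods (ideal_span (x :: r)) L y -> exists n c, N n /\ y = n + c * x.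
  move=> [u su [uJ ->]].
  suff [b [c [sb bJ ->]]] : exists b c, [/\ size b = size u, (forall z, z \in b -> ideal_span r z) &
      \prod_(z <- u) z = \prod_(z <- b) z + c * x].
    exists (\prod_(z <- b) z), c; split=> //; apply: hL.
    by exists b; rewrite ?sb.
  elim: u {su} uJ => [|z u IHu] uJ.
    by exists [::], 0; rewrite !big_nil mul0r addr0.
  have [|b [c [sb bJ e]]] := IHu; first by move=> w wu; apply: uJ; rewrite inE wu orbT.
  have /ideal_spanE [a ez] := uJ z (mem_head _ _).
  rewrite /= big_ord_recl /= in ez; set z' := \sum_i _ in ez.
  have hz' : ideal_span r z' by apply/ideal_spanE; exists (fun i => a (lift ord0 i)).
  exists (z' :: b), (a ord0 * (\prod_(w <- b) w + c * x) + z' * c); split.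
  - by rewrite /= sb.
  - by move=> w; rewrite inE => /orP[/eqP -> //|/bJ].
  - by rewrite !big_cons e ez; ring.
have h2 k y : prods (ideal_span (x :: r)) (k * L) y -> exists n c, N n /\ y = n + c * x ^+ k.
  elim: k y => [|k IHk] y.
    by move=> _; exists 0, y; rewrite expr0 mulr1 add0r; split=> //; apply: ideal_0.
  rewrite mulSn => /prods_split [u [v [/h1 [n [c [Nn ->]]] /IHk [n' [c' [Nn' ->]]] ->]]].
  exists (n * (n' + c' * x ^+ k) + c * x * n'), (c * c'); split.
    by apply: ideal_D; [apply: ideal_Mr | apply: ideal_M].
  by rewrite exprS; ring.
exists (M * L)%N => y /h2 [n [c [Nn ->]]].
by apply: ideal_D => //; apply: ideal_M.
Qed.

(* A filtration of the ring by ideals [K k], with [K k / K k.+1] free over [R / K 1] on the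
   classes of [beta k a], [a : I k]; for [R = S/(y)^s] these are the powers of [(y)]. *)
Record free_filtration (R : comPzRingType) (s : nat) := FreeFiltration {
  idx : nat -> finType;
  bet : forall k, idx k -> R;
  fil : nat -> ideal R;
  fil0 : forall x, fil 0 x;
  fils : forall x, fil s x -> x = 0;
  fil_dec : forall k x, fil k.+1 x -> fil k x;
  fil_bet : forall k a, (k < s)%N -> fil k (bet (k := k) a);
  fil_mul : forall k a x, fil 1 a -> fil k x -> fil k.+1 (a * x);
  fil_gen : forall k x, (k < s)%N -> fil k x ->
    exists c : idx k -> R, fil k.+1 (x - \sum_a c a * bet a);
  fil_free : forall k (c : idx k -> R), (k < s)%N -> fil k.+1 (\sum_a c a * bet a) ->
    forall a, fil 1 (c a)
}.

Section FilteredExt.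
Variables (R : comPzRingType) (s : nat) (F : free_filtration R s).
Local Notation K := (fil F).
Local Notation I := (idx F).

Definition inK k m n (X : 'M[R]_(m, n)) : Prop := forall i j, K k (X i j).

Lemma inKD k m n (X Y : 'M[R]_(m, n)) : inK k X -> inK k Y -> inK k (X + Y).
Proof. by move=> hX hY i j; rewrite mxE; apply: ideal_D. Qed.

Lemma inKN k m n (X : 'M[R]_(m, n)) : inK k X -> inK k (- X).
Proof. by move=> hX i j; rewrite mxE; apply: ideal_N. Qed.

Lemma inK0 k m n : inK k (0 : 'M[R]_(m, n)).
Proof. by move=> i j; rewrite mxE; apply: ideal_0. Qed.

Lemma inK_mul k l m n (Y : 'M[R]_(l, m)) (X : 'M[R]_(m, n)) : inK k X -> inK k (Y *m X).
Proof. by move=> hX i j; rewrite mxE; apply: ideal_sum => a _; apply: ideal_M. Qed.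

Lemma inK_mulr k l m n (Y : 'M[R]_(m, l)) (X : 'M[R]_(n, m)) : inK k X -> inK k (X *m Y).
Proof. by move=> hX i j; rewrite mxE; apply: ideal_sum => a _; apply: ideal_Mr. Qed.

Lemma inK_Z k m n c (X : 'M[R]_(m, n)) : inK k X -> inK k (c *: X).
Proof. by move=> hX i j; rewrite mxE; apply: ideal_M. Qed.

Lemma inK_bet k m n a (X : 'M[R]_(m, n)) : (k < s)%N -> inK 1 X -> inK k.+1 (bet (f := F) (k := k) a *: X).
Proof. by move=> ks hX i j; rewrite mxE mulrC; apply: fil_mul => //; apply: fil_bet. Qed.

Lemma inK_bet0 k m n a (X : 'M[R]_(m, n)) : (k < s)%N -> inK k (bet (f := F) (k := k) a *: X).
Proof. by move=> ks i j; rewrite mxE mulrC; apply/ideal_M/fil_bet. Qed.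

Lemma inK_sum k m n (J : finType) (X : J -> 'M[R]_(m, n)) :
  (forall a, inK k (X a)) -> inK k (\sum_a X a).
Proof. by move=> h i j; rewrite summxE; apply: ideal_sum => a _; apply: h. Qed.

Lemma inKs m n (X : 'M[R]_(m, n)) : inK s X -> X = 0.
Proof. by move=> h; apply/matrixP => i j; rewrite mxE; apply: fils (h i j). Qed.

Lemma inK_dec k m n (X : 'M[R]_(m, n)) : inK k.+1 X -> inK k X.
Proof. by move=> h i j; apply: fil_dec. Qed.

Lemma inK_gen k m n (X : 'M[R]_(m, n)) : (k < s)%N -> inK k X ->
  exists c : {ffun I k -> 'M[R]_(m, n)}, inK k.+1 (X - \sum_a bet a *: c a).
Proof.
move=> ks hX.
have [c hc] := choice (fun ij : 'I_m * 'I_n => fil_gen ks (hX ij.1 ij.2)).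
exists [ffun a => \matrix_(i, j) c (i, j) a] => i j; rewrite mxE mxE summxE.
have := hc (i, j); congr (K _ (_ - _)); apply: eq_bigr => a _.
by rewrite ffunE !mxE mulrC.
Qed.

Section Coefficients.
Variables (C : cpx R) (e q : nat) (E : 'M[R]_(e, q)).
Hypothesis exC : forall i, dif C i.+1 *m dif C i = 0.

(* [NK k X]: the columns of [X], as elements of [N = coker E], lie in [K k * N]. *)
Definition NK k m (X : 'M[R]_(m, q)) : Prop := exists W : 'M_(m, e), inK k (X - W *m E).

Lemma NKD k m (X Y : 'M[R]_(m, q)) : NK k X -> NK k Y -> NK k (X + Y).
Proof.
move=> [W hW] [V hV]; exists (W + V).
by have := inKD hW hV; congr (inK _ _); rewrite mulmxDl; mxlin.
Qed.

Lemma NKN k m (X : 'M[R]_(m, q)) : NK k X -> NK k (- X).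
Proof.
by move=> [W hW]; exists (- W); have := inKN hW; congr (inK _ _); rewrite mulNmx; mxlin.
Qed.

Lemma NKB k m (X Y : 'M[R]_(m, q)) : NK k X -> NK k Y -> NK k (X - Y).
Proof. by move=> hX hY; apply: NKD => //; apply: NKN. Qed.

Lemma NK0 k m : NK k (0 : 'M_(m, q)).
Proof. by exists 0; rewrite mul0mx subr0; apply: inK0. Qed.

Lemma NK_in k m (X : 'M[R]_(m, q)) : inK k X -> NK k X.
Proof. by exists 0; rewrite mul0mx subr0. Qed.

Lemma NK_rows k m (X : 'M[R]_(m, q)) : inrows X E -> NK k X.
Proof. by move=> [W ->]; exists W; rewrite subrr; apply: inK0. Qed.

Lemma NK_mul k l m (Y : 'M[R]_(l, m)) (X : 'M[R]_(m, q)) : NK k X -> NK k (Y *m X).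
Proof.
move=> [W hW]; exists (Y *m W); rewrite -mulmxA -mulmxBr; exact: inK_mul.
Qed.

Lemma NK_Z k m c (X : 'M[R]_(m, q)) : NK k X -> NK k (c *: X).
Proof. by move=> [W hW]; exists (c *: W); rewrite -scalemxAl -scalerBr; apply: inK_Z. Qed.

Lemma NK_dec k m (X : 'M[R]_(m, q)) : NK k.+1 X -> NK k X.
Proof. by move=> [W hW]; exists W; apply: inK_dec. Qed.

Lemma NKs m (X : 'M[R]_(m, q)) : NK s X -> inrows X E.
Proof. by move=> [W /inKs /eqP]; rewrite subr_eq0 => /eqP ->; exists W. Qed.

Lemma NKs_eq k m (X : 'M[R]_(m, q)) : k = s -> NK k X -> inrows X E.
Proof. by move=> ks; rewrite {k}ks; apply: NKs. Qed.

Lemma NK_sum k m (J : finType) (X : J -> 'M[R]_(m, q)) :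
  (forall a, NK k (X a)) -> NK k (\sum_a X a).
Proof.
move=> h; apply: (big_ind (@NK k m)) => [|x y|a _]; [exact: NK0 | exact: NKD | exact: h].
Qed.

Lemma NK_bet k m a (X : 'M[R]_(m, q)) : (k < s)%N -> NK 1 X -> NK k.+1 (bet (f := F) (k := k) a *: X).
Proof.
move=> ks [W hW]; exists (bet (f := F) (k := k) a *: W); rewrite -scalemxAl -scalerBr.
exact: inK_bet.
Qed.

Lemma NK_00 m (X : 'M[R]_(m, q)) : NK 0 X.
Proof. by apply: NK_in => i j; apply: fil0. Qed.

(* Freeness of [K k N / K k.+1 N] over [N / K 1 N]. *)
Definition gr_free : Prop := forall k m (c : {ffun I k -> 'M[R]_(m, q)}), (k < s)%N ->
  NK k.+1 (\sum_a bet a *: c a) -> forall a, NK 1 (c a).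

Hypothesis gr : gr_free.

(** [Zc i k] modulo [Bc i k] is Ext^(i+1)(M, N / K_k N) for [M = coker d_0] and [N = coker E]. Both
    are submodules of the cochains, so the groups for different [k] are compared inside one
    module. *)
Definition Zc (i k : nat) : submod 'M[R]_(dim C i.+1, q).
Proof.
apply: (@Submod _ _ (fun f => NK k (dif C i.+1 *m f))).
- by rewrite mulmx0; apply: NK0.
- by move=> x y hx hy; rewrite mulmxDr; apply: NKD.
- by move=> a x hx; rewrite -scalemxAr; apply: NK_Z.
Defined.

Definition Bc (i k : nat) : submod 'M[R]_(dim C i.+1, q).
Proof.
apply: (@Submod _ _ (fun f => exists g, NK k (f - dif C i *m g))).
- by exists 0; rewrite mulmx0 subr0; apply: NK0.
- move=> x y [g hg] [h hh]; exists (g + h).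
  by have := NKD hg hh; congr (NK _ _); rewrite mulmxDr; mxlin.
- move=> a x [g hg]; exists (a *: g); rewrite -scalemxAr -scalerBr; exact: NK_Z.
Defined.

Lemma Bc_Zc i k : sub_le (Bc i k) (Zc i k).
Proof.
move=> f [g hg]; have := NK_mul (dif C i.+1) hg.
by rewrite mulmxBr mulmxA exC mul0mx subr0.
Qed.

Lemma Bc_NK i k f : NK k f -> Bc i k f.
Proof. by move=> h; exists 0; rewrite mulmx0 subr0. Qed.

Definition comb k m (x : {ffun I k -> 'M[R]_(m, q)}) : 'M_(m, q) := \sum_a bet a *: x a.

Lemma combD k m (x y : {ffun I k -> 'M[R]_(m, q)}) : comb (x + y) = comb x + comb y.
Proof. by rewrite /comb -big_split; apply: eq_bigr => a _; rewrite ffunE scalerDr. Qed.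

Lemma combZ k m c (x : {ffun I k -> 'M[R]_(m, q)}) : comb (c *: x) = c *: comb x.
Proof.
rewrite /comb scaler_sumr; apply: eq_bigr => a _.
by rewrite ffunE !scalerA mulrC.
Qed.

Lemma combB k m (x y : {ffun I k -> 'M[R]_(m, q)}) : comb (x - y) = comb x - comb y.
Proof. by rewrite combD -scaleN1r combZ scaleN1r. Qed.

Lemma comb0 k m : comb (0 : {ffun I k -> 'M[R]_(m, q)}) = 0.
Proof. by rewrite /comb big1 // => a _; rewrite ffunE scaler0. Qed.

Lemma comb_mul k l m (Y : 'M[R]_(l, m)) (x : {ffun I k -> 'M[R]_(m, q)}) :
  Y *m comb x = comb [ffun a => Y *m x a].
Proof. by rewrite mulmx_sumr; apply: eq_bigr => a _; rewrite ffunE scalemxAr. Qed.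

Lemma NK_comb k m (x : {ffun I k -> 'M[R]_(m, q)}) : (k < s)%N ->
  (forall a, NK 1 (x a)) -> NK k.+1 (comb x).
Proof. by move=> ks h; apply: NK_sum => a; apply: NK_bet. Qed.

Lemma NK_gen k m (X : 'M[R]_(m, q)) : (k < s)%N -> NK k X ->
  exists x : {ffun I k -> 'M[R]_(m, q)}, NK k.+1 (X - comb x).
Proof.
move=> ks [W hW]; have [x hx] := inK_gen ks hW; exists x, W.
by move: hx; congr (inK _ _); rewrite /comb; mxlin.
Qed.

Lemma gr_diff k m (x y : {ffun I k -> 'M[R]_(m, q)}) : (k < s)%N ->
  NK k.+1 (comb x - comb y) -> forall a, NK 1 (x a - y a).
Proof.
move=> ks h a.
have := gr (c := x - y) ks _ a; rewrite !ffunE; apply.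
by move: h; rewrite -combB.
Qed.

(* The boundary of a class of degree [i] in [K k N], given its components. *)
Lemma gr_cocycle i k (x : {ffun I k -> _}) f : (k < s)%N -> Zc i k.+1 f ->
  Bc i k.+1 (f - comb x) -> forall a, Zc i 1 (x a).
Proof.
move=> ks Zf /Bc_Zc Bf a.
have h : NK k.+1 (comb [ffun a => dif C i.+1 *m x a]).
  rewrite -comb_mul; have := NKB Zf Bf.
  by congr (NK _ _); rewrite mulmxBr; mxlin.
by have := gr ks h a; rewrite ffunE.
Qed.

Lemma Bc_gen i k f : (k < s)%N -> Bc i k f ->
  exists x : {ffun I k -> _}, Bc i k.+1 (f - comb x).
Proof.
move=> ks [g /(NK_gen ks) [x hx]]; exists x, g.
by move: hx; congr (NK _ _); mxlin.
Qed.

Lemma Bc_comb i k (x : {ffun I k -> _}) : (k < s)%N ->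
  (forall a, Bc i 1 (x a)) -> Bc i k.+1 (comb x).
Proof.
move=> ks h; apply: (sub_sum (P := Bc i k.+1)) => a _; have [g hg] := h a.
exists (bet a *: g); rewrite -scalemxAr -scalerBr; exact: NK_bet.
Qed.

Section Length.
Variables (p : ideal R) (prime_p : prime_ideal p).

(** Layer [k] of [N / K_(k+1) N] consists of [#|I k|] copies of [N / K_1 N]; the part of Ext coming
    from it has length at most [#|I k| * m], and the rest embeds in Ext(M, N / K_k N). *)
Lemma length_up i m : lenle p m (Bc i 1) (Zc i 1) -> forall k, (k <= s)%N ->
  lenle p ((\sum_(j < k) #|I j|) * m) (Bc i k) (Zc i k).
Proof.
move=> hm; elim=> [|k IH] ks.
  rewrite big_ord0; apply: lenle0 => -[w _ /(_ 1 (np1 prime_p))]; apply.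
  exact/Bc_NK/NK_00.
have BY : sub_le (Bc i k.+1) (cap (Zc i k.+1) (Bc i k)).
  by move=> f Bf; split; [apply: Bc_Zc | case: Bf => g hg; exists g; apply: NK_dec].
rewrite big_ord_recr /= mulnDl addnC.
apply: (lenle_add prime_p (B := cap (Zc i k.+1) (Bc i k))) => //; first by move=> f [].
- move=> l; apply: (lenle_power prime_p (I := I k) (@Bc_Zc i 1) hm).
  (* [G A] pulls [A] back along [comb] to families of cocycles with values in [N / K_1 N]. *)
  pose g (A : submod 'M[R]_(dim C i.+1, q)) (x : {ffun I k -> 'M[R]_(dim C i.+1, q)}) :=
    (forall a, Zc i 1 (x a)) /\ A (comb x).
  have g0 A : g A 0 by split=> [a|]; rewrite ?ffunE ?comb0; apply: sub_0.
  have gD A x y : g A x -> g A y -> g A (x + y).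
    by move=> [hx Ax] [hy Ay]; split=> [a|]; rewrite ?ffunE ?combD; apply: sub_D.
  have gZ A c x : g A x -> g A (c *: x).
    by move=> [hx Ax]; split=> [a|]; rewrite ?ffunE ?combZ; apply: sub_Z.
  pose G A := Submod (g0 A) (@gD A) (@gZ A).
  have : lenge p ((#|I k| * m).+1) (G (Bc i k.+1)) (G (cap (Zc i k.+1) (Bc i k))).
    apply: lenge_map l => A B BA AB BY'; first by move=> x [hx Ax]; split=> //; apply: AB.
    move=> [w Bw hw]; have [Zw Bwk] := BY' _ Bw.
    have [x hx] := Bc_gen ks Bwk.
    have Zx := gr_cocycle ks Zw hx.
    exists x.
      split=> //; have -> : comb x = w - (w - comb x) by mxlin.
      by apply: sub_B => //; apply/AB/BA.
    move=> a na [_ Ax]; apply: (hw a na).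
    have -> : a *: w = comb (a *: x) + a *: (w - comb x).
      by rewrite combZ -scalerDr addrC subrK.
    by apply: sub_D => //; apply/sub_Z/BA.
  move=> l'; apply: lenge_monol (lenge_monor _ l') => x.
    move=> hx; have hx' a : Bc i 1 (x a) by have := hx a; rewrite /= in_setT.
    by split=> [a|]; [apply: Bc_Zc | apply: Bc_comb].
  by move=> [hx _] a; rewrite /= in_setT; apply: hx.
(* In the upper part, adding [Bc i k] loses no strictness: each submodule of the chain already
   contains the cocycles of level [k.+1] that lie in [Bc i k]. *)
- have ks' := ltnW ks; move=> l; apply: (IH ks').
  have : lenge p (((\sum_(j < k) #|I j|) * m).+1) (sum (cap (Zc i k.+1) (Bc i k)) (Bc i k))
      (sum (Zc i k.+1) (Bc i k)).
    apply: (lenge_map (F := fun A => sum A (Bc i k))) l => A B YA AB BZ.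
      by apply: sum_le; [move=> f /AB; apply: sum_l | apply: sum_r].
    move=> [w Bw hw]; exists w; first exact: sum_l.
    move=> a na [u [v [Au Bv e1]]]; apply: (hw a na).
    have Av : A v.
      apply: YA; split=> //; have -> : v = a *: w - u by rewrite e1 addrC addKr.
      by apply: sub_B; [apply/sub_Z/BZ | apply/BZ/AB].
    by rewrite e1; apply: sub_D.
  move=> l'; apply: lenge_monol (lenge_monor _ l'); first exact: sum_r.
  by apply: sum_le; [move=> f; apply: NK_dec | apply: Bc_Zc].
Qed.

(** The connecting map from Ext(M, N / K_(s-1) N) to Ext(M, K_(s-1) N) is onto because Ext(M, N)
    vanishes; since [K_s = 0], its target is a power of Ext(M, N / K_1 N). *)
Lemma socle_lift i k (x : {ffun I k -> 'M[R]_(dim C i.+2, q)}) : k.+1 = s -> ext0 C i.+1 E ->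
  (forall a, Zc i.+1 1 (x a)) -> exists2 f, Zc i k f & inrows (comb x - dif C i.+1 *m f) E.
Proof.
move=> ks ext hx; have ks' : (k < s)%N by rewrite -ks.
have [|f hf] := ext (comb x).
  rewrite comb_mul; apply: (NKs_eq ks); apply: NK_comb => // a.
  by rewrite ffunE; apply: hx.
exists f => //.
have h : NK k (comb x) by apply: NK_sum => a; apply: NK_in; apply: inK_bet0.
by have := NKB h (NK_rows k hf); congr (NK _ _); mxlin.
Qed.

Lemma socle_bound i k f : k.+1 = s -> Bc i k f -> exists x : {ffun I k -> _},
  (forall a, Bc i.+1 1 (x a)) /\ inrows (comb x - dif C i.+1 *m f) E.
Proof.
move=> ks; have ks' : (k < s)%N by rewrite -ks.
move=> /(Bc_gen ks') [x hx]; exists [ffun a => dif C i.+1 *m x a]; split=> [a|].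
  by rewrite ffunE; exists (x a); rewrite subrr; apply: NK0.
rewrite -comb_mul; apply: (NKs_eq ks); have := NKN (Bc_Zc hx).
by congr (NK _ _); rewrite mulmxBr; mxlin.
Qed.

(** Chains in [#|I k|] copies of Ext^(i+2)(M, N / K_1 N) are pulled back along the surjective
    connecting map to Ext^(i+1)(M, N / K_k N). *)
Lemma length_down i k m : k.+1 = s -> ext0 C i.+1 E ->
  lenge p m (Bc i.+1 1) (Zc i.+1 1) -> lenge p (#|I k| * m) (Bc i k) (Zc i k).
Proof.
move=> ks ext l0; have l := lenge_power (I k) l0; have ks' : (k < s)%N by rewrite -ks.
pose g (A : submod {ffun I k -> 'M[R]_(dim C i.+2, q)}) (f : 'M[R]_(dim C i.+1, q)) :=
  exists2 x, A x & inrows (comb x - dif C i.+1 *m f) E.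
have g0 A : g A 0.
  by exists 0; [apply: sub_0 | rewrite comb0 mulmx0 subrr; apply: inrows0].
have gD A f h : g A f -> g A h -> g A (f + h).
  move=> [x Ax hx] [y Ay hy]; exists (x + y); first exact: sub_D.
  by have := inrowsD hx hy; congr (inrows _ _); rewrite combD mulmxDr; mxlin.
have gZ A a f : g A f -> g A (a *: f).
  move=> [x Ax hx]; exists (a *: x); first exact: sub_Z.
  by rewrite combZ -scalemxAr -scalerBr; apply: inrowsZ.
pose G A := Submod (g0 A) (@gD A) (@gZ A).
have : lenge p (#|I k| * m) (G (power (I k) (Bc i.+1 1))) (G (power (I k) (Zc i.+1 1))).
  apply: lenge_map l => A B BA AB BZ; first by move=> f [x /AB Bx hx]; exists x.
  move=> [x Bx hw]; have [|f Zf hf] := socle_lift (x := x) ks ext.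
    by move=> a; have := BZ _ Bx a; rewrite /= in_setT.
  exists f; first by exists x.
  move=> a na [x' Ax' hx']; apply: (hw a na).
  have -> : a *: x = x' + (a *: x - x') by rewrite addrC subrK.
  apply: sub_D => //; apply: BA => b; rewrite /= in_setT !ffunE; apply: Bc_NK.
  have h : NK k.+1 (comb (a *: x) - comb x').
    apply: NK_rows; rewrite combZ; have := inrowsD (inrowsZ a hf) (inrowsN hx').
    by congr (inrows _ _); rewrite -scalemxAr; mxlin.
  by have := gr_diff ks' h b; rewrite !ffunE.
move=> l'; apply: lenge_monol (lenge_monor _ l') => f.
  move=> /(socle_bound ks) [x [Bx hx]]; exists x => // a; rewrite /= in_setT; apply: Bx.
move=> [x Zx hx]; have h : NK k (comb x) by apply: NK_sum => a; apply: NK_in; apply: inK_bet0.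
by have := NKB h (NK_rows k hx); congr (NK _ _); mxlin.
Qed.

End Length.

Hypothesis count : (\sum_(j < s.-1) #|I j| < #|I s.-1|)%N.
Hypothesis s_gt0 : (0 < s)%N.
Hypothesis noethR : noetherian R.

Definition annE i (r : R) : Prop := forall f, Zc i 1 f -> Bc i 1 (r *: f).

(** Each layer of [N / K_k N] costs one factor [r]. *)
Lemma ann_up i r k : (k <= s)%N -> annE i r -> forall f, Zc i k f -> Bc i k (r ^+ k *: f).
Proof.
move=> ks ann; elim: k ks => [|k IH] ks f Zf; first exact/Bc_NK/NK_00.
have [x hx] := Bc_gen ks (IH (ltnW ks) f (NK_dec Zf)).
have Zx := gr_cocycle ks (sub_Z (r ^+ k) Zf) hx.
have -> : r ^+ k.+1 *: f = r *: (r ^+ k *: f - comb x) + comb (r *: x).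
  by rewrite combZ -scalerDr subrK scalerA exprS.
apply: sub_D; first exact: sub_Z.
by apply: Bc_comb => // a; rewrite ffunE; apply: ann.
Qed.

(** An annihilator is carried to the next Ext through the connecting map; one index [a0] of the top
    layer is enough to place a class of Ext(M, N / K_1 N) there. *)
Lemma ann_next i r : ext0 C i.+1 E -> annE i r -> annE i.+1 (r ^+ s.-1).
Proof.
move=> ext ann f Zf; set k := s.-1; have ks : k.+1 = s by rewrite prednK.
have ks' : (k < s)%N by rewrite -ks.
have [a0 _] : exists a0, a0 \in I k by apply/card_gt0P; apply: leq_ltn_trans count.
pose x : {ffun I k -> _} := [ffun a => if a == a0 then f else 0].
have [|g Zg hg] := socle_lift (x := x) ks ext.
  by move=> a; rewrite ffunE; case: ifP => _ //; apply: sub_0.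
have [y [By hy]] := socle_bound ks (ann_up (ltnW ks') ann Zg).
have h : NK k.+1 (comb (r ^+ k *: x) - comb y).
  apply: NK_rows; rewrite combZ; have := inrowsD (inrowsZ (r ^+ k) hg) (inrowsN hy).
  by congr (inrows _ _); rewrite -scalemxAr; mxlin.
have := gr_diff ks' h a0; rewrite !ffunE eqxx => hN.
have -> : r ^+ k *: f = (r ^+ k *: f - y a0) + y a0 by rewrite subrK.
by apply: sub_D => //; apply: Bc_NK.
Qed.

(* Comparing lengths at a minimal prime of the support forces [Ext^i(coker d_0, N/K_1 N)]
   to vanish for large [i]. *)
Lemma ext_eventually0 n : (forall i, (n <= i)%N -> ext0 C i E) ->
  exists2 i, (n <= i)%N & sub_le (Zc i 1) (Bc i 1).
Proof.
move=> ext; apply: contrapT => no.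
have ann1 i : (n <= i)%N -> ~ annE i 1.
  by move=> ni h; apply: no; exists i => // f /h; rewrite scale1r.
have annM i a r : annE i r -> annE i (a * r).
  by move=> h f /h; rewrite -scalerA; apply: sub_Z.
(* The union over [i] of the radicals of the annihilators; it is an ideal because these radicals
   increase with [i], by [ann_next]. *)
pose cc r := exists2 i, (n <= i)%N & exists m, annE i (r ^+ m).
have cc_up i j r : (n <= i)%N -> (i <= j)%N -> (exists m, annE i (r ^+ m)) -> exists m, annE j (r ^+ m).
  move=> ni /subnK <-; elim: (j - i)%N => // d IH /IH [m hm].
  exists (m * s.-1)%N; rewrite exprM addSn; apply: ann_next hm; apply: ext.
  by rewrite -addSn; apply: leq_trans ni _; rewrite leq_addl.
have cc0 : cc 0.
  by exists n => //; exists 1%N => f _; rewrite expr1 scale0r; apply: sub_0.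
have ccM a x : cc x -> cc (a * x).
  by move=> [i ni [m hm]]; exists i => //; exists m; rewrite exprMn; apply: annM.
have ann0 i : annE i 0 by move=> f _; rewrite scale0r; apply: sub_0.
have annD i x y : annE i x -> annE i y -> annE i (x + y).
  by move=> hx hy f Zf; rewrite scalerDl; apply: sub_D; [apply: hx | apply: hy].
pose annI i := @Ideal R (annE i) (ann0 i) (@annD i) (@annM i).
have ccD x y : cc x -> cc y -> cc (x + y).
  move=> [i ni hi] [j nj hj]; set k := maxn i j.
  have [m hm] := cc_up _ k _ ni (leq_maxl _ _) hi; have [l hl] := cc_up _ k _ nj (leq_maxr _ _) hj.
  exists k; first by apply: leq_trans (leq_maxl _ _).
  exists (m + l)%N; apply: (_ : annI k _); rewrite exprDn; apply: ideal_sum => t _.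
  rewrite -mulr_natl; apply: ideal_M; case: (leqP l t) => lt.
    by apply: ideal_M; rewrite -(subnK lt) exprD; apply: ideal_M.
  have mt : (m <= m + l - t)%N by rewrite -addnBA ?leq_addr // ltnW.
  by apply: ideal_Mr; rewrite -(subnK mt) exprD; apply: ideal_M.
pose CC := @Ideal R cc cc0 ccD ccM.
have cc1 : ~ cc 1 by move=> [i ni [m]]; rewrite expr1n; apply: ann1.
have [r hr] := noethR CC.
have [i0 ni0 hi0] : exists2 i0, (n <= i0)%N & forall x, x \in r -> exists m, annI i0 (x ^+ m).
  have : forall x, x \in r -> cc x by move=> x xr; apply/hr/ideal_span_mem.
  elim: r {hr} => [|x r IH] h; first by exists n.
  have [|i ni hi] := IH; first by move=> y yr; apply: h; rewrite inE yr orbT.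
  have [j nj hj] := h x (mem_head _ _).
  exists (maxn i j); first by apply: leq_trans (leq_maxl _ _).
  move=> y; rewrite inE => /orP[/eqP ->|/hi h'].
    exact: (cc_up j _ _ nj (leq_maxr _ _) hj).
  exact: (cc_up i _ _ ni (leq_maxl _ _) h').
have [L hL] := prods_nil hi0.
(* A maximal member of the ideals [(CC : c)] with [c] outside [CC] is prime; as [CC] is radical, [c]
   is outside this prime too. *)
pose QQ (J : ideal R) := exists2 c, ~ cc c & forall x, J x <-> cc (x * c).
have Q0 : QQ CC by exists 1 => // x; rewrite mulr1.
have [p [[c ncc hp] _ pmax]] := noeth_max noethR Q0.
have prime_p : prime_ideal p.
  split=> [/hp|x y /hp cxy]; first by rewrite mul1r.
  have [py|npy] := pselect (p y); [by right | left].
  have J0 : cc (0 * (y * c)) by rewrite mul0r; exact cc0.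
  have JD u v : cc (u * (y * c)) -> cc (v * (y * c)) -> cc ((u + v) * (y * c)).
    by rewrite mulrDl; apply: (ccD _).
  have JM u v : cc (v * (y * c)) -> cc (u * v * (y * c)) by rewrite -mulrA; apply: (ccM _).
  apply: (pmax (Ideal J0 JD JM)); last by rewrite /= mulrA.
    by exists (y * c) => // /hp.
  by move=> z /hp h; rewrite /= mulrCA; apply: (ccM _).
have nc : ~ p c.
  by move=> /hp [i ni [m hm]]; apply: ncc; exists i => //; exists (2 * m)%N; rewrite exprM expr2.
have npX k : ~ p (c ^+ k).
  by elim: k => [|k IH]; rewrite ?expr0 ?exprS; [case: prime_p | apply: npM].
(* [c p] lies in [CC], so products of [L] elements of [c p] kill the Ext group at [i0], which
   therefore has finite length at [p]. *)
have [m hm] : exists m, lenle p m (Bc i0 1) (Zc i0 1).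
  apply: (len_finite prime_p (k := L) (c := c ^+ L)) => //; first exact: fg_mx.
    exact: Bc_Zc.
  move=> a f [u su [up ->]] Zf; apply: (_ : annI i0 _) Zf; apply: hL.
  exists [seq c * x | x <- u]; first by rewrite size_map.
  split; last by rewrite big_map big_split /= big_const_seq count_predT su iter_mulr_1.
  move=> _ /mapP [x xu ->]; apply/hr; rewrite mulrC; apply/hp; exact: up.
(* If this Ext vanished at [p], a product of multipliers outside [p] would kill it, hence lie in
   [CC] and so in [p]. *)
have strict i : (n <= i)%N -> pstrict p (Bc i 1) (Zc i 1).
  move=> ni; apply: contrapT => ns.
  have [k [g [Zg hg]]] := fg_mx noethR (Zc i 1).
  have h j : exists a, ~ p a /\ Bc i 1 (a *: g j).
    apply: contrapT => no'; apply: ns; exists (g j) => // a na Ba.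
    by apply: no'; exists a.
  have [a ha] := choice h.
  have na : ~ p (\prod_j a j).
    apply: (big_ind (fun x => ~ p x)) => [|x y|j _]; [exact: np1 | exact: npM | exact: (ha j).1].
  apply: na; apply/hp; rewrite mulrC; apply: (ccM _); exists i => //; exists 1%N; rewrite expr1.
  move=> f /hg [b ->]; rewrite scaler_sumr; apply: sub_sum => j _.
  rewrite scalerA [_ * b j]mulrC -scalerA; apply: sub_Z.
  by rewrite (bigD1 j) //= [a j * _]mulrC -scalerA; apply: (@sub_Z _ _ (Bc i 1)); apply: (ha j).2.
(* Infinite descent: [length_down], [length_up] and [count] lower the bound on the length at each
   step, while [strict] keeps the length positive. *)
suff : forall m i, (i0 <= i)%N -> ~ lenle p m (Bc i 1) (Zc i 1) by move/(_ m i0 (leqnn _)); apply.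
elim=> [|l IH] i ii; first by apply; apply: lenge1 (@Bc_Zc i 1) (strict i (leq_trans ni0 ii)).
move=> hl; apply: (IH i.+1); first exact: leqW.
move=> hl'; have ks : s.-1.+1 = s by rewrite prednK.
have := length_down ks (ext i.+1 (leqW (leq_trans ni0 ii))) hl'.
have sl : (s.-1 <= s)%N by rewrite leq_pred.
move=> /(lenge_le (k := ((\sum_(j < s.-1) #|I j|) * l.+1).+1)) h.
apply: (length_up prime_p hl sl); apply: h.
by rewrite ltn_mul2r.
Qed.

End Coefficients.
End FilteredExt.

(** * Modules over the filtered ring *)

Section Duality.
Variable R : comPzRingType.
Hypothesis noethR : noetherian R.

Lemma exact_cast a b c d n (e : a = b) (e1 : c = d) (X : 'M[R]_(c, a)) (T : 'M[R]_(d, b))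
  (Y : 'M[R]_(b, n)) : castmx (e1, e) X = T -> exactm T Y ->
  exactm X (castmx (esym e, erefl n) Y).
Proof. by case: _ / e Y T; case: _ / e1 => Y T; rewrite !castmx_id => ->. Qed.

(* The transposes of the differentials are syzygies of any order. *)
Lemma dual_exact d (G : cpx R) : injdim_le R d -> (forall i, dif G i.+1 *m dif G i = 0) ->
  (forall i, extR G i) -> exactc G.
Proof.
move=> id dd ext m; split=> // v hv.
pose T i := (dif G i)^T.
have exT i : exactm (T i) (T i.+1).
  split; first by rewrite -trmx_mul dd trmx0.
  move=> w e; have [|g hg] := ext i _ w^T.
    by apply: (can_inj trmxK); rewrite trmx_mul trmxK trmx0.
  by exists g^T; apply: (can_inj trmxK); rewrite trmx_mul !trmxK.
(* A resolution of [T m] is prolonged by [d + 1] further transposes; exactness of [G] at the vector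
   [v] becomes the vanishing of Ext at index [d] of this complex, where the injective dimension
   applies. *)
suff [C [exC [e [e1 [_ h]]]]] : exists C : cpx R, exactc C /\
    exists (e : dim C 0 = dim G (d + m.+1).+1) (e1 : dim C 1 = dim G (d + m.+1)),
    castmx (e1, e) (dif C 0) = T (d + m.+1)%N /\ (extR C d -> inrows v (dif G m.+1)).
  by apply/h/id.
elim: d {id} => [|k [C [exC [e [e1 [eT h]]]]]].
  exists (cons_cpx (T m.+1 : 'M_(dim (resol noethR (T m)) 0, _))); split.
    by apply: exact_cons; [exact: resol_exact | exact: exT].
  exists erefl, erefl; split; first by rewrite castmx_id.
  move=> h; have [|g hg] := h _ (v^T : 'M_(dim G m.+1, 1)).
    by rewrite /= -trmx_mul hv trmx0.
  by exists g^T; apply: (can_inj trmxK); rewrite trmx_mul trmxK hg.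
exists (cons_cpx (castmx (esym e, erefl) (T (k.+1 + m.+1)%N))); split.
  by apply: exact_cons => //; apply: exact_cast eT (exT _).
exists erefl, e; split; last by [].
by rewrite /= castmx_comp /= castmx_id.
Qed.

End Duality.

Section StepB.
Variables (R R1 : comPzRingType) (s : nat) (F : free_filtration R s) (p : {rmorphism R -> R1}).
Hypotheses (noethR : noetherian R) (s_gt0 : (0 < s)%N)
  (count : (\sum_(j < s.-1) #|idx F j| < #|idx F s.-1|)%N)
  (p_surj : forall y, exists x, p x = y) (p_ker : forall x, p x = 0 <-> fil F 1 x).

Lemma inK1P m n (X : 'M[R]_(m, n)) : inK F 1 X <-> map_mx p X = 0.
Proof.
split=> [h|e i j]; first by apply/matrixP => i j; rewrite !mxE; apply/p_ker/h.
by apply/p_ker; have := congr1 (fun M : 'M__ => M i j) e; rewrite !mxE.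
Qed.

Lemma NK1P e q m (E : 'M[R]_(e, q)) (X : 'M[R]_(m, q)) :
  NK F E 1 X <-> inrows (map_mx p X) (map_mx p E).
Proof.
split=> [[W /inK1P /eqP]|[W hW]].
  by rewrite map_mxB subr_eq0 map_mxM => /eqP ->; apply: inrows_mul.
have [V hV] := surj_mx W p_surj; exists V; apply/inK1P.
by rewrite map_mxB map_mxM hV -hW subrr.
Qed.

(** Descends from [N / K_s N = N] to [N / K_1 N]: the obstruction to lifting a cocycle from
    [N / K_l N] to [N / K_(l+1) N] lies in copies of the next Ext(M, N / K_1 N), which is zero. *)
Lemma vanish_step (C : cpx R) e q (E : 'M[R]_(e, q)) i :
  (forall i, dif C i.+1 *m dif C i = 0) -> gr_free F E -> ext0 C i E ->
  sub_le (Zc F C E i.+1 1) (Bc F C E i.+1 1) -> sub_le (Zc F C E i 1) (Bc F C E i 1).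
Proof.
move=> dd gr ext h.
have claim k : (k <= s)%N -> sub_le (Zc F C E i (s - k)) (Bc F C E i (s - k)).
  elim: k => [|k IH] ks; first by rewrite subn0 => f /NKs /ext [g /NK_rows hg]; exists g.
  move=> f Zf; set l := (s - k.+1)%N.
  have lk : (s - k = l.+1)%N by rewrite /l; lia.
  have ls : (l < s)%N by rewrite /l; lia.
  have [x hx] := NK_gen ls Zf.
  have Zx a : Zc F C E i.+1 1 (x a).
    have hN : NK F E l.+1 (comb [ffun a => dif C i.+2 *m x a]).
      rewrite -comb_mul; have := NKN (NK_mul (dif C i.+2) hx).
      by congr (NK _ _ _ _); rewrite mulmxBr mulmxA dd mul0mx sub0r opprK.
    by have := gr _ _ _ ls hN a; rewrite ffunE.
  have [g hg] := choice (fun a => h _ (Zx a)).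
  have Zf' : Zc F C E i l.+1 (f - comb [ffun a => g a]).
    rewrite /= mulmxBr comb_mul.
    have -> : dif C i.+1 *m f - comb [ffun a => dif C i.+1 *m [ffun a => g a] a] =
      (dif C i.+1 *m f - comb x) + comb (x - [ffun a => dif C i.+1 *m g a]).
      rewrite combB.
      have -> : [ffun a => dif C i.+1 *m [ffun a => g a] a] = [ffun a => dif C i.+1 *m g a].
        by apply/ffunP => a; rewrite !ffunE.
      by mxlin.
    by apply: NKD => //; apply: NK_comb => // a; rewrite !ffunE.
  rewrite lk in IH; have [g' hg'] := IH (ltnW ks) _ Zf'.
  exists g'; have -> : f - dif C i *m g' = (f - comb [ffun a => g a] - dif C i *m g') +
    comb [ffun a => g a] by mxlin.
  apply: NKD; first exact: NK_dec.
  by apply: NK_sum => a; apply: NK_in; apply: inK_bet0.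
by have := claim s.-1; rewrite (_ : s - s.-1 = 1)%N ?leq_pred //; [apply | lia].
Qed.

(** [ext_eventually0] yields a zero beyond any index, and [vanish_step] brings it down to that
    index. *)
Lemma vanish_all (C : cpx R) e q (E : 'M[R]_(e, q)) n :
  (forall i, dif C i.+1 *m dif C i = 0) -> gr_free F E ->
  (forall i, (n <= i)%N -> ext0 C i E) ->
  forall i, (n <= i)%N -> ext0 (mapc p C) i (map_mx p E).
Proof.
move=> dd gr ext i ni.
have [j ij hj] := ext_eventually0 dd gr count s_gt0 noethR
  (fun k ik => ext k (leq_trans ni ik)).
have : sub_le (Zc F C E i 1) (Bc F C E i 1).
  move: hj; rewrite -(subnK ij); elim: (j - i)%N => // k IH /= h.
  apply: IH; apply: vanish_step => //; apply: ext; apply: leq_trans ni _; lia.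
move=> h f' hf'; have [f hf] := surj_mx f' p_surj.
have [|g hg] := h f; first by apply/NK1P; rewrite map_mxM hf.
by exists (map_mx p g); move/NK1P: hg; rewrite map_mxB map_mxM hf.
Qed.

Lemma gr_free0 q : gr_free F (0 : 'M[R]_(0, q)).
Proof.
move=> k m c ks [W]; rewrite mulmx0 subr0 => h a; exists 0; rewrite mul0mx subr0 => i j.
apply: (fil_free (c := fun a => c a i j) ks); have := h i j; rewrite summxE.
by congr (fil _ _ _); apply: eq_bigr => b _; rewrite mxE mulrC.
Qed.

Lemma vanish_extR (C : cpx R) : (forall i, dif C i.+1 *m dif C i = 0) ->
  (forall i, extR C i) -> forall i, extR (mapc p C) i.
Proof.
move=> dd ext i q f' hf'.
have [||g [W]] := @vanish_all C 0 q 0 0 dd (@gr_free0 q) _ i (leq0n _) f'.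
- move=> j _ f [W]; rewrite mulmx0 => /ext [g ->].
  by exists g; rewrite subrr; apply: inrows0.
- by rewrite hf'; apply: inrows0.
- by rewrite map_mx0 mulmx0 => /eqP; rewrite subr_eq0 => /eqP ->; exists g.
Qed.

(** Local criterion of flatness: exactness of [mapc p C] is the vanishing of Tor with [R / K_1]. It
    lets [H] be changed by syzygies into a matrix with entries in [K_k], one layer at a time. *)
Lemma gr_free_dif (C : cpx R) : exactc C -> exactc (mapc p C) -> gr_free F (dif C 0).
Proof.
move=> ex ex1 k m c ks [H hH].
have gr0 j m' n' (x : {ffun idx F j -> 'M[R]_(m', n')}) : (j < s)%N ->
    inK F j.+1 (\sum_a bet a *: x a) -> forall a, inK F 1 (x a).
  move=> js h a i l; apply: (fil_free (c := fun a => x a i l) js).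
  have := h i l; rewrite summxE; congr (fil _ _ _); apply: eq_bigr => b _.
  by rewrite mxE mulrC.
have claim j : (j <= k)%N -> exists2 H', inK F j H' & H' *m dif C 0 = H *m dif C 0.
  elim: j => [_|j IH jk]; first by exists H => // i l; apply: fil0.
  have [H' hj eH'] := IH (ltnW jk); have js := ltn_trans jk ks.
  have [y hy] := inK_gen js hj.
  have hd (t : nat) (X : 'M[R]_(m, dim C 0)) : (t <= k)%N -> inK F k X -> inK F t X.
    move=> /subnK <-; elim: (k - t)%N => // u IHu; rewrite addSn => /inK_dec.
    exact: IHu.
  have hk : inK F k (H *m dif C 0).
    have -> : H *m dif C 0 = \sum_a bet a *: c a - (\sum_a bet a *: c a - H *m dif C 0) by mxlin.
    apply: inKD; first by apply: inK_sum => a; apply: inK_bet0.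
    by apply/inKN/inK_dec.
  have hyD a : inK F 1 (y a *m dif C 0).
    have := gr0 j _ _ [ffun a => y a *m dif C 0] js _ a; rewrite ffunE; apply.
    have -> : \sum_a bet a *: [ffun a => y a *m dif C 0] a =
       H *m dif C 0 - (H' - \sum_a bet a *: y a) *m dif C 0.
      rewrite mulmxBl eH' mulmx_suml opprB addrC subrK.
      by apply: eq_bigr => b _; rewrite ffunE -scalemxAl.
    by apply: inKD; [apply: hd hk | apply/inKN/inK_mulr].
  have hw a : exists w, inK F 1 (y a - w *m dif C 1).
    have [|W hW] := exact_inrows (ex1 0) (X := map_mx p (y a)).
      by rewrite -map_mxM; apply/inK1P.
    have [w hw] := surj_mx W p_surj; exists w; apply/inK1P.
    by rewrite map_mxB map_mxM hw -hW subrr.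
  have [w hw'] := choice hw.
  exists (H' - \sum_a bet a *: (w a *m dif C 1)).
    have -> : H' - \sum_a bet a *: (w a *m dif C 1) =
        (H' - \sum_a bet a *: y a) + \sum_a bet a *: (y a - w a *m dif C 1).
      have -> : \sum_a bet a *: (y a - w a *m dif C 1) =
          \sum_a bet a *: y a - \sum_a bet a *: (w a *m dif C 1).
        by rewrite -sumrB; apply: eq_bigr => a _; rewrite scalerBr.
      by mxlin.
    by apply: inKD => //; apply: inK_sum => a; apply: inK_bet.
  rewrite mulmxBl eH' mulmx_suml big1 ?subr0 // => a _.
  by rewrite -scalemxAl -mulmxA (exact_mul0 (ex 0)) mulmx0 scaler0.
have [H' hH' eH'] := claim k (leqnn _).
have [y hy] := inK_gen ks hH'.
move=> a; exists (y a).
have := gr0 k _ _ [ffun a => c a - y a *m dif C 0] ks _ a; rewrite ffunE; apply.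
have -> : \sum_a bet a *: [ffun a => c a - y a *m dif C 0] a =
    (\sum_a bet a *: c a - H *m dif C 0) + (H' - \sum_a bet a *: y a) *m dif C 0.
  rewrite mulmxBl eH' mulmx_suml addrA subrK -sumrB.
  by apply: eq_bigr => b _; rewrite ffunE scalerBr -scalemxAl.
by apply: inKD => //; apply: inK_mulr.
Qed.

(** [K_1] is nilpotent since [K_s = 0], so a splitting modulo [K_1] is refined layer by layer; the
    homotopy [E0], [H0] of the reduction corrects the error in each layer. *)
Lemma split_nilpotent (C : cpx R) : exactc C -> exactc (mapc p C) ->
  splitm (map_mx p (dif C 0)) -> splitm (dif C 0).
Proof.
move=> ex ex1 sp; have gr := gr_free_dif ex ex1.
have [_ [E0' [H0 hE0]]] := splitm_next (ex1 0) sp; have [E0 eE0] := surj_mx E0' p_surj.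
suff [E /inKs /eqP] : exists E, inK F s (dif C 0 - dif C 0 *m E *m dif C 0).
  by rewrite subr_eq0 => /eqP h; exists E.
have claim k : (k <= s)%N -> exists E, inK F k (dif C 0 - dif C 0 *m E *m dif C 0).
  elim: k => [_|k IH ks]; first by exists 0 => i j; apply: fil0.
  have [E hE] := IH (ltnW ks); set X := _ - _ in hE.
  have DX : dif C 1 *m X = 0.
    by rewrite mulmxBr !mulmxA (exact_mul0 (ex 0)) !mul0mx subrr.
  have [x hx] := inK_gen ks hE.
  have hY0 a : NK F (dif C 0) 1 (x a).
    apply: gr ks _ a.
    have -> : \sum_a bet a *: x a = X - (X - \sum_a bet a *: x a) by mxlin.
    apply: NKD; last by apply/NK_in/inKN.
    apply: NK_rows; exists (1%:M - dif C 0 *m E); by rewrite mulmxBl mul1mx.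
  have [Y hY] := choice hY0.
  have hDx a : inK F 1 (dif C 1 *m x a).
    have := gr_free0 (m := dim C 2) (c := [ffun a => dif C 1 *m x a]) ks _ a.
    rewrite ffunE => h; have [|W] := h; last by rewrite mulmx0 subr0.
    exists 0; rewrite mul0mx subr0.
    have -> : \sum_a bet a *: [ffun a => dif C 1 *m x a] a = - (dif C 1 *m (X - \sum_a bet a *: x a)).
      rewrite mulmxBr DX sub0r opprK mulmx_sumr.
      by apply: eq_bigr => b _; rewrite ffunE scalemxAr.
    by apply/inKN/inK_mul.
  have hx0 a : inK F 1 (x a - dif C 0 *m E0 *m Y a *m dif C 0).
    apply/inK1P; move/inK1P: (hDx a); move/inK1P: (hY a) => /eqP.
    rewrite map_mxB subr_eq0 => /eqP ey /=; rewrite map_mxM => ed.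
    apply/eqP; rewrite map_mxB subr_eq0; apply/eqP.
    rewrite !map_mxM eE0 -!mulmxA -map_mxM -ey mulmxA.
    rewrite -[LHS]mul1mx hE0 mulmxDl -[H0 *m _ *m _]mulmxA /= ed mulmx0 addr0.
    by rewrite /mapc /=.
  exists (E + \sum_a bet a *: (E0 *m Y a)).
  have -> : dif C 0 - dif C 0 *m (E + \sum_a bet a *: (E0 *m Y a)) *m dif C 0 =
     (X - \sum_a bet a *: x a) + \sum_a bet a *: (x a - dif C 0 *m E0 *m Y a *m dif C 0).
    have -> : \sum_a bet a *: (x a - dif C 0 *m E0 *m Y a *m dif C 0) =
       \sum_a bet a *: x a - dif C 0 *m (\sum_a bet a *: (E0 *m Y a)) *m dif C 0.
      rewrite mulmx_sumr mulmx_suml -sumrB; apply: eq_bigr => a _.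
      by rewrite scalerBr -scalemxAr -scalemxAl !mulmxA.
    by rewrite mulmxDr mulmxDl /X; mxlin.
  by apply: inKD => //; apply: inK_sum => a; apply: inK_bet.
exact: claim.
Qed.

(** Over [R1] the reduced complex has an acyclic dual and the injective dimension is finite, so it
    is exact; this gives the freeness along the filtration that the length argument needs. *)
Lemma strongSAC_filtered d : eventuallySplit R1 -> injdim_le R1 d -> strongSAC R.
Proof.
move=> ev id C ex ext [n hn].
have noeth1 := noeth_surj p_surj noethR.
have dd i := exact_mul0 (ex i).
have ext1 := vanish_extR dd ext.
have ex1 : exactc (mapc p C).
  by apply: (dual_exact noeth1 id) ext1 => i; rewrite -map_mxM dd map_mx0.
apply: split_nilpotent => //.
have h := vanish_all dd (gr_free_dif ex ex1) hn.
have [|d' sp] := ev _ ex1; first by exists n.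
exact: (split_down0 ex1 ext1 sp).
Qed.

End StepB.

(** * Complete intersections *)

Section LocMap.
Variables (R : comPzRingType) (S : mult_set R).

Definition locmap (x : R) : localization S := \pi_(localization S) (x, den_one S).

Lemma locmap_B : {morph locmap : x y / x - y}.
Proof.
move=> x y; have h : loc_add (locmap x) (loc_opp (locmap y)) = locmap (x - y).
  rewrite /locmap !pi_loc; apply: loc_eq; rewrite /= ?denM ?den1; ring.
exact: esym.
Qed.

Lemma locmap_M : multiplicative locmap.
Proof.
split=> // x y; have h : loc_mul (locmap x) (locmap y) = locmap (x * y).
  rewrite /locmap !pi_loc; apply: loc_eq; rewrite /= ?denM ?den1; ring.
exact: esym.
Qed.

HB.instance Definition _ := GRing.isZmodMorphism.Build R (localization S) locmap locmap_B.
HB.instance Definition _ := GRing.isMultiplicative.Build R (localization S) locmap locmap_M.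

Lemma locmap_loc : is_loc locmap S.
Proof.
have mk (s : R) (Ss : S s) : den (mk_den Ss) = s by [].
split=> [s Ss|x|a].
- exists (\pi_(localization S) (1, mk_den Ss)).
  have h : loc_mul (locmap s) (\pi_(localization S) (1, mk_den Ss)) = loc_one S.
    rewrite /locmap !pi_loc; apply: loc_eq; rewrite /= ?denM ?den1 ?mk; ring.
  exact: h.
- rewrite -[x]reprK; case: (repr x) => a s; exists a, (den s); split; first exact: denP.
  have h : loc_mul (locmap (den s)) (\pi_(localization S) (a, s)) = locmap a.
    rewrite /locmap !pi_loc; apply: loc_eq; rewrite /= ?denM ?den1; ring.
  exact: h.
- move=> h; have /localizationE [u Su] : locmap a = loc_zero S by exact: h.
  rewrite /= den1 mulr1 mul0r mulr0 => e.
  by exists u.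
Qed.

End LocMap.

Lemma loc_lift (R L M : comPzRingType) (phi : {rmorphism R -> L}) (T : mult_set R)
    (f : {rmorphism R -> M}) : is_loc phi T -> (forall s, T s -> exists t, f s * t = 1) ->
  exists g : {rmorphism L -> M}, forall x, g (phi x) = f x.
Proof.
move=> [un den ker] fu.
have cancel s x y : T s -> f s * x = f s * y -> x = y.
  move=> /fu [t ht] e; have := congr1 ( *%R t) e.
  by rewrite !mulrA [t * _]mulrC ht !mul1r.
have wd a b : phi a = phi b -> f a = f b.
  move=> e; have [|s Ts hs] := ker (a - b); first by rewrite rmorphB e subrr.
  apply: (cancel s) => //; rewrite -!rmorphM; apply/eqP.
  by rewrite -subr_eq0 -rmorphB -mulrBr hs rmorph0.
have ex x : exists y, forall a s, T s -> phi s * x = phi a -> f s * y = f a.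
  have [a [s [Ts e]]] := den x; have [t ht] := fu s Ts.
  exists (t * f a) => b u Tu e'.
  apply: (cancel s) => //; rewrite -[RHS]rmorphM.
  have -> : f s * (f u * (t * f a)) = f s * t * f (u * a) by rewrite rmorphM; ring.
  rewrite ht mul1r; apply: wd; rewrite !rmorphM -e -e'; ring.
have [g hg] := choice ex.
have gE x : g (phi x) = f x.
  by have := hg (phi x) x 1 (mult_1 T); rewrite !rmorph1 !mul1r; apply.
have gB : {morph g : x y / x - y}.
  move=> x y; have [a [s [Ts e]]] := den x; have [b [u [Tu e']]] := den y.
  have Tsu := mult_M Ts Tu; apply: (cancel (s * u)) => //.
  rewrite (hg (x - y) (u * a - s * b)) //; last first.
    by rewrite rmorphB !rmorphM -e -e'; ring.
  by rewrite rmorphB !rmorphM -(hg x a s Ts e) -(hg y b u Tu e'); ring.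
have gM : {morph g : x y / x * y}.
  move=> x y; have [a [s [Ts e]]] := den x; have [b [u [Tu e']]] := den y.
  have Tsu := mult_M Ts Tu; apply: (cancel (s * u)) => //.
  rewrite (hg (x * y) (a * b)) //; last by rewrite !rmorphM -e -e'; ring.
  by rewrite !rmorphM -(hg x a s Ts e) -(hg y b u Tu e'); ring.
have g1 : g 1 = 1 by rewrite -(rmorph1 phi) gE rmorph1.
pose i1 := GRing.isZmodMorphism.Build L M g gB.
pose i2 := GRing.isMultiplicative.Build L M g (conj gM g1).
by exists (HB.pack_for {rmorphism L -> M} g i1 i2).
Qed.

Lemma mult_one_subproof (R : comPzRingType) (x y : R) : x = 1 -> y = 1 -> x * y = 1.
Proof. by move=> -> ->; rewrite mulr1. Qed.

Definition mult_one (R : comPzRingType) : mult_set R :=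
  @MultSet R (fun x => x = 1) (erefl 1) (@mult_one_subproof R).

Lemma iso_loc (R S : comPzRingType) (g : {rmorphism R -> S}) :
  (forall y, exists x, g x = y) -> (forall x, g x = 0 -> x = 0) -> is_loc g (mult_one R).
Proof.
move=> surj inj; split=> [s ->|y|a /inj ->]; first by exists 1; rewrite rmorph1 mulr1.
  by have [x <-] := surj y; exists x, 1; split=> //; rewrite rmorph1 mul1r.
by exists 1; rewrite ?mulr0.
Qed.

(** Clearing denominators, the module is the localization of one presented over [Q]; the localized
    resolution of the latter splits from [d] on and computes the same Ext. *)
Lemma gldim_loc (Q L : comPzRingType) (phi : {rmorphism Q -> L}) (T : mult_set Q) d :
  is_loc phi T -> noetherian Q -> gldim_le Q d -> gldim_le L d.
Proof.
move=> loc nQ gd C ex; have fl := loc_flat loc.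
have [s Ts [w hw]] := loc_common loc (dif C 0); have [t ht] := loc_unit loc Ts.
pose C' := mapc phi (resol nQ w).
have ex' : exactc C' by apply: flat_exactc => //; apply: resol_exact.
have sp := gd _ (resol_exact nQ w).
apply: ext0_split => //.
apply: (@ext0_compare _ C C' (1%:M : 'M_(dim C 0, dim C 0)) (1%:M : 'M_(dim C 0, dim C 0))) => //.
- by rewrite mulmx1; exists (t%:M); rewrite mul_scalar_mx /= -hw scalerA mulrC ht scale1r.
- by rewrite mulmx1 /= -hw; apply/inrowsZ/inrows_refl.
- by rewrite mulmx1 subrr; apply: inrows0.
apply: (split_ext0 ex' (d := d)) => //.
by case: sp => E hE; exists (map_mx phi E); rewrite /= -!map_mxM hE.
Qed.

(** Regularity without properness of the ideal, so that it survives flat base change, after which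
    the quotient may be zero. *)
Definition wregular (R : comPzRingType) (s : seq R) : Prop := forall i, (i < size s)%N ->
  forall y, ideal_span (take i s) (s`_i * y) -> ideal_span (take i s) y.

Lemma span_map (R S : comPzRingType) (f : {rmorphism R -> S}) (s : seq R) x :
  ideal_span s x -> ideal_span (map f s) (f x).
Proof.
move=> /ideal_spanE [a ->]; rewrite rmorph_sum; apply: ideal_sum => i _.
by rewrite rmorphM; apply/ideal_M/ideal_span_mem/map_f/mem_nth.
Qed.

Lemma span_nil (R : comPzRingType) (x : R) : ideal_span [::] x <-> x = 0.
Proof.
split=> [/ideal_spanE [a ->]|->]; first by rewrite big_ord0.
exact: ideal_0.
Qed.

Lemma span_cons (R : comPzRingType) (z : R) s x :
  ideal_span (z :: s) x <-> exists c y, ideal_span s y /\ x = c * z + y.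
Proof.
split=> [/ideal_spanE [a ->]|[c [y [sy ->]]]].
  rewrite big_ord_recl /=; exists (a ord0), (\sum_i a (lift ord0 i) * s`_i); split=> //.
  by apply/ideal_spanE; exists (fun i => a (lift ord0 i)).
apply: ideal_D; first by apply/ideal_M/ideal_span_mem/mem_head.
by apply: ideal_span_sub sy => w ws; apply: ideal_span_mem; rewrite inE ws orbT.
Qed.

Lemma span_surj (R S : comPzRingType) (f : {rmorphism R -> S}) (s : seq R) (y : S) :
  (forall y, exists x, f x = y) -> ideal_span (map f s) y ->
  exists2 x, ideal_span s x & f x = y.
Proof.
move=> surj; elim: s y => [|z s IH] y.
  by move=> /span_nil ->; exists 0; [apply/span_nil | rewrite rmorph0].
move=> /span_cons [c [w [/IH [x sx <-] ->]]]; have [c' <-] := surj c.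
by exists (c' * z + x); [apply/span_cons; exists c', x | rewrite rmorphD rmorphM].
Qed.

Lemma span_ker (R S : comPzRingType) (f : {rmorphism R -> S}) (s : seq R) x :
  (forall z, z \in s -> f z = 0) -> ideal_span s x -> f x = 0.
Proof.
move=> h /ideal_spanE [a ->]; rewrite rmorph_sum big1 // => i _.
by rewrite rmorphM (h _ (mem_nth 0 (ltn_ord i))) mulr0.
Qed.

Lemma mod_elt_surjker (R R' : comPzRingType) (f : {rmorphism R -> R'}) z :
  (forall y, exists x, f x = y) -> (forall x, f x = 0 <-> ideal_span [:: z] x) -> mod_elt f z.
Proof.
move=> surj ker; split=> // x; rewrite ker span_cons; split=> [[c [y [/span_nil -> ->]]]|[c ->]].
  by exists c; rewrite addr0.
by exists c, 0; rewrite addr0; split=> //; apply: ideal_0.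
Qed.

Lemma regular_quotient0 (Q R : comPzRingType) (f : {rmorphism Q -> R}) d :
  (forall y, exists x, f x = y) -> (forall x, f x = 0 <-> ideal_span [::] x) ->
  eventuallySplit Q -> injdim_le Q d -> eventuallySplit R /\ injdim_le R d.
Proof.
move=> surj ker ev id.
have ker0 x : f x = 0 -> x = 0 by move=> /ker/span_nil.
  have [g hg] := @surj_lift _ _ _ f idfun surj ker0.
  have hg' y : f (g y) = y by have [x <-] := surj y; rewrite hg.
  have fl : flat g.
    apply: (loc_flat (iso_loc (g := g) _ _)) => [x|y e]; first by exists (f x); rewrite hg.
    by rewrite -[y]hg' e rmorph0.
  have gK m n (X : 'M[R]_(m, n)) : map_mx f (map_mx g X) = X.
    by apply/matrixP => i j; rewrite !mxE hg'.
  split=> [C ex [n hn]|C ex i di q h e].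
    have [|k [E hE]] := ev (mapc g C) (flat_exactc fl ex).
      by exists n => i ni; apply: flat_ext0 => //; apply: hn.
    exists k, (map_mx f E); have := congr1 (map_mx f) hE.
    by rewrite !map_mxM /= gK.
  have [|k hk] := id (mapc g C) (flat_exactc fl ex) i di q (map_mx g h).
    by rewrite /= -map_mxM e map_mx0.
  by exists (map_mx f k); have := congr1 (map_mx f) hk; rewrite map_mxM /= !gK.
Qed.

(** One hypersurface at a time: the first element is regular on [Q], and the images of the others
    are weakly regular on the quotient. *)
Lemma regular_quotient (Q R : comPzRingType) (f : {rmorphism Q -> R}) (s : seq Q) d :
  eventuallySplit Q -> injdim_le Q d -> wregular s ->
  (forall y, exists x, f x = y) -> (forall x, f x = 0 <-> ideal_span s x) ->
  eventuallySplit R /\ injdim_le R d.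
Proof.
move: {2}(size s) (leqnn (size s)) => n.
elim: n Q f s => [|n IH] Q f [|z s'] // sz ev id reg surj ker.
- exact: (regular_quotient0 surj ker ev id).
- exact: (regular_quotient0 surj ker ev id).
pose Q1 : comPzRingType := quotient (ideal_span [:: z]).
pose f1 : {rmorphism Q -> Q1} := GRing.RMorphism.clone Q Q1 (qpi (ideal_span [:: z])) _.
have mz : mod_elt f1 z.
  apply: mod_elt_surjker; [exact: qpi_surj | exact: qpi_eq0].
have nz : nzd z.
  move=> x e; have h := reg 0 isT x; rewrite take0 in h; apply/span_nil/h.
  by rewrite (_ : nth _ _ _ = z) // e; apply: ideal_0.
have kerf x : f1 x = 0 -> f x = 0.
  move=> /qpi_eq0 h; apply/ker; apply: ideal_span_sub h => y; rewrite inE => /eqP ->.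
  exact/ideal_span_mem/mem_head.
have [g hg] := surj_lift (@qpi_surj _ (ideal_span [:: z])) kerf.
have lft s0 x : ideal_span (map f1 s0) (f1 x) -> ideal_span (z :: s0) x.
  move=> /(span_surj (@qpi_surj _ _)) [x' sx' e].
  have /qpi_eq0 /span_cons [c [y [/span_nil -> ey]]] : f1 (x - x') = 0 by rewrite rmorphB e subrr.
  by apply/span_cons; exists c, x'; split=> //; rewrite -[x](subrK x') ey addr0.
have rgt s0 x : ideal_span (z :: s0) x -> ideal_span (map f1 s0) (f1 x).
  move=> /span_cons [c [y [sy ->]]]; rewrite rmorphD rmorphM.
  have -> : f1 z = 0 by apply/qpi_eq0/ideal_span_mem/mem_head.
  by rewrite mulr0 add0r; apply: span_map.
have idS : injdim_le Q d.+1 by move=> C ex i di; apply: id => //; apply: ltnW.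
apply: (IH Q1 g (map f1 s')).
- by rewrite size_map.
- exact: hypersurface_split mz nz ev.
- exact: hypersurface_injdim mz nz _ idS.
- move=> i; rewrite size_map => si y; have [y0 <-] := qpi_surj y.
  rewrite (nth_map 0) // -map_take -rmorphM => /lft h; apply: rgt.
  by apply: (reg i.+1).
- by move=> y; have [x <-] := surj y; exists (f1 x).
- move=> y; have [x <-] := qpi_surj y; rewrite hg ker; split; [exact: rgt | exact: lft].
Qed.

(** A relation modulo the ideal of [r] is a homogeneous relation once the elements of [r] are
    appended to [D]; flatness writes it as a combination of relations over [R]. *)
Lemma flat_relations (R S : comPzRingType) (phi : {rmorphism R -> S}) m (D : 'I_m -> R)
  (r r' : seq R) : flat phi ->
  (forall w : 'I_m -> R, ideal_span r (\sum_i w i * D i) -> forall i, ideal_span r' (w i)) ->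
  forall v : 'I_m -> S, ideal_span (map phi r) (\sum_i v i * phi (D i)) ->
  forall i, ideal_span (map phi r') (v i).
Proof.
move=> fl h v /ideal_spanE; rewrite size_map => -[a e] i0.
pose D' : 'M[R]_(m + size r, 1) := col_mx (\col_i D i) (\col_i r`_i).
pose v' : 'rV[S]_(m + size r) := row_mx (\row_i v i) (- \row_i a i).
have [|k [W WD [b hb]]] := fl _ _ D' v'.
  rewrite map_col_mx mul_row_col; apply/matrixP => i j; rewrite !ord1.
  rewrite mulNmx !mxE; apply/eqP; rewrite subr_eq0; apply/eqP.
  transitivity (\sum_i v i * phi (D i)); first by apply: eq_bigr => l _; rewrite !mxE.
  by rewrite e; apply: eq_bigr => l _; rewrite !mxE (nth_map 0).
have -> : v i0 = \sum_l b 0 l * phi (W l (lshift _ i0)).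
  have := congr1 (fun M : 'M__ => M 0 (lshift _ i0)) hb.
  by rewrite row_mxEl !mxE => ->; apply: eq_bigr => l _; rewrite mxE.
apply: ideal_sum => l _; apply: ideal_M; apply: span_map.
apply: (h (fun i => W l (lshift _ i))).
have : row l W *m D' = 0 by rewrite -row_mul WD row0.
rewrite -[row l W]hsubmxK mul_row_col => /(congr1 (fun M : 'M__ => M 0 0)).
rewrite mxE [RHS]mxE => /eqP; rewrite addr_eq0 => /eqP e1.
have -> : \sum_i W l (lshift (size r) i) * D i = (lsubmx (row l W) *m \col_i D i) 0 0.
  by rewrite mxE; apply: eq_bigr => i _; rewrite !mxE.
rewrite e1; apply: ideal_N; rewrite mxE; apply: ideal_sum => t _.
rewrite !mxE; apply/ideal_M/ideal_span_mem/mem_nth; exact: ltn_ord.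
Qed.

Lemma flat_colon (R S : comPzRingType) (phi : {rmorphism R -> S}) (r : seq R) (c : R)
  (r' : seq R) : flat phi -> (forall y, ideal_span r (c * y) -> ideal_span r' y) ->
  forall y, ideal_span (map phi r) (phi c * y) -> ideal_span (map phi r') y.
Proof.
move=> fl h y hy; apply: (flat_relations (D := fun _ : 'I_1 => c) fl _ (v := fun=> y) _ ord0).
  by move=> w; rewrite big_ord1 => hw i; rewrite ord1; apply: h; rewrite mulrC; exact: hw.
by rewrite big_ord1 mulrC.
Qed.

(** A non-local substitute for complete intersections, stable under localization and under quotients
    by a regular element; finite global dimension of [Q] replaces regularity. *)
Definition global_ci (R : comPzRingType) : Prop :=
  exists (Q : comPzRingType) (d : nat) (s : seq Q) (f : {rmorphism Q -> R}),
  [/\ noetherian Q, gldim_le Q d, wregular s,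
      forall y, exists x, f x = y & forall x, f x = 0 <-> ideal_span s x].

Lemma global_ci_noeth R : global_ci R -> noetherian R.
Proof. by move=> [Q [d [s [f [nQ _ _ surj _]]]]]; apply: noeth_surj surj nQ. Qed.

Lemma global_ci_split R : global_ci R -> eventuallySplit R /\ exists d, injdim_le R d.
Proof.
move=> [Q [d [s [f [nQ gd reg surj ker]]]]].
have ev : eventuallySplit Q by move=> C ex _; exists d; apply: gd.
have [h1 h2] := regular_quotient ev (gldim_injdim gd) reg surj ker.
by split=> //; exists d.
Qed.

Lemma global_ci_mod (R R' : comPzRingType) (p : {rmorphism R -> R'}) theta :
  global_ci R -> mod_elt p theta -> nzd theta -> global_ci R'.
Proof.
move=> [Q [d [s [f [nQ gd reg surj ker]]]]] [psurj pker] nz.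
have [t ht] := surj theta.
exists Q, d, (rcons s t), (p \o f); split=> // [i|y|x].
- rewrite size_rcons ltnS leq_eqVlt => /orP[/eqP ->|si] y.
    rewrite nth_rcons ltnn eqxx -cats1 takel_cat // take_size => /ker.
    by rewrite rmorphM ht => /nz /ker.
  by rewrite nth_rcons si -cats1 takel_cat ?(ltnW si) //; apply: reg.
- by have [x <-] := psurj y; have [w <-] := surj x; exists w.
- apply: (iff_trans (pker (f x))); split=> [[c e]|].
    have [c' hc] := surj c.
    have /ker hs : f (x - c' * t) = 0 by rewrite rmorphB rmorphM e hc ht subrr.
    rewrite -[x](subrK (c' * t)); apply: ideal_D; last first.
      by apply/ideal_M/ideal_span_mem; rewrite mem_rcons mem_head.
    by apply: ideal_span_sub hs => w ws; apply: ideal_span_mem; rewrite mem_rcons inE ws orbT.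
  move=> h; have : ideal_span (t :: s) x.
    apply: ideal_span_sub h => w; rewrite mem_rcons => ?; exact: ideal_span_mem.
  by move=> /span_cons [c [y [/ker fy ->]]]; exists (f c); rewrite rmorphD rmorphM fy ht addr0.
Qed.

Definition premult (Q R : comPzRingType) (f : {rmorphism Q -> R}) (T : mult_set R) : mult_set Q.
Proof.
apply: (@MultSet Q (fun x => T (f x))) => [|x y Tx Ty]; first by rewrite rmorph1; apply: mult_1.
by rewrite rmorphM; apply: mult_M.
Defined.

Lemma loc_quotient (Q R L : comPzRingType) (f : {rmorphism Q -> R}) (s : seq Q)
    (phi : {rmorphism R -> L}) (T : mult_set R) (T' := premult f T) : is_loc phi T ->
  (forall y, exists x, f x = y) -> (forall x, f x = 0 <-> ideal_span s x) ->
  exists g : {rmorphism localization T' -> L}, [/\ forall x, g (locmap T' x) = phi (f x),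
    forall y, exists x, g x = y & forall x, g x = 0 <-> ideal_span (map (locmap T') s) x].
Proof.
move=> loc surj ker.
pose psi : {rmorphism Q -> localization T'} := GRing.RMorphism.clone _ _ (locmap T') _.
have loc' : is_loc psi T' := locmap_loc T'.
have [un den lker] := loc; have [un' den' lker'] := loc'.
have [|g hg] := loc_lift (f := phi \o f) loc'; first by move=> t Tt; apply: un.
have cancel t x y : T t -> phi t * x = phi t * y -> x = y.
  move=> /un [u hu] e; have := congr1 ( *%R u) e.
  by rewrite !mulrA [u * _]mulrC hu !mul1r.
exists g; split; first exact: hg.
- move=> y; have [a [t [Tt e]]] := den y.
  have [a0 ha] := surj a; have [t0 ht] := surj t.
  have Tt0 : T' t0 by rewrite /= ht.
  have [u hu] := un' t0 Tt0; exists (u * psi a0).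
  apply: (cancel t) => //; rewrite e rmorphM hg /= ha -ht.
  have : g (psi t0 * u) = 1 by rewrite hu rmorph1.
  by rewrite rmorphM hg /= mulrA => ->; rewrite mul1r.
- move=> x; have [a [t [Tt e]]] := den' x; have [u hu] := un' t Tt.
  have ex : x = u * psi a by rewrite -e mulrA [u * _]mulrC hu mul1r.
  split=> [gx|].
    have ga : g (psi a) = 0 by rewrite -e rmorphM gx mulr0.
    have [w Tw] : exists2 w, T w & w * f a = 0 by apply: lker; rewrite hg in ga.
    have [w0 hw] := surj w; rewrite -hw -rmorphM => /ker hw0; have h : ideal_span (map psi s) (psi (w0 * a)) by apply: span_map.
    have [|v hv] := un' w0; first by rewrite /= hw.
    have -> : x = u * v * psi (w0 * a) by rewrite rmorphM ex -[LHS]mulr1 -hv; ring.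
    exact: ideal_M.
  apply: span_ker => y /mapP [z zs ->]; rewrite hg /=.
  have /ker -> : ideal_span s z by apply: ideal_span_mem.
  by rewrite rmorph0.
Qed.

Lemma global_ci_loc (R L : comPzRingType) (phi : {rmorphism R -> L}) (T : mult_set R) :
  is_loc phi T -> global_ci R -> global_ci L.
Proof.
move=> loc [Q [d [s [f [nQ gd reg surj ker]]]]].
have [g [hg gs gk]] := loc_quotient loc surj ker; have loc' := locmap_loc (premult f T).
exists (localization (premult f T)), d, (map (locmap (premult f T)) s), g; split=> //.
- exact: loc_noeth loc' nQ.
- exact: gldim_loc loc' nQ gd.
- move=> i; rewrite size_map => si y; rewrite (nth_map 0) // -map_take.
  apply: flat_colon; first exact: loc_flat loc'.
  exact: reg.
Qed.

(** * Roots and coefficients over algebraic numbers *)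

Section Transcendence.
Import Order.TTheory Num.Theory.

Lemma kronecker_inj B n (f g : 'I_n -> nat) : (forall i, (f i < B)%N) -> (forall i, (g i < B)%N) ->
  (\sum_i f i * B ^ i = \sum_i g i * B ^ i)%N -> forall i, f i = g i.
Proof.
elim: n f g => [|n IH] f g hf hg e; first by case.
have B0 : (0 < B)%N by apply: leq_ltn_trans (hf ord0).
have step (h : 'I_n.+1 -> nat) :
    (\sum_i h i * B ^ i = h ord0 + B * \sum_(i < n) h (lift ord0 i) * B ^ i)%N.
  rewrite big_ord_recl expn0 muln1 big_distrr; congr (_ + _)%N.
  by apply: eq_bigr => i _; rewrite lift0 expnS /=; lia.
rewrite !step in e.
have e0 : f ord0 = g ord0.
  have := congr1 (modn^~ B) e; rewrite /= ![(B * _)%N]mulnC ![(_ + _ * B)%N]addnC !modnMDl.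
  by rewrite !modn_small // => ->.
move=> i; case: (unliftP ord0 i) => [j|] -> //.
apply: (IH (fun j => f (lift ord0 j)) (fun j => g (lift ord0 j))) => //.
by move: e; rewrite e0 => /addnI /eqP; rewrite eqn_pmul2l // => /eqP.
Qed.

(** Kronecker substitution of [x^(B^i)] for the variables, with [B] above the total degree, keeps
    monomials apart; the resulting univariate polynomial vanishes at all natural numbers. *)
Lemma mpoly_vanish (K : numFieldType) n (p : {mpoly K[n]}) :
  (forall v, p.@[v] = 0) -> p = 0.
Proof.
move=> h; set B := msize p.
have [->|p0] := eqVneq p 0; first by [].
pose k (m : 'X_{1..n}) := (\sum_i m i * B ^ i)%N.
pose P : {poly K} := \sum_(m <- msupp p) p@_m *: 'X^(k m).
have P0 : P = 0.
  pose rs := [seq (i%:R : K) | i <- iota 0 (size P)].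
  apply: (@roots_geq_poly_eq0 _ _ rs); last by rewrite size_map size_iota.
    apply/allP => x _; apply/rootP.
    transitivity (p.@[fun i => x ^+ (B ^ i)]); last exact: h.
    rewrite horner_sum mevalE; apply: eq_bigr => m _; rewrite hornerZ hornerXn; congr (_ * _).
    by rewrite -prodrXr; apply: eq_bigr => i _; rewrite mulnC exprM.
  by rewrite map_inj_uniq ?iota_uniq // => i j /eqP; rewrite eqr_nat => /eqP.
apply/mpolyP => m; rewrite mcoeff0.
have [ms|] := boolP (m \in msupp p); last by move/memN_msupp_eq0.
have lt m' : m' \in msupp p -> forall i, (m' i < B)%N.
  move=> ms' i; apply: leq_ltn_trans (msize_mdeg_lt ms').
  by rewrite mdegE (bigD1 i) //= leq_addr.
have := congr1 (fun q : {poly K} => q`_(k m)) P0; rewrite coef0 coef_sum.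
rewrite (bigD1_seq m) ?msupp_uniq //= coefZ coefXn eqxx mulr1 big1_seq ?addr0 // => m' /andP[ne ms'].
rewrite coefZ coefXn; case: eqP => [e|_]; last by rewrite mulr0.
case/eqP: ne; apply/mnmP => i.
by have := kronecker_inj (lt _ ms) (lt _ ms') e i.
Qed.

Lemma size_prod_le (K : idomainType) (I : eqType) (r : seq I) (P : pred I) (F : I -> {poly K}) (d : I -> nat) :
  (forall i, P i -> (size (F i) <= (d i).+1)%N) ->
  (size (\prod_(i <- r | P i) F i)%R <= (\sum_(i <- r | P i) d i).+1)%N.
Proof.
move=> h; elim: r => [|i r IH]; first by rewrite !big_nil size_poly1.
rewrite !big_cons; case: ifP => // Pi.
apply: leq_trans (size_polyMleq _ _) _; have := h i Pi; move: IH; set a := size _; set b := size _.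
lia.
Qed.

Lemma size_mmap (K : fieldType) n (h : 'I_n -> {poly K}) (q : {mpoly K[n]}) s :
  (msize q <= s)%N -> (forall j, (size (h j) <= 2)%N) -> (size (mmap (polyC) h q) <= s)%N.
Proof.
move=> qs hh; rewrite /mmap big_seq; apply: (big_ind (fun p : {poly K} => size p <= s)%N).
- by rewrite size_poly0.
- by move=> x y hx hy; apply: leq_trans (size_polyD _ _) _; rewrite geq_max hx.
move=> m /msize_mdeg_lt lt; apply: leq_trans (leq_trans lt qs).
rewrite mul_polyC; apply: leq_trans (size_scale_leq _ _) _; rewrite mdegE.
apply: size_prod_le => i _; apply: leq_trans (size_poly_exp_leq _ _) _.
by rewrite ltnS; have := hh i; case: (size (h i)) => [|[|[|//]]] _ /=; rewrite ?mul0n ?mul1n.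
Qed.

(** The non-leading coefficients of the monic polynomial with roots [r i]: up to sign, their
    elementary symmetric functions. *)
Definition vieta (K : comNzRingType) n (r : 'I_n -> K) (j : 'I_n) : K := (\prod_i ('X - (r i)%:P))`_j.

(** Each Vieta coefficient is affine in any single root, so the total degree of [q] bounds the
    degree in that root. *)
Lemma vieta_coordinate (K : fieldType) n s (q : {mpoly K[n]}) (r : 'I_n -> K) k : (msize q <= s)%N ->
  exists2 H : {poly K}, (size H <= s)%N &
    forall x, q.@[vieta (fun i => if i == k then x else r i)] = H.[x].
Proof.
move=> qs; pose W := \prod_(i | i != k) ('X - (r i)%:P).
pose h (j : 'I_n) : {poly K} := (('X * W)`_j)%:P - W`_j *: 'X.
exists (mmap polyC h q).
  apply: size_mmap => // j; apply: leq_trans (size_polyD _ _) _.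
  rewrite geq_max size_polyN (leq_trans (size_polyC_leq1 _)) //=.
  by apply: leq_trans (size_scale_leq _ _) _; rewrite size_polyX.
move=> x; rewrite mevalE /mmap horner_sum; apply: eq_bigr => m _.
rewrite hornerM hornerC; congr (_ * _); rewrite /mmap1 horner_prod; apply: eq_bigr => j _.
rewrite horner_exp /vieta (bigD1 k) //= eqxx (eq_bigr (fun i => 'X - (r i)%:P)); last first.
  by move=> i /negbTE ->.
by rewrite -/W mulrBl coefB coefCM hornerD hornerN hornerZ hornerX hornerC [x * _]mulrC.
Qed.

(** The roots are freed from the nodes one at a time: the other roots occupy at most [n - 1] nodes,
    and the remaining ones, at least [s], are zeros of a polynomial of degree below [s]. When all
    roots are free, algebraic closedness reaches every point. *)
Lemma unisolvence n s t (q : {mpoly algC[n]}) (r : 'I_t -> algC) : t = (n + s.-1)%N -> (0 < s)%N ->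
  injective r -> (msize q <= s)%N ->
  (forall f : 'I_n -> 'I_t, injective f -> q.@[vieta (r \o f)] = 0) -> q = 0.
Proof.
move=> tE s0 injr qs h.
have claim k : (k <= n)%N -> forall (v : 'I_n -> algC) (f : 'I_n -> 'I_t),
    (forall i : 'I_n, (k <= i)%N -> v i = r (f i)) ->
    (forall i j : 'I_n, (k <= i)%N -> (k <= j)%N -> f i = f j -> i = j) -> q.@[vieta v] = 0.
  elim: k => [_ v f hv hf|k IH kn v f hv hf].
    rewrite (_ : v = r \o f); last by apply/funext => i; apply: hv.
    by apply: h => i j; apply: hf.
  pose k0 := Ordinal kn; have [H sH HE] := vieta_coordinate v k0 qs.
  suff H0 : H = 0.
    have := HE (v k0); rewrite H0 horner0 => <-; congr (q.@[vieta _]).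
    by apply/funext => i; have [->|] := eqVneq i k0.
  pose used : {set 'I_t} := [set f i | i in [set i : 'I_n | (k < i)%N]].
  apply: (@roots_geq_poly_eq0 _ _ [seq r l | l <- enum (~: used)]).
  - apply/allP => x /mapP [l lu ->]; rewrite mem_enum inE in lu; apply/rootP; rewrite -HE.
    apply: (IH (ltnW kn) _ (fun i => if i == k0 then l else f i)) => [i ki|i j ki kj].
      case: eqP => // /eqP ne; apply: hv; rewrite ltn_neqAle ki andbT.
      by apply: contra ne => /eqP e; apply/eqP/val_inj.
    have lt (i' : 'I_n) : (k <= i')%N -> i' != k0 -> (k < i')%N.
      move=> ki' ne; rewrite ltn_neqAle ki' andbT.
      by apply: contra ne => /eqP e; apply/eqP/val_inj.
    case: eqP => [->|/eqP ni]; case: eqP => [-> //|/eqP nj].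
    + move=> e; case/negP: lu; rewrite e; apply: imset_f; rewrite inE; exact: lt.
    + move=> e; case/negP: lu; rewrite -e; apply: imset_f; rewrite inE; exact: lt.
    + by move=> e; apply: hf => //; apply: lt.
  - by rewrite map_inj_uniq ?enum_uniq.
  rewrite size_map -cardE; apply: leq_trans sH _.
  have := cardsC used; rewrite card_ord.
  have : (#|used| <= n.-1)%N.
    apply: leq_trans (leq_imset_card _ _) _.
    have : [set i : 'I_n | (k < i)%N] \subset [set~ k0].
      by apply/subsetP => i; rewrite !inE => ki; apply: contraTneq ki => ->; rewrite ltnn.
    by move/subset_leq_card; rewrite cardsC1 card_ord.
  move=> h1 h2; have h3 : (s <= #|~: used|)%N by lia.
  exact: h3.
apply: mpoly_vanish => y.
(* The monic polynomial with lower coefficients [y]; its roots exhibit [y] as a Vieta point. *)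
pose P : {poly algC} := \poly_(j < n.+1) (if insub j is Some i then y i else 1).
have Pn : P`_n = 1 by rewrite coef_poly ltnSn insubF ?ltnn.
have sP : size P = n.+1.
  apply/eqP; rewrite eqn_leq size_poly ltnNge; apply/negP => /leq_sizeP /(_ n (leqnn _)).
  by rewrite Pn => /eqP; rewrite oner_eq0.
have [rs eP] := closed_field_poly_normal P.
rewrite lead_coefE sP Pn scale1r in eP.
have srs : size rs = n by have := sP; rewrite eP size_prod_XsubC => -[].
have e1 : P = \prod_(i < n) ('X - (rs`_i)%:P).
  by rewrite eP (big_nth 0) big_mkord srs.
have -> : y = vieta (fun i : 'I_n => rs`_i).
  apply/funext => j; rewrite /vieta -e1 coef_poly ltnS ltnW ?ltn_ord //.
  by rewrite (insubT (fun j => j < n)%N (ltn_ord j)) /=; congr y; apply: val_inj.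
have nt : (n <= t)%N by rewrite tE leq_addr.
apply: (claim n (leqnn n) _ (widen_ord nt)) => [i|i j]; by rewrite leqNgt ltn_ord.
Qed.

End Transcendence.

(** * Minors of Toeplitz matrices *)

(* Among the terms of a minor of a Toeplitz matrix the diagonal one has the smallest
   weight [sum (s + 1) ^ index]. *)
Lemma toeplitz_weight s (c : 'I_s -> nat) (u : 'S_s) : (forall i j : 'I_s, (i <= j)%N -> (c i <= c j)%N) ->
  u != 1%g -> (forall k, u k <= c k + k)%N ->
  (\sum_k s.+1 ^ c k < \sum_k s.+1 ^ (c k + k - u k))%N.
Proof.
move=> mono u1 hu.
have [k0 hk0] : exists k, u k != k.
  apply/existsP; apply: contraNT u1; rewrite negb_exists => /forallP h.
  by apply/eqP/permP => k; rewrite perm1; apply/eqP; rewrite -[_ == _]negbK.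
(* Above the largest moved index [k] everything is fixed, so [u k < k] and the exponent at [k]
   grows; one more factor [s + 1] outweighs the at most [s] terms with index up to [k]. *)
case: (@arg_maxnP _ k0 (fun k => u k != k) (fun k : 'I_s => k : nat) hk0) => k uk kmax.
have fixed (j : 'I_s) : (k < j)%N -> u j = j.
  by move=> kj; apply/eqP; apply: contraTT kj => /kmax; rewrite -leqNgt.
have s1 : (1 < s.+1)%N by rewrite ltnS; apply: leq_ltn_trans (ltn_ord k).
have ltk : (u k < k)%N.
  rewrite ltn_neqAle uk leqNgt; apply/negP => kuk.
  by have := fixed _ kuk => /perm_inj e; rewrite e eqxx in uk.
rewrite (bigID (fun j : 'I_s => k < j)%N) [X in (_ < X)%N](bigID (fun j : 'I_s => k < j)%N) /=.
rewrite (eq_bigr (fun j => s.+1 ^ (c j + j - u j))%N); last first.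
  by move=> j kj; rewrite fixed // addnK.
rewrite ltn_add2l [X in (_ < X)%N](bigD1 k) ?ltnn //=.
apply: (leq_trans _ (leq_addr _ _)).
apply: (@leq_trans (s.+1 ^ (c k).+1)%N); last first.
  by rewrite leq_exp2l //; lia.
apply: (@leq_ltn_trans (\sum_(j < s | ~~ (k < j)%N) s.+1 ^ c k)%N).
  apply: leq_sum => j; rewrite -leqNgt => jk; rewrite leq_exp2l //.
  exact: mono.
rewrite sum_nat_const expnS ltn_mul2r expn_gt0 /= ltnS.
by apply: leq_trans (max_card _) _; rewrite card_ord.
Qed.

Section ToeplitzMinors.
Variables (R : comPzRingType) (G : R -> Prop) (yy : nat -> R) (n s : nat).
Hypotheses (G0 : G 0) (GD : forall x y, G x -> G y -> G (x + y)) (GN : forall x, G x -> G (- x)).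

Definition toepdet (g : 'I_s -> nat) : R :=
  \sum_(u : 'S_s) (-1) ^+ u * \prod_k (if (u k <= g k)%N then yy (g k - u k)%N else 0).

Hypothesis yy0 : forall i, (n <= i)%N -> yy i = 0.
Hypothesis minors : forall g : 'I_s -> nat, (forall i j : 'I_s, (i < j)%N -> (g i < g j)%N) ->
  (forall k, g k < n + s.-1)%N -> G (toepdet g).

(** For sorted [c], the minor with columns [c k + k] has the wanted product as diagonal term, and
    its other terms have larger weight; the weight is at most [s (s + 1)^n], so the induction ends.
    [G] is only additive, so it can be an ideal or [reducible]. *)
Lemma toeplitz_monomial (c : seq nat) : size c = s -> all (fun x => x < n)%N c ->
  G (\prod_(x <- c) yy x).
Proof.
pose w (c : seq nat) := (\sum_(x <- c) s.+1 ^ x)%N.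
have [N] := ubnP (s * s.+1 ^ n - w c)%N; elim: N c => // N IH c lt sc cn.
pose cs := sort leq c; have pcs : perm_eq cs c by rewrite perm_sort.
have scs : size cs = s by rewrite size_sort.
pose c' (k : 'I_s) := nth 0%N cs k.
have c'n k : (c' k < n)%N.
  by have /allP := cn; apply; rewrite -(perm_mem pcs) mem_nth // scs.
have mono (i j : 'I_s) : (i <= j)%N -> (c' i <= c' j)%N.
  move=> ij; have := sort_sorted leq_total c => /(sorted_leq_nth leq_trans leqnn 0%N).
  by apply; rewrite // inE -/cs scs.
have prodE (T : Type) (idx : T) (op : Monoid.com_law idx) (F : nat -> T) :
    \big[op/idx]_(x <- c) F x = \big[op/idx]_(k < s) F (c' k).
  by rewrite -(perm_big _ pcs) (big_nth 0%N) big_mkord scs.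
rewrite prodE; pose g k := (c' k + k)%N.
have Gg : G (toepdet g).
  apply: minors => [i j ij|k]; first by have := mono i j (ltnW ij); rewrite /g; lia.
  by have := c'n k; have := ltn_ord k; rewrite /g; lia.
have Gsum (I : Type) (r : seq I) (P : pred I) F : (forall i, P i -> G (F i)) -> G (\sum_(i <- r | P i) F i).
  by move=> h; apply: (big_ind G).
have -> : \prod_(k < s) yy (c' k) = toepdet g - \sum_(u : 'S_s | u != 1%g)
    (-1) ^+ u * \prod_k (if (u k <= g k)%N then yy (g k - u k)%N else 0).
  rewrite /toepdet (bigD1 1%g) //= addrK odd_perm1 expr0 mul1r.
  by apply: eq_bigr => k _; rewrite perm1 leq_addl addnK.
apply: GD => //; apply/GN/Gsum => u u1.
suff GP : G (\prod_k (if (u k <= g k)%N then yy (g k - u k)%N else 0)).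
  by case: (odd_perm u); rewrite ?expr0 ?expr1 ?mul1r // mulN1r; apply: GN.
have [/forallP hu|] := boolP [forall k, u k <= g k]%N; last first.
  by rewrite negb_forall => /existsP [k /negbTE hk]; rewrite (bigD1 k) //= hk mul0r.
rewrite (eq_bigr (fun k => yy (g k - u k)%N)) => [|k _]; last by rewrite hu.
have [/forallP hn|] := boolP [forall k, g k - u k < n]%N; last first.
  rewrite negb_forall => /existsP [k]; rewrite -leqNgt => hk.
  by rewrite (bigD1 k) //= yy0 ?mul0r.
pose d := [seq (g k - u k)%N | k <- enum 'I_s].
have -> : \prod_k yy (g k - u k)%N = \prod_(x <- d) yy x by rewrite big_map big_enum.
apply: IH.
- have wd : (w c < w d)%N.
    rewrite /w prodE /d big_map big_enum /=; exact: toeplitz_weight.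
  have : (w d <= s * s.+1 ^ n)%N.
    rewrite /w /d big_map big_enum /=; apply: leq_trans (@leq_sum _ _ _ _ (fun=> s.+1 ^ n)%N _) _.
      move=> k _; have s1 : (1 < s.+1)%N by rewrite ltnS; apply: leq_ltn_trans (ltn_ord k).
      by rewrite leq_exp2l // ltnW.
    by rewrite sum_nat_const card_ord.
  by lia.
- by rewrite size_map size_enum_ord.
- by apply/allP => x /mapP [k _ ->].
Qed.

End ToeplitzMinors.

(** * The generic matrix modulo linear forms *)

Section Generic.
Variables (s' t n N : nat) (e : 'I_s'.+1 -> 'I_t -> 'I_N).
Local Notation s := s'.+1.
Hypotheses (tE : (n + s')%N = t) (e_inj : forall i j i' j', e i j = e i' j' -> i = i' /\ j = j').

(** The matrix occupies the variables [e i j] among [N]; the others are parameters, for instance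
    left over from pivots. The [y] variables are the first [n] entries of the first row. *)
Definition isy (k : 'I_N) : bool := [exists j : 'I_t, (j < n)%N && (k == e ord0 j)].

Definition ydeg (m : 'X_{1..N}) : nat := \sum_(k | isy k) m k.

Lemma ydegD m1 m2 : ydeg (m1 + m2)%MM = (ydeg m1 + ydeg m2)%N.
Proof. by rewrite /ydeg -big_split; apply: eq_bigr => k _; rewrite mnmDE. Qed.

Lemma ydeg1 k : ydeg U_(k)%MM = isy k.
Proof.
rewrite /ydeg; have [yk|nyk] := boolP (isy k).
  rewrite (bigD1 k) //= mnm1E eqxx big1 // => j /andP[_ jk].
  by rewrite mnm1E eq_sym (negbTE jk).
rewrite big1 // => j yj; rewrite mnm1E; case: eqP => // kj.
by rewrite kj yj in nyk.
Qed.

(* Twisting the generic matrix by a Toeplitz matrix in the first [n] variables of its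
   first row: modulo the other variables it becomes Toeplitz. *)
Definition yv (A : nzRingType) (i : nat) : {mpoly A[N]} :=
  if (insub i : option 'I_t) is Some j then (if (i < n)%N then 'X_(e ord0 j) else 0) else 0.

Definition toep (A : nzRingType) (i : 'I_s) (j : 'I_t) : {mpoly A[N]} :=
  if (i <= j)%N then yv A (j - i) else 0.

Definition freev (A : nzRingType) (i : 'I_s) (j : 'I_t) : {mpoly A[N]} :=
  if (i == ord0) && (j < n)%N then 0 else 'X_(e i j).

Definition Xi (A : nzRingType) : 'M[{mpoly A[N]}]_(s, t) :=
  \matrix_(i, j) (freev A i j + toep A i j).

Section Coeff.
Variable A : comNzRingType.
Implicit Types p q : {mpoly A[N]}.

Definition ydlt d p : bool := all (fun m => ydeg m < d)%N (msupp p).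

Lemma ydlt0 d : ydlt d 0. Proof. by rewrite /ydlt msupp0. Qed.

Lemma ydlt_le d d' p : (d <= d')%N -> ydlt d p -> ydlt d' p.
Proof. by move=> dd /allP h; apply/allP => m /h lt; apply: leq_trans dd. Qed.

Lemma ydltD d p q : ydlt d p -> ydlt d q -> ydlt d (p + q).
Proof.
move=> /allP hp /allP hq; apply/allP => m /msuppD_le; rewrite mem_cat => /orP[/hp|/hq] //.
Qed.

Lemma ydltN d p : ydlt d p -> ydlt d (- p).
Proof. by rewrite /ydlt (perm_all _ (msuppN _)). Qed.

Lemma ydlt_sum d (I : Type) (r : seq I) (P : pred I) (F : I -> {mpoly A[N]}) :
  (forall i, P i -> ydlt d (F i)) -> ydlt d (\sum_(i <- r | P i) F i).
Proof. by move=> h; apply: (big_ind (ydlt d)) => //; [exact: ydlt0 | move=> x y; exact: ydltD]. Qed.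

Lemma ydltM d d' p q : ydlt d.+1 p -> ydlt d' q -> ydlt (d + d') (p * q).
Proof.
move=> /allP hp /allP hq; apply/allP => m /msuppM_le /allpairsP [[m1 m2] /= [/hp h1 /hq h2 ->]].
by rewrite ydegD; clear tE e_inj; lia.
Qed.

Lemma ydltZ d c p : ydlt d p -> ydlt d (c *: p).
Proof. by move=> /allP h; apply/allP => m /msuppZ_le /h. Qed.

Lemma ydltX m : ydlt (ydeg m).+1 ('X_[m] : {mpoly A[N]}).
Proof. by rewrite /ydlt msuppX /= ltnSn. Qed.

Lemma ydlt1 : ydlt 1 (1 : {mpoly A[N]}).
Proof. by rewrite /ydlt msupp1 /= /ydeg big1 // => k _; rewrite mnm0E. Qed.

Lemma isyP (j : 'I_t) : (j < n)%N -> isy (e ord0 j).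
Proof. by move=> jn; apply/existsP; exists j; rewrite jn eqxx. Qed.

Lemma isyE i j : isy (e i j) = (i == ord0) && (j < n)%N.
Proof.
apply/existsP/andP => [[j' /andP[jn /eqP /e_inj [-> ->]]]|[/eqP -> jn]]; first by rewrite eqxx.
by exists j; rewrite jn eqxx.
Qed.

Lemma ydlt_freev i j : ydlt 1 (freev A i j).
Proof.
rewrite /freev; case: ifP => [_|h]; first exact: ydlt0.
by have := ydltX U_(e i j); rewrite ydeg1 isyE h.
Qed.

Lemma ydlt_yv i : ydlt 2 (yv A i).
Proof.
rewrite /yv; case: insubP => [j _ _|_]; last exact: ydlt0.
case: ifP => _; last exact: ydlt0.
by apply: ydlt_le (ydltX _); rewrite ydeg1; case: isy.
Qed.

Lemma ydlt_toep i j : ydlt 2 (toep A i j).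
Proof. by rewrite /toep; case: ifP => _; [exact: ydlt_yv | exact: ydlt0]. Qed.

(** With [a] of [y]-degree zero and [b] of [y]-degree at most one, only the product of the [b] can
    reach the top [y]-degree. *)
Lemma ydlt_prod (I : Type) (r : seq I) (a b : I -> {mpoly A[N]}) :
  (forall i, ydlt 1 (a i)) -> (forall i, ydlt 2 (b i)) ->
  ydlt (size r) (\prod_(i <- r) (a i + b i) - \prod_(i <- r) b i) /\
  ydlt (size r).+1 (\prod_(i <- r) (a i + b i)).
Proof.
move=> ha hb; elim: r => [|i r [IH1 IH2]].
  by rewrite !big_nil subrr; split; [exact: ydlt0 | exact: ydlt1].
rewrite !big_cons; split.
  have -> : (a i + b i) * \prod_(j <- r) (a j + b j) - b i * \prod_(j <- r) b j =
    a i * \prod_(j <- r) (a j + b j) + b i * (\prod_(j <- r) (a j + b j) - \prod_(j <- r) b j).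
    by ring.
  apply: ydltD; first exact: (ydltM (ha i) IH2).
  exact: (ydltM (hb i) IH1).
have hab : ydlt 2 (a i + b i) by apply: ydltD => //; apply: ydlt_le (ha i).
exact: (ydltM hab IH2).
Qed.

Variable J : ideal {mpoly A[N]}.
Hypothesis minorJ : forall g : 'I_s -> 'I_t, J (\det (\matrix_(i, k) Xi A i (g k))).

Definition reducible p : Prop := exists q, J (p - q) /\ ydlt s q.

Lemma reducible_low p : ydlt s p -> reducible p.
Proof. by exists p; rewrite subrr; split=> //; apply: ideal_0. Qed.

Lemma reducibleD p q : reducible p -> reducible q -> reducible (p + q).
Proof.
move=> [p' [Jp hp]] [q' [Jq hq]]; exists (p' + q'); split; last exact: ydltD.
have -> : p + q - (p' + q') = (p - p') + (q - q') by ring.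
exact: ideal_D.
Qed.

Lemma reducibleN p : reducible p -> reducible (- p).
Proof.
move=> [q [Jq hq]]; exists (- q); split; last exact: ydltN.
have -> : - p - - q = - (p - q) by ring.
exact: ideal_N.
Qed.

(** A maximal minor of [Xi] is a Toeplitz minor plus terms of [y]-degree below [s], so
    [toeplitz_monomial] applies with reducibility as the predicate. *)
Lemma reducible_monomial (c : seq nat) : size c = s -> all (fun x => x < n)%N c ->
  reducible (\prod_(x <- c) yv A x).
Proof.
apply: toeplitz_monomial.
- exact/reducible_low/ydlt0.
- exact: reducibleD.
- exact: reducibleN.
- move=> i ni; rewrite /yv; case: insubP => // j _ _.
  by rewrite ltnNge ni.
move=> g gmono gt.
have gt' k : (g k < t)%N by rewrite -tE; apply: gt.
pose h k := Ordinal (gt' k).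
have detE : \det (\matrix_(i, k) Xi A i (h k)) =
    \sum_(u : 'S_s) (-1) ^+ u * \prod_k (freev A (u k) (h k) + toep A (u k) (h k)).
  rewrite -det_tr; apply: eq_bigr => u _; congr (_ * _).
  by apply: eq_bigr => k _; rewrite !mxE.
have -> : toepdet (yv A) g = \det (\matrix_(i, k) Xi A i (h k)) -
   \sum_(u : 'S_s) (-1) ^+ u * (\prod_k (freev A (u k) (h k) + toep A (u k) (h k)) -
     \prod_k toep A (u k) (h k)).
  rewrite detE -sumrB; apply: eq_bigr => u _.
  rewrite -mulrBr opprB addrC subrK; congr (_ * _).
apply: reducibleD.
  by exists 0; rewrite subr0; split; [exact: minorJ | exact: ydlt0].
apply/reducibleN/reducible_low/ydlt_sum => u _.
have [h1 _] := ydlt_prod (index_enum 'I_s) (a := fun k => freev A (u k) (h k))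
  (b := fun k => toep A (u k) (h k)) (fun k => ydlt_freev _ _) (fun k => ydlt_toep _ _).
have sz : size (index_enum 'I_s) = s by rewrite -[RHS]card_ord cardT enumT.
rewrite sz in h1; case: (odd_perm u); rewrite ?expr0 ?expr1 ?mul1r // mulN1r.
exact: ydltN.
Qed.

Lemma ydeg_factor k (m : 'X_{1..N}) : (k <= ydeg m)%N -> exists c m',
  [/\ size c = k, all (fun x => x < n)%N c, ydeg m = (k + ydeg m')%N &
      'X_[m] = \prod_(x <- c) yv A x * 'X_[m']].
Proof.
elim: k => [_|k IH km].
  by exists [::], m; rewrite big_nil mul1r add0n.
have [c [m' [sc cn em eX]]] := IH (ltnW km).
have [l yl ml] : exists2 l, isy l & (0 < m' l)%N.
  have : (0 < ydeg m')%N by lia.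
  rewrite /ydeg lt0n sum_nat_eq0 negb_forall => /existsP [l].
  by rewrite negb_imply => /andP[yl ml]; exists l => //; rewrite lt0n.
have [j /andP[jn /eqP el]] := existsP yl.
have eU : (U_(l) <= m')%MM by rewrite lep1mP -lt0n.
have em' : ydeg m' = (1 + ydeg (m' - U_(l))%MM)%N.
  by rewrite -{1}(submK eU) ydegD ydeg1 yl addnC.
exists (val j :: c), (m' - U_(l))%MM; split=> /=.
- by rewrite sc.
- by rewrite jn.
- by rewrite em em'; lia.
- have eyv : yv A j = 'X_l.
    rewrite /yv; case: insubP => [j' _ /val_inj ->|]; last by rewrite ltn_ord.
    by rewrite jn el.
  rewrite eX -{1}(submK eU) mpolyXD big_cons eyv; ring.
Qed.

Lemma reducibleZ c p : reducible p -> reducible (c *: p).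
Proof.
move=> [q [Jq hq]]; exists (c *: q); rewrite -scalerBr; split.
  by rewrite -mul_mpolyC; apply: ideal_M.
exact: ydltZ.
Qed.

(** Replacing a factor of [y]-degree [s] by its reduction strictly lowers the [y]-degree, on which
    the induction runs. *)
Lemma reducible_X d m : (ydeg m < d)%N -> reducible 'X_[m].
Proof.
elim: d m => // d IH m lt; case: (leqP s (ydeg m)) => [sm|ms]; last first.
  by apply/reducible_low/ydlt_le/ydltX.
have [c [m' [sc cn em ->]]] := ydeg_factor sm.
have [q [Jq hq]] := reducible_monomial sc cn.
have hqm : ydlt (ydeg m) (q * 'X_[m']).
  rewrite em; have := ydltM (d := s') (d' := (ydeg m').+1) hq (ydltX m').
  by rewrite addSnnS.
have [q' [Jq' hq']] : reducible (q * 'X_[m']).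
  rewrite [q * _]mpolyE big_seq; apply: (big_ind reducible).
  - exact/reducible_low/ydlt0.
  - exact: reducibleD.
  - move=> m1 m1s; apply: reducibleZ; apply: IH.
    by have := allP hqm _ m1s => h; apply: leq_trans h _.
exists q'; split=> //.
have -> : \prod_(x <- c) yv A x * 'X_[m'] - q' =
  'X_[m'] * (\prod_(x <- c) yv A x - q) + (q * 'X_[m'] - q') by ring.
by apply: ideal_D => //; apply: ideal_M.
Qed.

Lemma reducible_all p : reducible p.
Proof.
rewrite [p]mpolyE; apply: (big_ind reducible).
- exact/reducible_low/ydlt0.
- exact: reducibleD.
- by move=> m _; apply: reducibleZ; apply: (reducible_X (ltnSn _)).
Qed.

End Coeff.
End Generic.

(** * Linear independence of the maximal minors *)

Section MinorIndependence.
Import Order.TTheory Num.Theory.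

(** Reducing the Bezout coefficient of [y] modulo [u] bounds one factor; comparing sizes bounds the
    other. *)
Lemma bezout_degree (K : fieldType) s n (u y c : {poly K}) : coprimep u y ->
  size u = s.+1 -> (size y <= n.+1)%N -> (size c <= n + s)%N ->
  exists (du dy : {poly K}), [/\ (size du <= s)%N, (size dy <= n)%N & du * y + u * dy = c].
Proof.
move=> /Bezout_eq1_coprimepP [[v w] /= e] su sy sc.
have u0 : u != 0 by rewrite -size_poly_gt0 su.
pose b := (c * w) %% u; have sb : (size b <= s)%N by rewrite -ltnS -su ltn_modp.
have [a ha] : exists a, c - b * y = u * a.
  exists (c * v + (c * w) %/ u * y); rewrite /b.
  have := divp_eq (c * w) u; set q := _ %/ _; set m := _ %% _ => eq.
  have -> : m = c * w - q * u by rewrite eq addrC addKr.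
  by rewrite -{1}[c]mulr1 -e; ring.
exists b, a; split=> //; last by rewrite -ha addrC subrK.
have [->|a0] := eqVneq a 0; first by rewrite size_poly0.
have : (size (u * a)%R <= n + s)%N.
  rewrite -ha; apply: leq_trans (size_polyD _ _) _; rewrite geq_max sc size_polyN.
  have [->|y0] := eqVneq y 0; first by rewrite mulr0 size_poly0.
  apply: leq_trans (size_polyMleq _ _) _.
  have : (0 < size y)%N by rewrite size_poly_gt0.
  move=> _; rewrite -subn1 leq_subLR; apply: leq_trans (leq_add sb sy) _; by rewrite add1n addnS [(s + n)%N]addnC.
by rewrite size_mul // su addSn /= addnC leq_add2r.
Qed.

Definition ev0 : {poly algC} -> algC := horner_eval 0.
HB.instance Definition _ := GRing.RMorphism.on ev0.

Lemma ev0_div (c : {poly algC}) : ev0 c = 0 -> exists d, c = 'X * d.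
Proof.
rewrite /ev0 /horner_eval => e; exists (c %/ 'X).
have : 'X %| c by rewrite -['X]subr0 -polyC0 dvdp_XsubCl rootE e.
by move=> /divpK {1}<-; rewrite mulrC.
Qed.

Lemma ev0_div_poly (c : {poly {poly algC}}) : map_poly ev0 c = 0 -> exists d, c = 'X%:P * d.
Proof.
move=> e; have h i : exists d, c`_i = 'X * d.
  by apply: ev0_div; rewrite -coef_map e coef0.
have [d hd] := choice h; exists (\poly_(i < size c) d i).
apply/polyP => i; rewrite coefCM coef_poly; case: ltnP => [_|ic]; first exact: hd.
by rewrite mulr0 nth_default.
Qed.

Section Newton.
Variables (s' n t : nat).
Hypothesis tE : (n + s')%N = t.
Hypothesis s'_gt0 : (0 < s')%N.
Local Notation s := s'.+1.
Local Notation L := {poly algC}.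

Variable g : {poly algC}.
(** The special matrix. A row is encoded by the polynomial of its entries, [zeta i + 'X^i * Y] with
    [Y] the polynomial of the [y] variables. For [U] with top coefficient 1 in degree [s'], the
    equation [U X = 0] for this matrix reads [U * (Y + 'X^n) = g]. *)
Definition zeta0 (i : 'I_s) : {poly algC} := if (i < s')%N then 'X^(n + i) else 'X^t - g.

Variable eta : 'I_s -> {poly algC}.
Definition zeta (i : 'I_s) : {poly L} := map_poly polyC (zeta0 i) + 'X%:P * map_poly polyC (eta i).

Hypotheses (g_monic : g \is monic) (g_size : size g = t.+1) (eta_size : forall i, (size (eta i) <= t)%N).

(* [u X = 0] for the matrix [X] of the family, written as an equation between polynomials. *)
Definition eqn (U Y : {poly L}) : {poly L} := U * Y + \sum_(i < s) (U`_i)%:P * zeta i.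

Lemma poly_trunc (R : nzRingType) d (u : {poly R}) : (size u <= d)%N -> \sum_(i < d) (u`_i) *: 'X^i = u.
Proof.
move=> sd; rewrite -poly_def; apply/polyP => i; rewrite coef_poly; case: ltnP => // di.
by rewrite nth_default // (leq_trans sd).
Qed.

Lemma zeta0_sum (u : {poly algC}) : (size u <= s)%N ->
  \sum_(i < s) (u`_i)%:P * zeta0 i = 'X^n * u - (u`_s')%:P * g.
Proof.
move=> su; rewrite -{2}(poly_trunc su) !big_ord_recr /= /zeta0 ltnn [in RHS]mulrDr mulrBr addrA.
congr (_ + _ - _); last by rewrite -mul_polyC mulrCA -exprD tE.
rewrite mulr_sumr; apply: eq_bigr => i _; rewrite /= ltn_ord.
by rewrite -mul_polyC mulrCA -exprD.
Qed.

Lemma zeta0_size i : (size (zeta0 i) <= t)%N.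
Proof.
rewrite /zeta0; case: ifP => [lt|_]; first by rewrite size_polyXn; lia.
apply/leq_sizeP => j tj; rewrite coefB coefXn; case: eqP => [->|ne].
  by move: g_monic; rewrite monicE lead_coefE g_size /= => /eqP ->; rewrite subrr.
by rewrite sub0r nth_default ?oppr0 // g_size; lia.
Qed.

Lemma map_ev0_C (c : {poly algC}) : map_poly ev0 (map_poly polyC c) = c.
Proof.
apply/polyP => i; rewrite !coef_map; exact: hornerC.
Qed.

Lemma ev0_X : ev0 'X = 0. Proof. exact: hornerX. Qed.

Lemma map_zeta i : map_poly ev0 (zeta i) = zeta0 i.
Proof.
by rewrite /zeta rmorphD rmorphM /= map_ev0_C map_polyC /= ev0_X mul0r addr0.
Qed.

Lemma zeta_size i : (size (zeta i) <= t)%N.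
Proof.
apply: leq_trans (size_polyD _ _) _; rewrite geq_max (leq_trans (size_poly _ _)) ?zeta0_size //=.
rewrite mul_polyC; apply: leq_trans (size_scale_leq _ _) _.
exact: leq_trans (size_poly _ _) _.
Qed.

Lemma eqn_size (U Y : {poly L}) : (size U <= s)%N -> (size Y <= n)%N -> (size (eqn U Y) <= t)%N.
Proof.
move=> sU sY; apply: leq_trans (size_polyD _ _) _; rewrite geq_max; apply/andP; split.
  have [->|Y0] := eqVneq Y 0; first by rewrite mulr0 size_poly0.
  apply: leq_trans (size_polyMleq _ _) _.
  have : (0 < size Y)%N by rewrite size_poly_gt0.
  by rewrite -tE; lia.
apply: (big_ind (fun p : {poly L} => size p <= t)%N) => [|p q hp hq|i _].
- by rewrite size_poly0.
- by apply: leq_trans (size_polyD _ _) _; rewrite geq_max hp.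
- by rewrite mul_polyC; apply: leq_trans (size_scale_leq _ _) (zeta_size i).
Qed.

Lemma map_eqn (U Y : {poly L}) : map_poly ev0 (eqn U Y) =
  map_poly ev0 U * map_poly ev0 Y + \sum_(i < s) ((map_poly ev0 U)`_i)%:P * zeta0 i.
Proof.
rewrite /eqn rmorphD rmorphM rmorph_sum; congr (_ + _); apply: eq_bigr => i _.
by rewrite rmorphM /= map_zeta map_polyC coef_map.
Qed.

(* Hensel: a coprime factorization of [g] lifts to a solution of [eqn] modulo every power of
   the deformation parameter. *)
Lemma newton (u y : {poly algC}) M : coprimep u y -> size u = s -> u`_s' = 1 ->
  size y = n.+1 -> y`_n = 1 -> u * y = g -> (0 < M)%N ->
  exists (U Y c : {poly L}), [/\ (size U <= s)%N, U`_s' = 1, (size Y <= n)%N,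
    map_poly ev0 U = u & map_poly ev0 Y = y - 'X^n] /\ eqn U Y = ('X^M)%:P * c.
Proof.
move=> cop su u1 sy y1 uy; case: M => // M _; elim: M => [|M].
  exists (map_poly polyC u), (map_poly polyC (y - 'X^n)).
  have e0 : map_poly ev0 (eqn (map_poly polyC u) (map_poly polyC (y - 'X^n))) = 0.
    rewrite map_eqn !map_ev0_C zeta0_sum ?su // u1 mulrBr uy polyC1; ring.
  have [c ec] := ev0_div_poly e0.
  exists c; split; last by rewrite expr1.
  rewrite !map_ev0_C; split=> //.
  - by apply: leq_trans (size_poly _ _) _; rewrite su.
  - by rewrite coef_map /= u1.
  - apply: leq_trans (size_poly _ _) _.
    apply/leq_sizeP => j nj; rewrite coefB coefXn; case: eqP => [->|ne].
      by rewrite y1 subrr.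
    by rewrite subr0 nth_default // sy ltn_neqAle nj andbT; apply/eqP => e; apply: ne.
move=> [U [Y [c [[sU U1 sY mU mY] eq]]]].
have sc : (size c <= t)%N.
  apply: leq_trans (eqn_size sU sY); rewrite eq mul_polyC size_scale //.
  by rewrite -size_poly_gt0 size_polyXn.
(* Newton correction: at parameter zero the linearized equation is a Bezout equation in [u] and [y];
   the bound [s'] on [du] keeps the top coefficient of [U] equal to 1. *)
have [du [dy [sdu sdy edu]]] : exists (du dy : {poly algC}),
    [/\ (size du <= s')%N, (size dy <= n)%N & du * y + u * dy = - map_poly ev0 c].
  apply: bezout_degree => //; first by rewrite sy.
  by rewrite size_polyN tE; apply: leq_trans (size_poly _ _) sc.
pose DU : {poly L} := map_poly polyC du; pose DY : {poly L} := map_poly polyC dy.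
pose lam : {poly L} := ('X^(M.+1))%:P.
have lamE : lam = 'X%:P * ('X^M)%:P by rewrite /lam exprS polyCM.
have eqn2 : eqn (U + lam * DU) (Y + lam * DY) =
    lam * (c + DU * Y + U * DY + lam * (DU * DY) + \sum_(i < s) (DU`_i)%:P * zeta i).
  rewrite [RHS]mulrDr mulr_sumr /eqn.
  have -> : \sum_(i < s) ((U + lam * DU)`_i)%:P * zeta i =
      \sum_(i < s) (U`_i)%:P * zeta i + \sum_(i < s) lam * ((DU`_i)%:P * zeta i).
    rewrite -big_split; apply: eq_bigr => i _ /=.
    by rewrite coefD /lam coefCM polyCD polyCM; ring.
  have -> : lam * (c + DU * Y + U * DY + lam * (DU * DY)) =
    lam * c + lam * DU * Y + lam * U * DY + lam * lam * (DU * DY) by ring.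
  rewrite -[lam * c]eq /eqn; ring.
have sdu0 : du`_s' = 0 by rewrite nth_default.
have e0 : map_poly ev0 (c + DU * Y + U * DY + lam * (DU * DY) + \sum_(i < s) (DU`_i)%:P * zeta i) = 0.
  have lam0 : map_poly ev0 lam = 0.
    by rewrite lamE rmorphM /= map_polyC /= ev0_X mul0r.
  rewrite !rmorphD /= !rmorphM /= lam0 mul0r addr0 !map_ev0_C mU mY rmorph_sum /=.
  rewrite (eq_bigr (fun i : 'I_s => (du`_i)%:P * zeta0 i)); last first.
    by move=> i _; rewrite rmorphM /= map_zeta map_polyC /= -coef_map map_ev0_C.
  rewrite zeta0_sum ?sdu0 ?polyC0 ?mul0r ?subr0; last by apply: leq_trans sdu _.
  have -> : map_poly ev0 c + du * (y - 'X^n) + u * dy + 'X^n * du =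
    map_poly ev0 c + (du * y + u * dy) by ring.
  by rewrite edu subrr.
have [d ed] := ev0_div_poly e0.
have lamZ (p : {poly L}) : (size (lam * p)%R <= size p)%N.
  by rewrite /lam mul_polyC size_scale_leq.
exists (U + lam * DU), (Y + lam * DY), d; split; last first.
  by rewrite eqn2 ed mulrA; congr (_ * _); rewrite /lam -polyCM -exprSr.
have lam0 : map_poly ev0 lam = 0 by rewrite lamE rmorphM /= map_polyC /= ev0_X mul0r.
split.
- apply: leq_trans (size_polyD _ _) _; rewrite geq_max sU /=.
  by apply: leq_trans (lamZ _) (leq_trans (size_poly _ _) (leq_trans sdu _)).
- by rewrite coefD U1 /lam coefCM coef_map /= sdu0 polyC0 mulr0 addr0.
- apply: leq_trans (size_polyD _ _) _; rewrite geq_max sY /=.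
  by apply: leq_trans (lamZ _) (leq_trans (size_poly _ _) sdy).
- by rewrite rmorphD rmorphM /= lam0 mul0r addr0.
- by rewrite rmorphD rmorphM /= lam0 mul0r addr0.
Qed.

End Newton.

Lemma meval_map_mpoly (R S : comNzRingType) (f : {rmorphism R -> S}) k (v : 'I_k -> R) (p : {mpoly R[k]}) :
  (map_mpoly f p).@[fun i => f (v i)] = f p.@[v].
Proof.
pose a : {rmorphism {mpoly R[k]} -> S} := GRing.RMorphism.clone _ _ (meval (fun i => f (v i)) \o map_mpoly f) _.
pose b : {rmorphism {mpoly R[k]} -> S} := GRing.RMorphism.clone _ _ (f \o meval v) _.
rewrite -[LHS]/(a p) -[RHS]/(b p) [p]mpolyE !rmorph_sum; apply: eq_bigr => m _.
rewrite -mul_mpolyC !rmorphM; congr (_ * _); first by rewrite /a /b /= map_mpolyC /= !mevalC.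
rewrite /a /b /= map_mpolyX !mevalX rmorph_prod.
by apply: eq_bigr => i _; rewrite rmorphXn.
Qed.

(** * Deformation from the special matrix to an arbitrary point *)

Section Independence.
Variables (s' t n N : nat) (e : 'I_s'.+1 -> 'I_t -> 'I_N).
Local Notation s := s'.+1.
Hypotheses (tE : (n + s')%N = t) (e_inj : forall i j i' j', e i j = e i' j' -> i = i' /\ j = j').
Hypothesis s'_gt0 : (0 < s')%N.
Local Notation L := {poly algC}.

Let g : {poly algC} := \prod_(l < t) ('X - ((l : nat)%:R)%:P).
Variable w : 'I_N -> algC.

(** The direction from the special matrix to [w], which is reached at parameter 1. *)
Definition etaw (i : 'I_s) : {poly algC} := \poly_(j < t)
  (if (i == ord0) && (j < n)%N then 0 else
   if insub j is Some j' then w (e i j') - (zeta0 n t g i)`_j else 0).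

Definition posn (k : 'I_N) : option ('I_s * 'I_t) := [pick ij | e ij.1 ij.2 == k].

Lemma posnE i j : posn (e i j) = Some (i, j).
Proof.
rewrite /posn; case: pickP => [[i' j'] /= /eqP /e_inj [-> ->] //|/(_ (i, j))].
by rewrite eqxx.
Qed.

Definition base (k : 'I_N) : algC := if posn k is Some ij then (zeta0 n t g ij.1)`_ij.2 else w k.

(** A line in the non-[y] variables towards [w], with the [y] variables at [Y]. The coefficient map
    [c] lets one formula give both points over [L] and, with indeterminates for [Y], the polynomial
    [qpoly]. *)
Definition hpoint (B : comNzRingType) (c : L -> B) (Y : nat -> B) (k : 'I_N) : B :=
  if isy n e k then Y (if posn k is Some ij then ij.2 : nat else 0%N)
  else c ((base k)%:P + 'X * (w k - base k)%:P).

Let J : ideal {mpoly int[N]} := ideal_gen (fun d => exists g' : 'I_s -> 'I_t,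
  d = \det (\matrix_(i, k) Xi n e int i (g' k))).

Lemma g_size : size g = t.+1.
Proof. by rewrite size_prod_XsubC; congr _.+1; rewrite -[RHS]card_ord cardT enumT. Qed.

Lemma g_monic : g \is monic. Proof. exact: monic_prod_XsubC. Qed.

Lemma zeta_coef i (j : 'I_t) Y : meval (hpoint id Y) (map_mpoly intr (freev n e int i j)) =
  (zeta n t g etaw i)`_j.
Proof.
rewrite /zeta coefD coefCM !coef_map /= coef_poly ltn_ord valK /freev.
(* The special matrix has to vanish at the [y] positions: row 0 is ['X^n] because [0 < s']. *)
case: ifP => [/andP[/eqP -> jn]|h].
  rewrite !rmorph0 mulr0 addr0 /zeta0 /= s'_gt0 coefXn addn0.
  by rewrite (ltn_eqF jn).
rewrite map_mpolyX mevalXU /hpoint isyE // h /base posnE /=.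
by rewrite rmorphB mulrC.
Qed.

Lemma yv_coef (Y : {poly L}) j : (size Y <= n)%N ->
  meval (hpoint id (fun k => Y`_k)) (map_mpoly intr (yv n e int j)) = Y`_j.
Proof.
move=> sY; rewrite /yv; case: insubP => [j' _ <-|]; last first.
  rewrite -leqNgt => tj; rewrite !rmorph0 nth_default //.
  by apply: leq_trans sY _; apply: leq_trans tj; rewrite -tE leq_addr.
case: ltnP => jn; last by rewrite !rmorph0 nth_default // (leq_trans sY).
by rewrite map_mpolyX mevalXU /hpoint isyE // jn posnE.
Qed.

Lemma eqn_coef (U Y : {poly L}) (j : 'I_t) : (size U <= s)%N -> (size Y <= n)%N ->
  \sum_(i < s) U`_i * meval (hpoint id (fun k => Y`_k)) (map_mpoly intr (Xi n e int i j)) =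
  (eqn n t g etaw U Y)`_j.
Proof.
move=> sU sY; rewrite /eqn coefD -{2}(poly_trunc sU) mulr_suml !coef_sum -big_split.
apply: eq_bigr => i _ /=; rewrite -scalerAl coefZ coefXnM coefCM -(zeta_coef _ _ (fun k => Y`_k)) -mulrDr.
rewrite mxE !rmorphD /= addrC; congr (_ * (_ + _)).
rewrite /toep; case: (ltnP j i) => _; first by rewrite !rmorph0.
exact: yv_coef.
Qed.

(** The approximate kernel vector gives [u D = 'X^M cc]; multiplying by the adjugate and reading the
    last coordinate, where [u] is 1, shows that ['X^M] divides the minor. *)
Lemma minors_small (U Y c : {poly L}) M (p : {mpoly int[N]}) : (size U <= s)%N -> U`_s' = 1 ->
  (size Y <= n)%N -> eqn n t g etaw U Y = ('X^M)%:P * c -> J p ->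
  exists b, meval (hpoint id (fun k => Y`_k)) (map_mpoly intr p) = 'X^M * b.
Proof.
move=> sU U1 sY eq.
pose ev (x : {mpoly int[N]}) : L := meval (hpoint id (fun k => Y`_k)) (map_mpoly intr x).
pose In (x : {mpoly int[N]}) := exists b, ev x = 'X^M * b.
have In0 : In 0 by exists 0; rewrite /ev !rmorph0 mulr0.
have InD x y : In x -> In y -> In (x + y).
  by move=> [a ea] [b eb]; exists (a + b); rewrite /ev !rmorphD /= mulrDr -ea -eb.
have InM a x : In x -> In (a * x).
  by move=> [b eb]; exists (ev a * b); rewrite /ev !rmorphM /= -/(ev a) -/(ev x) eb mulrCA.
apply: (ideal_gen_sub (J := Ideal In0 InD InM)) => d /= [g' ->].
pose evm : {rmorphism {mpoly int[N]} -> L} :=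
  GRing.RMorphism.clone _ _ (meval (hpoint id (fun k => Y`_k)) \o map_mpoly intr) _.
rewrite /In; have -> : ev (\det (\matrix_(i, k) Xi n e int i (g' k))) =
  \det (map_mx evm (\matrix_(i, k) Xi n e int i (g' k))) by rewrite det_map_mx.
set D := map_mx _ _; pose u : 'rV[L]_s := \row_(i < s) U`_i; pose cc : 'rV[L]_s := \row_(k < s) c`_(g' k).
have uD : u *m D = 'X^M *: cc.
  apply/rowP => k; rewrite !mxE -coefCM -eq -eqn_coef //.
  by apply: eq_bigr => i _; rewrite !mxE.
have := congr1 (fun v : 'rV[L]_s => (v *m \adj D) 0 ord_max) uD.
rewrite -mulmxA mul_mx_adj mul_mx_scalar -scalemxAl !mxE /= U1 mulr1 => ->.
by exists ((cc *m \adj D) 0 ord_max); rewrite mxE.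
Qed.

Definition qpoly (p : {mpoly int[N]}) : {mpoly L[n]} :=
  meval (hpoint (@mpolyC n L) (fun k => if insub k is Some i then 'X_i else 0)) (map_mpoly intr p).

Lemma meval_isum (B : comNzRingType) (h : 'I_N -> B) (p : {mpoly int[N]}) :
  meval h (map_mpoly intr p) = \sum_(m <- msupp p) (p@_m)%:~R * \prod_k h k ^+ m k.
Proof.
pose f : {rmorphism {mpoly int[N]} -> B} := GRing.RMorphism.clone _ _ (meval h \o map_mpoly intr) _.
rewrite -[LHS]/(f p) {1}[p]mpolyE (rmorph_sum f); apply: eq_bigr => m _.
by rewrite -mul_mpolyC (rmorphM f) /f /= map_mpolyC /= mevalC map_mpolyX mevalX.
Qed.

Lemma qpoly_eval p (Y : nat -> L) :
  (qpoly p).@[fun i => Y i] = meval (hpoint id Y) (map_mpoly intr p).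
Proof.
rewrite /qpoly !meval_isum rmorph_sum; apply: eq_bigr => m _.
rewrite rmorphM rmorph_int rmorph_prod; congr (_ * _); apply: eq_bigr => k _.
rewrite rmorphXn /=; congr (_ ^+ _); rewrite /hpoint; case: ifP => [yk|_]; last by rewrite mevalC.
have [j /andP[jn /eqP ->]] := existsP yk; rewrite posnE /= insubT /=.
by rewrite mevalXU.
Qed.

Lemma msize_leP (R : nzRingType) k d (p : {mpoly R[k]}) :
  reflect (forall m, m \in msupp p -> (mdeg m < d)%N) (msize p <= d)%N.
Proof.
apply: (iffP idP) => [h m ms|h]; first exact: leq_trans (msize_mdeg_lt ms) h.
by rewrite msizeE; apply/bigmax_leqP_seq => m ms _; apply: h.
Qed.

Lemma msizeM_deg (R : nzRingType) k a b (p q : {mpoly R[k]}) :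
  (msize p <= a.+1)%N -> (msize q <= b.+1)%N -> (msize (p * q)%R <= (a + b).+1)%N.
Proof.
move=> /msize_leP hp /msize_leP hq; apply/msize_leP => m /msuppM_le /allpairsP [[m1 m2] /= [h1 h2 ->]].
by rewrite mdegD; have := hp _ h1; have := hq _ h2; lia.
Qed.

Lemma qpoly_size p : ydlt n e s p -> (msize (qpoly p) <= s)%N.
Proof.
move=> /allP hp; rewrite /qpoly meval_isum big_seq.
apply: (big_ind (fun q : {mpoly L[n]} => msize q <= s)%N) => [|q r hq hr|m ms].
- by rewrite msize0.
- by apply: leq_trans (msizeD_le _ _) _; rewrite geq_max hq.
have {ms}lt := hp m ms.
rewrite -(rmorph_int (@mpolyC n L)) mul_mpolyC.
apply: leq_trans (msizeZ_le _ _) _; apply: leq_trans lt; rewrite /ydeg [X in (_ <= X.+1)%N]big_mkcond /=.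
apply: (big_rec2 (fun (q : {mpoly L[n]}) (d : nat) => msize q <= d.+1)%N) => [|k q d _ IH].
  by rewrite msize1.
apply: msizeM_deg IH; rewrite /hpoint; case: ifP => yk; last first.
  by rewrite -rmorphXn /= msizeC; case: eqP.
have [j /andP[jn /eqP ek]] := existsP yk; rewrite ek posnE /= insubT /=.
by rewrite mpolyXn msizeX mdegMn mdeg1 mul1n.
Qed.

(** Repeated division by the parameter: at parameter zero the quotient vanishes at the Vieta points
    of all factors of degree [n] of [g], so it is zero by [unisolvence] and one more power divides.
    Divisibility by all powers forces zero. *)
Lemma qpoly_0 p : ydlt n e s p -> J p -> qpoly p = 0.
Proof.
move=> hp Jp; pose r (l : 'I_t) : algC := (l : nat)%:R.
have injr : injective r by move=> i j /eqP; rewrite eqr_nat => /eqP /val_inj.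
have claim M : exists q', qpoly p = 'X^M *: q'.
  elim: M => [|M [q' eq]]; first by exists (qpoly p); rewrite expr0 scale1r.
  have sq' : (msize q' <= s)%N.
    by rewrite -(msizeZ (c := 'X^M)) ?expf_neq0 ?polyX_eq0 // -eq; exact: qpoly_size.
  suff q0 : map_mpoly ev0 q' = 0.
    have h m : exists d, q'@_m = 'X * d by apply: ev0_div; rewrite -mcoeff_map_mpoly q0 mcoeff0.
    have [d hd] := choice h; exists (\sum_(m <- msupp q') d m *: 'X_[m]).
    rewrite eq {1}[q']mpolyE exprSr -scalerA; congr (_ *: _); rewrite scaler_sumr.
    by apply: eq_bigr => m _; rewrite scalerA -hd.
  apply: (unisolvence (s := s) (esym tE) _ injr) => //.
    apply: leq_trans sq'; apply/msize_leP => m ms; apply: msize_mdeg_lt.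
    by move: ms; rewrite !mcoeff_msupp mcoeff_map_mpoly; apply: contra_neq => ->; exact: horner0.
  move=> f injf; pose used : {set 'I_t} := [set f i | i in 'I_n].
  pose y : {poly algC} := \prod_(i < n) ('X - (r (f i))%:P).
  pose u : {poly algC} := \prod_(l <- enum (~: used)) ('X - (r l)%:P).
  have uy : u * y = g.
    rewrite /g (bigID (mem used)) /= mulrC /u big_enum /=; congr (_ * _).
      by rewrite big_imset //= => i j _ _; apply: injf.
    by apply: eq_bigl => l; rewrite inE.
  have y_monic : y \is monic by apply: monic_prod_XsubC.
  have u_monic : u \is monic by apply: monic_prod_XsubC.
  have sy : size y = n.+1.
    by rewrite size_prod_XsubC; congr _.+1; rewrite -[RHS]card_ord cardT enumT.
  have su : size u = s.
    have := size_monicM u_monic (monic_neq0 y_monic); rewrite uy g_size sy -tE.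
    by move: (size u) => k; lia.
  have cop : coprimep u y.
    apply/Pdiv.ClosedField.coprimepP => x; rewrite rootE horner_prod prodf_seq_eq0.
    move=> /hasP [l]; rewrite mem_enum inE => lu; rewrite hornerXsubC subr_eq0 => /eqP ->.
    rewrite horner_prod; apply/prodf_neq0 => i _; rewrite hornerXsubC subr_eq0.
    by apply: contra lu => /eqP /injr ->; apply: imset_f.
  have u1 : u`_s' = 1 by move: u_monic; rewrite monicE lead_coefE su => /eqP.
  have y1 : y`_n = 1 by move: y_monic; rewrite monicE lead_coefE sy => /eqP.
  have seta i : (size (etaw i) <= t)%N by apply: size_poly.
  have [U [Y [c [[sU U1 sY _ mY] eqc]]]] :=
    newton tE s'_gt0 g_monic g_size seta cop su u1 sy y1 uy (ltn0Sn M).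
  have [b eb] := minors_small sU U1 sY eqc Jp.
  have : (q'.@[fun i => Y`_i]) = 'X * b.
    apply: (mulfI (x := 'X^M)); first by rewrite expf_neq0 ?polyX_eq0.
    by rewrite mulrA -exprSr -eb -qpoly_eval eq mevalZ.
  move=> /(congr1 ev0); rewrite rmorphM /= ev0_X mul0r => <-.
  have -> : vieta (r \o f) = fun i : 'I_n => ev0 Y`_i.
    apply/funext => i; rewrite -coef_map mY coefB coefXn (ltn_eqF (ltn_ord i)) subr0.
    by rewrite /vieta /y.
  exact: (meval_map_mpoly ev0).
apply/mpolyP => m; rewrite mcoeff0.
have [//|c0] := eqVneq (qpoly p)@_m 0.
have [q' eq] := claim (size (qpoly p)@_m).
have := congr1 (mcoeff m) eq; rewrite mcoeffZ => e1.
have q0 : q'@_m != 0 by apply: contra_neq c0; rewrite e1 => ->; rewrite mulr0.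
have := congr1 (fun x : L => size x) e1; rewrite /= mulrC size_mulXn //.
have : (0 < size q'@_m)%N by rewrite size_poly_gt0.
by move: (size q'@_m) (size (qpoly p)@_m) => a b; lia.
Qed.

End Independence.

(** At parameter 1 the line reaches the arbitrary point [w], so [p] vanishes everywhere over the
    algebraic numbers. *)
Lemma minors_independent s' t n N (e : 'I_s'.+1 -> 'I_t -> 'I_N) : (0 < s')%N -> (n + s')%N = t ->
  (forall i j i' j', e i j = e i' j' -> i = i' /\ j = j') -> forall p : {mpoly int[N]},
  ydlt n e s'.+1 p -> ideal_gen (fun d => exists g : 'I_s'.+1 -> 'I_t,
     d = \det (\matrix_(i, k) Xi n e int i (g k))) p -> p = 0.
Proof.
move=> s'0 tE e_inj p hp Jp.
suff e0 : map_mpoly intr p = 0 :> {mpoly algC[N]}.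
  apply/mpolyP => m; have := congr1 (mcoeff m) e0; rewrite mcoeff_map_mpoly !mcoeff0.
  by move=> /eqP; rewrite intr_eq0 => /eqP.
apply: mpoly_vanish => w.
pose Y (j : nat) : {poly algC} := if insub j is Some j' then (w (e ord0 j'))%:P else 0.
have := qpoly_eval n e_inj w p Y; rewrite (qpoly_0 tE e_inj s'0 w hp Jp) meval0.
move=> /(congr1 (horner_eval 1)); rewrite !meval_isum rmorph0 rmorph_sum => /esym; apply: etrans.
apply: eq_bigr => m _; rewrite rmorphM rmorph_int rmorph_prod; congr (_ * _).
apply: eq_bigr => k _; rewrite rmorphXn; congr (_ ^+ _); rewrite /hpoint; case: ifP => [yk|_].
  have [j /andP[jn /eqP ->]] := existsP yk; rewrite (posnE e_inj) /= /Y valK.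
  by rewrite /= /horner_eval hornerC.
by rewrite /= /horner_eval hornerD hornerM hornerX !hornerC mul1r addrC subrK.
Qed.

End MinorIndependence.

(** * Regularity of the linear forms *)

Lemma span_cat (R : comPzRingType) (s1 s2 : seq R) x :
  ideal_span (s1 ++ s2) x <-> exists a b, [/\ ideal_span s1 a, ideal_span s2 b & x = a + b].
Proof.
elim: s1 x => [|z s1 IH] x; rewrite ?cat_cons ?cat0s.
  split=> [h|[a [b [/span_nil -> sb ->]]]]; last by rewrite add0r.
  by exists 0, x; split=> //; [apply/span_nil | rewrite add0r].
rewrite span_cons; split=> [[c [y [/IH [a [b [sa sb ->]]] ->]]]|].
  by exists (c * z + a), b; split=> //; [apply/span_cons; exists c, a | rewrite addrA].
move=> [a [b [/span_cons [c [y [sy ->]]] sb ->]]].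
by exists c, (y + b); split; [apply/IH; exists y, b | rewrite addrA].
Qed.

Section VariableIdeals.
Variables (A : comNzRingType) (N : nat).
Implicit Types (p q c : {mpoly A[N]}) (S : seq 'I_N) (m : 'X_{1..N}).

Definition vars S : seq {mpoly A[N]} := [seq 'X_k | k <- S].

Definition hasvar S m : bool := has (fun k => 0 < m k)%N S.

Definition varmem S p : Prop := forall m, m \in msupp p -> hasvar S m.

Lemma hasvarD S m1 m2 : hasvar S (m1 + m2)%MM = hasvar S m1 || hasvar S m2.
Proof. by rewrite /hasvar -has_predU; apply: eq_has => k /=; rewrite mnmDE addn_gt0. Qed.

(** An ideal generated by variables is monomial, so membership is tested on each monomial. *)
Lemma varmemP S p : ideal_span (vars S) p <-> varmem S p.
Proof.
split=> [h|h]; last first.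
  rewrite [p]mpolyE big_seq; apply: ideal_sum => m /h /hasP [k kS mk].
  have eU : (U_(k) <= m)%MM by rewrite lep1mP -lt0n.
  rewrite -(submK eU) mpolyXD scalerAl; apply/ideal_M/ideal_span_mem/map_f/kS.
have K0 : varmem S 0 by move=> m; rewrite msupp0.
have KD x y : varmem S x -> varmem S y -> varmem S (x + y).
  by move=> hx hy m /msuppD_le; rewrite mem_cat => /orP[/hx|/hy].
have KM a x : varmem S x -> varmem S (a * x).
  by move=> hx m /msuppM_le /allpairsP [[m1 m2] /= [_ /hx h2 ->]]; rewrite hasvarD h2 orbT.
apply: (ideal_span_sub (J := Ideal K0 KD KM)) h => x /mapP [k kS ->] m /=.
rewrite msuppX inE => /eqP ->; apply/hasP; exists k => //.
by rewrite mnm1E eqxx.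
Qed.

Lemma varmem_regular S k c : k \notin S -> varmem S ('X_k * c) -> varmem S c.
Proof.
move=> kS h m ms; have : (U_(k) + m)%MM \in msupp ('X_k * c).
  by move: ms; rewrite !mcoeff_msupp mulrC mcoeffMX.
move=> /h; rewrite hasvarD orbC => /orP[//|/hasP [l lS]].
by rewrite mnm1E lt0b => /eqP e; rewrite e lS in kS.
Qed.

End VariableIdeals.

Section Minors.
Variables (s' t n N : nat) (e : 'I_s'.+1 -> 'I_t -> 'I_N).
Local Notation s := s'.+1.
Hypotheses (tE : (n + s')%N = t) (e_inj : forall i j i' j', e i j = e i' j' -> i = i' /\ j = j').
Local Notation isy := (isy n e).
Local Notation ydeg := (ydeg n e).
Local Notation ydlt := (ydlt n e).

Definition minors (A : comNzRingType) : seq {mpoly A[N]} :=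
  [seq \det (\matrix_(i, k) Xi n e A i (g k)) | g : {ffun 'I_s -> 'I_t}].

Lemma minors_mem (A : comNzRingType) (g : 'I_s -> 'I_t) :
  \det (\matrix_(i, k) Xi n e A i (g k)) \in minors A.
Proof.
apply/mapP; exists (finfun g); first by rewrite mem_enum.
by congr (\det _); apply/matrixP => i k; rewrite !mxE ffunE.
Qed.

Lemma map_Xi (A : comNzRingType) i j : map_mpoly intr (Xi n e int i j) = Xi n e A i j.
Proof.
have yvE l : map_mpoly intr (yv n e int l) = yv n e A l.
  rewrite /yv; case: insub => [l'|]; last by rewrite rmorph0.
  by case: ifP => _; [rewrite map_mpolyX | rewrite rmorph0].
rewrite !mxE rmorphD /=; congr (_ + _).
  by rewrite /freev; case: ifP => _; [rewrite rmorph0 | rewrite map_mpolyX].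
by rewrite /toep; case: ifP => _; [rewrite yvE | rewrite rmorph0].
Qed.

Hypothesis s'_gt0 : (0 < s')%N.

Lemma minors_int_free (p : {mpoly int[N]}) : ydlt s p -> ideal_span (minors int) p -> p = 0.
Proof.
move=> hp h; apply: (minors_independent s'_gt0 tE e_inj hp).
apply: ideal_span_sub h => x /mapP [g _ ->].
by move=> J hJ; apply: hJ; exists g.
Qed.

Lemma minors_reducible (A : comNzRingType) (p : {mpoly A[N]}) :
  exists q, ideal_span (minors A) (p - q) /\ ydlt s q.
Proof.
apply: (reducible_all tE e_inj) => g; exact/ideal_span_mem/minors_mem.
Qed.

(* The normal form modulo the minors has integral coefficients; its coordinates extend to
   linear forms over every ring of coefficients. *)
Lemma minors_free (A : comNzRingType) (p : {mpoly A[N]}) :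
  ydlt s p -> ideal_span (minors A) p -> p = 0.
Proof.
have [nf hnf] := choice (fun m => @minors_reducible int 'X_[m]).
have nf_low m : (ydeg m < s)%N -> nf m = 'X_[m].
  move=> lt; have [h1 h2] := hnf m; apply/esym/eqP; rewrite -subr_eq0; apply/eqP.
  apply: minors_int_free => //; apply: ydltD; last exact: ydltN.
  by apply: ydlt_le; last exact: ydltX.
have nf_ker (d : {mpoly int[N]}) : ideal_span (minors int) d -> \sum_(m <- msupp d) d@_m *: nf m = 0.
  move=> hd; apply: minors_int_free.
    by apply: ydlt_sum => m _; apply: ydltZ; have [] := hnf m.
  have -> : \sum_(m <- msupp d) d@_m *: nf m = d - \sum_(m <- msupp d) d@_m *: ('X_[m] - nf m).
    by rewrite [X in _ = X - _]mpolyE -sumrB; apply: eq_bigr => m _; rewrite scalerBr opprB addrC subrK.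
  apply: ideal_B => //; apply: ideal_sum => m _; rewrite -mul_mpolyC; apply: ideal_M.
  by have [] := hnf m.
move=> hp Jp; apply/mpolyP => m0; rewrite mcoeff0.
have [m0p|/memN_msupp_eq0 //] := boolP (m0 \in msupp p).
pose lam m : A := ((nf m)@_m0)%:~R.
(* The linear form reading the coefficient at [m0] of the normal form. It kills the ideal of minors
   because their monomial multiples are integral, and it takes the value [p@_m0] at [p]. *)
pose F (q : {mpoly A[N]}) := \sum_(m <- msupp q) q@_m * lam m.
have Fwide (q : {mpoly A[N]}) r : uniq r -> {subset msupp q <= r} -> F q = \sum_(m <- r) q@_m * lam m.
  move=> ur sub; rewrite [RHS](bigID (mem (msupp q))) /= [X in _ + X]big1 ?addr0; last first.
    by move=> m /memN_msupp_eq0 ->; rewrite mul0r.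
  rewrite -big_filter; apply: perm_big; apply: uniq_perm; rewrite ?msupp_uniq ?filter_uniq //.
  by move=> m; rewrite mem_filter; case: (boolP (m \in _)) => // /sub ->.
have FD q r : F (q + r) = F q + F r.
  pose u := undup (msupp q ++ msupp r).
  rewrite !(Fwide _ u) ?undup_uniq //; last first.
  - by move=> m /msuppD_le; rewrite mem_undup.
  - by move=> m mq; rewrite mem_undup mem_cat mq.
  - by move=> m mq; rewrite mem_undup mem_cat mq orbT.
  by rewrite -big_split; apply: eq_bigr => m _ /=; rewrite mcoeffD mulrDl.
have F0 : F 0 = 0 by rewrite /F msupp0 big_nil.
have FZ a q : F (a *: q) = a * F q.
  rewrite (Fwide _ (msupp q)) ?msupp_uniq //; last by move=> m; apply: msuppZ_le.
  by rewrite mulr_sumr; apply: eq_bigr => m _; rewrite mcoeffZ mulrA.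
have Fsum (I : Type) (r : seq I) (G : I -> {mpoly A[N]}) : F (\sum_(i <- r) G i) = \sum_(i <- r) F (G i).
  by apply: (big_morph F FD F0).
have Fint (d : {mpoly int[N]}) : ideal_span (minors int) d -> F (map_mpoly intr d) = 0.
  move=> /nf_ker /(congr1 (mcoeff m0)); rewrite mcoeff0 raddf_sum => /(congr1 (fun z : int => z%:~R : A)).
  rewrite /= mulr0z rmorph_sum (Fwide _ (msupp d)) ?msupp_uniq // => [h|m].
    by rewrite -[RHS]h; apply: eq_bigr => m _; rewrite /= mcoeffZ rmorphM mcoeff_map_mpoly.
  by rewrite !mcoeff_msupp mcoeff_map_mpoly; apply: contra_neq => h0; rewrite /= h0.
have -> : p@_m0 = F p.
  rewrite /F (bigD1_seq m0) ?msupp_uniq //= big1_seq ?addr0.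
    by rewrite /lam nf_low ?(allP hp) // mcoeffX eqxx mulr1.
  move=> m /andP[ne ms]; rewrite /lam nf_low ?(allP hp) // mcoeffX (negbTE ne).
  by rewrite mulr0.
pose Q (x : {mpoly A[N]}) := forall q, F (q * x) = 0.
have Q0 : Q 0 by move=> q; rewrite mulr0.
have QD x y : Q x -> Q y -> Q (x + y) by move=> hx hy q; rewrite mulrDr FD hx hy addr0.
have QM a x : Q x -> Q (a * x) by move=> hx q; rewrite mulrA.
rewrite -[p]mul1r; apply: (ideal_span_sub (J := Ideal Q0 QD QM)) Jp 1 => x /mapP [g _ ->] q /=.
rewrite [q]mpolyE mulr_suml Fsum big1 // => m _; rewrite -scalerAl FZ.
have -> : 'X_[m] * \det (\matrix_(i, k) Xi n e A i (g k)) =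
    map_mpoly intr ('X_[m] * \det (\matrix_(i, k) Xi n e int i (g k))).
  rewrite rmorphM /= map_mpolyX -det_map_mx; congr (_ * \det _).
  by apply/matrixP => i k; rewrite [LHS]mxE -map_Xi [RHS]mxE [in RHS]mxE.
by rewrite Fint ?mulr0 //; apply/ideal_M/ideal_span_mem/minors_mem.
Qed.

Section Regular.
Variable A : comNzRingType.

(** Low [y]-degree is preserved by multiplication with the other variables, so between normal forms
    a relation modulo the minors is an identity of polynomials, where variables form a regular
    sequence. *)
Lemma theta_regular (S : seq 'I_N) k (c : {mpoly A[N]}) : (forall l, l \in k :: S -> ~~ isy l) ->
  k \notin S -> ideal_span (minors A ++ vars A S) ('X_k * c) -> ideal_span (minors A ++ vars A S) c.
Proof.
move=> ny kS /span_cat [j [b [Jj Sb e1]]].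
have lowX l (v : {mpoly A[N]}) : l \in k :: S -> ydlt s v -> ydlt s ('X_l * v).
  move=> /ny yl hv; rewrite -[s]add0n; apply: ydltM hv.
  by apply: ydlt_le; [|exact: ydltX]; rewrite ydeg1 (negbTE yl).
have [v [Jv lv]] := minors_reducible c.
(* The coefficients of [b] are reduced rather than [b] itself, so that the reduction stays in the
   ideal of the variables. *)
have [b' [Jb' lb' Sb']] : exists b', [/\ ideal_span (minors A) (b - b'), ydlt s b' & ideal_span (vars A S) b'].
  have /ideal_spanE [a ->] := Sb.
  have [w hw] := choice (fun i => minors_reducible (a i)).
  exists (\sum_i w i * (vars A S)`_i); split.
  - rewrite -sumrB; apply: ideal_sum => i _; rewrite -mulrBl; apply: ideal_Mr.
    by have [] := hw i.
  - apply: ydlt_sum => i _; have [_ lw] := hw i.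
    have lt : (i < size S)%N by rewrite -(size_map (fun k => 'X_k : {mpoly A[N]})) ltn_ord.
    by rewrite mulrC (nth_map k) //; apply: lowX => //; rewrite inE mem_nth ?orbT.
  - by apply: ideal_sum => i _; apply/ideal_M/ideal_span_mem/mem_nth.
have e0 : 'X_k * v - b' = 0.
  apply: minors_free; first by apply: ydltD; [apply: lowX; rewrite ?mem_head | exact: ydltN].
  have -> : 'X_k * v - b' = 'X_k * c - b - 'X_k * (c - v) + (b - b') by ring.
  rewrite e1 addrK; apply: ideal_D => //; apply: ideal_B => //; exact: ideal_M.
apply/span_cat; exists (c - v), v; split=> //; last by rewrite subrK.
apply/varmemP/(varmem_regular kS)/varmemP.
by move/eqP: e0; rewrite subr_eq0 => /eqP ->.
Qed.

End Regular.
End Minors.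

(** * The associated filtered ring *)

Lemma ideal_gen_ind (R : comPzRingType) (S P : R -> Prop) : P 0 -> (forall x y, P x -> P y -> P (x + y)) ->
  (forall a x, P x -> P (a * x)) -> (forall x, S x -> P x) -> forall x, ideal_gen S x -> P x.
Proof. by move=> P0 PD PM SP x; apply: (ideal_gen_sub (J := Ideal P0 PD PM)). Qed.

Lemma span_image (R : comPzRingType) (I : finType) (F : I -> R) x :
  ideal_span [seq F a | a : I] x <-> exists c : I -> R, x = \sum_a c a * F a.
Proof.
split; last first.
  by move=> [c ->]; apply: ideal_sum => a _; apply/ideal_M/ideal_span_mem/map_f; rewrite mem_enum.
move=> h; apply: (ideal_gen_ind (P := fun x => exists c : I -> R, x = \sum_a c a * F a) _ _ _ _ h).
- by exists (fun=> 0); rewrite big1 // => a _; rewrite mul0r.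
- move=> y z [c ->] [d ->]; exists (fun a => c a + d a).
  by rewrite -big_split; apply: eq_bigr => a _; rewrite mulrDl.
- by move=> b y [c ->]; exists (fun a => b * c a); rewrite mulr_sumr; apply: eq_bigr => a _; rewrite mulrA.
move=> y /mapP [a _ ->]; exists (fun b => (b == a)%:R).
by rewrite (bigD1 a) //= eqxx mul1r big1 ?addr0 // => b /negbTE ->; rewrite mul0r.
Qed.

Section Associated.
Variables (s' t n N : nat) (e : 'I_s'.+1 -> 'I_t -> 'I_N).
Local Notation s := s'.+1.
Hypotheses (tE : (n + s')%N = t) (e_inj : forall i j i' j', e i j = e i' j' -> i = i' /\ j = j').
Local Notation isy := (isy n e).
Local Notation ydeg := (ydeg n e).

Definition thetas : seq 'I_N := [seq k <- enum 'I_N | [exists i, exists j, k == e i j] && ~~ isy k].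
Definition ys : seq 'I_N := [seq k <- enum 'I_N | isy k].

Lemma mem_ys k : (k \in ys) = isy k.
Proof. by rewrite mem_filter mem_enum andbT. Qed.

Lemma thetas_nisy k : k \in thetas -> ~~ isy k.
Proof. by rewrite mem_filter => /andP[/andP[]]. Qed.

Lemma freev_thetas (A : comNzRingType) i j : ideal_span (vars A thetas) (freev n e A i j).
Proof.
rewrite /freev; case: ifP => h; first exact: ideal_0.
apply/ideal_span_mem/map_f; rewrite mem_filter mem_enum andbT isyE // h andbT.
by apply/existsP; exists i; apply/existsP; exists j.
Qed.

(** Membership in [(thetas) + (y)^k], read off the monomials. *)
Definition gpred (A : comNzRingType) k (p : {mpoly A[N]}) : Prop :=
  forall m, m \in msupp p -> hasvar thetas m || (k <= ydeg m)%N.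

Section Poly.
Variable A : comNzRingType.
Implicit Types p q : {mpoly A[N]}.

Lemma gpred0 k : gpred k (0 : {mpoly A[N]}). Proof. by move=> m; rewrite msupp0. Qed.

Lemma gpredD k p q : gpred k p -> gpred k q -> gpred k (p + q).
Proof. by move=> hp hq m /msuppD_le; rewrite mem_cat => /orP[/hp|/hq]. Qed.

Lemma gpredM k l p q : gpred k p -> gpred l q -> gpred (k + l) (p * q).
Proof.
move=> hp hq m /msuppM_le /allpairsP [[m1 m2] /= [/hp h1 /hq h2 ->]].
rewrite hasvarD ydegD; case: (hasvar _ m1) h1 => //= h1; case: (hasvar _ m2) h2 => //= h2.
exact: leq_add.
Qed.

Lemma gpred_true p : gpred 0 p. Proof. by move=> m _; rewrite orbT. Qed.

Definition gideal k : ideal {mpoly A[N]} :=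
  Ideal (gpred0 k) (@gpredD k) (fun a x => @gpredM 0 k a x (@gpred_true a)).

Lemma gpred_theta k l : l \in thetas -> gpred k ('X_l : {mpoly A[N]}).
Proof.
move=> lt m; rewrite msuppX inE => /eqP ->; apply/orP; left.
by apply/hasP; exists l => //; rewrite mnm1E eqxx.
Qed.

Lemma gpred_y l : isy l -> gpred 1 ('X_l : {mpoly A[N]}).
Proof. by move=> yl m; rewrite msuppX inE => /eqP ->; rewrite ydeg1 yl; apply/orP; right. Qed.

Lemma gpred_toep i j : gpred 1 (toep n e A i j).
Proof.
rewrite /toep; case: ifP => _; last exact: gpred0.
rewrite /yv; case: insubP => [l _ el|_]; last exact: gpred0.
by case: ifP => ln; [apply/gpred_y/isyP; rewrite el | exact: gpred0].
Qed.

Lemma gpred_Xi i j : gpred 1 (Xi n e A i j).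
Proof.
rewrite mxE; apply: gpredD; last exact: gpred_toep.
have h x : x \in vars A thetas -> gideal 1 x by move=> /mapP [l lt ->]; apply: gpred_theta.
exact: (ideal_span_sub h (freev_thetas _ _)).
Qed.

Lemma gpred_prod (I : Type) (r : seq I) (F : I -> {mpoly A[N]}) :
  (forall i, gpred 1 (F i)) -> gpred (size r) (\prod_(i <- r) F i).
Proof.
by move=> h; elim: r => [|i r IH]; [exact: gpred_true | rewrite big_cons; exact: (gpredM (h i) IH)].
Qed.

Lemma gpred_minors x : x \in minors n e A -> gpred s x.
Proof.
move=> /mapP [g _ ->]; apply: (@ideal_sum _ (gideal s)) => u _; apply: (@ideal_M _ (gideal s)).
have := @gpred_prod _ (index_enum 'I_s) (fun k => (\matrix_(i, l) Xi n e A i (g l)) k (u k)).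
have -> : size (index_enum 'I_s) = s by rewrite -[RHS]card_ord cardT enumT.
by apply=> i; rewrite mxE; apply: gpred_Xi.
Qed.

Lemma span_monoL (s1 s2 : seq {mpoly A[N]}) x : ideal_span s1 x -> ideal_span (s1 ++ s2) x.
Proof. by apply: ideal_span_sub => y ys1; apply: ideal_span_mem; rewrite mem_cat ys1. Qed.

Lemma span_monoR (s1 s2 : seq {mpoly A[N]}) x : ideal_span s2 x -> ideal_span (s1 ++ s2) x.
Proof. by apply: ideal_span_sub => y ys1; apply: ideal_span_mem; rewrite mem_cat ys1 orbT. Qed.

(** Modulo [thetas] the matrix is the Toeplitz matrix itself, and [toeplitz_monomial] applies with
    an ideal as the predicate. *)
Lemma high_monomial m : (s <= ydeg m)%N -> ideal_span (minors n e A ++ vars A thetas) 'X_[m].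
Proof.
move=> sm; have [c [m' [sc cn _ ->]]] := ydeg_factor tE A sm; apply: ideal_Mr.
set K := ideal_span _; move: sc cn; apply: (@toeplitz_monomial _ K (yv n e A) n s).
- exact: ideal_0.
- exact: ideal_D.
- exact: ideal_N.
- move=> i ni; rewrite /yv; case: insubP => // j _ _.
  by rewrite ltnNge ni.
move=> g gmono gt.
have gt' k : (g k < t)%N by rewrite -tE; apply: gt.
pose h k := Ordinal (gt' k).
have -> : toepdet (yv n e A) g = \det (\matrix_(i, k) toep n e A i (h k)).
  rewrite -[RHS]det_tr; apply: eq_bigr => u _; congr (_ * _).
  by apply: eq_bigr => k _; rewrite !mxE.
pose T : ideal {mpoly A[N]} := ideal_span (vars A thetas).
have sub : T (\det (\matrix_(i, k) Xi n e A i (h k)) - \det (\matrix_(i, k) toep n e A i (h k))).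
  apply/qpi_eq0; rewrite rmorphB -!det_map_mx; apply/eqP; rewrite subr_eq0; apply/eqP.
  congr (\det _); apply/matrixP => i k; rewrite [LHS]mxE [RHS]mxE [X in qpi _ X = _]mxE [in LHS]mxE [in RHS]mxE.
  rewrite rmorphD /=.
  by have /qpi_eq0 -> := @freev_thetas A i (h k); rewrite add0r.
rewrite -[X in K X](subKr (\det (\matrix_(i, k) Xi n e A i (h k)))).
apply: ideal_B; last exact: span_monoR.
apply: span_monoL; apply: ideal_span_mem; exact: minors_mem.
Qed.

Lemma gpred_high p : gpred s p -> ideal_span (minors n e A ++ vars A thetas) p.
Proof.
move=> hp; rewrite [p]mpolyE big_seq; apply: ideal_sum => m /hp /orP[h|h]; last first.
  by rewrite -mul_mpolyC; apply/ideal_M/high_monomial.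
apply: span_monoR; apply/varmemP => m' /msuppZ_le; rewrite msuppX inE => /eqP -> //.
Qed.

Lemma n_le_t : (n <= t)%N. Proof. by rewrite -tE leq_addr. Qed.

Definition yi (i : 'I_n) : 'I_N := e ord0 (widen_ord n_le_t i).

Lemma yi_inj : injective yi.
Proof. by move=> i j /e_inj [_ h]; apply: val_inj; have := congr1 val h. Qed.

Lemma isy_yi i : isy (yi i).
Proof. by apply: isyP => /=. Qed.

Lemma isy_ex k : isy k -> exists i, k = yi i.
Proof.
move=> /existsP [j /andP[jn /eqP ->]]; exists (Ordinal jn); rewrite /yi; congr (e _ _).
exact: val_inj.
Qed.

Lemma ydegE m : ydeg m = (\sum_(i < n) m (yi i))%N.
Proof.
rewrite -[LHS]/(\sum_(k | isy k) m k)%N (eq_bigl (mem (yi @: [set: 'I_n]))) => [|k].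
  rewrite big_imset => [|? ? _ _ /yi_inj //]; by apply: eq_bigl => i; rewrite inE.
apply/idP/imsetP => [/isy_ex [i ->]|[i _ ->]]; [by exists i | exact: isy_yi].
Qed.

Definition mon (f : 'I_n -> nat) : 'X_{1..N} := [multinom (\sum_(i < n | yi i == l) f i)%N | l < N].

Lemma mon_yi f i : mon f (yi i) = f i.
Proof.
rewrite mnmE (eq_bigl (pred1 i)) ?big_pred1_eq // => j.
by apply/eqP/eqP => [/yi_inj|->].
Qed.

Lemma mon_nisy f k : ~~ isy k -> mon f k = 0%N.
Proof. by move=> yk; rewrite mnmE big1 // => i /eqP e1; rewrite -e1 isy_yi in yk. Qed.

Lemma ydeg_mon f : ydeg (mon f) = (\sum_i f i)%N.
Proof. by rewrite ydegE; apply: eq_bigr => i _; rewrite mon_yi. Qed.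

Lemma mon_split k m : (k <= ydeg m)%N -> exists f m', (\sum_i f i = k)%N /\ m = (mon f + m')%MM.
Proof.
rewrite ydegE => km.
have [f fk fm] : exists2 f : 'I_n -> nat, (\sum_i f i = k)%N & forall i, (f i <= m (yi i))%N.
  elim: k km => [_|k IH km]; first by exists (fun=> 0%N) => //; rewrite big1.
  have [f fk fm] := IH (ltnW km).
  have [i lt] : exists i, (f i < m (yi i))%N.
    apply: contrapT => h; move: km; rewrite ltnNge => /negP; apply; rewrite -fk.
    by apply: leq_sum => i _; rewrite leqNgt; apply/negP => lt; apply: h; exists i.
  exists (fun j => (f j + (j == i))%N) => [|j].
    rewrite big_split /= fk (bigD1 i) //= eqxx big1 ?addn0 ?addn1 // => j /negbTE ->.
    by [].
  by case: eqP => [->|_]; rewrite ?addn1 ?addn0.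
exists f, (m - mon f)%MM; split=> //; rewrite addmC submK //.
apply/mnm_lepP => l; have [yl|nl] := boolP (isy l); last by rewrite mon_nisy.
by have [i ->] := isy_ex yl; rewrite mon_yi.
Qed.

Definition yidx (k : nat) : finType := {a : n.-tuple 'I_k.+1 | (\sum_(i <- a) i == k)%N}.

Definition tupf k (a : yidx k) (i : 'I_n) : nat := tnth (val a) i.

Lemma tupf_sum k (a : yidx k) : (\sum_i tupf a i = k)%N.
Proof. by have /eqP := valP a; rewrite big_tuple. Qed.

Lemma tupf_ex k (f : 'I_n -> nat) : (\sum_i f i = k)%N -> exists a : yidx k, tupf a = f.
Proof.
move=> fk; have fle i : (f i < k.+1)%N by rewrite ltnS -fk (bigD1 i) //= leq_addr.
pose a := [tuple (Ordinal (fle i)) | i < n].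
have ha : (\sum_(i <- a) i == k)%N.
  by rewrite big_tuple; apply/eqP; rewrite -[RHS]fk; apply: eq_bigr => i _; rewrite tnth_mktuple.
by exists (exist _ a ha); apply/funext => i; rewrite /tupf tnth_mktuple.
Qed.

Lemma tupf_inj k (a b : yidx k) : tupf a = tupf b -> a = b.
Proof.
move=> h; apply/val_inj/eq_from_tnth => i; apply: val_inj; exact: (congr1 (fun f => f i) h).
Qed.

Definition xmon k (a : yidx k) : {mpoly A[N]} := 'X_[mon (tupf a)].

Lemma gpred_xmon k a : gpred k (@xmon k a).
Proof. by move=> m; rewrite msuppX inE => /eqP ->; rewrite ydeg_mon tupf_sum leqnn orbT. Qed.

Lemma gpred_span k p : gpred k p -> ideal_span ([seq xmon b | b : yidx k] ++ vars A thetas) p.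
Proof.
move=> hp; rewrite [p]mpolyE big_seq; apply: ideal_sum => m /hp /orP[h|h].
  by apply: span_monoR; apply/varmemP => m' /msuppZ_le; rewrite msuppX inE => /eqP ->.
rewrite -mul_mpolyC; apply: ideal_M; have [f [m' [fk ->]]] := mon_split h.
have [a ea] := tupf_ex fk; rewrite mpolyXD; apply/ideal_Mr/span_monoL/ideal_span_mem.
by apply/mapP; exists a; rewrite ?mem_enum // /xmon ea.
Qed.

(** A monomial [m] of [w a] without theta or [y] variables contributes [m + mon (tupf a)], which no
    other summand can cancel and whose [y]-degree is only [k]. *)
Lemma mon_free k (w : yidx k -> {mpoly A[N]}) : gpred k.+1 (\sum_a w a * xmon a) ->
  forall a, ideal_span (vars A (thetas ++ ys)) (w a).
Proof.
move=> h a; apply/varmemP => m ms; apply: contraT => nm.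
have nt : ~~ hasvar thetas m by apply: contra nm; rewrite /hasvar has_cat => ->.
have ny l : isy l -> m l = 0%N.
  move=> yl; apply/eqP; rewrite -leqn0 leqNgt; apply: contra nm => lt.
  by apply/hasP; exists l => //; rewrite mem_cat mem_ys yl orbT.
have mn : (m + mon (tupf a))%MM \in msupp (\sum_a w a * xmon a).
  rewrite mcoeff_msupp raddf_sum (bigD1 a) //= [X in _ + X]big1 ?addr0 => [|b ba].
    by rewrite addmC mcoeffMX -mcoeff_msupp.
  apply: memN_msupp_eq0; apply: contra ba => /msuppM_le /allpairsP [[m1 m2] /= [_]].
  rewrite msuppX inE => /eqP -> e1; apply/eqP/tupf_inj/funext => i.
  have e2 j : (tupf a j = m1 (yi j) + tupf b j)%N.
    by have := congr1 (fun x : 'X_{1..N} => x (yi j)) e1; rewrite !mnmDE !mon_yi (ny _ (isy_yi j)).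
  have : (\sum_j m1 (yi j) == 0)%N.
    have := tupf_sum a; rewrite (eq_bigr _ (fun j _ => e2 j)) big_split /= tupf_sum.
    by move: (\sum_j _)%N => x; clear; lia.
  by rewrite sum_nat_eq0 => /forallP /(_ i) /= /eqP m10; rewrite e2 m10.
have := h _ mn; rewrite hasvarD (negbTE nt) ydegD ydeg_mon tupf_sum.
have -> : ydeg m = 0%N by rewrite ydegE big1 // => i _; apply: ny; exact: isy_yi.
rewrite add0n ltnn orbF => /hasP [l /thetas_nisy yl].
by rewrite mon_nisy.
Qed.

End Poly.

Section Quotient.
Variables (A : comNzRingType) (B R : comPzRingType).
Variables (psi : {rmorphism {mpoly A[N]} -> B}) (f : {rmorphism B -> R}).
Hypotheses (psi_flat : flat psi) (f_surj : forall y, exists x, f x = y).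
Hypothesis f_ker : forall x, f x = 0 <-> ideal_span (map psi (minors n e A ++ vars A thetas)) x.

Let rho : {rmorphism {mpoly A[N]} -> R} := GRing.RMorphism.clone _ _ (f \o psi) _.

Definition yfil k : ideal R := ideal_gen (fun x => exists2 p, gpred k p & x = rho p).

Lemma yfil_rho k p : gpred k p -> yfil k (rho p).
Proof. by move=> hp J; apply; exists p. Qed.

Lemma yfil_ind k (P : R -> Prop) : P 0 -> (forall x y, P x -> P y -> P (x + y)) ->
  (forall a x, P x -> P (a * x)) -> (forall p, gpred k p -> P (rho p)) -> forall x, yfil k x -> P x.
Proof. by move=> P0 PD PM SP; apply: ideal_gen_ind => // x [p hp ->]; apply: SP. Qed.

Lemma yfil_bot x : yfil s x -> x = 0.
Proof.
move: x; apply: yfil_ind => // [x y -> ->|a x ->|p /gpred_high h]; rewrite ?addr0 ?mulr0 //.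
by apply/f_ker; apply: span_map.
Qed.

Lemma yfil_dec k x : yfil k.+1 x -> yfil k x.
Proof.
move: x; apply: yfil_ind; [exact: ideal_0 | exact: ideal_D | exact: ideal_M |].
move=> p hp; apply: yfil_rho => m /hp /orP[->//|h]; by rewrite (ltnW h) orbT.
Qed.

Lemma yfil_mul k a x : yfil 1 a -> yfil k x -> yfil k.+1 (a * x).
Proof.
move=> ha hx; move: a ha; apply: yfil_ind => [|a b ha hb|c a ha|p hp].
- by rewrite mul0r; apply: ideal_0.
- by rewrite mulrDl; apply: ideal_D.
- by rewrite -mulrA; apply: ideal_M.
move: x hx; apply: yfil_ind => [|x y hx hy|c x hx|q hq].
- by rewrite mulr0; apply: ideal_0.
- by rewrite mulrDr; apply: ideal_D.
- by rewrite mulrCA; apply: ideal_M.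
by rewrite -rmorphM; apply: yfil_rho; apply: (@gpredM _ 1 k).
Qed.

Lemma gpred_cat k p : ideal_span (vars A thetas) p -> gpred k p.
Proof.
move=> h; have h1 x : x \in vars A thetas -> gideal A k x by move=> /mapP [l lt ->]; apply: gpred_theta.
exact: (ideal_span_sub h1 h).
Qed.

Lemma yfil_gen k x : yfil k x -> exists c : yidx k -> R, yfil k.+1 (x - \sum_a c a * rho (xmon A a)).
Proof.
move: x; apply: yfil_ind => [|x y [c hc] [d hd]|b x [c hc]|p /gpred_span /span_cat [q [r [/span_image [c ->] hr ->]]]].
- by exists (fun=> 0); rewrite big1 ?subr0 => [|a _]; [apply: ideal_0 | rewrite mul0r].
- exists (fun a => c a + d a); have -> : \sum_a (c a + d a) * rho (xmon A a) =
      \sum_a c a * rho (xmon A a) + \sum_a d a * rho (xmon A a).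
    by rewrite -big_split; apply: eq_bigr => a _; rewrite mulrDl.
  by rewrite opprD addrACA; apply: ideal_D.
- exists (fun a => b * c a); have -> : \sum_a b * c a * rho (xmon A a) = b * \sum_a c a * rho (xmon A a).
    by rewrite mulr_sumr; apply: eq_bigr => a _; rewrite mulrA.
  by rewrite -mulrBr; apply: ideal_M.
exists (fun a => rho (c a)); rewrite rmorphD rmorph_sum [X in X - _]addrC.
have -> : \sum_a rho (c a * xmon A a) = \sum_a rho (c a) * rho (xmon A a).
  by apply: eq_bigr => a _; rewrite rmorphM.
by rewrite addrK; apply/yfil_rho/gpred_cat.
Qed.

Definition ylist k : seq {mpoly A[N]} :=
  [seq xmon A b | b : yidx k] ++ vars A thetas ++ minors n e A.

Lemma yfil_lift k x : yfil k x -> exists2 z, f z = x & ideal_span (map psi (ylist k)) z.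
Proof.
move: x; apply: yfil_ind => [|x y [z <- hz] [w <- hw]|a x [z <- hz]|p /gpred_span hp].
- by exists 0; [rewrite rmorph0 | apply: ideal_0].
- by exists (z + w); [rewrite rmorphD | apply: ideal_D].
- by have [b <-] := f_surj a; exists (b * z); [rewrite rmorphM | apply: ideal_M].
exists (psi p) => //; apply: span_map; rewrite /ylist catA; exact: span_monoL.
Qed.

Lemma span_sub2 (Q : comPzRingType) (s1 s2 : seq Q) x :
  (forall y, y \in s1 -> ideal_span s2 y) -> ideal_span s1 x -> ideal_span s2 x.
Proof. by move=> h; apply: ideal_span_sub. Qed.

Lemma span_yfil1 z : ideal_span (map psi (vars A (thetas ++ ys))) z -> yfil 1 (f z).
Proof.
move=> /ideal_spanE [b ->]; rewrite rmorph_sum; apply: ideal_sum => i _; rewrite rmorphM; apply: ideal_M.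
have : (map psi (vars A (thetas ++ ys)))`_i \in map psi (vars A (thetas ++ ys)) by apply: mem_nth.
move=> /mapP [x /mapP [l lt ->] ->]; apply: yfil_rho; move: lt; rewrite mem_cat mem_ys.
by move=> /orP[]; [exact: gpred_theta | exact: gpred_y].
Qed.

(** This is [mon_free] over the polynomial ring, transported along the flat map [psi] by
    [flat_relations]. *)
Lemma yfil_free k (c : yidx k -> R) : (k < s)%N -> yfil k.+1 (\sum_a c a * rho (xmon A a)) ->
  forall a, yfil 1 (c a).
Proof.
move=> ks hc a; have [c' hc'] := choice (fun a => f_surj (c a)).
have hz : ideal_span (map psi (ylist k.+1)) (\sum_a c' a * psi (xmon A a)).
  have [z ez hz] := yfil_lift hc.
  have hk : f (\sum_a c' a * psi (xmon A a) - z) = 0.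
    rewrite rmorphB ez rmorph_sum; apply/eqP; rewrite subr_eq0; apply/eqP.
    by apply: eq_bigr => b _; rewrite rmorphM hc'.
  rewrite -[X in ideal_span _ X](subrK z); apply: ideal_D => //.
  move/f_ker: hk; apply: span_sub2 => y /mapP [q hq ->]; apply/ideal_span_mem/map_f.
  by move: hq; rewrite /ylist !mem_cat => /orP[] ->; rewrite ?orbT.
pose D (i : 'I_#|yidx k|) := xmon A (enum_val i).
have sumE (Q : comPzRingType) (F : yidx k -> Q) : \sum_a F a = \sum_(i < #|yidx k|) F (enum_val i).
  by rewrite (reindex (@enum_val _ (yidx k))) //; apply: onW_bij; apply: enum_val_bij.
have key : forall w : 'I_#|yidx k| -> {mpoly A[N]}, ideal_span (ylist k.+1) (\sum_i w i * D i) ->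
    forall i, ideal_span (vars A (thetas ++ ys)) (w i).
  move=> w hw i; rewrite -(enum_valK i).
  apply: (mon_free (w := fun a => w (enum_rank a))).
  have -> : \sum_a w (enum_rank a) * xmon A a = \sum_i w i * D i.
    by rewrite sumE; apply: eq_bigr => j _; rewrite enum_valK.
  have h1 x : x \in ylist k.+1 -> gideal A k.+1 x.
    rewrite !mem_cat => /or3P[/mapP [b _ ->]|/mapP [l lt ->]|/gpred_minors hx].
    - exact: gpred_xmon.
    - exact: gpred_theta.
    - by move=> m /hx /orP[->//|h]; rewrite (leq_trans ks h) orbT.
  exact: (ideal_span_sub h1 hw).
have := flat_relations psi_flat key (v := fun i => c' (enum_val i)) _ (enum_rank a).
rewrite enum_rankK => h; have {h}h := h _; rewrite -hc'.
apply: span_yfil1; apply: h; rewrite sumE in hz.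
exact: hz.
Qed.

Definition yfiltration : free_filtration R s.
Proof.
apply: (@FreeFiltration _ _ yidx (fun k a => rho (xmon A a)) yfil).
- move=> x; rewrite -[x]mulr1; apply: ideal_M; rewrite -(rmorph1 rho); apply: yfil_rho.
  exact: gpred_true.
- exact: yfil_bot.
- exact: yfil_dec.
- by move=> k a _; apply/yfil_rho/gpred_xmon.
- exact: yfil_mul.
- by move=> k x _; exact: yfil_gen.
- exact: yfil_free.
Defined.

End Quotient.

Lemma yidx_card k : (0 < n)%N -> #|yidx k| = 'C(n.-1 + k, n.-1).
Proof.
move=> n0; rewrite card_sig; have -> : #|[pred x : n.-tuple 'I_k.+1 | (\sum_(i <- x) i == k)%N]| =
  #|[set x : n.-1.+1.-tuple 'I_k.+1 | (\sum_(i <- x) i == k)%N]|.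
  by rewrite (prednK n0); apply: eq_card => x; rewrite inE.
exact: card_ord_partitions.
Qed.

(** By the hockey-stick identity the left side is [C(n - 1 + s', n)], which is [s' / n] times the
    right side. *)
Lemma yidx_count : (s <= n)%N -> (\sum_(j < s') #|yidx j| < #|yidx s'|)%N.
Proof.
move=> sn; have n0 : (0 < n)%N by apply: leq_trans sn.
rewrite yidx_card // (eq_bigr (fun j : 'I_s' => 'C(n.-1 + j, n.-1))); last by move=> j _; apply: yidx_card.
have -> : (\sum_(j < s') 'C(n.-1 + j, n.-1) = 'C(n.-1 + s', n.-1.+1))%N.
  elim: (s') => [|k IH]; first by rewrite big_ord0 addn0 bin_small.
  by rewrite big_ord_recr /= IH addnS binS.
rewrite -(ltn_pmul2l (m := n.-1.+1)) // mul_bin_left addKn ltn_pmul2r ?bin_gt0 ?leq_addr //.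
by rewrite prednK.
Qed.

Lemma strongSAC_associated (A : comNzRingType) (B R : comPzRingType) (psi : {rmorphism {mpoly A[N]} -> B})
  (f : {rmorphism B -> R}) (B1 : comPzRingType) (g : {rmorphism B -> B1}) d :
  flat psi -> (forall y, exists x, f x = y) ->
  (forall x, f x = 0 <-> ideal_span (map psi (minors n e A ++ vars A thetas)) x) ->
  (forall y, exists x, g x = y) ->
  (forall x, g x = 0 <-> ideal_span (map psi (vars A (thetas ++ ys))) x) ->
  noetherian B -> eventuallySplit B1 -> injdim_le B1 d -> (0 < s')%N -> (s <= n)%N -> strongSAC R.
Proof.
move=> fl surj ker gsurj gker nB ev id s0 sn.
have low q : gpred 1 q -> ideal_span (vars A (thetas ++ ys)) q.
  move=> hq; apply/varmemP => m /hq; rewrite /hasvar has_cat => /orP[->//|].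
  rewrite ydegE lt0n sum_nat_eq0 negb_forall => /existsP [i] /=; rewrite -lt0n => mi.
  by apply/orP; right; apply/hasP; exists (yi i); rewrite ?mem_ys ?isy_yi.
have fg x : f x = 0 -> g x = 0.
  move=> /ker h; apply/gker; apply: span_sub2 h => y /mapP [q hq ->]; apply: span_map.
  move: hq; rewrite mem_cat => /orP[/gpred_minors hq|/mapP [l lt ->]]; last first.
    by apply/ideal_span_mem/map_f; rewrite mem_cat lt.
  by apply: low => m /hq /orP[->//|h1]; rewrite (leq_trans _ h1) ?orbT.
have [p hp] := surj_lift surj fg.
apply: (@strongSAC_filtered R B1 s (yfiltration fl surj ker) p _ _ _ _ _ d) => //.
- exact: noeth_surj surj nB.
- exact: yidx_count.
- by move=> y; have [x <-] := gsurj y; exists (f x); rewrite hp.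
move=> x; split=> [e0|].
  have [z ez] := surj x; rewrite -ez; apply: span_yfil1; apply/gker.
  by rewrite -hp ez.
move: x; apply: yfil_ind => [|x y e1 e2|a x e1|q /low hq].
- by rewrite rmorph0.
- by rewrite rmorphD e1 e2 addr0.
- by rewrite rmorphM e1 mulr0.
by rewrite /= hp; apply/gker/span_map.
Qed.

End Associated.

(** * Determinantal rings with entries in the Jacobson radical *)

(** Polynomial rings need nonzero coefficients, whereas quotients and localizations may vanish; the
    equality of structures allows substitution once 1 is known to be nonzero. *)
Lemma nontrivial_pack (B : comPzRingType) : (1 : B) != 0 ->
  exists B' : comNzRingType, (B' : comPzRingType) = B.
Proof.
move=> h; pose m := GRing.PzSemiRing_isNonZero.Build B h.
by exists (HB.pack_for comNzRingType (B : Type) (GRing.ComPzRing.class B) m); case: B h m.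
Qed.

Lemma mpoly_eval_ex (A : comNzRingType) N (B : comPzRingType) (phi : {rmorphism A -> B}) (h : 'I_N -> B) :
  exists psi : {rmorphism {mpoly A[N]} -> B}, (forall a, psi a%:MP = phi a) /\ forall k, psi 'X_k = h k.
Proof.
have [e|ne] := eqVneq (1 : B) 0; last first.
  have [B' eB] := nontrivial_pack ne; subst B.
  exists (GRing.RMorphism.clone _ _ (meval h \o map_mpoly phi) _).
  split=> [a|k] /=; first by rewrite map_mpolyC /= mevalC.
  by rewrite map_mpolyX mevalXU.
have all0 (x y : B) : x = y by rewrite -[x]mul1r -[y]mul1r e !mul0r.
pose g (x : {mpoly A[N]}) : B := 0.
have gB : {morph g : x y / x - y} by move=> x y; apply: all0.
have gM : {morph g : x y / x * y} by move=> x y; apply: all0.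
have g1 : g 1 = 1 by apply: all0.
pose i1 := GRing.isZmodMorphism.Build _ _ g gB.
pose i2 := GRing.isMultiplicative.Build _ _ g (conj gM g1).
exists (HB.pack_for {rmorphism {mpoly A[N]} -> B} g i1 i2); split=> *; exact: all0.
Qed.

Lemma mpoly_rmorph_eq (A : comNzRingType) N (B : comPzRingType) (f g : {rmorphism {mpoly A[N]} -> B}) :
  (forall a, f a%:MP = g a%:MP) -> (forall k, f 'X_k = g 'X_k) -> f =1 g.
Proof.
move=> hC hX p; rewrite [p]mpolyE !rmorph_sum; apply: eq_bigr => m _.
rewrite -mul_mpolyC !rmorphM hC; congr (_ * _).
rewrite mpolyXE_id !rmorph_prod; apply: eq_bigr => k _.
by rewrite !rmorphXn hX.
Qed.

Lemma loc_rmorph_eq (P L B : comPzRingType) (phi : {rmorphism P -> L}) (T : P -> Prop) (f g : {rmorphism L -> B}) :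
  is_loc phi T -> (forall x, f (phi x) = g (phi x)) -> f =1 g.
Proof.
move=> [un den _] h x; have [a [s [Ts e]]] := den x; have [u hu] := un s Ts.
have : f (phi s) * f x = f (phi s) * g x by rewrite -rmorphM e h h -e rmorphM.
move=> /(congr1 ( *%R (f u))); rewrite !mulrA -rmorphM [u * _]mulrC hu rmorph1 !mul1r.
by [].
Qed.

Lemma flat_factor (P L B : comPzRingType) (phi : {rmorphism P -> L}) (T : mult_set P)
  (psi0 : {rmorphism P -> B}) (psi : {rmorphism L -> B}) :
  is_loc phi T -> (forall x, psi (phi x) = psi0 x) -> flat psi0 -> flat psi.
Proof.
move=> loc h fl m n D v vD; have [s Ts [D0 hD]] := loc_common loc D.
have mapE k l (X : 'M[P]_(k, l)) : map_mx psi (map_mx phi X) = map_mx psi0 X.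
  by apply/matrixP => i j; rewrite !mxE h.
have [|k [W WD hv]] := fl _ _ D0 v.
  by rewrite -mapE -hD map_mxZ -scalemxAr vD scaler0.
exists k, (map_mx phi W); last by rewrite mapE.
have [t ht] := loc_unit loc Ts.
have : map_mx phi W *m (phi s *: D) = 0 by rewrite hD -map_mxM WD map_mx0.
move=> /(congr1 ( *:%R t)); rewrite scaler0 scalemxAr scalerA mulrC ht scale1r.
by [].
Qed.

(** [c] is regular on [P / L], hence by flatness on [B / L], and dividing by its image gives
    [B / (L, c)]. *)
Lemma quotient_step (P B R' R : comPzRingType) (psi : {rmorphism P -> B}) L c
  (f' : {rmorphism B -> R'}) (f : {rmorphism B -> R}) : flat psi ->
  (forall y, exists x, f' x = y) -> (forall x, f' x = 0 <-> ideal_span (map psi L) x) ->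
  (forall y, exists x, f x = y) -> (forall x, f x = 0 <-> ideal_span (map psi (rcons L c)) x) ->
  (forall y, ideal_span L (c * y) -> ideal_span L y) ->
  exists p : {rmorphism R' -> R}, mod_elt p (f' (psi c)) /\ nzd (f' (psi c)).
Proof.
move=> fl surj' ker' surj ker colon.
have kk x : f' x = 0 -> f x = 0.
  move=> /ker' h; apply/ker; rewrite map_rcons -cats1; apply: ideal_span_sub h => y ys.
  by apply: ideal_span_mem; rewrite mem_cat ys.
have [p hp] := surj_lift surj' kk; exists p; split; last first.
  move=> y; have [x <-] := surj' y; rewrite -rmorphM => /ker' h; apply/ker'.
  exact: (flat_colon fl colon).
split=> [y|y]; first by have [x <-] := surj y; exists (f' x).
have [x <-] := surj' y; rewrite hp; split=> [/ker|[d hd]].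
  rewrite map_rcons -cats1 => /span_cat [a [b [ha /span_cons [d [z [/span_nil -> ->]]] ->]]].
  have [_ /(_ ha) e] := ker' a.
  by exists (f' d); rewrite rmorphD e add0r addr0 rmorphM.
have [d' hd'] := surj' d; rewrite -hd' -rmorphM in hd.
have /kk : f' (x - d' * psi c) = 0 by rewrite rmorphB hd subrr.
rewrite rmorphB => /eqP; rewrite subr_eq0 => /eqP ->; rewrite rmorphM.
have [_ -> ] := ker (psi c); first by rewrite mulr0.
by apply/ideal_span_mem/map_f; rewrite mem_rcons mem_head.
Qed.

Lemma global_ci_strongSAC R : global_ci R -> strongSAC R.
Proof.
move=> /global_ci_split [ev _] C ex ext h; have [d sp] := ev C ex h.
exact: (split_down0 ex ext sp).
Qed.

Lemma global_ci_bij (B R : comPzRingType) (f : {rmorphism B -> R}) : (forall y, exists x, f x = y) ->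
  (forall x, f x = 0 -> x = 0) -> global_ci B -> global_ci R.
Proof. by move=> surj inj; apply: global_ci_loc; apply: iso_loc. Qed.

Lemma global_ci_vars (A : comNzRingType) N (B R : comPzRingType) (psi : {rmorphism {mpoly A[N]} -> B})
  (S : seq 'I_N) (f : {rmorphism B -> R}) : flat psi -> global_ci B -> uniq S ->
  (forall y, exists x, f x = y) -> (forall x, f x = 0 <-> ideal_span (map psi (vars A S)) x) -> global_ci R.
Proof.
move=> fl cB; elim/last_ind: S R f => [|S k IH] R f uS surj ker.
  by apply: (global_ci_bij surj) => // x /ker /span_nil.
pose I := ideal_span (map psi (vars A S)).
pose f' : {rmorphism B -> quotient I} := GRing.RMorphism.clone _ _ (qpi I) _.
rewrite rcons_uniq in uS; have /andP[kS uS'] := uS.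
have surj' y : exists x, f' x = y := qpi_surj y.
have ker' x : f' x = 0 <-> ideal_span (map psi (vars A S)) x := qpi_eq0 I x.
rewrite /vars map_rcons in ker.
have [|p [mp nz]] := quotient_step fl surj' ker' surj ker.
  by move=> y /varmemP h; apply/varmemP/(varmem_regular kS).
exact: global_ci_mod (IH _ f' uS' surj' ker') mp nz.
Qed.

Section Theta.
Variables (s' t n N : nat) (e : 'I_s'.+1 -> 'I_t -> 'I_N).
Local Notation s := s'.+1.
Hypotheses (tE : (n + s')%N = t) (e_inj : forall i j i' j', e i j = e i' j' -> i = i' /\ j = j').
Hypotheses (s'_gt0 : (0 < s')%N) (sn : (s <= n)%N).
Variables (A : comNzRingType) (B : comPzRingType) (psi : {rmorphism {mpoly A[N]} -> B}).
Hypotheses (fl : flat psi) (cB : global_ci B) (jac : forall i j, in_jac (psi 'X_(e i j))).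

(** Induction on the forms not yet killed: each is regular and in the Jacobson radical, so
    [strongSAC_mod] climbs back over it; when all are killed the ring is the filtered one. *)
Lemma strongSAC_thetas S2 S1 (R : comPzRingType) (f : {rmorphism B -> R}) : S1 ++ S2 = thetas n e ->
  (forall y, exists x, f x = y) ->
  (forall x, f x = 0 <-> ideal_span (map psi (minors n e A ++ vars A S1)) x) -> strongSAC R.
Proof.
have ut : uniq (thetas n e) by apply/filter_uniq/enum_uniq.
elim: S2 S1 R f => [|k S2 IH] S1 R f eS surj ker.
  rewrite cats0 in eS; subst S1.
  pose I := ideal_span (map psi (vars A (thetas n e ++ ys n e))).
  pose g : {rmorphism B -> quotient I} := GRing.RMorphism.clone _ _ (qpi I) _.
  have gs y : exists x, g x = y := qpi_surj y.
  have gk x : g x = 0 <-> ideal_span (map psi (vars A (thetas n e ++ ys n e))) x := qpi_eq0 I x.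
  have cI : global_ci (quotient I).
    apply: (global_ci_vars fl cB _ gs gk); rewrite cat_uniq ut (filter_uniq _ (enum_uniq _)) andbT.
    by apply/hasPn => k; rewrite mem_ys; apply: contraL => /thetas_nisy.
  have [ev [d id]] := global_ci_split cI.
  exact: (strongSAC_associated tE e_inj fl surj ker gs gk (global_ci_noeth cB) ev id).
have kt : k \in thetas n e by rewrite -eS mem_cat mem_head orbT.
pose I := ideal_span (map psi (minors n e A ++ vars A (rcons S1 k))).
pose g : {rmorphism B -> quotient I} := GRing.RMorphism.clone _ _ (qpi I) _.
have gs y : exists x, g x = y := qpi_surj y.
have gk x : g x = 0 <-> ideal_span (map psi (minors n e A ++ vars A (rcons S1 k))) x := qpi_eq0 I x.
have gk' := gk; rewrite /vars map_rcons -rcons_cat in gk'.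
have [|p [mp nz]] := quotient_step fl surj ker gs gk'.
  move=> y; apply: (theta_regular tE e_inj s'_gt0) => [l|].
    by rewrite inE => /orP[/eqP ->|lS]; apply: thetas_nisy => //; rewrite -eS mem_cat lS.
  by move: ut; rewrite -eS cat_uniq => /and3P[_ /hasPn h _]; apply: h; rewrite mem_head.
apply: (strongSAC_mod mp nz); last by apply: (IH (rcons S1 k) _ g) => //; rewrite cat_rcons.
have [i [j ek]] : exists i j, k = e i j.
  by move: kt; rewrite mem_filter => /andP[/andP[/existsP [i /existsP [j /eqP ek]] _] _]; exists i, j.
move=> a; have [a' <-] := surj a; have [b hb] := jac i j a'.
by exists (f b); rewrite -[1 in LHS](rmorph1 f) ek -rmorphM -rmorphD -rmorphM hb rmorph1.
Qed.

End Theta.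

(** * Pivots and Schur complements *)

Definition dets (B : comPzRingType) s t (X : 'I_s -> 'I_t -> B) : seq B :=
  [seq \det (\matrix_(i < s, k < s) X i (g k)) | g : {ffun 'I_s -> 'I_t}].

Lemma dets_mem (B : comPzRingType) s t (X : 'I_s -> 'I_t -> B) (g : 'I_s -> 'I_t) :
  \det (\matrix_(i < s, k < s) X i (g k)) \in dets X.
Proof.
apply/mapP; exists (finfun g); first by rewrite mem_enum.
by congr (\det _); apply/matrixP => i k; rewrite !mxE ffunE.
Qed.

Lemma map_dets (B B' : comPzRingType) (f : {rmorphism B -> B'}) s t (X : 'I_s -> 'I_t -> B) :
  map f (dets X) = dets (fun i j => f (X i j)).
Proof.
rewrite /dets -map_comp; apply: eq_map => g /=; rewrite -det_map_mx; congr (\det _).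
by apply/matrixP => i k; rewrite !mxE.
Qed.

Section Pivot.
Variables (B : comPzRingType) (s t : nat) (X : 'I_s.+1 -> 'I_t.+1 -> B) (i : 'I_s.+1) (j : 'I_t.+1) (u : B).
Hypothesis unit_u : X i j * u = 1.

Definition schur (k : 'I_s) (l : 'I_t) : B :=
  X (lift i k) (lift j l) - X (lift i k) j * u * X i (lift j l).

Let Y (k : 'I_s) (l : 'I_t.+1) : B := X (lift i k) l - X (lift i k) j * u * X i l.

Let Yj k : Y k j = 0.
Proof. by rewrite /Y -mulrA [u * _]mulrC unit_u mulr1 subrr. Qed.

Let elim : 'M[B]_s.+1 := \matrix_(a, b) ((a == b)%:R - (if (b == i) && (a != i) then X a j * u else 0)).

Let det_elim : \det elim = 1.
Proof.
rewrite (expand_det_row _ i) (bigD1 i) //= big1 ?addr0; last first.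
  by move=> k ki; rewrite mxE eqxx andbF subr0 eq_sym (negbTE ki) mul0r.
rewrite mxE eqxx andbF subr0 mul1r /cofactor -signr_odd oddD addbb expr0 mul1r.
rewrite (_ : row' i (col' i elim) = 1%:M) ?det1 //; apply/matrixP => a b; rewrite !mxE.
rewrite (inj_eq lift_inj) [lift i b == i]eq_sym (negbTE (neq_lift i b)) subr0.
by [].
Qed.

Let det_row (g : 'I_s.+1 -> 'I_t.+1) : \det (\matrix_(a < s.+1, k < s.+1) X a (g k)) =
  \det (\matrix_(a < s.+1, k < s.+1) (if unlift i a is Some a' then Y a' (g k) else X i (g k))).
Proof.
rewrite -[LHS]mul1r -det_elim -det_mulmx; congr (\det _); apply/matrixP => a k; rewrite !mxE.
case: (unliftP i a) => [a'|] -> {a}.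
  rewrite (bigD1 (lift i a')) //= (bigD1 i) ?neq_lift //= big1 => [|b /andP[b1 b2]].
    rewrite !mxE !eqxx [lift i a' == i]eq_sym (negbTE (neq_lift i a')) /= addr0 subr0 mul1r sub0r mulNr.
    by rewrite /Y.
  by rewrite !mxE (negbTE b2) /= eq_sym (negbTE b1) subr0 mul0r.
rewrite (bigD1 i) //= big1 ?addr0 => [|b bi]; rewrite !mxE eqxx ?andbF subr0 ?mul1r //.
by rewrite eq_sym (negbTE bi) mul0r.
Qed.

(** Row [i] clears the column [j]. A minor of the complement times the pivot is a minor through that
    column; conversely a minor expands along row [i], and cofactors still containing column [j] are
    zero. *)
Lemma dets_schur z : ideal_span (dets X) z <-> ideal_span (dets schur) z.
Proof.
have unl a : unlift i (lift i a) = Some a by rewrite liftK.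
split; apply: span_sub2 => {z} _ /mapP [g _ ->]; last first.
  pose g1 (k : 'I_s.+1) := if unlift i k is Some l then lift j (g l) else j.
  have -> : \det (\matrix_(a < s, k < s) schur a (g k)) = u * \det (\matrix_(a < s.+1, k < s.+1) X a (g1 k)).
    rewrite det_row (expand_det_col _ i) (bigD1 i) //= big1 ?addr0 => [|b bi]; last first.
      have [b' ->] : exists b', b = lift i b' by have [b' ->] := unlift_some (negbT (introF eqP (fun h => negP bi (introT eqP (esym h))))); exists b'.
      by rewrite mxE unl /g1 unlift_none Yj mul0r.
    rewrite mxE unlift_none /g1 unlift_none mulrA [u * _]mulrC unit_u mul1r.
    rewrite /cofactor -signr_odd oddD addbb expr0 mul1r; congr (\det _).
    by apply/matrixP => a b; rewrite !mxE !unl.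
  by apply/ideal_M/ideal_span_mem/dets_mem.
rewrite det_row (expand_det_row _ i); apply: ideal_sum => k _; apply: ideal_M; apply: ideal_M.
pose h l := g (lift k l).
have -> : row' i (col' k (\matrix_(a < s.+1, k0 < s.+1)
     (if unlift i a is Some a' then Y a' (g k0) else X i (g k0)))) = \matrix_(a, l) Y a (h l).
  by apply/matrixP => a b; rewrite !mxE unl.
have [[l hl]|nh] := pselect (exists l, h l = j).
  rewrite (expand_det_col _ l) big1; first exact: ideal_0.
  by move=> a _; rewrite mxE hl Yj mul0r.
have [h' hh'] : exists h', forall l, h l = lift j (h' l).
  apply: (@fin_all_exists _ _ (fun l y => h l = lift j y)) => l.
  case: (unliftP j (h l)) => [y ey|e]; first by exists y.
  by case: nh; exists l.
have -> : \matrix_(a, l) Y a (h l) = \matrix_(a < s, l < s) schur a (h' l).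
  by apply/matrixP => a b; rewrite !mxE hh'.
exact/ideal_span_mem/dets_mem.
Qed.

End Pivot.

Lemma in_jac0 (R : comPzRingType) : in_jac (0 : R).
Proof. by move=> a; exists 1; rewrite mulr0 addr0 mulr1. Qed.

Lemma in_jacB (R : comPzRingType) (x y : R) : in_jac x -> in_jac y -> in_jac (x - y).
Proof.
move=> hx hy a; have [b hb] := hx a; have [c hc] := hy (- (a * b)); exists (b * c).
have -> : (1 + a * (x - y)) * (b * c) = ((1 + a * x) * b - a * b * y) * c by ring.
by rewrite hb -mulNr hc.
Qed.

Section Twist.
Variables (s' t n N : nat) (e : 'I_s'.+1 -> 'I_t -> 'I_N).
Local Notation s := s'.+1.
Hypotheses (tE : (n + s')%N = t) (e_inj : forall i j i' j', e i j = e i' j' -> i = i' /\ j = j').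
Hypotheses (s'_gt0 : (0 < s')%N) (sn : (s <= n)%N).
Variables (A : comNzRingType) (B : comPzRingType) (psi : {rmorphism {mpoly A[N]} -> B}).
Hypotheses (fl : flat psi) (cB : global_ci B) (jac : forall i j, in_jac (psi 'X_(e i j))).

Definition twist (k : 'I_N) : {mpoly A[N]} :=
  if posn e k is Some ij then (if ij.1 == ord0 then 0 else toep n e A ij.1 ij.2) else 0.

Lemma twistE k : twist k = 0 \/ exists j, twist k = 'X_(e ord0 j).
Proof.
rewrite /twist; case: posn => [[i j] /=|]; last by left.
case: eqP => _; first by left.
rewrite /toep; case: ifP => _; last by left.
rewrite /yv; case: insubP => [l _ _|_]; last by left.
by case: ifP => _; [right; exists l | left].
Qed.

Lemma Xi_twist i j : Xi n e A i j = 'X_(e i j) + twist (e i j).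
Proof.
rewrite mxE /twist (posnE e_inj) /= /freev; case: eqP => [->|_] //=.
rewrite addr0 /toep /= subn0 /yv valK.
by case: ifP => _; rewrite ?add0r ?addr0.
Qed.

(** Twists involve only variables of the first row, which the substitutions fix, so [al] and [be]
    are inverse automorphisms; composing [psi] with [al] turns [Xi] into the given matrix. *)
Lemma strongSAC_jac (R : comPzRingType) (f : {rmorphism B -> R}) : (forall y, exists x, f x = y) ->
  (forall x, f x = 0 <-> ideal_span (dets (fun i j => psi 'X_(e i j))) x) -> strongSAC R.
Proof.
move=> surj ker.
have [al [alC alX]] := mpoly_eval_ex (@mpolyC N A) (fun k => 'X_k - twist k).
have [be [beC beX]] := mpoly_eval_ex (@mpolyC N A) (fun k => 'X_k + twist k).
have t0 j : twist (e ord0 j) = 0 by rewrite /twist (posnE e_inj).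
have alT k : al (twist k) = twist k.
  by case: (twistE k) => [->|[j ->]]; rewrite ?rmorph0 // alX t0 subr0.
have beT k : be (twist k) = twist k.
  by case: (twistE k) => [->|[j ->]]; rewrite ?rmorph0 // beX t0 addr0.
have albe p : al (be p) = p.
  apply: (@mpoly_rmorph_eq A N _ (GRing.RMorphism.clone _ _ (al \o be) _) (GRing.RMorphism.clone _ _ idfun _)).
    by move=> a /=; rewrite beC alC.
  by move=> k /=; rewrite beX rmorphD alT alX subrK.
have beal p : be (al p) = p.
  apply: (@mpoly_rmorph_eq A N _ (GRing.RMorphism.clone _ _ (be \o al) _) (GRing.RMorphism.clone _ _ idfun _)).
    by move=> a /=; rewrite alC beC.
  by move=> k /=; rewrite alX rmorphB beT beX addrK.
pose psi' : {rmorphism {mpoly A[N]} -> B} := GRing.RMorphism.clone _ _ (psi \o al) _.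
have fl' : flat psi'.
  apply: flat_comp fl; apply: loc_flat (iso_loc _ _) => [y|x h]; first by exists (be y).
  by rewrite -[x]beal h rmorph0.
have psiX i j : psi' (Xi n e A i j) = psi 'X_(e i j).
  by rewrite Xi_twist /= rmorphD alT alX subrK.
have eqL : map psi' (minors n e A ++ vars A [::]) = dets (fun i j => psi 'X_(e i j)).
  rewrite cats0 /minors -/(dets (fun i k => Xi n e A i k)) map_dets.
  by congr dets; apply/funext => i; apply/funext => j; rewrite psiX.
apply: (strongSAC_thetas tE e_inj s'_gt0 sn fl' cB _ (S2 := thetas n e) (S1 := [::]) _ surj) => //.
  move=> i j; rewrite /= alX rmorphB; apply: in_jacB => //.
  by case: (twistE (e i j)) => [->|[l ->]] //; rewrite rmorph0; apply: in_jac0.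
by move=> x; rewrite eqL.
Qed.

End Twist.

(** * Induction on the size of the minors *)

Section Cover.
Variable R : comPzRingType.

Definition powset (x : R) : mult_set R.
Proof.
apply: (@MultSet R (fun a => exists k, a = x ^+ k)); first by exists 0%N.
by move=> _ _ [k ->] [l ->]; exists (k + l)%N; rewrite exprD.
Defined.

(** Localizing at [1 + I] puts [I] into the Jacobson radical. *)
Definition oneset (I : ideal R) : mult_set R.
Proof.
apply: (@MultSet R (fun a => I (a - 1))); first by rewrite subrr; apply: ideal_0.
move=> x y Ix Iy; have -> : x * y - 1 = y * (x - 1) + (y - 1) by ring.
by apply: ideal_D => //; apply: ideal_M.
Defined.

Definition splitup_ideal m n (D : 'M[R]_(m, n)) : ideal R.
Proof.
apply: (@Ideal R (fun a => exists E, D *m E *m D = a *: D)).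
- by exists 0; rewrite mulmx0 mul0mx scale0r.
- by move=> a b [E hE] [F hF]; exists (E + F); rewrite mulmxDr mulmxDl hE hF scalerDl.
- by move=> a b [E hE]; exists (a *: E); rewrite -scalemxAr -scalemxAl hE scalerA.
Defined.

Lemma strongSAC_splitup (L : comPzRingType) (phi : {rmorphism R -> L}) (T : mult_set R) (C : cpx R) :
  is_loc phi T -> strongSAC L -> exactc C -> (forall i, extR C i) ->
  (exists n, forall i, (n <= i)%N -> ext0 C i (dif C 0)) ->
  exists2 a, T a & splitup_ideal (dif C 0) a.
Proof.
move=> loc sac ex h [n hn]; have fl := loc_flat loc.
apply: (descends_split (loc_descends loc)); apply: (sac (mapc phi C)).
- exact: flat_exactc.
- by move=> i; apply: flat_extR.
- by exists n => i ni; apply: flat_ext0 => //; apply: hn.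
Qed.

Lemma radD (I : ideal R) a b m n : I (a ^+ m) -> I (b ^+ n) -> I ((a + b) ^+ (m + n)).
Proof.
move=> Ia Ib; rewrite exprDn; apply: ideal_sum => i _; rewrite -mulr_natl; apply: ideal_M.
have [ni|ni] := leqP n i.
  by rewrite -(subnK ni) exprD mulrA; apply: ideal_M.
have -> : (m + n - i = (n - i) + m)%N by lia.
by rewrite exprD -mulrA mulrCA; apply: ideal_Mr.
Qed.

(** The multipliers splitting [d_0] form an ideal containing a power of every element of the ideal
    of [s], and some [a] congruent to 1; a power of [1 - a] together with [a] gives 1. *)
Lemma strongSAC_cover (s : seq R) :
  (forall x, x \in s -> strongSAC (localization (powset x))) ->
  strongSAC (localization (oneset (ideal_span s))) -> strongSAC R.
Proof.
move=> hs h1 C ex h hn; pose I := splitup_ideal (dif C 0).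
suff [E hE] : I 1 by exists E; rewrite hE scale1r.
have [a Ta Ia] := strongSAC_splitup (locmap_loc (oneset (ideal_span s))) h1 ex h hn.
have rad z : ideal_span s z -> exists n, I (z ^+ n).
  apply: (@ideal_gen_ind _ _ (fun z => exists n, I (z ^+ n))).
  - by exists 1%N; rewrite expr1; apply: ideal_0.
  - by move=> x y [m hm] [n hn']; exists (m + n)%N; apply: radD.
  - by move=> b x [n hx]; exists n; rewrite exprMn; apply: ideal_M.
  move=> x xs; have [b [n ->] Ib] := strongSAC_splitup (locmap_loc (powset x)) (hs x xs) ex h hn.
  by exists n.
have [|m hm] := rad (1 - a); first by rewrite -opprB; apply: ideal_N.
have := radD (a := a) (m := 1) Ia hm.
by rewrite addrC subrK expr1n.
Qed.

End Cover.

(** Pivoting leaves variables outside the smaller matrix, hence the free [N] and the embedding [e];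
    the flat map [psi] absorbs the localizations and substitutions made on the way. *)
Theorem strongSAC_determinantal s' t N (e : 'I_s'.+1 -> 'I_t -> 'I_N) (A : comNzRingType)
    (B R : comPzRingType) (psi : {rmorphism {mpoly A[N]} -> B}) (f : {rmorphism B -> R}) :
  (forall i j i' j', e i j = e i' j' -> i = i' /\ j = j') -> (s'.+1 <= t)%N -> (2 * s'.+1 <= t + 1)%N -> flat psi -> global_ci B ->
  (forall y, exists x, f x = y) ->
  (forall x, f x = 0 <-> ideal_span (dets (fun i j => psi 'X_(e i j))) x) -> strongSAC R.
Proof.
elim: s' t N e A B R psi f => [|s' IH] t N e A B R psi f e_inj st st2 fl cB surj ker.
  (* For [s = 1] the ideal is generated by variables, and the quotient is again a complete
     intersection. *)
  apply: global_ci_strongSAC; pose S := [seq e ord0 j | j : 'I_t].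
  have uS : uniq S by rewrite map_inj_uniq ?enum_uniq // => j l /e_inj [].
  apply: (global_ci_vars fl cB uS surj) => x; rewrite ker; split; apply: span_sub2 => y.
    move=> /mapP [g _ ->]; rewrite det_mx11 mxE; apply/ideal_span_mem/map_f/map_f.
    by apply/mapP; exists (g 0); rewrite ?mem_enum // (_ : 0 = ord0).
  move=> /mapP [_ /mapP [_ /mapP [j _ ->] ->] ->]; apply: ideal_span_mem.
  have := dets_mem (fun i j => psi 'X_(e i j)) (fun _ => j); rewrite det_mx11 mxE.
  by rewrite (_ : 0 = ord0).
case: t e st st2 e_inj ker => // t e st st2 e_inj ker.
pose X (ij : 'I_s'.+2 * 'I_t.+1) : R := f (psi 'X_(e ij.1 ij.2)).
apply: (@strongSAC_cover _ [seq X ij | ij : 'I_s'.+2 * 'I_t.+1]).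
  move=> _ /mapP [[i j] _ ->]; set T := powset _.
  have [g [gE gs gk]] := loc_quotient (locmap_loc T) surj ker; pose T' := premult f T.
  have loc' := locmap_loc T'.
  have cB' : global_ci (localization T') by exact: global_ci_loc loc' cB.
  pose psi1 : {rmorphism {mpoly A[N]} -> localization T'} := GRing.RMorphism.clone _ _ (locmap T' \o psi) _.
  have fl1 : flat psi1 by apply: flat_comp fl _; apply: loc_flat loc'.
  have [u hu] : exists u, psi1 'X_(e i j) * u = 1.
    by apply: (loc_unit loc'); exists 1%N; rewrite expr1.
  rewrite map_dets in gk.
  (* The pivot is inverted in the polynomial ring itself, because the Schur substitution divides by
     it. *)
  pose v : {mpoly A[N]} := 'X_(e i j); pose W := powset v.
  pose L := localization W; have locL : is_loc (locmap W) W := locmap_loc W.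
  have [w hw] : exists w, locmap W v * w = 1 by apply: (loc_unit locL); exists 1%N; rewrite expr1.
  have [|psi2 psi2E] := loc_lift (f := psi1) locL.
    move=> _ [k ->]; exists (u ^+ k); rewrite rmorphXn -exprMn hu expr1n. by [].
  have fl2 : flat psi2 by apply: flat_factor locL psi2E fl1.
  have ew : psi2 w = u.
    have : psi2 (locmap W v * w) = 1 by rewrite hw rmorph1.
    rewrite rmorphM psi2E => /(congr1 ( *%R u)); rewrite mulrA [u * _]mulrC hu mul1r mulr1. by [].
  (* The term subtracted in a Schur complement. It involves only the pivot row and column, which the
     substitutions fix, so those with opposite signs are mutually inverse. *)
  pose sh (k : 'I_N) : L := if posn e k is Some ab then
    (if (ab.1 != i) && (ab.2 != j) then locmap W 'X_(e ab.1 j) * w * locmap W 'X_(e i ab.2) else 0) else 0.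
  pose lc : {rmorphism A -> L} := GRing.RMorphism.clone _ _ (locmap W \o (@mpolyC N A)) _.
  have [si [siC siX]] := mpoly_eval_ex lc (fun k => locmap W 'X_k - sh k).
  have [ta [taC taX]] := mpoly_eval_ex lc (fun k => locmap W 'X_k + sh k).
  have shij a : sh (e a j) = 0 by rewrite /sh (posnE e_inj) /= eqxx andbF.
  have shi b : sh (e i b) = 0 by rewrite /sh (posnE e_inj) /= eqxx.
  have inv_si (rr : {rmorphism {mpoly A[N]} -> L}) : rr v = locmap W v ->
      exists rv : {rmorphism L -> L}, forall x, rv (locmap W x) = rr x.
    move=> hv; apply: (loc_lift (f := rr) locL) => _ [k ->]; exists (w ^+ k).
    by rewrite rmorphXn hv -exprMn hw expr1n.
  have [|sv svE] := inv_si si; first by rewrite siX shij subr0.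
  have [|tv tvE] := inv_si ta; first by rewrite taX shij addr0.
  have fixw (rv : {rmorphism L -> L}) : rv (locmap W v) = locmap W v -> rv w = w.
    move=> hv; have : rv (locmap W v * w) = 1 by rewrite hw rmorph1.
    rewrite rmorphM hv => /(congr1 ( *%R w)); rewrite mulrA [w * _]mulrC hw mul1r mulr1. by [].
  have fixsh (rv : {rmorphism L -> L}) : (forall a, rv (locmap W 'X_(e a j)) = locmap W 'X_(e a j)) ->
      (forall b, rv (locmap W 'X_(e i b)) = locmap W 'X_(e i b)) -> forall k, rv (sh k) = sh k.
    move=> h1 h2 k; rewrite /sh; case: posn => [[a b] /=|]; last by rewrite rmorph0.
    case: ifP => _; [rewrite !rmorphM h1 h2 fixw //; exact: h1 | by rewrite rmorph0].
  have svsh : forall k, sv (sh k) = sh k.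
    by apply: fixsh => a; rewrite svE siX; [rewrite shij subr0 | rewrite shi subr0].
  have tvsh : forall k, tv (sh k) = sh k.
    by apply: fixsh => a; rewrite tvE taX; [rewrite shij addr0 | rewrite shi addr0].
  have svtv : forall x, sv (tv x) = x.
    apply: (@loc_rmorph_eq _ _ _ (locmap W) W (GRing.RMorphism.clone _ _ (sv \o tv) _)
      (GRing.RMorphism.clone _ _ idfun _) locL) => x /=; rewrite tvE.
    apply: (@mpoly_rmorph_eq A N _ (GRing.RMorphism.clone _ _ (sv \o ta) _) (GRing.RMorphism.clone _ _ (locmap W) _)).
      by move=> a /=; rewrite taC /= svE siC.
    by move=> k /=; rewrite taX rmorphD svE siX svsh subrK.
  have tvsv : forall x, tv (sv x) = x.
    apply: (@loc_rmorph_eq _ _ _ (locmap W) W (GRing.RMorphism.clone _ _ (tv \o sv) _)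
      (GRing.RMorphism.clone _ _ idfun _) locL) => x /=; rewrite svE.
    apply: (@mpoly_rmorph_eq A N _ (GRing.RMorphism.clone _ _ (tv \o si) _) (GRing.RMorphism.clone _ _ (locmap W) _)).
      by move=> a /=; rewrite siC /= tvE taC.
    by move=> k /=; rewrite siX rmorphB tvE taX tvsh addrK.
  have flsv : flat sv.
    apply: loc_flat (iso_loc _ _) => [y|x hx]; first by exists (tv y).
    by rewrite -[x]tvsv hx rmorph0.
  pose psi' : {rmorphism {mpoly A[N]} -> localization T'} := GRing.RMorphism.clone _ _ (psi2 \o (sv \o locmap W)) _.
  have fl' : flat psi' by apply: flat_comp fl2; apply: flat_comp flsv; apply: loc_flat locL.
  pose e' (k : 'I_s'.+1) (l : 'I_t) := e (lift i k) (lift j l).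
  apply: (IH t N e' A (localization T') _ psi' g) => //.
  - move=> a b a' b' /e_inj [h1 h2]; split; [exact: lift_inj h1 | exact: lift_inj h2].
  - lia.
  move=> x; rewrite gk (dets_schur (X := fun a b => locmap T' (psi 'X_(e a b))) hu).
  suff -> : schur (fun a b => locmap T' (psi 'X_(e a b))) i j u = (fun k l => psi' 'X_(e' k l)) by [].
  apply/funext => k; apply/funext => l; rewrite /= svE siX rmorphB psi2E /sh (posnE e_inj) /=.
  by rewrite eq_sym neq_lift eq_sym neq_lift /= !rmorphM !psi2E ew.
(* The remaining piece of the cover: all entries now lie in the Jacobson radical. *)
set T := oneset _.
have [g [gE gs gk]] := loc_quotient (locmap_loc T) surj ker; pose T' := premult f T.
have loc' := locmap_loc T'.
have cB' : global_ci (localization T') by exact: global_ci_loc loc' cB.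
pose psi1 : {rmorphism {mpoly A[N]} -> localization T'} := GRing.RMorphism.clone _ _ (locmap T' \o psi) _.
have fl1 : flat psi1 by apply: flat_comp fl _; apply: loc_flat loc'.
rewrite map_dets in gk.
have tE : ((t.+1 - s'.+1) + s'.+1 = t.+1)%N by rewrite subnK // ltnW.
apply: (strongSAC_jac tE e_inj _ _ fl1 cB' _ gs gk) => //; first by lia.
(* With [a = b / t0] one has [1 + a x = (t0 + b x) / t0], and the numerator is still congruent to
   1. *)
move=> i j a; have [un den _] := loc'; have [b [t0 [Tt e0]]] := den a.
have [u hu] := un t0 Tt.
have [|z hz] := un (t0 + b * psi 'X_(e i j)).
  pose I := ideal_span [seq X ij | ij : 'I_s'.+2 * 'I_t.+1].
  change (I (f (t0 + b * psi 'X_(e i j)) - 1)).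
  rewrite rmorphD addrAC; apply: ideal_D; first exact: Tt.
  by rewrite rmorphM; apply/ideal_M/ideal_span_mem/mapP; exists (i, j); rewrite ?mem_enum.
exists (locmap T' t0 * z); rewrite rmorphD rmorphM /= in hz; rewrite /= -[RHS]hz.
have -> : locmap T' b = locmap T' t0 * a by rewrite -e0.
by ring.
Qed.

(** * Polynomial rings and global dimension *)

Section Cone.
Variables (R : comPzRingType) (P P' : cpx R) (c : forall i, 'M[R]_(dim P' i, dim P i)).
Hypotheses (exP : exactc P) (exP' : exactc P').
Hypothesis cE : forall i, dif P' i *m c i = c i.+1 *m dif P i.

Definition cone_dim i := if i is j.+1 then (dim P' j + dim P j.+1)%N else dim P 0.

Definition cone_dif i : 'M[R]_(cone_dim i.+1, cone_dim i) :=
  match i return 'M[R]_(cone_dim i.+1, cone_dim i) with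
  | 0 => col_mx (c 0) (dif P 0)
  | j.+1 => block_mx (- dif P' j) (c j.+1) 0 (dif P j.+1)
  end.

Definition cone : cpx R := Cpx cone_dif.

(** The condition is injectivity of the map induced on cokernels; the cone then resolves the
    cokernel of that map. *)
Lemma cone_exact : (forall a : 'rV_(dim P' 0), inrows (a *m c 0) (dif P 0) -> inrows a (dif P' 0)) ->
  exactc cone.
Proof.
move=> inj [|i]; split=> /=.
- rewrite mul_block_col mul0mx add0r mulNmx cE (exact_mul0 (exP 0)).
  by rewrite addNr col_mx0.
- move=> v; rewrite -[v]hsubmxK mul_row_col; set a := lsubmx v; set b := rsubmx v => e.
  have [w ew] : inrows a (dif P' 0).
    by apply: inj; exists (- b); rewrite mulNmx; apply/eqP; rewrite -addr_eq0 e.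
  have [z ez] : inrows (b + w *m c 1) (dif P 1).
    apply: exact_inrows (exP 0) _; rewrite mulmxDl -mulmxA -cE mulmxA -ew addrC.
    by rewrite e.
  exists (row_mx (- w) z); rewrite mul_row_block mulNmx mulmxN opprK -ew mulmx0 addr0.
  by rewrite mulNmx -ez addrC addrK.
- rewrite mulmx_block !mulmx0 !mul0mx !add0r mulmxN mulNmx opprK (exact_mul0 (exP' i)) addr0.
  rewrite mulNmx cE (exact_mul0 (exP _)) addNr.
  by rewrite block_mx0.
move=> v; rewrite -[v]hsubmxK mul_row_block; set a := lsubmx v; set b := rsubmx v.
rewrite mulmx0 addr0 mulmxN -[X in _ = X]row_mx0 => /eq_row_mx [/eqP]; rewrite oppr_eq0 => /eqP e1 e2.
have [w ew] : inrows a (dif P' i.+1) by apply: exact_inrows (exP' i) e1.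
have [z ez] : inrows (b + w *m c i.+2) (dif P i.+2).
  apply: exact_inrows (exP i.+1) _; rewrite mulmxDl -mulmxA -cE mulmxA -ew addrC.
  by rewrite e2.
exists (row_mx (- w) z); rewrite mul_row_block mulNmx mulmxN opprK -ew mulmx0 addr0.
by rewrite mulNmx -ez addrC addrK.
Qed.

Lemma cone_ext0 i e q (E : 'M[R]_(e, q)) : ext0 P i.+1 E -> ext0 P' i E -> ext0 cone i.+1 E.
Proof.
move=> hP hP' f /=; rewrite -[f]vsubmxK; set f1 := usubmx f; set f2 := dsubmx f.
rewrite mul_block_col mul0mx add0r => h.
have [W hW] := h; have [h1 h2] : inrows (- dif P' i.+1 *m f1 + c i.+2 *m f2) E /\ inrows (dif P i.+2 *m f2) E.
  split; first by exists (usubmx W); have := congr1 usubmx hW; rewrite col_mxKu -mul_usub_mx.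
  by exists (dsubmx W); have := congr1 dsubmx hW; rewrite col_mxKd -mul_dsub_mx.
have [g2 hg2] := hP _ h2.
have [|g1 hg1] := hP' (f1 - c i.+1 *m g2).
  have -> : dif P' i.+1 *m (f1 - c i.+1 *m g2) =
      c i.+2 *m (f2 - dif P i.+1 *m g2) - (- dif P' i.+1 *m f1 + c i.+2 *m f2).
    by rewrite !mulmxBr mulNmx mulmxA cE mulmxA; mxlin.
  by apply: inrowsD; [apply: inrowsM | apply: inrowsN].
exists (col_mx (- g1) g2); rewrite mul_block_col mul0mx add0r opp_col_mx add_col_mx.
have [W1 h3] : inrows (f1 - (- dif P' i *m - g1 + c i.+1 *m g2)) E.
  by have -> : f1 - (- dif P' i *m - g1 + c i.+1 *m g2) = f1 - c i.+1 *m g2 - dif P' i *m g1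
    by rewrite mulmxN mulNmx opprK; mxlin.
have [W2 h4] := hg2.
by exists (col_mx W1 W2); rewrite mul_col_mx -h3 -h4.
Qed.

End Cone.

(** * Global dimension of a polynomial ring in one variable *)

Section PolyRing.
Variable Q : comNzRingType.
Local Notation S := {poly Q}.

Definition crow m n k (X : 'M[S]_(m, n)) : 'M[Q]_(m, n) := \matrix_(i, j) (X i j)`_k.

Lemma crow_bound m n (X : 'M[S]_(m, n)) : exists K, forall i j, (size (X i j) <= K)%N.
Proof.
exists (\max_(ij : 'I_m * 'I_n) size (X ij.1 ij.2)) => i j.
exact: (leq_bigmax (i, j)).
Qed.

Lemma crowE m n K (X : 'M[S]_(m, n)) : (forall i j, (size (X i j) <= K)%N) ->
  X = \sum_(k < K) 'X^k *: map_mx polyC (crow k X).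
Proof.
move=> h; apply/matrixP => i j; rewrite summxE; apply/polyP => l; rewrite coef_sum.
have [lK|Kl] := ltnP l K.
  rewrite (bigD1 (Ordinal lK)) //= big1 ?addr0 => [|k kl]; rewrite !mxE coefXnM.
    by rewrite ltnn subnn coefC eqxx.
  rewrite coefC; case: ltnP => // kl'; rewrite subn_eq0 leqNgt ltn_neqAle kl' andbT.
  by rewrite (_ : (k : nat) != l) //; apply: contra kl => /eqP e; apply/eqP/val_inj.
rewrite nth_default ?(leq_trans (h i j)) // big1 // => k _.
rewrite !mxE coefXnM coefC; case: ltnP => // kl; rewrite subn_eq0 leqNgt (leq_trans (ltn_ord k)) //.
Qed.

Lemma crow_mul m n p k (X : 'M[S]_(m, n)) (D : 'M[Q]_(n, p)) : crow k (X *m map_mx polyC D) = crow k X *m D.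
Proof.
apply/matrixP => i j; rewrite !mxE coef_sum; apply: eq_bigr => l _.
by rewrite !mxE coefMC.
Qed.

Lemma flat_polyC : flat (GRing.RMorphism.clone _ _ (@polyC Q) _).
Proof.
move=> m n D v vD; have [K hK] := crow_bound v.
exists K, (\matrix_(k < K) crow k v).
  apply/row_matrixP => k; rewrite row_mul rowK -crow_mul row0.
  rewrite (_ : v *m _ = 0) //; by apply/matrixP => i j; rewrite !mxE coef0.
exists (\row_k 'X^k); rewrite {1}(crowE hK); apply/rowP => j; rewrite summxE !mxE.
by apply: eq_bigr => k _; rewrite !mxE.
Qed.

Hypothesis noethQ : noetherian Q.
Local Notation pc := (GRing.RMorphism.clone Q S (@polyC Q) _).

Section Module.
Variables (p m : nat) (D : 'M[S]_(p, m)) (n : nat).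
Hypothesis D_size : forall i j, (size (D i j) <= n.+1)%N.

(* Row vectors of degree at most [n], encoded by their coefficients. *)
Definition dec (x : 'M[Q]_(n.+1, m)) : 'rV[S]_m := \row_j \poly_(k < n.+1) x (inord k) j.

Lemma dec_coef x j (k : 'I_n.+1) : (dec x 0 j)`_k = x k j.
Proof. by rewrite mxE coef_poly ltn_ord inord_val. Qed.

Lemma dec_coef0 x j k : (n < k)%N -> (dec x 0 j)`_k = 0.
Proof. by move=> nk; rewrite mxE coef_poly ltnNge nk. Qed.

Lemma dec_eq (x : 'M[Q]_(n.+1, m)) (v : 'rV[S]_m) : (forall j (k : 'I_n.+1), x k j = (v 0 j)`_k) -> (forall j k, (n < k)%N -> (v 0 j)`_k = 0) ->
  dec x = v.
Proof.
move=> h1 h2; apply/rowP => j; apply/polyP => k; have [kn|kn] := ltnP k n.+1.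
  by rewrite -[k]/(val (Ordinal kn)) dec_coef h1.
by rewrite dec_coef0 ?h2.
Qed.

Lemma decD x y : dec (x + y) = dec x + dec y.
Proof.
apply: dec_eq => [j k|j k nk]; rewrite [(dec x + _) _ _]mxE coefD; first by rewrite !dec_coef mxE.
by rewrite !dec_coef0 // addr0.
Qed.

Lemma decZ a x : dec (a *: x) = a%:P *: dec x.
Proof.
apply: dec_eq => [j k|j k nk]; rewrite [(_ *: dec x) _ _]mxE coefCM; first by rewrite dec_coef mxE.
by rewrite dec_coef0 // mulr0.
Qed.

Lemma dec0 : dec 0 = 0.
Proof. by apply: dec_eq => [j k|j k nk]; rewrite ?mxE coef0. Qed.

Lemma dec_inj x : dec x = 0 -> x = 0.
Proof. by move=> h; apply/matrixP => k j; rewrite -dec_coef h !mxE coef0. Qed.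

Lemma dec_sum g (a : 'rV[Q]_g) (G : 'I_g -> 'M[Q]_(n.+1, m)) :
  dec (\sum_i a 0 i *: G i) = \sum_i (a 0 i)%:P *: dec (G i).
Proof.
rewrite (big_morph dec decD dec0); apply: eq_bigr => i _; exact: decZ.
Qed.

(* Multiplication by the variable, on the vectors of degree less than [n]. *)
Definition shiftc (x : 'M[Q]_(n.+1, m)) : 'M[Q]_(n.+1, m) :=
  \matrix_(k, j) (if k == 0 :> nat then 0 else x (inord k.-1) j).

Lemma dec_shift (x : 'M[Q]_(n.+1, m)) : (forall j, x ord_max j = 0) -> dec (shiftc x) = 'X *: dec x.
Proof.
move=> top; apply: dec_eq => [j k|j k nk]; rewrite [(_ *: dec x) _ _]mxE coefXM; last first.
  case: k nk => // k; rewrite ltnS leq_eqVlt => /orP[/eqP <-|nk] /=; last by rewrite dec_coef0.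
  by rewrite -[n]/(val (@ord_max n)) dec_coef.
rewrite mxE; case: eqP => // /eqP k0.
have lt : (k.-1 < n.+1)%N by apply: leq_ltn_trans (leq_pred k) (ltn_ord k).
rewrite -[k.-1 in RHS]/(val (Ordinal lt)) dec_coef; congr (x _ j).
by apply: val_inj; exact: inordK lt.
Qed.

Definition decm g (G : 'I_g -> 'M[Q]_(n.+1, m)) : 'M[S]_(g, m) := \matrix_(i, j) dec (G i) 0 j.

Lemma decm_row g G i : row i (@decm g G) = dec (G i).
Proof. by apply/rowP => j; rewrite !mxE. Qed.

Lemma decm_mul g G (a : 'rV[Q]_g) : map_mx polyC a *m decm G = dec (\sum_i a 0 i *: G i).
Proof.
rewrite mulmx_sum_row dec_sum; apply: eq_bigr => i _.
by rewrite decm_row !mxE.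
Qed.

Lemma coef_mulX (v : 'rV[S]_m) K j k : (('X^K *: v) 0 j)`_(K + k) = (v 0 j)`_k.
Proof. by rewrite mxE coefXnM ltnNge leq_addr addKn. Qed.

Lemma fg_matrix (P : submod 'M[Q]_(n.+1, m)) : exists g (G : 'I_g -> 'M[Q]_(n.+1, m)),
  (forall i, P (G i)) /\ forall x, P x -> exists a : 'rV_g, x = \sum_i a 0 i *: G i.
Proof.
have gen x : P x -> lspan (fun k : 'I_#|{: 'I_n.+1 * 'I_m}| => delta_mx (enum_val k).1 (enum_val k).2) x.
  move=> _; exists (fun k => x (enum_val k).1 (enum_val k).2).
  rewrite {1}[x]matrix_sum_delta pair_bigA /= (reindex (@enum_val _ {: 'I_n.+1 * 'I_m})) //=.
  exact: onW_bij (enum_val_bij _).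
have [g [G [PG hG]]] := noeth_fgsub noethQ gen; exists g, G; split=> // x /hG [a ->].
by exists (\row_i a i); apply: eq_bigr => i _; rewrite mxE.
Qed.

Lemma relations_matrix g (G : 'I_g -> 'M[Q]_(n.+1, m)) : exists r (Rl : 'M[Q]_(r, g)),
  forall a : 'rV[Q]_g, \sum_i a 0 i *: G i = 0 <-> inrows a Rl.
Proof.
have P0 : \sum_i (0 : 'rV[Q]_g) 0 i *: G i = 0 by rewrite big1 // => i _; rewrite mxE scale0r.
have PD (a b : 'rV[Q]_g) : \sum_i a 0 i *: G i = 0 -> \sum_i b 0 i *: G i = 0 -> \sum_i (a + b) 0 i *: G i = 0.
  move=> ea eb; transitivity (\sum_i a 0 i *: G i + \sum_i b 0 i *: G i); last by rewrite ea eb addr0.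
  by rewrite -big_split; apply: eq_bigr => i _; rewrite mxE scalerDl.
have PZ c (a : 'rV[Q]_g) : \sum_i a 0 i *: G i = 0 -> \sum_i (c *: a) 0 i *: G i = 0.
  move=> ea; transitivity (c *: \sum_i a 0 i *: G i); last by rewrite ea scaler0.
  by rewrite scaler_sumr; apply: eq_bigr => i _; rewrite mxE scalerA.
have [r [Rl h]] := noeth_rV noethQ (Submod P0 PD PZ).
by exists r, Rl => a; apply: h.
Qed.

Let Un (x : 'M[Q]_(n.+1, m)) : Prop := inrows (dec x) D.

Let Un0 : Un 0. Proof. by rewrite /Un dec0; apply: inrows0. Qed.
Let UnD x y : Un x -> Un y -> Un (x + y). Proof. by rewrite /Un decD; apply: inrowsD. Qed.
Let UnZ a x : Un x -> Un (a *: x). Proof. by rewrite /Un decZ; apply: inrowsZ. Qed.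

Let top (x : 'M[Q]_(n.+1, m)) : Prop := Un x /\ forall j, x ord_max j = 0.
Let top0 : top 0. Proof. by split=> // j; rewrite mxE. Qed.
Let topD x y : top x -> top y -> top (x + y).
Proof. by move=> [h1 h2] [h3 h4]; split=> [|j]; [exact: UnD | rewrite mxE h2 h4 addr0]. Qed.
Let topZ a x : top x -> top (a *: x).
Proof. by move=> [h1 h2]; split=> [|j]; [exact: UnZ | rewrite mxE h2 mulr0]. Qed.

(* The rows of [D] span [U]; with [U_k] the elements of degree at most [k], the sequence
   [0 -> S (x) U_(n-1) -> S (x) U_n -> U -> 0] is exact. *)
Lemma poly_presentation : exists g g' r r' (Gh : 'M[S]_(g, m)) (A B : 'M[Q]_(g', g))
    (Rl : 'M[Q]_(r, g)) (Rl' : 'M[Q]_(r', g')),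
  let c0 := 'X *: map_mx polyC A - map_mx polyC B in
  [/\ inrows D Gh /\ inrows Gh D, c0 *m Gh = 0, map_mx polyC Rl *m Gh = 0,
    inrows (Rl' *m A) Rl /\ inrows (Rl' *m B) Rl &
    (forall x : 'rV_g, x *m Gh = 0 -> inrows x (col_mx c0 (map_mx polyC Rl))) /\
    (forall a : 'rV_g', inrows (a *m c0) (map_mx polyC Rl) -> inrows a (map_mx polyC Rl'))].
Proof.
have [g [G [UG hG]]] := fg_matrix (Submod Un0 UnD UnZ).
have [g' [G' [UG' hG']]] := fg_matrix (Submod top0 topD topZ).
have [r [Rl hR]] := relations_matrix G; have [r' [Rl' hR']] := relations_matrix G'.
have [A hA] : exists A : 'M[Q]_(g', g), forall i, G' i = \sum_j A i j *: G j.
  have [A hA] := @row_choice Q g' g (fun i w => G' i = \sum_j w 0 j *: G j) (fun i => hG _ (UG' i).1).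
  by exists A => i; rewrite hA; apply: eq_bigr => j _; rewrite mxE.
have [B hB] : exists B : 'M[Q]_(g', g), forall i, shiftc (G' i) = \sum_j B i j *: G j.
  have h i : exists w : 'rV_g, shiftc (G' i) = \sum_j w 0 j *: G j.
    by apply: hG; rewrite /= /Un dec_shift; [apply: inrowsZ; exact: (UG' i).1 | exact: (UG' i).2].
  have [B hB] := @row_choice Q g' g (fun i w => shiftc (G' i) = \sum_j w 0 j *: G j) h.
  by exists B => i; rewrite hB; apply: eq_bigr => j _; rewrite mxE.
pose Gh := decm G; exists g, g', r, r', Gh, A, B, Rl, Rl'.
have comb q (a : 'rV[Q]_q) (C : 'M[Q]_(q, g)) (H : 'I_q -> 'M[Q]_(n.+1, m)) :
    (forall i, H i = \sum_j C i j *: G j) -> \sum_j (a *m C) 0 j *: G j = \sum_i a 0 i *: H i.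
  move=> hC; under [RHS]eq_bigr => i _ do rewrite hC scaler_sumr.
  rewrite exchange_big; apply: eq_bigr => j _; rewrite mxE scaler_suml.
  by apply: eq_bigr => i _; rewrite scalerA.
have shift_sum (a : 'rV[Q]_g') : shiftc (\sum_i a 0 i *: G' i) = \sum_i a 0 i *: shiftc (G' i).
  apply/matrixP => k j; rewrite mxE !summxE; case: eqP => [k0|k0].
    by rewrite big1 // => i _; rewrite !mxE k0 eqxx mulr0.
  by apply: eq_bigr => i _; rewrite !mxE; case: eqP k0.
have topsum (a : 'rV[Q]_g') j : (\sum_i a 0 i *: G' i) ord_max j = 0.
  by rewrite summxE big1 // => i _; rewrite mxE (UG' i).2 mulr0.
have AG (a : 'rV[Q]_g') : map_mx polyC (a *m A) *m Gh = dec (\sum_i a 0 i *: G' i).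
  by rewrite decm_mul (comb _ _ _ _ hA).
have BG (a : 'rV[Q]_g') : map_mx polyC (a *m B) *m Gh = 'X *: dec (\sum_i a 0 i *: G' i).
  by rewrite decm_mul (comb _ _ _ _ hB) -shift_sum dec_shift.
have c0Gh : ('X *: map_mx polyC A - map_mx polyC B) *m Gh = 0.
  rewrite mulmxBl -scalemxAl; apply/row_matrixP => i; rewrite raddfB /= row0 linearZ /= !row_mul.
  by rewrite -!map_row !rowE AG BG subrr.
have RGh (a : 'rV[Q]_g) : map_mx polyC a *m Gh = 0 <-> inrows a Rl.
  by rewrite decm_mul -hR; split=> [/dec_inj//|->]; rewrite dec0.
have RlGh : map_mx polyC Rl *m Gh = 0.
  apply/row_matrixP => i; rewrite row_mul -map_row row0; apply/RGh/inrows_row/inrows_refl.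
split=> //=.
- split; apply: inrowsP => i; last by rewrite decm_row; apply: UG.
  have [a ea] : exists a : 'rV_g, dec (\matrix_(k, j) (D i j)`_k) = map_mx polyC a *m Gh.
    have eD : dec (\matrix_(k, j) (D i j)`_k) = row i D.
      apply: dec_eq => [j k|j k nk]; rewrite !mxE //.
      by rewrite nth_default // (leq_trans (D_size i j)).
    have [|a ->] := hG (\matrix_(k, j) (D i j)`_k).
      by rewrite /= /Un eD; apply/inrows_row/inrows_refl.
    by exists a; rewrite decm_mul.
  have eD : dec (\matrix_(k, j) (D i j)`_k) = row i D.
    apply: dec_eq => [j k|j k nk]; rewrite !mxE //.
    by rewrite nth_default // (leq_trans (D_size i j)).
  by rewrite -eD ea; apply: inrows_mul.
- have Rl0 i : \sum_j (row i Rl') 0 j *: G' j = 0 by apply/hR'/inrows_row/inrows_refl.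
  split; apply: inrowsP => i; rewrite row_mul; apply/RGh.
    by rewrite AG Rl0 dec0.
  by rewrite BG Rl0 dec0 scaler0.
split.
(* The kernel of [Gh], by induction on the degree of [x]: the top coefficient represents a vector
   without leading term, so a multiple of [c0] can be subtracted to lower the degree. *)
- suff claim K (x : 'rV[S]_g) : (forall i j, (size (x i j) <= K)%N) -> x *m Gh = 0 ->
      inrows x (col_mx ('X *: map_mx polyC A - map_mx polyC B) (map_mx polyC Rl)).
    by move=> x xG; have [K hK] := crow_bound x; apply: claim hK xG.
  have Rin (a : 'rV[Q]_g) : inrows a Rl -> inrows (map_mx polyC a)
      (col_mx ('X *: map_mx polyC A - map_mx polyC B) (map_mx polyC Rl)).
    move=> [w ->]; exists (row_mx 0 (map_mx polyC w)).
    by rewrite mul_row_col mul0mx add0r map_mxM.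
  elim: K x => [|K IH] x hx xG.
    have -> : x = 0 by apply/matrixP => i j; rewrite !mxE; apply/eqP; rewrite -size_poly_eq0 -leqn0.
    exact: inrows0.
  case: K IH hx => [|K] IH hx.
    have ex : x = map_mx polyC (crow 0 x).
      by rewrite {1}(crowE hx) big_ord1 expr0 scale1r.
    by rewrite ex; apply/Rin/RGh; rewrite -ex.
  pose xK := crow K.+1 x.
  have topK j : (\sum_i xK 0 i *: G i) ord_max j = 0.
    have := congr1 (fun v : 'rV[S]_m => (v 0 j)`_(K.+1 + n)) xG; rewrite [x](crowE hx) big_ord_recr /=.
    rewrite mulmxDl -scalemxAl decm_mul addmxE coefD coef_mulX zeromxE coef0.
    rewrite (dec_coef _ j ord_max).
    rewrite mulmx_suml summxE coef_sum big1 ?add0r // => k _.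
    rewrite -scalemxAl decm_mul mxE coefXnM ifN ?dec_coef0 //; [have := ltn_ord k; lia|].
    by have := ltn_ord k; lia.
  have [|y ey] := hG' (\sum_i xK 0 i *: G i).
    split=> //; rewrite /Un -decm_mul; apply: inrowsM; apply: inrowsP => i; rewrite decm_row; apply: UG.
  have hxy : inrows (xK - y *m A) Rl.
    apply/RGh; rewrite map_mxB mulmxBl AG -ey decm_mul subrr. by [].
  pose x' : 'rV[S]_g := \sum_(k < K.+1) 'X^k *: map_mx polyC (crow k x) + 'X^K *: map_mx polyC (y *m B).
  have exx : x = 'X^K *: (map_mx polyC y *m ('X *: map_mx polyC A - map_mx polyC B)) +
      'X^(K.+1) *: map_mx polyC (xK - y *m A) + x'.
    rewrite {1}(crowE hx) big_ord_recr /= -/xK /x' mulmxBr -scalemxAr map_mxB !map_mxM.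
    rewrite !scalerBr scalerA -exprSr; mxlin.
  rewrite exx; apply: inrowsD; first apply: inrowsD.
  - apply: inrowsZ; exists (row_mx (map_mx polyC y) 0); by rewrite mul_row_col mul0mx addr0.
  - by apply/inrowsZ/Rin.
  apply: IH.
    move=> i j; rewrite mxE; apply: leq_trans (size_polyD _ _) _; rewrite geq_max; apply/andP; split.
      rewrite summxE; apply: (big_ind (fun q : S => size q <= K.+1)%N) => [|q1 q2 h1 h2|k _].
      - by rewrite size_poly0.
      - by apply: leq_trans (size_polyD _ _) _; rewrite geq_max h1.
      - rewrite !mxE; apply: leq_trans (size_polyMleq _ _) _; rewrite size_polyXn.
        by have := size_polyC_leq1 (x i j)`_k; have := ltn_ord k; move: (size _) => z; lia.
    rewrite !mxE; apply: leq_trans (size_polyMleq _ _) _; rewrite size_polyXn.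
    have h : (size (\sum_j0 y i j0 * B j0 j)%:P <= 1)%N by exact: size_polyC_leq1.
    by move: h; set z := size _; lia.
  have := xG; rewrite {1}exx !mulmxDl -scalemxAl -mulmxA c0Gh mulmx0 scaler0 add0r -scalemxAl.
  by have /RGh -> := hxy; rewrite scaler0 add0r.
(* Injectivity: the vector attached to [crow k a] is the shift of the one attached to [crow k.+1 a],
   and these vanish for large [k], hence for all. *)
move=> a [w hw].
have z0 k : \sum_i (crow k a) 0 i *: G' i = 0 -> inrows (crow k a) Rl' by move/hR'.
suff all0 : forall k, \sum_i (crow k a) 0 i *: G' i = 0.
  have [K hK] := crow_bound a; rewrite (crowE hK).
  apply: (big_ind (fun v => inrows v (map_mx polyC Rl'))) => [|v1 v2 h1 h2|k _]; first exact: inrows0.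
    exact: inrowsD.
  by apply: inrowsZ; have [v ->] := z0 k (all0 k); exists (map_mx polyC v); rewrite map_mxM.
have step k : \sum_i (crow k a) 0 i *: G' i = shiftc (\sum_i (crow k.+1 a) 0 i *: G' i).
  have /hR : inrows (crow k.+1 (a *m ('X *: map_mx polyC A - map_mx polyC B))) Rl.
    by rewrite hw crow_mul; apply: inrows_mul.
  have -> : crow k.+1 (a *m ('X *: map_mx polyC A - map_mx polyC B)) = crow k a *m A - crow k.+1 a *m B.
    rewrite -!crow_mul mulmxBr -scalemxAr; apply/matrixP => i j; rewrite !mxE coefB; congr (_ - _).
    by rewrite coefXM.
  move=> e; apply/eqP; rewrite -subr_eq0 -(comb _ _ _ _ hA) shift_sum -(comb _ _ _ _ hB) -sumrB -[X in _ == X]e.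
  by apply/eqP; apply: eq_bigr => i _; rewrite addmxE oppmxE scalerBl.
have [K hK] := crow_bound a.
have shift0 : shiftc 0 = 0 by apply/matrixP => i j; rewrite !mxE; case: eqP.
have big k : (K <= k)%N -> \sum_i (crow k a) 0 i *: G' i = 0.
  move=> Kk; rewrite big1 // => i _; rewrite mxE nth_default ?scale0r //.
  exact: leq_trans (hK _ _) Kk.
suff down : forall d, \sum_i (crow (K - d) a) 0 i *: G' i = 0.
  by move=> k; have [kK|/ltnW Kk] := leqP k K; [rewrite -(subKn kK) | exact: big Kk].
elim=> [|d IH]; first by rewrite subn0 big.
have [lt|ge] := ltnP d K; last by have := IH; rewrite (eqP (ge : (K - d == 0)%N)) (eqP (leqW ge : (K - d.+1 == 0)%N)).
rewrite step; have -> : (K - d.+1).+1 = (K - d)%N by lia.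
by rewrite IH shift0.
Qed.

End Module.

(** The row space of [d_0] is resolved by a cone over two extended complexes that split from [d] on:
    one degree is spent on the cone, one on passing to the syzygy. *)
Lemma gldim_poly d : gldim_le Q d -> gldim_le S d.+2.
Proof.
move=> gd C exC.
have [n hn] := crow_bound (dif C 0).
have [|g [g' [r [r' [Gh [A [B [Rl [Rl' /= [[DG GD] cG RG [RA RB] [ker inj]]]]]]]]]]] :=
  @poly_presentation _ _ (dif C 0) n; first by move=> i j; apply: leqW.
pose P := mapc pc (resol noethQ Rl); pose P' := mapc pc (resol noethQ Rl').
have exP : exactc P by apply: flat_exactc flat_polyC _; apply: resol_exact.
have exP' : exactc P' by apply: flat_exactc flat_polyC _; apply: resol_exact.
pose c0 : 'M[S]_(dim P' 0, dim P 0) := 'X *: map_mx polyC A - map_mx polyC B.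
have h0 : inrows (dif P' 0 *m c0) (dif P 0).
  rewrite /c0 mulmxBr -scalemxAr /= -!map_mxM; have [w1 ->] := RA; have [w2 ->] := RB.
  apply: inrowsD; first apply: inrowsZ; last apply: inrowsN; rewrite map_mxM; exact: inrows_mul.
have [c [c0E cE]] := chain_lift exP (fun i => (exP' i).1) h0.
pose T := cone c.
have exT : exactc T by apply: cone_exact => // a; rewrite c0E; apply: inj.
have [u0 hu] := DG; have [v0 hv] := GD.
have spl (M : cpx Q) : exactc M -> forall i e q (E : 'M[S]_(e, q)), (d <= i)%N -> ext0 (mapc pc M) i E.
  move=> exM i e q E di; apply: (split_ext0 (flat_exactc flat_polyC exM) _ di).
  by have [F hF] := gd M exM; exists (map_mx polyC F); rewrite /= -!map_mxM hF.
have dT : dif T 0 *m Gh = 0 by rewrite /= mul_col_mx c0E cG RG col_mx0.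
have kT (x : 'rV[S]_g) : x *m Gh = 0 -> inrows x (dif T 0) by move=> ex; have := ker x ex; rewrite /= c0E.
have kT' q (x : 'M[S]_(q, g)) : x *m Gh = 0 -> inrows x (dif T 0).
  move=> e; apply: inrowsP => i; apply: kT; by rewrite -row_mul e row0.
apply: (@ext0_split _ (shift C) d.+1); first exact: exact_shift.
apply: (@ext0_compare _ (shift C) T (u0 : 'M_(dim (shift C) 0, dim T 0)) v0) => //; first exact: exact_shift.
- by apply: kT'; rewrite -mulmxA -hu (exact_mul0 (exC 0)).
- by apply: exact_inrows (exC 0) _; rewrite -mulmxA -hv.
- by apply: exact_inrows (exC 0) _; rewrite mulmxBl mul1mx -mulmxA -hv -hu subrr.
by apply: cone_ext0 => //; apply: spl => //; apply: resol_exact.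
Qed.

End PolyRing.

(** * The principal ideal theorem *)

Section PrincipalIdeal.
Variable R : comPzRingType.
Hypothesis noethR : noetherian R.
Implicit Types (I J : ideal R).

Lemma ideal_fg (P : submod R^o) : fgsub P.
Proof.
apply: (noeth_fgsub noethR (g := fun _ : 'I_1 => (1 : R^o))) => x _.
by exists (fun=> x); rewrite big_ord1; apply: esym; apply: mulr1.
Qed.

Definition adjoin I (x : R) : ideal R.
Proof.
apply: (@Ideal R (fun z => exists a q, I q /\ z = a * x + q)).
- by exists 0, 0; split; [apply: ideal_0 | rewrite mul0r addr0].
- move=> z w [a [b [Ib ->]]] [c [d [Id ->]]]; exists (a + c), (b + d).
  by split; [exact: ideal_D | rewrite mulrDl addrACA].
- move=> c z [a [b [Ib ->]]]; exists (c * a), (c * b).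
  by split; [exact: ideal_M | rewrite mulrDr mulrA].
Defined.

Lemma adjoin_l I (x z : R) : I z -> adjoin I x z.
Proof. by exists 0, z; rewrite mul0r add0r. Qed.

Lemma adjoin_r I (x a : R) : adjoin I x (a * x).
Proof. by exists a, 0; rewrite addr0; split=> //; apply: ideal_0. Qed.

Lemma adjoin_gen I (x : R) : adjoin I x x.
Proof. by have := adjoin_r I x 1; rewrite mul1r. Qed.

Lemma adjoin_sub I (x : R) J : ideal_sub I J -> J x -> ideal_sub (adjoin I x) J.
Proof. by move=> IJ Jx z [a [q [/IJ Jq ->]]]; apply: ideal_D => //; apply: ideal_M. Qed.

(* An ideal maximal among those containing no [c * p^k] with [c] outside [p] is prime. *)
Lemma prime_between (p : ideal R) I : prime_ideal p ->
  (exists c k, ~ p c /\ forall a, prods p k a -> I (c * a)) \/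
  exists q : ideal R, [/\ prime_ideal q, ideal_sub I q, ideal_sub q p & ~ ideal_sub p q].
Proof.
move=> pp; pose good J := exists c k, ~ p c /\ forall a, prods p k a -> J (c * a).
have [|bad] := pselect (good I); [by left | right].
have [J [badJ IJ maxJ]] := noeth_max noethR (Q := fun J => ~ good J) bad.
have goodP z : ~ J z -> good (adjoin J z).
  move=> nJ; apply: contrapT => h; apply: nJ; apply: (maxJ _ h); first by move=> w; apply: adjoin_l.
  by have := adjoin_r J z 1; rewrite mul1r.
exists J; split=> //.
- split=> [J1|x y Jxy].
    apply: badJ; exists 1, 0%N; split=> [|a _]; first by case: pp.
    by rewrite mul1r -[a]mulr1; apply: ideal_M.
  have [|nx] := pselect (J x); [by left | right]; apply: contrapT => ny.
  have [c [k [nc hc]]] := goodP _ nx; have [d [l [nd hd]]] := goodP _ ny.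
  apply: badJ; exists (c * d), (k + l)%N; split; first exact: npM pp _ _ nc nd.
  move=> a ha; have [a1 [a2 [h1 h2 ->]]] := prods_split ha.
  have -> : c * d * (a1 * a2) = (c * a1) * (d * a2) by ring.
  have [s [j [Jj ->]]] := hc _ h1; have [s' [j' [Jj' ->]]] := hd _ h2.
  have -> : (s * x + j) * (s' * y + j') = s * s' * (x * y) + (s * x + j) * j' + s' * y * j by ring.
  by apply: ideal_D; [apply: ideal_D|]; apply: ideal_M.
- move=> z Jz; apply: contrapT => nz; apply: badJ; exists z, 0%N; split=> // a _.
  by rewrite mulrC; apply: ideal_M.
- move=> pJ; apply: badJ; exists 1, 1%N; split=> [|a [[|b [|? ?]] // _ [hb ->]]]; first by case: pp.
  by rewrite big_seq1 mul1r; apply/pJ/hb; rewrite mem_head.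
Qed.

Definition icolon I (b : R) : ideal R.
Proof.
apply: (@Ideal R (fun t => I (t * b))); first by rewrite mul0r; apply: ideal_0.
  by move=> x y hx hy; rewrite mulrDl; apply: ideal_D.
by move=> x y hy; rewrite -mulrA; apply: ideal_M.
Defined.

Definition sm I : submod R^o := @Submod R R^o I (@ideal_0 _ I) (@ideal_D _ I) (@ideal_M _ I).

Section Krull.
Variables (p0 p1 p2 : ideal R) (x : R).
Hypotheses (pr0 : prime_ideal p0) (pr1 : prime_ideal p1) (pr2 : prime_ideal p2).
Hypotheses (s01 : ideal_sub p0 p1) (s12 : ideal_sub p1 p2) (ns01 : ~ ideal_sub p1 p0).
Hypotheses (p2x : p2 x) (np1x : ~ p1 x).

Lemma prime_pow (p : ideal R) (z : R) k : prime_ideal p -> ~ p z -> ~ p (z ^+ k).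
Proof.
move=> pp nz; elim: k => [|k IH]; first by rewrite expr0; case: pp.
by rewrite exprS; apply: npM.
Qed.

Lemma prods_pow c k n a : (forall a, prods p2 k a -> adjoin p0 x (c * a)) -> prods p2 (n * k) a ->
  adjoin p0 (x ^+ n) (c ^+ n * a).
Proof.
move=> h; elim: n a => [|n IH] a.
  by move=> _; rewrite !expr0 mul1r -[a]mulr1; apply: adjoin_r.
rewrite mulSn => /prods_split [a1 [a2 [h1 h2 ->]]].
have [s [j [Jj e1]]] := h _ h1; have [s' [j' [Jj' e2]]] := IH _ h2.
have -> : c ^+ n.+1 * (a1 * a2) = (c * a1) * (c ^+ n * a2) by rewrite exprS; ring.
rewrite e1 e2; exists (s * s'), ((s * x + j) * j' + s' * x ^+ n * j); split.
  by apply: ideal_D; apply: ideal_M.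
by rewrite exprS; ring.
Qed.

(* Kaplansky's proof of the principal ideal theorem, by counting lengths. *)
Lemma krull_pit c k : ~ p2 c -> (forall a, prods p2 k a -> adjoin p0 x (c * a)) -> False.
Proof.
move=> nc hck.
have [y p1y np0y] : exists2 y, p1 y & ~ p0 y.
  by apply: contrapT => h; apply: ns01 => y p1y; apply: contrapT => ny; apply: h; exists y.
pose Y := adjoin p0 y.
(* The ideals [(Y : x^n)] stabilize at [n0]; for [u = x^(n0 + 1)] this yields
   [(Y : u^2) = (Y : u)]. *)
pose colon n := icolon Y (x ^+ n).
have [_ [[n0 ->] _ maxn]] := noeth_max noethR (Q := fun J => exists n, J = colon n) (ex_intro _ 0%N (erefl (colon 0%N))).
have stable n t : Y (t * x ^+ (n0 + n)) -> Y (t * x ^+ n0).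
  move=> h; apply: (maxn (colon (n0 + n)%N)) => //; first by exists (n0 + n)%N.
  by move=> z hz; change (Y (z * x ^+ (n0 + n))); rewrite exprD mulrA; apply: ideal_Mr.
pose u := x ^+ n0.+1.
have np1u : ~ p1 u by apply: prime_pow.
have np0u : ~ p0 u by move=> h; apply/np1u/s01.
have cancel (p : ideal R) z w : prime_ideal p -> ~ p z -> p (z * w) -> p w by move=> [_ pp] nz /pp [].
have uy t : Y (t * (u * u)) -> Y (t * u).
  rewrite -exprD => h; have -> : t * u = x * (t * x ^+ n0) by rewrite /u exprS; ring.
  apply: ideal_M; apply: (stable (n0.+2)); move: h; congr (Y (t * x ^+ _)); lia.
pose U := adjoin p0 (u * u); pose B := adjoin p0 u; pose W := adjoin B y.
pose Z := adjoin U (u * y); pose W' := adjoin U y.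
have UB : ideal_sub U B by apply: adjoin_sub; [move=> z; apply: adjoin_l | apply: adjoin_r].
have BW : ideal_sub B W by move=> z; apply: adjoin_l.
have W'W : ideal_sub W' W.
  by apply: adjoin_sub; [move=> z /UB /BW | exact: adjoin_gen].
have UW' : ideal_sub U W' by move=> z; apply: adjoin_l.
have [L [Lge Lle]] : exists L, lenge p2 L (sm U) (sm W) /\ lenle p2 L (sm U) (sm W).
  have UW : sub_le (sm U) (sm W) by move=> z /UB /BW.
  have [||m hm] := len_finite (k := (n0.+1 + n0.+1) * k) (c := c ^+ (n0.+1 + n0.+1)) pr2 ideal_fg UW.
  - exact: prime_pow.
  - move=> a w ha _; change (U (c ^+ (n0.+1 + n0.+1) * a * w)); apply: ideal_Mr.
    by have := prods_pow hck ha; rewrite exprD.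
  exact: len_exact UW hm.
(* Multiplication by [u] carries chains of [W / B] into [Z / U], and [u t -> y t] carries chains of
   [B / U] into [W' / Z], strictness being the content of [uy]; so [W' / U] is at least as long as
   [W / U]. *)
have key : lenge p2 L (sm U) (sm W').
  have [a [b [la lb Lab]]] := lenge_split pr2 (UB : sub_le (sm U) (sm B)) (BW : sub_le (sm B) (sm W)) Lge.
  apply: (lenge_le Lab); rewrite addnC.
  pose Fp (M : submod R^o) (z : R^o) := exists m q, [/\ M m, p0 q & z = u * m + q].
  have F0 M : Fp M 0 by exists 0, 0; split; [apply: sub_0 | apply: ideal_0 | rewrite mulr0 addr0].
  have FD M z z' : Fp M z -> Fp M z' -> Fp M (z + z').
    move=> [m [q [Mm p0q ->]]] [m' [q' [Mm' p0q' ->]]]; exists (m + m'), (q + q').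
    by split; [apply: sub_D | apply: ideal_D | rewrite mulrDr addrACA].
  have FZ M r z : Fp M z -> Fp M (r *: z).
    move=> [m [q [Mm p0q ->]]]; exists (r *: m), (r * q); split; [exact: sub_Z | exact: ideal_M |].
    by rewrite -[r *: m]/(r * m) -[LHS]/(r * (u * m + q)); ring.
  pose F M := Submod (F0 M) (FD M) (FZ M).
  pose Gp (M : submod R^o) (z : R^o) := exists t w, [/\ M (u * t), Z w & z = y * t + w].
  have G0 M : Gp M 0.
    by exists 0, 0; split; [rewrite mulr0; apply: sub_0 | apply: ideal_0 | rewrite mulr0 addr0].
  have GD M z z' : Gp M z -> Gp M z' -> Gp M (z + z').
    move=> [m [q [Mm p0q ->]]] [m' [q' [Mm' p0q' ->]]]; exists (m + m'), (q + q').
    by split; [rewrite mulrDr; apply: sub_D | apply: ideal_D | rewrite mulrDr addrACA].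
  have GZ M r z : Gp M z -> Gp M (r *: z).
    move=> [m [q [Mm p0q ->]]]; exists (r * m), (r * q); split; [|exact: ideal_M |].
      by rewrite mulrCA; apply: (@sub_Z _ _ M r).
    by rewrite -[LHS]/(r * (y * m + q)); ring.
  pose G M := Submod (G0 M) (GD M) (GZ M).
  have hF : lenge p2 b (F (sm B)) (F (sm W)).
    apply: lenge_map lb => M M' BM MM' M'W; first by move=> _ [m [q [/MM' Mm p0q ->]]]; exists m, q.
    move=> [w M'w hw]; exists (u * w); first by exists w, 0; rewrite addr0; split=> //; apply: ideal_0.
    move=> s ns [m [q [Mm p0q e]]]; apply: (hw s ns).
    have : p0 (s * w - m).
      apply: (cancel p0 u) => //; have -> : u * (s * w - m) = q; last by [].
      by change (s * (u * w) = u * m + q) in e; rewrite mulrBr mulrCA e addrAC subrr add0r.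
    move=> /(@adjoin_l _ u) /BM h; have := sub_D h Mm; rewrite subrK. by [].
  have hG : lenge p2 a (G (sm U)) (G (sm B)).
    apply: lenge_map la => M M' UM MM' M'B; first by move=> _ [m [q [/MM' Mm p0q ->]]]; exists m, q.
    move=> [w M'w hw]; have [t [q [p0q ew]]] := M'B _ M'w.
    have p0M z : p0 z -> M z by move=> h; apply/UM/adjoin_l.
    have M'ut : M' (u * t).
      have := sub_B M'w (MM' _ (p0M _ p0q)); rewrite ew addrK mulrC. by [].
    exists (y * t); first by exists t, 0; rewrite addr0; split=> //; apply: ideal_0.
    move=> s ns [t' [z [Mt' [al [z' [[be [q' [p0q' ez']]] ez]]] e]]].
    apply: (hw s ns); change (s * (y * t) = y * t' + z) in e; rewrite ez ez' in e.
    have [ga [q2 [p0q2 e2]]] : Y (be * u).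
      apply: uy; exists (s * t - t' - al * u), (- q'); split; first exact: ideal_N.
      have -> : be * (u * u) = s * (y * t) - y * t' - al * (u * y) - q' by rewrite e; ring.
      ring.
    have h3 : p0 (s * t - t' - al * u - ga * u).
      apply: (cancel p0 y) => //.
      have -> : y * (s * t - t' - al * u - ga * u) = q2 * u + q'; last first.
        by apply: ideal_D => //; apply: ideal_Mr.
      have -> : y * (s * t - t' - al * u - ga * u) = s * (y * t) - y * t' - al * (u * y) - ga * y * u by ring.
      have -> : ga * y = be * u - q2 by rewrite e2 addrK.
      by rewrite e; ring.
    have -> : s *: w = u * t' + ((al + ga) * (u * u) + (u * (s * t - t' - al * u - ga * u) + s * q)).
      by rewrite -[LHS]/(s * w) ew; ring.
    apply: sub_D => //; apply: UM; exists (al + ga), (u * (s * t - t' - al * u - ga * u) + s * q).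
    by split=> //; apply: ideal_D; apply: ideal_M.
  apply: (lenge_cat (B := sm Z)).
    apply: (lenge_monol (U := F (sm B))); last apply: (lenge_monor (W := F (sm W))) hF.
      move=> z [al [q [p0q ->]]]; exists (al * u), q; split=> //; first exact: adjoin_r.
      ring.
    move=> _ [m [q [[be [m' [[al [q' [p0q' ->]]] ->]]] p0q ->]]].
    exists be, (al * (u * u) + (u * q' + q)); split; last by ring.
    by exists al, (u * q' + q); split=> //; apply: ideal_D => //; apply: ideal_M.
  apply: (lenge_monol (U := G (sm U))); last apply: (lenge_monor (W := G (sm B))) hG.
    by move=> z Zz; exists 0, z; rewrite !mulr0 add0r; split=> //; apply: ideal_0.
  move=> _ [t [w [_ [be [w' [Uw' ->]]] ->]]]; exists (t + be * u), w'; split=> //; ring.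
(* Thus [W'] and [W] agree at [p2]. If [s u] lay in [(p0, u^2, y)] with [s] outside [p2], then
   [u (s - ga u)] would be in [p1], and [s] in [p2]. *)
have : ~ pstrict p2 (sm W') (sm W).
  move=> st; apply: Lle; rewrite -addn1; apply: lenge_cat key _; exact: lenge1.
apply; exists u; first by apply: BW; exact: adjoin_gen.
move=> s ns [de [q [[ga [q' [p0q' eq]]] e]]]; apply: ns.
have e' : u * (s - ga * u) = de * y + q'.
  by change (s * u = de * y + q) in e; rewrite mulrBr [u * s]mulrC e eq; ring.
have /s12 h : p1 (s - ga * u).
  apply: (cancel p1 u) => //; rewrite e'; apply: ideal_D; [exact: ideal_M | exact: s01].
rewrite -[s](subrK (ga * u)); apply: ideal_D => //; apply: ideal_M.
by rewrite /u exprS; apply: ideal_Mr.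
Qed.

End Krull.

(** [krull_pit] excludes that a power of [p2] lies in [(p0, x)] up to a factor outside [p2], so
    [prime_between] produces an intermediate prime. *)
Lemma prime_through (p0 p1 p2 : ideal R) (x : R) : prime_ideal p0 -> prime_ideal p1 -> prime_ideal p2 ->
  ideal_sub p0 p1 -> ~ ideal_sub p1 p0 -> ideal_sub p1 p2 -> ~ ideal_sub p2 p1 -> p2 x ->
  exists q : ideal R, [/\ prime_ideal q, ideal_sub p0 q, ~ ideal_sub q p0, ideal_sub q p2 & ~ ideal_sub p2 q /\ q x].
Proof.
move=> pr0 pr1 pr2 s01 ns01 s12 ns12 p2x.
have [p1x|np1x] := pselect (p1 x); first by exists p1.
have [[c [k [nc hck]]]|[q [prq Iq qp2 np2q]]] := prime_between (adjoin p0 x) pr2.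
  by case: (krull_pit pr0 pr1 pr2 s01 s12 ns01 p2x np1x nc hck).
have qx : q x by apply: Iq; exact: adjoin_gen.
exists q; split=> //; first by move=> z p0z; apply/Iq/adjoin_l.
by move=> qp0; apply/np1x/s01/qp0.
Qed.

Fixpoint pchain k (p q : ideal R) : Prop :=
  if k is k'.+1 then exists r : ideal R, [/\ prime_ideal q, pchain k' p r, ideal_sub r q & ~ ideal_sub q r]
  else prime_ideal p /\ ideal_eq p q.

Lemma pchain_sub k (p q : ideal R) : pchain k p q -> [/\ prime_ideal p, prime_ideal q & ideal_sub p q].
Proof.
elim: k q => [|k IH] q /=.
  move=> [[n1 pp] e]; split=> // [|x /e //]; split=> [/e //|x y /e /pp [/e|/e]]; by [left | right].
move=> [r [pq /IH [pp pr pr'] rq _]]; split=> // x /pr' /rq. by [].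
Qed.

(** Working from the top, [prime_through] replaces each intermediate prime by one containing [x];
    the chain above the bottom keeps its length. *)
Lemma pchain_through k (p q : ideal R) (x : R) : pchain k.+1 p q -> q x ->
  exists r : ideal R, [/\ prime_ideal r, ideal_sub p r, ~ ideal_sub r p, r x & pchain k r q].
Proof.
elim: k q => [|k IH] q /=.
  move=> [r [pq [pp e] rq nqr]] qx; exists q; split=> //.
  - by move=> z /e /rq.
  - by move=> h; apply: nqr => z /h /e.
move=> [q1 [pq [q2 [pq1 ch q21 nq12]] q1q nqq1]] qx.
have [pp pq2 pq2'] := pchain_sub ch.
have [q' [pq' s1 ns1 s2 [ns2 q'x]]] := prime_through pq2 pq1 pq q21 nq12 q1q nqq1 qx.
have [|r [pr s3 ns3 rx ch']] := IH q' _ q'x; first by exists q2.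
by exists r; split=> //; exists q'.
Qed.

(** As [x] is outside [p], the coefficients of [x] fall into [p], so [p = J + x p]; on generators of
    [p] the matrix [1 - x M] is invertible. *)
Lemma nakayama (p : ideal R) J (x : R) : in_jac x -> ideal_sub p (adjoin J x) -> prime_ideal p -> ~ p x -> ideal_sub J p -> ideal_sub p J.
Proof.
move=> jac pJ [_ pp] npx Jp.
have [l hl] := noethR p.
have st i : exists w : 'I_(size l) -> R, J (l`_i - x * \sum_j w j * l`_j).
  have [lt|ge] := ltnP i (size l); last first.
    exists (fun=> 0); rewrite nth_default // big1 ?mulr0 ?subrr; first exact: ideal_0.
    by move=> j _; rewrite mul0r.
  have pl : p l`_i by apply/hl/ideal_span_mem/mem_nth.
  have [a [j [Jj e]]] := pJ _ pl.
  have pa : p a.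
    have : p (a * x) by rewrite -[a * x](addrK j) -e; apply: ideal_B => //; apply: Jp.
    by move=> /pp [].
  have /hl /ideal_spanE [w ew] := pa; exists w.
  by rewrite -ew e mulrC addrC addKr.
have [w hw] := choice st.
pose M : 'M[R]_(size l) := \matrix_(i, j) w i j; pose L : 'cV[R]_(size l) := \col_i l`_i.
have mz := mod_elt_surjker (f := GRing.RMorphism.clone _ _ (qpi (ideal_span [:: x])) _)
  (@qpi_surj _ _) (qpi_eq0 (ideal_span [:: x])).
have [X [XM _]] := inv_mx mz M jac.
have JL i : J (((1%:M - x *: M) *m L) i 0).
  have := hw i; rewrite mulmxBl mul1mx -scalemxAl !mxE; congr (J (_ - x * _)).
  by apply: eq_bigr => j _; rewrite !mxE.
have eL : L = X *m ((1%:M - x *: M) *m L) by rewrite mulmxA XM mul1mx.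
move=> z /hl; apply: ideal_span_sub => y /(nthP 0) [i si <-].
have -> : l`_i = L (Ordinal si) 0 by rewrite mxE.
rewrite eL mxE; apply: ideal_sum => j _; exact: ideal_M.
Qed.

(** [pchain_through] gives a prime containing [x] with a chain shorter by one, so by induction
    [(l1, x)] is prime; then [p] lies in [(l1, x)], [x] is outside [p], and Nakayama gives
    [p = (l1)]. Primality of the successive ideals is regularity. *)
Lemma regular_chain (m : ideal R) (l1 l2 : seq R) (p : ideal R) : (forall x, m x -> in_jac x) -> ideal_eq m (ideal_span (l1 ++ l2)) ->
  ideal_sub (ideal_span l1) p -> pchain (size l2) p m ->
  [/\ prime_ideal (ideal_span l1), ideal_eq p (ideal_span l1) &
   forall i, (i < size l2)%N -> forall y, ideal_span (l1 ++ take i l2) (l2`_i * y) -> ideal_span (l1 ++ take i l2) y].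
Proof.
move=> jac; elim: l2 l1 p => [|x l2 IH] l1 p em Jp ch.
  rewrite cats0 in em; have [[n1 pp] e] := ch.
  have e' : ideal_eq p (ideal_span l1) by move=> z; split=> [/e /em|/em /e].
  by split=> //; split=> [/e' //|a b /e' /pp [/e'|/e']]; [left | right].
have mx : m x by apply/em/ideal_span_mem; rewrite mem_cat mem_head orbT.
have [r [pr spr nspr rx ch']] := pchain_through ch mx.
have [|||pJ' er reg] := IH (rcons l1 x) r.
- by rewrite cat_rcons.
- apply: ideal_span_sub => z; rewrite mem_rcons inE => /orP[/eqP -> //|zl].
  by apply/spr/Jp/ideal_span_mem.
- exact: ch'.
have J'E z : ideal_span (rcons l1 x) z <-> adjoin (ideal_span l1) x z.
  rewrite -cats1 span_cat; split=> [[a [b [ha /span_cons [c [w [/span_nil -> ->]]] ->]]]|[a [q [hq ->]]]].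
    by exists c, a; rewrite addr0 addrC.
  exists q, (a * x); split=> //; last by rewrite addrC.
  by apply/ideal_M/ideal_span_mem/mem_head.
have npx : ~ p x.
  move=> px; apply: nspr => z /er /J'E; apply: adjoin_sub => //.
have [pp _ _] := pchain_sub ch.
have pJ : ideal_sub p (ideal_span l1).
  by apply: (nakayama (jac _ mx)) => // z /spr /er /J'E.
have ep : ideal_eq p (ideal_span l1) by move=> z; split=> [/pJ|/Jp].
have pJ1 : prime_ideal (ideal_span l1).
  by case: pp => n1 pp; split=> [/ep //|a b /ep /pp [/ep|/ep]]; [left | right].
split=> // -[|i]; first by rewrite take0 cats0 => _ y; case: pJ1 => _ h /h [/ep|].
by rewrite ltnS => si y; rewrite -cat_rcons; apply: reg.
Qed.

Lemma maximal_above I : ~ I 1 -> exists2 m, maximal_ideal m & ideal_sub I m.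
Proof.
move=> nI; have [J [nJ IJ maxJ]] := noeth_max noethR (Q := fun J => ~ J 1) nI.
by exists J => //; split=> // K JK nK; apply: maxJ.
Qed.

Lemma unit_or_maximal (a : R) : (exists b, a * b = 1) \/ exists2 m : ideal R, maximal_ideal m & m a.
Proof.
have [h|h] := pselect (ideal_span [:: a] 1).
  by left; have /span_cons [c [y [/span_nil -> e]]] := h; exists c; rewrite e addr0 mulrC.
right; have [m mm sub] := maximal_above h; exists m => //; apply: sub.
exact/ideal_span_mem/mem_head.
Qed.

Lemma local_jac (m : ideal R) (x : R) : local_ring_at m -> m x -> in_jac x.
Proof.
move=> [[n1 _] uniq] mx a; have [//|[m' mm' h]] := unit_or_maximal (1 + a * x).
case: n1; rewrite -[1](addrK (a * x)); apply: ideal_B; [exact/(uniq _ mm') | exact: ideal_M].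
Qed.

End PrincipalIdeal.

(** * Regular local rings have finite global dimension *)

(** Hilbert's basis theorem: [n] bounds the degrees that realize generators of the ideal of leading
    coefficients, and below degree [n] the ideal is a submodule of [Q^n]. *)
Lemma noeth_poly (Q : comNzRingType) : noetherian Q -> noetherian {poly Q}.
Proof.
move=> nQ I.
pose Lp (a : Q) := exists k p, [/\ I p, (size p <= k.+1)%N & p`_k = a].
have L0 : Lp 0 by exists 0%N, 0; rewrite size_poly0 coef0; split=> //; apply: ideal_0.
have up k l p : (k <= l)%N -> I p -> (size p <= k.+1)%N ->
    [/\ I ('X^(l - k) * p), (size ('X^(l - k) * p)%R <= l.+1)%N & ('X^(l - k) * p)`_l = p`_k].
  move=> kl Ip sp; split; first exact: ideal_M.
    apply: leq_trans (size_polyMleq _ _) _; rewrite size_polyXn.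
    by move: (size p) sp => z; lia.
  by rewrite coefXnM ltnNge leq_subr /= subKn.
have LD a b : Lp a -> Lp b -> Lp (a + b).
  move=> [k [p [Ip sp <-]]] [l [q [Iq sq <-]]].
  have [I1 s1 <-] := up k (maxn k l) p (leq_maxl _ _) Ip sp.
  have [I2 s2 <-] := up l (maxn k l) q (leq_maxr _ _) Iq sq.
  exists (maxn k l), ('X^(maxn k l - k) * p + 'X^(maxn k l - l) * q); split; [exact: ideal_D | | by rewrite coefD].
  by apply: leq_trans (size_polyD _ _) _; rewrite geq_max s1 s2.
have LM c a : Lp a -> Lp (c * a).
  move=> [k [p [Ip sp <-]]]; exists k, (c%:P * p); split; [exact: ideal_M | | by rewrite coefCM].
  by rewrite mul_polyC; apply: leq_trans (size_scale_leq _ _) sp.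
have [l hl] := nQ (Ideal L0 LD LM).
have gen (i : 'I_(size l)) : exists kp : nat * {poly Q}, [/\ I kp.2, (size kp.2 <= kp.1.+1)%N & kp.2`_kp.1 = l`_i].
  have [k [p h]] : Lp l`_i by apply/hl/ideal_span_mem/mem_nth.
  by exists (k, p).
have [kp hkp] := choice gen.
pose n := \max_i (kp i).1.
have [p hp] : exists p : 'I_(size l) -> {poly Q}, forall i, [/\ I (p i), (size (p i) <= n.+1)%N & (p i)`_n = l`_i].
  exists (fun i => 'X^(n - (kp i).1) * (kp i).2) => i; have [h1 h2 <-] := hkp i.
  by apply: up => //; apply: (leq_bigmax i).
pose low (v : 'rV[Q]_n) := I (rVpoly v).
have low0 : low 0 by rewrite /low linear0; apply: ideal_0.
have lowD v w : low v -> low w -> low (v + w) by rewrite /low linearD; apply: ideal_D.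
have lowZ c v : low v -> low (c *: v) by rewrite /low linearZ /= -mul_polyC; apply: ideal_M.
have [k [D hD]] := noeth_rV nQ (Submod low0 lowD lowZ).
exists ([seq p i | i : 'I_(size l)] ++ [seq rVpoly (row j D) | j : 'I_k]) => q; split; last first.
  apply: ideal_span_sub => z; rewrite mem_cat => /orP[] /mapP [i _ ->]; first by have [] := hp i.
  by have /hD := inrows_row i (inrows_refl D).
have [m sm] := ubnP (size q); elim: m q sm => // m IH q; rewrite ltnS => sm Iq.
have [qn|nq] := leqP (size q) n.
  have [W hW] : inrows (poly_rV q : 'rV_n) D by apply/hD; rewrite /= /low poly_rV_K.
  rewrite -(poly_rV_K qn) hW mulmx_sum_row linear_sum; apply: ideal_sum => j _.
  rewrite -[X in ideal_span _ X]/(rVpoly (W 0 j *: row j D)).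
  have -> : rVpoly (W 0 j *: row j D) = (W 0 j)%:P * rVpoly (row j D) by rewrite linearZ /= mul_polyC.
  apply/ideal_M/ideal_span_mem; rewrite mem_cat; apply/orP; right.
  by apply: map_f; rewrite mem_enum.
have q0 : (0 < size q)%N by apply: leq_ltn_trans nq.
have /hl /ideal_spanE [a ea] : Lp q`_(size q).-1.
  by exists (size q).-1, q; rewrite prednK.
pose r := \sum_i (a i)%:P * ('X^((size q).-1 - n) * p i).
have rs : ideal_span ([seq p i | i : 'I_(size l)] ++ [seq rVpoly (row j D) | j : 'I_k]) r.
  apply: ideal_sum => i _; do 2 apply: ideal_M; apply: ideal_span_mem; rewrite mem_cat.
  by rewrite map_f ?mem_enum.
have nq' : (n <= (size q).-1)%N by rewrite -ltnS prednK.
have hr i : [/\ I ('X^((size q).-1 - n) * p i), (size ('X^((size q).-1 - n) * p i)%R <= size q)%N &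
    ('X^((size q).-1 - n) * p i)`_(size q).-1 = l`_i].
  by have [h1 h2 <-] := hp i; have := up n (size q).-1 (p i) nq' h1 h2; rewrite prednK.
have Ir : I r by apply: ideal_sum => i _; apply: ideal_M; have [] := hr i.
rewrite -[q](subrK r); apply: ideal_D => //; apply: IH; last exact: ideal_B.
apply: leq_trans sm; rewrite -[X in (_ < X)%N](prednK q0) ltnS; apply/leq_sizeP => j jq; rewrite coefB.
have [ej|ne] := eqVneq j (size q).-1.
  rewrite ej coef_sum ea; apply/eqP; rewrite subr_eq0; apply/eqP; apply: eq_bigr => i _.
  by have [_ _ h] := hr i; rewrite coefCM h.
have jq' : (size q <= j)%N by rewrite -[X in (X <= _)%N](prednK q0) ltn_neqAle eq_sym ne.
rewrite nth_default // coef_sum big1 ?subrr // => i _; rewrite coefCM nth_default ?mulr0 //.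
by have [_ h _] := hr i; apply: leq_trans h jq'.
Qed.

Lemma mpoly0_iso (Q : comNzRingType) : is_loc (GRing.RMorphism.clone Q {mpoly Q[0]} (@mpolyC 0 Q) _) (mult_one Q).
Proof.
apply: iso_loc => [p|x /(congr1 (mcoeff 0%MM))]; last by rewrite /= mcoeffC eqxx mulr1 mcoeff0.
exists (p@_0%MM); apply/mpolyP => m; have -> : m = 0%MM by apply/mnmP => -[].
by rewrite /= mcoeffC eqxx mulr1.
Qed.

Lemma mpolyS_iso (Q : comNzRingType) n : exists f : {rmorphism {poly {mpoly Q[n]}} -> {mpoly Q[n.+1]}},
  is_loc f (mult_one _).
Proof.
pose f : {rmorphism {poly {mpoly Q[n]}} -> {mpoly Q[n.+1]}} :=
  GRing.RMorphism.clone _ _ (horner_eval ('X_ord_max : {mpoly Q[n.+1]}) \o map_poly (@mwiden n Q)) _.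
have fC q : f q%:P = mwiden q by rewrite /f /= map_polyC /horner_eval /= hornerC.
have fX : f 'X = 'X_ord_max by rewrite /f /= map_polyX /horner_eval hornerX.
clearbody f.
pose c : {rmorphism Q -> {poly {mpoly Q[n]}}} := GRing.RMorphism.clone _ _ (polyC \o (@mpolyC n Q)) _.
have [g [gC gX]] := mpoly_eval_ex c (fun k => if unlift ord_max k is Some k' then ('X_k')%:P else 'X).
exists f; apply: iso_loc => [y|x fx].
  exists (g y); apply: (@mpoly_rmorph_eq Q n.+1 _ (GRing.RMorphism.clone _ _ (f \o g) _) (GRing.RMorphism.clone _ _ idfun _)).
    by move=> a; rewrite /= gC /c /= fC mwidenC.
  move=> k /=; rewrite gX; case: unliftP => [k' ->|-> //]; rewrite fC mwidenX mnmwiden1.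
  congr 'X_[U_(_)]; apply: val_inj; by rewrite /= /bump leqNgt ltn_ord.
have gw : (GRing.RMorphism.clone _ _ (g \o @mwiden n Q) _ : {rmorphism _ -> _}) =1 polyC.
  apply: (@mpoly_rmorph_eq Q n _ (GRing.RMorphism.clone _ _ (g \o @mwiden n Q) _) (GRing.RMorphism.clone _ _ polyC _)).
    by move=> a; rewrite /= mwidenC gC.
  move=> k; rewrite /= mwidenX mnmwiden1 gX.
  case: unliftP => [k' /(congr1 val) e|/(congr1 val) e]; last first.
    by have := ltn_ord k; move: e => /= ->; rewrite ltnn.
  by congr ('X_[U_(_)])%:P; apply: val_inj; move: e; rewrite /= /bump leqNgt ltn_ord.
have gmax : g 'X_ord_max = 'X by rewrite gX unlift_none.
have gf p : g (f p) = p.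
  have ep : p = \sum_(i < size p) p`_i *: 'X^i by rewrite -poly_def coefK.
  rewrite [in LHS]ep [RHS]ep !rmorph_sum; apply: eq_bigr => i _.
  rewrite -mul_polyC !rmorphM !rmorphXn fC fX gmax; congr (_ * _); exact: gw.
by rewrite -[x]gf fx rmorph0.
Qed.

Lemma mpoly_noeth_gldim (Q : comNzRingType) n : noetherian Q -> noetherian {mpoly Q[n]} /\
  forall d, gldim_le Q d -> exists d', gldim_le {mpoly Q[n]} d'.
Proof.
move=> nQ; elim: n => [|n [IHn IHd]].
  have loc := mpoly0_iso Q; split; first exact: loc_noeth loc nQ.
  by move=> d gd; exists d; apply: gldim_loc loc nQ gd.
have [f loc] := mpolyS_iso Q n; have np := noeth_poly IHn.
split; first exact: loc_noeth loc np.
move=> d /IHd [d' gd']; exists d'.+2; apply: gldim_loc loc np _; exact: gldim_poly.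
Qed.

Section MpolyConst.
Variables (N : nat).

Definition mrow (B : comNzRingType) m n (k : 'X_{1..N}) (X : 'M[{mpoly B[N]}]_(m, n)) : 'M[B]_(m, n) :=
  \matrix_(i, j) (X i j)@_k.

Lemma flat_mpolyC (Q : comNzRingType) : flat (GRing.RMorphism.clone Q {mpoly Q[N]} (@mpolyC N Q) _).
Proof.
move=> m n D v vD; pose d := (\max_j msize (v 0%R j))%N.
have hd j : (msize (v 0%R j) <= d)%N by apply: (leq_bigmax j).
pose T : finType := 'X_{1..N < d}.
exists #|T|, (\matrix_(k < #|T|) mrow (enum_val k : 'X_{1..N < d}) v).
  apply/row_matrixP => k; rewrite row_mul rowK row0; apply/rowP => j.
  have := congr1 (fun w : 'rV[{mpoly Q[N]}]_n => (w 0 j)@_(enum_val k : 'X_{1..N < d})) vD.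
  rewrite !mxE mcoeff0 raddf_sum => e; rewrite -[RHS]e; apply: eq_bigr => i _.
  by rewrite !mxE [v 0 i * _]mulrC /= mcoeffCM mulrC.
exists (\row_k 'X_[(enum_val k : 'X_{1..N < d})]); apply/rowP => j.
rewrite !mxE {1}(mpolywE (hd j)) (reindex (@enum_val _ T)) /=; last exact: onW_bij (enum_val_bij _).
by apply: eq_bigr => k _; rewrite !mxE /= mulrC mul_mpolyC.
Qed.

Lemma global_ci_mpoly (Q K : comNzRingType) (s : seq Q) (f : {rmorphism Q -> K}) d : noetherian Q -> gldim_le Q d ->
  wregular s -> (forall y, exists x, f x = y) -> (forall x, f x = 0 <-> ideal_span s x) -> global_ci {mpoly K[N]}.
Proof.
move=> nQ gd reg surj ker; have [nm gm] := mpoly_noeth_gldim N nQ; have [d' gd'] := gm d gd.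
exists {mpoly Q[N]}, d', (map (@mpolyC N Q) s), (GRing.RMorphism.clone _ _ (map_mpoly f) _); split=> //.
- move=> i; rewrite size_map => si y; rewrite (nth_map 0) // -map_take.
  exact: (flat_colon (flat_mpolyC (Q := Q)) (reg i si)).
- move=> y; have [g hg] := choice surj; exists (\sum_(m <- msupp y) g y@_m *: 'X_[m]).
  rewrite rmorph_sum [RHS]mpolyE; apply: eq_bigr => m _.
  by rewrite /= -!mul_mpolyC rmorphM /= map_mpolyC /= hg map_mpolyX.
- move=> x; split=> [e|h].
    rewrite [x]mpolyE; apply: ideal_sum => m _; rewrite -mul_mpolyC; apply: ideal_Mr.
    have h1 : ideal_span s x@_m.
      apply/ker; rewrite -mcoeff_map_mpoly; have := congr1 (mcoeff m) e; rewrite mcoeff0; exact.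
    move: h1 => /ideal_spanE [a ->]; rewrite rmorph_sum; apply: ideal_sum => i _.
    by rewrite rmorphM; apply/ideal_M/ideal_span_mem/map_f/mem_nth.
  apply: span_ker h => _ /mapP [z zs ->]; rewrite /= map_mpolyC /=.
  by have -> : f z = 0 by apply/ker/ideal_span_mem.
Qed.

End MpolyConst.

Lemma field_split (F : fieldType) m n (D : 'M[F]_(m, n)) : splitm D.
Proof. by exists (pinvmx D); rewrite mulmxKpV. Qed.

Lemma gldim_field (R : comPzRingType) : (forall a : R, a = 0 \/ exists b, a * b = 1) -> gldim_le R 0.
Proof.
move=> hR; have [e|ne] := eqVneq (1 : R) 0.
  by move=> C _; exists 0; apply/matrixP => i j; rewrite -[LHS]mul1r -[RHS]mul1r e !mul0r.
have [R' eR] := nontrivial_pack ne; subst R.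
have hinv (a : R') : exists b, (a != 0 -> b * a = 1) /\ (a = 0 -> b = 0).
  have [->|[b hb]] := hR a; first by exists 0; rewrite eqxx.
  exists b; split=> [_|a0]; first by rewrite mulrC.
  by move: ne; rewrite -hb a0 mul0r eqxx.
have [inv hi] := choice hinv.
have mulVf a : a != 0 -> inv a * a = 1 by have [] := hi a.
have inv0 : inv 0 = 0 by have [_] := hi 0; apply.
pose fm := GRing.ComNzRing_isField.Build R' mulVf inv0.
pose F : fieldType := HB.pack_for fieldType (R' : Type) (GRing.ComNzRing.class R') fm.
by move=> C _; apply: (@field_split F).
Qed.

Lemma prime_chain_pchain (R : comPzRingType) (p : nat -> ideal R) n : prime_chain p n -> pchain n (p 0%N) (p n).
Proof.
elim: n => [|n IH] [pr st]; first by split=> //; apply: pr.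
exists (p n); split; [exact: pr | | exact: (st n (ltnSn n)).1 | exact: (st n (ltnSn n)).2].
apply: IH; split=> [i ni|i ni]; [apply: pr; exact: leqW | apply: st; exact: leqW].
Qed.

(** The generators of the maximal ideal form a regular sequence; the residue field has global
    dimension 0, and each generator put back adds one. *)
Lemma regular_local_gldim (Q : comPzRingType) : regular_local_ring Q -> exists d, gldim_le Q d.
Proof.
move=> [nQ [m [locm [s [[[p ch] _] em]]]]].
have [mm uniq] := locm; have pm := maximal_prime mm.
have jac x : m x -> in_jac x := fun mx => local_jac nQ locm mx.
have below q : prime_ideal q -> ideal_sub q m.
  by move=> [nq _] x qx; have [M mM sub] := maximal_above nQ nq; apply/(uniq _ mM)/sub.
(* The given chain is not known to end at [m]; its last prime is replaced by [m]. *)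
have ch' : pchain (size s) (p 0%N) m.
  have [k ek] : exists k, size s = k by exists (size s).
  move: ch; rewrite ek; case: k ek => [e0 /prime_chain_pchain [pp _]|k _ /prime_chain_pchain [r [pr c1 c2 c3]]].
    split=> // x; split=> [/(below _ pp)//|/em]; rewrite (size0nil e0) => /span_nil ->; exact: ideal_0.
  have sub := below _ pr; exists r; split=> // [x /c2 /sub //|h]; apply: c3 => x /sub /h. by [].
have [_ _ reg] := regular_chain nQ (l1 := [::]) jac em (fun x h => ideal_span_sub (fun y (hy : y \in [::]) => False_ind _ (notF hy)) h) ch'.
have main l2 l1 (R : comPzRingType) (f : {rmorphism Q -> R}) : l1 ++ l2 = s ->
    (forall y, exists x, f x = y) -> (forall x, f x = 0 <-> ideal_span l1 x) -> gldim_le R (size l2).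
  elim: l2 l1 R f => [|x l2 IH] l1 R f el surj ker.
    apply: gldim_field => a; have [x <-] := surj a.
    have [mx|nmx] := pselect (m x); [left | right].
      by apply/ker; rewrite cats0 in el; rewrite el; apply/em.
    have [[b hb]|[M mM Mx]] := unit_or_maximal nQ x; first by exists (f b); rewrite -rmorphM hb rmorph1.
    by case: nmx; apply/(uniq _ mM).
  pose I := ideal_span (rcons l1 x).
  pose g : {rmorphism Q -> quotient I} := GRing.RMorphism.clone _ _ (qpi I) _.
  have gs y : exists x, g x = y := qpi_surj y.
  have gk z : g z = 0 <-> ideal_span (rcons l1 x) z := qpi_eq0 I z.
  pose idm : {rmorphism Q -> Q} := GRing.RMorphism.clone _ _ idfun _.
  have flid : flat idm by apply: (loc_flat (iso_loc _ _)) => [y|//]; exists y.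
  have mid l : map idm l = l by rewrite map_id.
  have [||y|q [mp nz]] := @quotient_step Q Q R _ idm l1 x f g flid surj _ gs.
  - by move=> z; rewrite mid.
  - by move=> z; rewrite mid.
  - have si : (size l1 < size s)%N by rewrite -el size_cat /= addnS ltnS leq_addr.
    have := reg _ si y; rewrite /= -el take_size_cat // nth_cat ltnn subnn; exact.
  apply: (gldim_mod mp nz); last by apply: (IH (rcons l1 x) _ g); rewrite ?cat_rcons.
  have mx : m x by apply/em/ideal_span_mem; rewrite -el mem_cat mem_head orbT.
  move=> a; have [a' <-] := surj a; have [b hb] := jac x mx a'.
  by exists (f b); rewrite -[1 in LHS](rmorph1 f) -rmorphM -rmorphD -rmorphM hb rmorph1.
exists (size s); apply: (main s [::] Q (GRing.RMorphism.clone _ _ idfun _)) => // [y|x]; first by exists y.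
by rewrite span_nil.
Qed.

(** * Artin-Rees and the completion *)

Section Linearize.
Variable N : nat.

Definition mdx p d : finType := ('I_p * 'X_{1..N < d})%type.

Section Ring.
Variable B : comNzRingType.

Definition mdec p d (w : 'rV[B]_#|mdx p d|) : 'rV[{mpoly B[N]}]_p :=
  \row_i \sum_(m : 'X_{1..N < d}) w 0 (enum_rank ((i, m) : mdx p d)) *: 'X_[m].

Definition menc p d (v : 'rV[{mpoly B[N]}]_p) : 'rV[B]_#|mdx p d| :=
  \row_k (v 0 (enum_val k).1)@_((enum_val k).2 : 'X_{1..N < d}).

(** Multiplication by [D] from vectors of degree below [d], truncated below [d']: a polynomial
    system becomes one over the coefficients. *)
Definition mlin p q d d' (D : 'M[{mpoly B[N]}]_(p, q)) : 'M[B]_(#|mdx p d|, #|mdx q d'|) :=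
  \matrix_(k, l) ('X_[(enum_val k).2 : 'X_{1..N < d}] * D (enum_val k).1 (enum_val l).1)@_((enum_val l).2 : 'X_{1..N < d'}).

Lemma mencK p d (v : 'rV[{mpoly B[N]}]_p) : (forall j, (msize (v 0%R j) <= d)%N) -> mdec (menc d v) = v.
Proof.
move=> h; apply/rowP => j; rewrite mxE [RHS](mpolywE (h j)); apply: eq_bigr => m _.
by rewrite mxE enum_rankK.
Qed.

Lemma mdec0 p d : mdec (0 : 'rV[B]_#|mdx p d|) = 0.
Proof. by apply/rowP => j; rewrite !mxE big1 // => m _; rewrite mxE scale0r. Qed.

Lemma menc_eq0 p d (v : 'rV[{mpoly B[N]}]_p) : (forall j, (msize (v 0%R j) <= d)%N) -> menc d v = 0 -> v = 0.
Proof. by move=> h e; rewrite -(mencK h) e mdec0. Qed.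

Lemma menc_mul p q d d' (w : 'rV[B]_#|mdx p d|) (D : 'M[{mpoly B[N]}]_(p, q)) :
  menc d' (mdec w *m D) = w *m mlin d d' D.
Proof.
apply/rowP => l; rewrite !mxE raddf_sum.
rewrite (reindex (@enum_rank (mdx p d))) /=; last exact: onW_bij (enum_rank_bij _).
transitivity (\sum_(i < p) \sum_(m : 'X_{1..N < d}) w 0 (enum_rank ((i, m) : mdx p d)) *
   mlin d d' D (enum_rank ((i, m) : mdx p d)) l); last first.
  by rewrite pair_bigA; apply: eq_bigr => -[i m] _.
apply: eq_bigr => i _; rewrite mxE mulr_suml raddf_sum; apply: eq_bigr => m _.
by rewrite mxE enum_rankK /= -scalerAl mcoeffZ.
Qed.

Lemma mdec_mul_size p q d (D : 'M[{mpoly B[N]}]_(p, q)) : exists d', forall (w : 'rV[B]_#|mdx p d|) j,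
  (msize ((mdec w *m D) 0%R j) <= d')%N.
Proof.
exists (\max_(k : 'I_p * 'X_{1..N < d} * 'I_q) msize ('X_[k.1.2] * D k.1.1 k.2)%R)%N => w j.
rewrite mxE; apply: (big_ind (fun x : {mpoly B[N]} => msize x <= _)%N) => [|x y hx hy|i _].
- by rewrite msize0.
- by apply: leq_trans (msizeD_le _ _) _; rewrite geq_max hx.
rewrite mxE mulr_suml; apply: (big_ind (fun x : {mpoly B[N]} => msize x <= _)%N) => [|x y hx hy|m _].
- by rewrite msize0.
- by apply: leq_trans (msizeD_le _ _) _; rewrite geq_max hx.
rewrite -scalerAl; apply: leq_trans (msizeZ_le _ _) _.
exact: (leq_bigmax (F := fun k : 'I_p * 'X_{1..N < d} * 'I_q => msize ('X_[k.1.2] * D k.1.1 k.2)%R) ((i, m), j)).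
Qed.

Lemma mdec_comb p d k (Y : 'rV[B]_k) (W : 'M[B]_(k, #|mdx p d|)) :
  mdec (Y *m W) = map_mx (@mpolyC N B) Y *m (\matrix_(r, j) mdec (row r W) 0 j).
Proof.
apply/rowP => j; rewrite !mxE.
under eq_bigr => m _ do rewrite mxE scaler_suml.
rewrite exchange_big; apply: eq_bigr => r _; rewrite !mxE mulr_sumr; apply: eq_bigr => m _.
by rewrite mxE mul_mpolyC scalerA.
Qed.

End Ring.

Variables (A K : comNzRingType) (phi : {rmorphism A -> K}).
Local Notation Phi := (GRing.RMorphism.clone {mpoly A[N]} {mpoly K[N]} (map_mpoly phi) _).

Lemma map_mlin p q d d' (D : 'M[{mpoly A[N]}]_(p, q)) : map_mx phi (mlin d d' D) = mlin d d' (map_mx Phi D).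
Proof. by apply/matrixP => k l; rewrite !mxE -mcoeff_map_mpoly rmorphM /= map_mpolyX. Qed.

Lemma row_bound (B : comNzRingType) p (v : 'rV[{mpoly B[N]}]_p) : exists d, forall j, (msize (v 0%R j) <= d)%N.
Proof. by exists (\max_j msize (v 0%R j))%N => j; apply: (leq_bigmax j). Qed.

Lemma flat_mpoly : flat phi -> flat Phi.
Proof.
move=> fl m n D v vD; have [d hd] := row_bound v; have [d' hd'] := mdec_mul_size d D.
have [|k [W WD [Y hY]]] := fl _ _ (mlin d d' D) (menc d v).
  rewrite map_mlin -menc_mul mencK // vD; apply/rowP => l; by rewrite !mxE mcoeff0.
exists k, (\matrix_(r, j) mdec (row r W) 0 j).
  apply/row_matrixP => r; rewrite row_mul row0.
  rewrite (_ : row r _ = mdec (row r W)); last by apply/rowP => j; rewrite !mxE.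
  apply: (menc_eq0 (d := d')); first exact: hd'.
  by rewrite menc_mul -row_mul WD row0.
rewrite -(mencK hd) hY mdec_comb; exists (map_mx (@mpolyC N K) Y); congr (_ *m _).
apply/matrixP => r j; rewrite !mxE rmorph_sum; apply: eq_bigr => l _.
by rewrite !mxE -!mul_mpolyC rmorphM /= map_mpolyC /= map_mpolyX.
Qed.

(** [d'] bounds [b] and all products with vectors of degree below [d], so the truncated system is
    equivalent to the original one. *)
Lemma descends_mpoly (T : A -> Prop) : descends phi T -> descends Phi (fun p => exists2 a, T a & p = a%:MP).
Proof.
move=> de m n D b [v hv]; have [d hd] := row_bound v; have [d1 hd1] := mdec_mul_size d D.
have [d2 hd2] := row_bound b; pose d' := maxn d1 d2.
have [|a Ta [w hw]] := de _ _ (mlin d d' D) (menc d' b).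
  exists (menc d v); rewrite map_mlin -menc_mul mencK // -hv; apply/rowP => l.
  by rewrite !mxE mcoeff_map_mpoly.
exists a%:MP; first by exists a.
exists (mdec w); apply/eqP; rewrite -subr_eq0; apply/eqP; apply: (menc_eq0 (d := d')) => [j|].
  rewrite addmxE oppmxE; apply: leq_trans (msizeD_le _ _) _; rewrite geq_max; apply/andP; split.
    rewrite mxE mul_mpolyC; apply: leq_trans (msizeZ_le _ _) _.
    by apply: leq_trans (hd2 j) _; rewrite leq_maxr.
  by rewrite msizeN; apply: leq_trans (hd1 _ _) _; rewrite leq_maxl.
have -> : menc d' (a%:MP *: b - mdec w *m D) = a *: menc d' b - menc d' (mdec w *m D).
  by apply/rowP => l; rewrite !mxE mcoeffB mul_mpolyC mcoeffZ.
by rewrite menc_mul hw subrr.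
Qed.

End Linearize.

Section Quotients.
Variables (P P' R R' : comPzRingType) (Phi : {rmorphism P -> P'}) (L : seq P).
Variables (f : {rmorphism P -> R}) (f' : {rmorphism P' -> R'}) (Psi : {rmorphism R -> R'}).
Hypotheses (surj : forall y, exists x, f x = y) (surj' : forall y, exists x, f' x = y).
Hypotheses (ker : forall x, f x = 0 <-> ideal_span L x)
  (ker' : forall x, f' x = 0 <-> ideal_span (map Phi L) x) (PsiE : forall x, Psi (f x) = f' (Phi x)).

(** Its rows generate the vectors with entries in the ideal of [L]; stacking it under a matrix
    expresses solvability modulo that ideal. *)
Definition lam q : 'M[P]_(#|{: 'I_(size L) * 'I_q}|, q) :=
  \matrix_(k, j) (let ij : 'I_(size L) * 'I_q := enum_val k in if ij.2 == j then L`_ij.1 else 0).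

Lemma lam_rows q (v : 'rV[P']_q) : (forall j, f' (v 0 j) = 0) -> inrows v (map_mx Phi (lam q)).
Proof.
move=> h; have h' j : exists a : 'I_(size L) -> P', v 0 j = \sum_i a i * Phi L`_i.
  have /ker' /ideal_spanE := h j; rewrite size_map => -[a e]; exists a.
  by rewrite e; apply: eq_bigr => i _; rewrite (nth_map 0).
have [a ha] := choice h'; exists (\row_k (let ij : 'I_(size L) * 'I_q := enum_val k in a ij.2 ij.1)); apply/rowP => j.
rewrite mxE (reindex (@enum_rank {: 'I_(size L) * 'I_q})) /=; last exact: onW_bij (enum_rank_bij _).
transitivity (\sum_i \sum_(l < q) (if l == j then a l i * Phi L`_i else 0)); last first.
  rewrite pair_bigA; apply: eq_bigr => -[i l] _; rewrite !mxE enum_rankK /=.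
  by case: eqP => // _; rewrite rmorph0 mulr0.
by rewrite ha; apply: eq_bigr => i _; rewrite -big_mkcond big_pred1_eq.
Qed.

Lemma lam0 q : map_mx f (lam q) = 0.
Proof.
apply/matrixP => k j; rewrite !mxE /=; case: eqP => _; last by rewrite rmorph0.
by apply/ker/ideal_span_mem/mem_nth.
Qed.

Lemma map_Psi m n (X : 'M[P]_(m, n)) : map_mx Psi (map_mx f X) = map_mx f' (map_mx Phi X).
Proof. by apply/matrixP => i j; rewrite !mxE PsiE. Qed.

Lemma flat_quotient : flat Phi -> flat Psi.
Proof.
move=> fl m n D v vD; have [D1 eD] := surj_mx D surj; have [v1 ev] := surj_mx v surj'.
have [Y hY] : inrows (v1 *m map_mx Phi D1) (map_mx Phi (lam n)).
  apply: lam_rows => j; have := congr1 (fun w : 'rV[R']_n => w 0 j) vD.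
  by rewrite -eD -ev map_Psi -map_mxM !mxE.
have [|k [W WD [Z hZ]]] := fl _ _ (col_mx D1 (lam n)) (row_mx v1 (- Y)).
  by rewrite map_col_mx mul_row_col mulNmx hY subrr.
exists k, (map_mx f (lsubmx W)).
  rewrite -eD -map_mxM; have := WD; rewrite -[W in LHS]hsubmxK mul_row_col => /eqP; rewrite addr_eq0 => /eqP ->.
  by rewrite map_mxN map_mxM lam0 mulmx0 oppr0.
exists (map_mx f' Z); rewrite map_Psi -map_mxM -ev; congr (map_mx f' _).
have := congr1 lsubmx hZ; rewrite row_mxKl => ->.
by rewrite -[map_mx Phi W]hsubmxK -map_lsubmx -map_rsubmx mul_mx_row row_mxKl.
Qed.

Lemma descends_quotient (T : P -> Prop) : descends Phi T -> descends Psi (fun y => exists2 a, T a & y = f a).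
Proof.
move=> de m n D b [v hv]; have [D1 eD] := surj_mx D surj; have [v1 ev] := surj_mx v surj'.
have [b1 eb] := surj_mx b surj.
have [Y hY] : inrows (map_mx Phi b1 - v1 *m map_mx Phi D1) (map_mx Phi (lam n)).
  apply: lam_rows => j; have := congr1 (fun w : 'rV[R']_n => w 0 j) hv.
  rewrite -eD -ev -eb !map_Psi -map_mxM !mxE => e; apply/eqP; rewrite rmorphB subr_eq0; apply/eqP.
  exact: e.
have [|a Ta [w hw]] := de _ _ (col_mx D1 (lam n)) b1.
  by exists (row_mx v1 Y); rewrite map_col_mx mul_row_col -hY addrC subrK.
exists (f a); first by exists a.
exists (map_mx f (lsubmx w)); rewrite -eb -eD -map_mxZ hw -[w in LHS]hsubmxK mul_row_col map_mxD !map_mxM.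
by rewrite lam0 mulmx0 addr0.
Qed.

End Quotients.

Section ArtinRees.
Variables (R : comNzRingType) (I : ideal R).
Hypothesis noethR : noetherian R.

Lemma pow_mono k l x : (k <= l)%N -> ideal_pow I l x -> ideal_pow I k x.
Proof.
move=> /subnK <-; elim: (l - k)%N => // n IH h; apply: IH; move: h; rewrite addSn.
rewrite /ideal_pow iterS -/(ideal_pow I _); apply: ideal_gen_sub => z [a [b [_ hb ->]]].
exact: ideal_M.
Qed.

Lemma pow_mul k l x y : ideal_pow I k x -> ideal_pow I l y -> ideal_pow I (k + l) (x * y).
Proof.
elim: k x => [|k IH] x hx hy; first exact: ideal_M.
pose J : ideal R := icolon (ideal_pow I (k.+1 + l)) y.
apply: (@ideal_gen_sub _ _ J _ x hx) => z [a [b [Ia hb ->]]].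
change (ideal_pow I (k.+1 + l) (a * b * y)); rewrite -mulrA.
by move=> M hM; apply: hM; exists a, (b * y); split=> //; apply: IH.
Qed.

(** [th] maps a polynomial ring onto the Rees algebra of [I]. The vectors whose coefficients all lie
    in the row space of [D] form a finitely generated module, and [c] bounds the degrees of its
    generators, so in degree [k + c] their multipliers lie in [I^k]. *)
Lemma artin_rees m n (D : 'M[R]_(m, n)) : exists c, forall k (w : 'rV[R]_m),
  (forall j, ideal_pow I (k + c) ((w *m D) 0 j)) ->
  exists2 w' : 'rV[R]_m, (forall i, ideal_pow I k (w' 0 i)) & w' *m D = w *m D.
Proof.
have [xs hxs] := noethR I; pose r := size xs.
pose pC : {rmorphism R -> {poly R}} := GRing.RMorphism.clone _ _ polyC _.
have [th [thC thX]] := mpoly_eval_ex pC (fun i : 'I_r => (xs`_i)%:P * 'X).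
pose rees (q : {poly R}) := forall a, ideal_pow I a q`_a.
have reesM p q : rees p -> rees q -> rees (p * q).
  move=> hp hq a; rewrite coefM; apply: ideal_sum => i _.
  rewrite -[a in ideal_pow I a _](subnKC (n := a) (m := i)); first exact: pow_mul.
  by rewrite -ltnS.
have reesC a : rees a%:P.
  by move=> [|b]; rewrite coefC; [exact: Logic.I | exact: (ideal_0 (ideal_pow I b.+1))].
have th_rees p : rees (th p).
  rewrite [p]mpolyE rmorph_sum => a; rewrite coef_sum; apply: ideal_sum => mm _; move: a.
  rewrite -mul_mpolyC rmorphM; apply: (reesM).
    by rewrite thC; apply: reesC.
  rewrite mpolyXE_id rmorph_prod; apply: (big_ind rees) => [||i _].
  - by rewrite -polyC1; apply: reesC.
  - exact: reesM.
  rewrite rmorphXn; elim: (mm i) => [|k IH]; first by rewrite expr0 -polyC1; apply: reesC.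
  rewrite exprS; apply: reesM IH => -[|[|a]]; rewrite thX; first exact: Logic.I.
    have -> : ((xs`_i)%:P * 'X)`_1 = xs`_i by rewrite coefMX coefC.
    move=> M hM; apply: hM; exists xs`_i, 1; rewrite mulr1; split=> //.
    by apply/hxs/ideal_span_mem/mem_nth.
  have -> : ((xs`_i)%:P * 'X)`_a.+2 = 0 by rewrite coefMX coefC.
  exact: ideal_0.
have th_pow k x : ideal_pow I k x -> exists p, th p = x%:P * 'X^k.
  elim: k x => [|k IH] x; first by exists x%:MP; rewrite thC expr0 mulr1.
  apply: (@ideal_gen_ind _ _ (fun x => exists p, th p = x%:P * 'X^(k.+1))).
  - by exists 0; rewrite rmorph0 polyC0 mul0r.
  - by move=> y z [p hp] [q hq]; exists (p + q); rewrite rmorphD hp hq polyCD mulrDl.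
  - by move=> a y [p hp]; exists (a%:MP * p); rewrite rmorphM thC hp polyCM mulrA.
  move=> _ [a [b [/hxs /ideal_spanE [cc ->] /IH [q hq] ->]]]; exists ((\sum_i (cc i)%:MP * 'X_i) * q).
  rewrite rmorphM hq rmorph_sum exprS polyCM mulrACA; congr (_ * _).
  rewrite rmorph_sum mulr_suml; apply: eq_bigr => i _.
  by rewrite rmorphM thC thX mulrA /pC /= -polyCM.
pose coefrow k (G : 'rV[{mpoly R[r]}]_n) : 'rV[R]_n := \row_j (th (G 0 j))`_k.
pose Np (G : 'rV[{mpoly R[r]}]_n) := forall k, inrows (coefrow k G) D.
have N0 : Np 0.
  move=> k; rewrite (_ : coefrow k 0 = 0); first exact: inrows0.
  by apply/rowP => j; rewrite !mxE rmorph0 coef0.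
have ND G H : Np G -> Np H -> Np (G + H).
  move=> hG hH k; rewrite (_ : coefrow k (G + H) = coefrow k G + coefrow k H); first exact: inrowsD.
  by apply/rowP => j; rewrite !mxE rmorphD coefD.
have coefrowZ k p G : coefrow k (p *: G) = \sum_(a < k.+1) (th p)`_a *: coefrow (k - a)%N G.
  by apply/rowP => j; rewrite !mxE rmorphM coefM summxE; apply: eq_bigr => a _; rewrite !mxE.
have NZ p G : Np G -> Np (p *: G).
  move=> hG k; rewrite coefrowZ; apply: (big_ind (fun v => inrows v D)) => [|v w|a _].
  - exact: inrows0.
  - exact: inrowsD.
  - exact: inrowsZ.
have [nP _] := mpoly_noeth_gldim r noethR.
have [l [G hG]] := noeth_rV nP (Submod N0 ND NZ).
have hrow i k : exists w : 'rV[R]_m, coefrow k (row i G) = w *m D.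
  have /hG h : inrows (row i G) G by apply/inrows_row/inrows_refl.
  by have [w e] := h k; exists w.
have [W hW] := choice (fun ik : 'I_l * nat => hrow ik.1 ik.2).
pose c := (\max_(ij : 'I_l * 'I_n) size (th (G ij.1 ij.2)))%N.
have big i k : (c <= k)%N -> coefrow k (row i G) = 0.
  move=> ck; apply/rowP => j; rewrite !mxE nth_default //.
  apply: leq_trans ck; exact: (leq_bigmax (F := fun ij : 'I_l * 'I_n => size (th (G ij.1 ij.2))) (i, j)).
exists c => k w hw; pose e := (k + c)%N.
have [F hF] := choice (fun j => th_pow _ _ (hw j)).
have : inrows (\row_j F j) G.
  apply/hG => a; have [->|ae] := eqVneq a e.
    exists w; apply/rowP => j; rewrite !mxE hF coefCM coefXn eqxx mulr1. by rewrite mxE.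
  rewrite (_ : coefrow a _ = 0); first exact: inrows0.
  by apply/rowP => j; rewrite !mxE hF coefCM coefXn (negbTE ae) mulr0.
move=> [p hp]; pose wt i a := if (e - a < c)%N then W (i, (e - a)%N) else 0.
exists (\sum_i \sum_(a < e.+1) (th (p 0 i))`_a *: wt i a).
  move=> j; rewrite summxE; apply: ideal_sum => i _; rewrite summxE; apply: ideal_sum => a _.
  rewrite mxE /wt; case: ltnP => h; last by rewrite mxE mulr0; apply: ideal_0.
  apply: ideal_Mr; apply: (pow_mono (l := a)); last exact: th_rees.
  by move: h; rewrite /e; have := ltn_ord a; lia.
have <- : coefrow e (\row_j F j) = w *m D.
  by apply/rowP => j; rewrite [LHS]mxE mxE hF coefCM coefXn eqxx mulr1.
rewrite mulmx_suml hp [p *m G]mulmx_sum_row.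
have coefsum (J : finType) (H : J -> 'rV[{mpoly R[r]}]_n) : coefrow e (\sum_i H i) = \sum_i coefrow e (H i).
  by apply/rowP => j; rewrite !mxE !summxE rmorph_sum coef_sum; apply: eq_bigr => i _; rewrite mxE.
rewrite coefsum; apply: eq_bigr => i _; rewrite coefrowZ mulmx_suml; apply: eq_bigr => a _.
rewrite -scalemxAl /wt; congr (_ *: _); case: ltnP => h; first by rewrite -hW.
by rewrite mul0mx big.
Qed.

(** Artin-Rees for [b] stacked over [D] puts [(1 - w) b] in the row space with [w] in [I], and
    [1 - w] is a unit. *)
Lemma intersection m n (D : 'M[R]_(m, n)) (b : 'rV[R]_n) : (forall x, I x -> in_jac x) ->
  (forall k, exists a : 'rV[R]_m, forall j, ideal_pow I k ((b - a *m D) 0 j)) -> inrows b D.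
Proof.
move=> jac h; have [c hc] := artin_rees (col_mx b D); have [a ha] := h (1 + c)%N.
have [|w' hw' e] := hc 1%N (row_mx 1%:M (- a)).
  by move=> j; rewrite mul_row_col mul1mx mulNmx; apply: ha.
move: e; rewrite -[w']hsubmxK !mul_row_col mul1mx mulNmx; set w1 := lsubmx w'; set w2 := rsubmx w' => e.
have Iw : I (w1 0 0).
  have := hw' (lshift _ 0); rewrite (_ : w' 0 (lshift m 0) = w1 0 0); last by rewrite mxE.
  change (ideal_mul I (unit_ideal R) (w1 0 0) -> I (w1 0 0)).
  apply: ideal_gen_sub => z [x [y [Ix _ ->]]]; exact: ideal_Mr.
have [u hu] := jac _ Iw (-1); rewrite mulN1r in hu.
have e2 : (1 - w1 0 0) *: b = (w2 + a) *m D.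
  have ew : w1 *m b = w1 0 0 *: b.
    by rewrite {1}[w1]mx11_scalar mul_scalar_mx.
  rewrite scalerBl scale1r -ew mulmxDl.
  have := congr1 (fun X => X - w1 *m b + a *m D) e; rewrite /= => e3.
  transitivity (b - a *m D - w1 *m b + a *m D); first by mxlin.
  by rewrite -e3; mxlin.
exists (u *: (w2 + a)); rewrite -scalemxAl -e2 scalerA mulrC hu scale1r.
by [].
Qed.

End ArtinRees.

(** * Faithful flatness of the completion *)

Section Completion.
Variables (R : comNzRingType) (I : ideal R).
Hypothesis noethR : noetherian R.
Hypothesis jac : forall x, I x -> in_jac x.
Local Notation Rh := (completion I).

Definition hatf (r : R) : quotient_prod I := fun n => \pi_(quotient (ideal_pow I n)) r.

Lemma hat_coherent r : coherent (hatf r).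
Proof. by apply/asboolP => n; exists r. Qed.

Definition hat (r : R) : Rh := exist _ (hatf r) (hat_coherent r).

Lemma hat_B : {morph hat : x y / x - y}.
Proof. by move=> x y; apply: val_inj; apply: functional_extensionality_dep => n; apply: pi_quotientB. Qed.

Lemma hat_M : multiplicative hat.
Proof.
split=> [x y|]; apply: val_inj; apply: functional_extensionality_dep => n //=.
by symmetry; apply: pi_quotientM.
Qed.

HB.instance Definition _ := GRing.isZmodMorphism.Build R Rh hat hat_B.
HB.instance Definition _ := GRing.isMultiplicative.Build R Rh hat hat_M.

Definition proj n (x : Rh) : quotient (ideal_pow I n) := val x n.

Lemma proj_B n : {morph proj n : x y / x - y}. Proof. by []. Qed.
Lemma proj_M n : multiplicative (proj n). Proof. by []. Qed.

HB.instance Definition _ n := GRing.isZmodMorphism.Build Rh (quotient (ideal_pow I n)) (proj n) (proj_B n).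
HB.instance Definition _ n := GRing.isMultiplicative.Build Rh (quotient (ideal_pow I n)) (proj n) (proj_M n).

Lemma proj_hat n r : proj n (hat r) = qpi (ideal_pow I n) r. Proof. by []. Qed.

Lemma proj_ext (x y : Rh) : (forall n, proj n x = proj n y) -> x = y.
Proof. by move=> h; apply: val_inj; apply: functional_extensionality_dep => n; apply: h. Qed.

Definition rep n (x : Rh) : R := repr (proj n x).
Lemma repE n x : qpi (ideal_pow I n) (rep n x) = proj n x.
Proof. by rewrite /rep /qpi reprK. Qed.

Lemma qpiB J (x y : R) : qpi J x = qpi J y <-> J (x - y). Proof. exact: quotientE. Qed.

Lemma rep_step n x : ideal_pow I n (rep n.+1 x - rep n x).
Proof.
have /asboolP /(_ n) [r [e1 e2]] := valP x.
have h1 : ideal_pow I n (rep n x - r) by apply/qpiB; rewrite repE.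
have h2 : ideal_pow I n.+1 (rep n.+1 x - r) by apply/qpiB; rewrite repE.
have -> : rep n.+1 x - rep n x = (rep n.+1 x - r) - (rep n x - r) by ring.
by apply: ideal_B => //; apply: (pow_mono (leqnSn n) h2).
Qed.

Lemma rep_le n k x : ideal_pow I n (rep (n + k) x - rep n x).
Proof.
elim: k => [|k IH]; first by rewrite addn0 subrr; apply: ideal_0.
have -> : rep (n + k.+1) x - rep n x = (rep (n + k).+1 x - rep (n + k) x) + (rep (n + k) x - rep n x).
  by rewrite addnS; ring.
by apply: ideal_D => //; apply: (pow_mono (leq_addr k n)); apply: rep_step.
Qed.

Lemma limit (a : nat -> R) : (forall n, ideal_pow I n (a n.+1 - a n)) ->
  exists x : Rh, forall n, proj n x = qpi (ideal_pow I n) (a n).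
Proof.
move=> h; pose y : quotient_prod I := fun n => qpi (ideal_pow I n) (a n).
have cy : coherent y.
  apply/asboolP => n; exists (a n.+1); split=> //.
  by apply/qpiB; rewrite -opprB; apply: ideal_N.
by exists (exist _ y cy).
Qed.

Lemma proj_term n (x : Rh) a r : qpi (ideal_pow I n) a = proj n x -> qpi (ideal_pow I n) (a * r) = proj n (x * hat r).
Proof. by move=> e; have [h _] := qpi_M (ideal_pow I n); rewrite h e. Qed.

(** The truncations of [v] are approximate solutions, which Artin-Rees for [D] corrects to exact
    solutions [z k] close to [v]; these are combinations of the syzygies [W], and the coefficients
    can be chosen to converge. *)
Lemma hat_flat : flat (GRing.RMorphism.clone _ _ hat _).
Proof.
move=> m n D v vD; have [p [W exW]] := syz_exists noethR D.
have [c hc] := artin_rees I noethR D; have [c' hc'] := artin_rees I noethR W.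
pose a k : 'rV[R]_m := \row_i rep k (v 0 i).
have aD k j : ideal_pow I k ((a k *m D) 0 j).
  apply/qpi_eq0; rewrite mxE rmorph_sum.
  have := congr1 (fun w : 'rV[Rh]_n => proj k (w 0 j)) vD; rewrite !mxE /= rmorph_sum rmorph0 => e.
  rewrite -[RHS]e; apply: eq_bigr => i _; rewrite [in RHS]mxE.
  by apply: proj_term; rewrite mxE repE.
have hz k : exists z : 'rV[R]_m, z *m D = 0 /\ forall i, ideal_pow I k ((z - a k) 0 i).
  have [w' hw' e] := hc k (a (k + c)%N) (fun j => aD _ j).
  exists (a (k + c)%N - w'); split=> [|i]; first by rewrite mulmxBl e subrr.
  have -> : (a (k + c)%N - w' - a k) 0 i = (rep (k + c) (v 0 i) - rep k (v 0 i)) - w' 0 i.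
    by rewrite !mxE; ring.
  by apply: ideal_B => //; apply: rep_le.
have [z hz'] := choice hz.
have dz k i : ideal_pow I k ((z k.+1 - z k) 0 i).
  have -> : (z k.+1 - z k) 0 i = (z k.+1 - a k.+1) 0 i - (z k - a k) 0 i + (rep k.+1 (v 0 i) - rep k (v 0 i)).
    by rewrite !mxE; ring.
  apply: ideal_D; last exact: rep_step.
  by apply: ideal_B; [apply: (pow_mono (leqnSn k)); exact: (hz' k.+1).2 | exact: (hz' k).2].
have zW k : exists u : 'rV[R]_p, z k = u *m W by have [e _] := hz' k; have [u eu] := exW.2 _ e; exists u.
have [u0 hu0] := zW c'.
(* Artin-Rees for [W] makes the increments of the coefficients lie in [I^k], so that their sums have
   a limit. *)
have step k : exists de : 'rV[R]_p, (forall i, ideal_pow I k (de 0 i)) /\ de *m W = z (k + c').+1 - z (k + c')%N.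
  have [u hu] := zW (k + c').+1; have [u' hu'] := zW (k + c')%N.
  have [|de h1 h2] := hc' k (u - u'); last by exists de; split=> //; rewrite h2 mulmxBl -hu -hu'.
  by move=> j; rewrite mulmxBl -hu -hu'; apply: dz.
have [de hde] := choice step.
pose f k := u0 + \sum_(l < k) de l.
have fW k : f k *m W = z (k + c')%N.
  rewrite /f mulmxDl -hu0; elim: k => [|k IH]; first by rewrite big_ord0 mul0mx addr0.
  by rewrite big_ord_recr mulmxDl addrA IH (hde k).2 addrC subrK.
have fstep k i : ideal_pow I k (f k.+1 0 i - f k 0 i).
  have -> : f k.+1 0 i - f k 0 i = de k 0 i by rewrite /f big_ord_recr !mxE; ring.
  exact: (hde k).1.
have [y hy] := choice (fun i => limit (fun k => fstep k i)).
exists p, W; first exact: exact_mul0 exW.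
exists (\row_i y i); apply/rowP => j; apply: proj_ext => k.
rewrite [in RHS]mxE rmorph_sum.
transitivity (qpi (ideal_pow I k) ((f k *m W) 0 j)); last first.
  rewrite mxE rmorph_sum; apply: eq_bigr => i _.
  by rewrite [(\row_i0 y i0) 0 i]mxE [(map_mx _ W) i j]mxE; apply: proj_term; rewrite hy.
rewrite fW -repE; apply/qpiB; rewrite -opprB; apply: ideal_N.
have -> : z (k + c')%N 0 j - rep k (v 0 j) = (z (k + c')%N - a (k + c')%N) 0 j + (rep (k + c') (v 0 j) - rep k (v 0 j)).
  by rewrite !mxE; ring.
apply: ideal_D; last exact: rep_le.
apply: (pow_mono (leq_addr c' k)); exact: (hz' (k + c')%N).2.
Qed.

(** Truncating a solution over the completion solves the system modulo every power of [I], and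
    [intersection] applies. *)
Lemma hat_descends : descends (GRing.RMorphism.clone _ _ hat _) (fun a => a = 1).
Proof.
move=> m n D b [v hv]; exists 1 => //; rewrite scale1r; apply: (intersection noethR jac) => k.
exists (\row_i rep k (v 0 i)) => j; apply/qpi_eq0; rewrite addmxE oppmxE rmorphB.
apply/eqP; rewrite subr_eq0; apply/eqP.
have := congr1 (fun w : 'rV[Rh]_n => proj k (w 0 j)) hv; rewrite !mxE /= rmorph_sum proj_hat => ->.
rewrite rmorph_sum; apply: eq_bigr => i _; rewrite [in LHS]mxE.
by apply: esym; apply: proj_term; rewrite mxE repE.
Qed.

End Completion.

(** * Ext and projective resolutions *)

Section RowImage.
Variables (R : comPzRingType) (p m : nat) (D : 'M[R]_(p, m)).

(** [projective] quantifies over modules, so lifting into a row space requires it as a module. *)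
Definition row_image : pred 'rV[R]_m := fun w => `[< inrows w D >].

Lemma row_image_closed : submod_closed row_image.
Proof.
split=> [|a x y /asboolP hx /asboolP hy]; first by apply/asboolP; exact: inrows0.
by apply/asboolP; apply: inrowsD => //; apply: inrowsZ.
Qed.

HB.instance Definition _ := GRing.isSubmodClosed.Build R 'rV[R]_m row_image row_image_closed.

Definition row_image_type : Type := {w : 'rV[R]_m | row_image w}.
HB.instance Definition _ := SubChoice.on row_image_type.
HB.instance Definition _ :=
  GRing.SubChoice_isSubLmodule.Build R 'rV[R]_m row_image row_image_type row_image_closed.

End RowImage.

Section Edge.
Variable R : comPzRingType.
Implicit Types (X Y M N : lmodType R).

Lemma linear_ex X Y (f : X -> Y) : (forall a x y, f (a *: x + y) = a *: f x + f y) ->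
  exists F : {linear X -> Y}, forall x, F x = f x.
Proof.
move=> hf; pose i := GRing.isLinear.Build R X Y *:%R f hf.
by exists (HB.pack_for {linear X -> Y} f i).
Qed.

Lemma free_map n Y (y : 'I_n -> Y) : exists F : {linear 'rV[R]_n -> Y}, forall v, F v = \sum_i v 0 i *: y i.
Proof.
apply: linear_ex => a u v; rewrite scaler_sumr -big_split; apply: eq_bigr => i _.
by rewrite !mxE scalerDl scalerA.
Qed.

Lemma projective_lift X p m (D : 'M[R]_(p, m)) (h : {linear X -> 'rV[R]_m}) : projective X ->
  (forall x, inrows (h x) D) -> exists k : {linear X -> 'rV[R]_p}, forall x, k x *m D = h x.
Proof.
move=> pX hD; pose T := row_image_type D.
pose mk w (hw : inrows w D) : T := exist _ w (asboolT hw).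
have [g hg] : exists g : {linear 'rV[R]_p -> T}, forall v, g v = mk _ (inrows_mul v D).
  by apply: linear_ex => a u v; apply: val_inj; rewrite /= mulmxDl scalemxAl.
have [f hf] : exists f : {linear X -> T}, forall x, f x = mk _ (hD x).
  by apply: linear_ex => a u v; apply: val_inj; rewrite /= linearP.
have [y|k hk] := pX _ _ g f.
  have /asboolP [v ev] := valP y; exists v; rewrite hg; apply: val_inj; exact: esym ev.
by exists k => x; have := congr1 val (hk x); rewrite hg hf.
Qed.

Section Compare.
Variables (M : lmodType R) (C : cpx R) (g' : 'I_(dim C 0) -> M).
Hypothesis exC : exactc C.
Hypothesis gen' : forall x, exists a : 'rV[R]_(dim C 0), x = \sum_i a 0 i *: g' i.
Hypothesis rel : forall v : 'rV[R]_(dim C 0), \sum_i v 0 i *: g' i = 0 <-> inrows v (dif C 0).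
Variable P : projective_resolution M.

Lemma to_resolution : exists al : forall i, {linear 'rV[R]_(dim C i) -> res_mod P i},
  (forall v, res_aug P (al 0%N v) = \sum_i v 0 i *: g' i) /\
  forall i v, res_diff P i (al i.+1 v) = al i (v *m dif C i).
Proof.
pose good i (a : {linear 'rV[R]_(dim C i) -> res_mod P i}) := forall v, exists z, res_diff P i z = a (v *m dif C i).
have step i (a : {a | good i a}) : exists b : {b | good i.+1 b},
    forall v, res_diff P i (sval b v) = sval a (v *m dif C i).
  case: a => a ga /=.
  have [z hz] := choice (fun k => ga (delta_mx 0 k)).
  have [b hb] := free_map z.
  have hb' v : res_diff P i (b v) = a (v *m dif C i).
    rewrite hb linear_sum {2}[v]row_sum_delta mulmx_suml linear_sum; apply: eq_bigr => k _.
    by rewrite linearZ hz -scalemxAl linearZ.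
  suff gb : good i.+1 b by exists (exist _ b gb).
  by move=> v; apply/res_exactS; rewrite hb' -mulmxA (exact_mul0 (exC i)) mulmx0 linear0.
have [y hy] := choice (fun i => res_aug_surj P (g' i)).
have [a0 ha0] := free_map y.
have aug0 v : res_aug P (a0 v) = \sum_i v 0 i *: g' i.
  by rewrite ha0 linear_sum; apply: eq_bigr => i _; rewrite linearZ hy.
have g0 : good 0%N a0 by move=> v; apply/res_exact0; rewrite aug0; apply/rel/inrows_mul.
pose F i := projT1 (choice (step i)); have hF i := projT2 (choice (step i)).
pose s := nat_rect (fun i => {a | good i a}) (exist _ a0 g0) F.
by exists (fun i => sval (s i)); split=> // i v; apply: hF.
Qed.

Lemma from_resolution : exists be : forall i, {linear res_mod P i -> 'rV[R]_(dim C i)},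
  (forall x, \sum_i (be 0%N x) 0 i *: g' i = res_aug P x) /\
  forall i x, be i.+1 x *m dif C i = be i (res_diff P i x).
Proof.
pose good i (b : {linear res_mod P i -> 'rV[R]_(dim C i)}) := forall x, inrows (b (res_diff P i x)) (dif C i).
have step i (b : {b | good i b}) : exists c : {c | good i.+1 c},
    forall x, sval c x *m dif C i = sval b (res_diff P i x).
  case: b => b gb /=.
  pose h : {linear res_mod P i.+1 -> 'rV[R]_(dim C i)} := GRing.Linear.clone _ _ _ _ (b \o res_diff P i) _.
  have [c hc] := @projective_lift _ _ _ _ h (@res_projective _ _ P i.+1) gb.
  suff gc : good i.+1 c by exists (exist _ c gc).
  move=> x; apply: exact_inrows (exC i) _; rewrite hc /=.
  have -> : res_diff P i (res_diff P i.+1 x) = 0 by apply/res_exactS; exists x.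
  exact: linear0.
have [pi hpi] := free_map g'.
have [y|b0 hb0] := res_projective (p := P) (n := 0%N) (g := pi) (res_aug P).
  by have [a ->] := gen' y; exists a; rewrite hpi.
have g0 : good 0%N b0.
  move=> x; apply/rel; rewrite -hpi hb0; apply/res_exact0; by exists x.
pose F i := projT1 (choice (step i)); have hF i := projT2 (choice (step i)).
pose s := nat_rect (fun i => {a | good i a}) (exist _ b0 g0) F.
exists (fun i => sval (s i)); split=> [x|i x]; last exact: hF.
by rewrite /= -hpi hb0.
Qed.

(** The hypothesis concerns an arbitrary projective resolution: the cocycle is carried there by
    [be], bounded, and brought back by [al]; [be] after [al] is homotopic to the identity of [C]. *)
Lemma ext_matrix N q (y : 'I_q -> N) e (E : 'M[R]_(e, q)) i :
  (forall x, exists a : 'rV[R]_q, x = \sum_l a 0 l *: y l) ->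
  (forall v : 'rV[R]_q, \sum_l v 0 l *: y l = 0 <-> inrows v E) ->
  (forall f : {linear res_mod P i.+1 -> N}, cocycle f -> coboundary f) -> ext0 C i E.
Proof.
move=> genN relN ext f hf.
have [al [al0 alS]] := to_resolution; have [be [be0 beS]] := from_resolution.
have [piN hN] := free_map y.
have [phi hphi] : exists phi : {linear res_mod P i.+1 -> N}, forall x, phi x = piN (be i.+1 x *m f).
  by apply: linear_ex => a u v; rewrite linearP mulmxDl -scalemxAl linearP.
have cphi : cocycle phi.
  move=> x; rewrite hphi -beS -mulmxA hN; apply/relN; exact: inrowsM.
have [ga hga] := ext phi cphi.
have [G hG] := choice (fun k => genN (ga (al i (delta_mx 0 k)))).
pose g1 : 'M[R]_(dim C i, q) := \matrix_k G k.
have g1E v : piN (v *m g1) = ga (al i v).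
  rewrite mulmx_sum_row linear_sum {2}[v]row_sum_delta !linear_sum; apply: eq_bigr => k _.
  by rewrite !linearZ rowK hN -hG.
pose c k : 'M[R]_(dim C k, dim C k) := \matrix_l be k (al k (delta_mx 0 l)).
have cE k v : v *m c k = be k (al k v).
  rewrite mulmx_sum_row {2}[v]row_sum_delta !linear_sum; apply: eq_bigr => l _.
  by rewrite rowK !linearZ.
have cm k : dif C k *m (c k - 1%:M) = (c k.+1 - 1%:M) *m dif C k.
  rewrite mulmxBr mulmxBl mulmx1 mul1mx; congr (_ - _); apply/row_matrixP => l.
  by rewrite !row_mul cE [row l (c _)]rowK beS alS -rowE.
have [h0 hh0] : inrows (c 0%N - 1%:M) (dif C 0).
  apply: inrowsP => l; apply/rel; rewrite raddfB /= rowK row1.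
  have -> : \sum_i (be 0%N (al 0%N (delta_mx 0 l)) - delta_mx 0 l) 0 i *: g' i =
      \sum_i (be 0%N (al 0%N (delta_mx 0 l))) 0 i *: g' i - \sum_i (delta_mx 0 l : 'rV_(dim C 0)) 0 i *: g' i.
    by rewrite -sumrB; apply: eq_bigr => k _; rewrite addmxE oppmxE scalerBl.
  by rewrite be0 al0 subrr.
have [||h [h' hh]] := chain_null exC (fun i => (exC i).1) cm (k := 0) (d := 0) (h0 := 0) (h1 := h0) _ _ i.
- by rewrite mulmx0.
- by rewrite mulmx0 add0r hh0.
exists (g1 - h *m f).
have -> : f - dif C i *m (g1 - h *m f) =
    (c i.+1 *m f - dif C i *m g1) - h' *m (dif C i.+1 *m f).
  have -> : c i.+1 = dif C i *m h + h' *m dif C i.+1 + 1%:M by rewrite -hh subrK.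
  by rewrite !mulmxDl mul1mx mulmxBr !mulmxA; mxlin.
apply: inrowsD; last by apply/inrowsN/inrowsM.
apply: inrowsP => l; apply/relN; rewrite -hN raddfB linearB /= !row_mul g1E rowK -hphi hga.
by rewrite alS -rowE subrr.
Qed.

(** The projector [1 - E d_0] kills the relations, so lifting on generators after applying it does
    not depend on the representative. *)
Lemma split_projective : splitm (dif C 0) -> projective M.
Proof.
move=> [E hE] X Y G f surj.
have [x hx] := choice (fun i => surj (f (g' i))); have [F hF] := free_map x.
have [rep hrep] := choice gen'.
pose Pi := 1%:M - E *m dif C 0.
have Pi0 v : inrows v (dif C 0) -> v *m Pi = 0.
  by case=> W ->; rewrite -mulmxA mulmxBr mulmx1 mulmxA hE subrr mulmx0.
have relB (v w : 'rV[R]_(dim C 0)) : \sum_i (v - w) 0 i *: g' i = \sum_i v 0 i *: g' i - \sum_i w 0 i *: g' i.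
  by rewrite -sumrB; apply: eq_bigr => i _; rewrite addmxE oppmxE scalerBl.
have [h hh] : exists h : {linear M -> X}, forall m, h m = F (rep m *m Pi).
  apply: linear_ex => a u v; rewrite -linearZ -linearD scalemxAl -mulmxDl.
  congr (F _); apply/eqP; rewrite -subr_eq0 -mulmxBl; apply/eqP/Pi0/rel.
  rewrite relB -hrep [X in _ - X](_ : _ = a *: u + v) ?subrr //.
  rewrite {2}[u]hrep {2}[v]hrep scaler_sumr -big_split; apply: eq_bigr => i _.
  by rewrite addmxE scalemxE scalerDl scalerA.
exists h => m; rewrite hh hF linear_sum.
transitivity (f (\sum_i (rep m *m Pi) 0 i *: g' i)).
  by rewrite linear_sum; apply: eq_bigr => i _; rewrite !linearZ hx.
rewrite mulmxBr mulmx1 relB -hrep mulmxA (_ : \sum_i _ = 0) ?subr0 //.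
by apply/rel/inrows_mul.
Qed.

End Compare.

(** [M] resolves itself, with zero modules in positive degrees. *)
Lemma projective_Ext M N i : projective M -> (0 < i)%N -> Ext_eq0 i M N.
Proof.
move=> pM; pose T k : lmodType R := if k is 0%N then M else 'rV[R]_0.
have z0 (y : 'rV[R]_0) : y = 0 by apply: thinmx0.
have pT k : projective (T k).
  case: k => [|k] //= X Y G f _; exists \0 => p.
  by rewrite [p]z0 !linear0.
have e0 (y : M) : (idfun : {linear T 0%N -> M}) y = 0 <->
    exists z : T 1%N, (\0 : {linear T 1%N -> T 0%N}) z = y.
  by split=> [/= ->|[z <-]] //; exists 0.
have eS k (y : T k.+1) : (\0 : {linear T k.+1 -> T k}) y = 0 <->
    exists z : T k.+2, (\0 : {linear T k.+2 -> T k.+1}) z = y.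
  by split=> // _; exists 0; rewrite [y]z0.
pose P := @ProjectiveResolution R M T (fun k => \0) idfun pT (fun x => ex_intro _ x erefl) e0 eS.
by case: i => // j _; exists P => f _; exists \0 => x; rewrite [x]z0 linear0.
Qed.

End Edge.

Lemma SAC_of_strongSAC (R : comPzRingType) : noetherian R -> strongSAC R -> SAC R.
Proof.
move=> nR sR M [n [g hg]] extRo [k extM].
have K0 : \sum_i (0 : 'rV[R]_n) 0 i *: g i = 0.
  by rewrite big1 // => i _; rewrite zeromxE scale0r.
have KD (x y : 'rV[R]_n) : \sum_i x 0 i *: g i = 0 -> \sum_i y 0 i *: g i = 0 ->
    \sum_i (x + y) 0 i *: g i = 0.
  move=> hx hy; transitivity (\sum_i x 0 i *: g i + \sum_i y 0 i *: g i).
    by rewrite -big_split; apply: eq_bigr => i _; rewrite addmxE scalerDl.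
  by rewrite hx hy addr0.
have KZ a (x : 'rV[R]_n) : \sum_i x 0 i *: g i = 0 -> \sum_i (a *: x) 0 i *: g i = 0.
  move=> hx; transitivity (a *: \sum_i x 0 i *: g i); last by rewrite hx scaler0.
  by rewrite scaler_sumr; apply: eq_bigr => i _; rewrite scalemxE scalerA.
have [p [D hD]] := noeth_rV nR (Submod K0 KD KZ).
pose C := resol nR D; have exC : exactc C by apply: resol_exact.
have gen x : exists a : 'rV[R]_(dim C 0), x = \sum_i a 0 i *: g i.
  have [a ->] := hg x; exists (\row_i a i); apply: eq_bigr => i _; by rewrite mxE.
have extA (N : lmodType R) q (y : 'I_q -> N) e (E : 'M[R]_(e, q)) j :
    (forall x, exists a : 'rV[R]_q, x = \sum_l a 0 l *: y l) ->
    (forall v : 'rV[R]_q, \sum_l v 0 l *: y l = 0 <-> inrows v E) ->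
    Ext_eq0 j.+1 M N -> ext0 C j E.
  move=> genN relN [P hP]; exact (@ext_matrix R M C g exC gen hD P N q y e E j genN relN hP).
suff sD : splitm (dif C 0).
  by move=> i; apply: projective_Ext; exact (@split_projective R M C g gen hD sD).
apply: (sR C exC) => [j q f df|].
  (* The hypothesis has coefficients of rank one, so a matrix of cochains is bounded column by
     column. *)
  have hcol (l : 'I_q) : exists h : 'cV[R]_(dim C j), col l f = dif C j *m h.
    have [||||h [W]] := @extA R^o 1%N (fun=> 1) 0%N 0 j _ _ _ (col l f).
    - by move=> x; exists (const_mx x); rewrite big_ord1 mxE [_ *: _]mulr1.
    - move=> v; rewrite big_ord1 [_ *: _]mulr1; split=> [v0|[W ->]]; last by rewrite mulmx0 mxE.
      by rewrite (_ : v = 0); [exact: inrows0 | apply/rowP => z; rewrite ord1 v0 mxE].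
    - exact: extRo.
    - by rewrite colE mulmxA df mul0mx; apply: inrows0.
    by rewrite mulmx0 => /eqP; rewrite subr_eq0 => /eqP ->; exists h.
  have [h hh] := choice hcol; exists (\matrix_(a, l) h l a 0).
  apply/matrixP => a l; have /matrixP /(_ a 0) := hh l; rewrite !mxE => ->.
  by apply: eq_bigr => z _; rewrite mxE.
exists k => j kj; apply: (@extA M _ g _ (dif C 0)) => //.
by apply: extM; apply: leq_trans kj _.
Qed.

(** * Descent to the completed localizations *)

(** Repeated columns give zero and sorting distinct ones costs a sign; this links [dets] with the
    increasing selections of [minor_of]. *)
Lemma minors_sorted (B : comPzRingType) s t (X : 'I_s -> 'I_t -> B) (g : 'I_s -> 'I_t) :
  let M := \matrix_(i, k) X i (g k) in
  \det M = 0 \/ exists (h : 'I_s -> 'I_t) (b : bool),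
    {homo h : i j / (i < j)%N} /\ \det M = (-1) ^+ b * \det (\matrix_(i, k) X i (h k)).
Proof.
move=> M; have [inj|ninj] := pselect (injective g); last first.
  left; have [i [j [ne eg]]] : exists i j, i != j /\ g i = g j.
    apply: contrapT => h; apply: ninj => i j eg; apply: contrapT => ne.
    by apply: h; exists i, j; split=> //; apply/eqP.
  by rewrite -det_tr; apply: (determinant_alternate ne) => k; rewrite !mxE eg.
right; pose T := [tuple g i | i < s]; pose r := sort (relpre val leq) T.
have /tuple_permP [p hp] : perm_eq r T by rewrite perm_sort.
pose h (i : 'I_s) := g (p i).
have sr : sorted ltn (map val r).
  rewrite -sort_map ltn_sorted_uniq_leq sort_uniq map_inj_uniq; last exact: val_inj.
  rewrite (sort_sorted leq_total) andbT.
  by apply/tuple_uniqP => i j; rewrite !tnth_mktuple => /inj.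
have rE : map val r = [seq val (h i) | i <- enum 'I_s].
  by rewrite hp -map_comp; apply: eq_map => i /=; rewrite tnth_mktuple.
exists h, (odd_perm p); split=> [i j ij|].
  have n0 (k : 'I_s) : nth 0%N (map val r) k = h k.
    by rewrite rE (nth_map k) ?size_enum_ord // nth_ord_enum.
  rewrite -!n0; apply: (sorted_ltn_nth ltn_trans 0%N sr) => //;
    by rewrite inE rE size_map size_enum_ord.
have -> : \matrix_(i, k) X i (h k) = col_perm p M by apply/matrixP => i k; rewrite !mxE.
by rewrite col_permE det_mulmx det_perm odd_permV mulrCA -signr_addb addbb mulr1.
Qed.

Lemma determinantal_ideal_span (A : comNzRingType) s t :
  ideal_eq (determinantal_ideal A s t s) (ideal_span (dets (fun i j => 'X_(mxvec_index i j) : {mpoly A[s * t]}))).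
Proof.
pose X (i : 'I_s) (j : 'I_t) : {mpoly A[s * t]} := 'X_(mxvec_index i j).
move=> x; split; apply: ideal_gen_sub => y; last first.
  move=> /mapP [g _ ->]; have [->|[h [b [incr ->]]]] := minors_sorted X g; first exact: ideal_0.
  apply: ideal_M => J; apply; exists id, h; split=> //.
  by congr (\det _); apply/matrixP => i j; rewrite !mxE.
move=> [f [g [incr _ ->]]]; have injf : injective f.
  move=> i j e; apply: val_inj; have [/incr|/incr|//] := ltngtP i j; by rewrite e ltnn.
have -> : mxsub f g (generic_mx A s t) = row_perm (perm injf) (\matrix_(i, k) X i (g k)).
  by apply/matrixP => i j; rewrite !mxE permE.
by rewrite row_permE det_mulmx; apply: ideal_M; apply: ideal_span_mem; apply: dets_mem.
Qed.

Lemma flat_descends_comp (R S U : comPzRingType) (f : {rmorphism R -> S}) (g : {rmorphism S -> U}) T :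
  flat f -> descends f T -> flat g -> descends g (fun a => a = 1) ->
  exists h : {rmorphism R -> U}, flat h /\ descends h T.
Proof.
move=> ff df fg dg; exists (GRing.RMorphism.clone _ _ (g \o f) _); split; first exact: flat_comp.
move=> m n D b; rewrite (map_mx_comp f g b) (map_mx_comp f g D) => /dg [_ ->].
by rewrite scale1r; apply: df.
Qed.

Lemma completion_faithfully_flat (L : comPzRingType) (m : ideal L) : noetherian L -> local_ring_at m ->
  exists h : {rmorphism L -> completion m}, flat h /\ descends h (fun a => a = 1).
Proof.
move=> nL locm; have ne : (1 : L) != 0.
  by apply/eqP => e; case: locm => [[m1 _] _]; apply: m1; rewrite e; apply: ideal_0.
have [L' eL] := nontrivial_pack ne; subst L.
exists (GRing.RMorphism.clone _ _ (hat m) _); split; first exact: hat_flat.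
exact: (hat_descends nL (fun x mx => local_jac nL locm mx)).
Qed.

(** The completion is exchanged for the isomorphic [Q / (s)], and both rings are repacked as nonzero
    rings so that polynomial rings over them exist. *)
Lemma complete_intersection_cover (L : comPzRingType) : complete_intersection L ->
  exists (K Q : comNzRingType) (h : {rmorphism L -> K}) (f : {rmorphism Q -> K}) (s : seq Q) d,
    [/\ flat h /\ descends h (fun a => a = 1), noetherian Q /\ gldim_le Q d, wregular s,
        forall y, exists x, f x = y & forall x, f x = 0 <-> ideal_span s x].
Proof.
move=> [nL [m [locm [Q [rQ [s [[s1 reg] [g bg]]]]]]]].
have [h [fh dh]] := completion_faithfully_flat nL locm.
have [d gQ] := regular_local_gldim rQ.
have neQ : (1 : Q) != 0 by apply/eqP => e; apply: s1; rewrite e; apply: ideal_0.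
have : exists (K : comPzRingType) (h : {rmorphism L -> K}) (f : {rmorphism Q -> K}),
    [/\ (1 : K) != 0, flat h, descends h (fun a => a = 1),
        forall y, exists x, f x = y & forall x, f x = 0 <-> ideal_span s x].
  exists (quotient (ideal_span s)).
  have locg : is_loc g (mult_one _).
    case: bg => g' gK g'K; apply: iso_loc => [y|x e]; first by exists (g' y).
    by rewrite -[x]gK e -(rmorph0 g) gK.
  have [h2 [fh2 dh2]] := flat_descends_comp fh dh (loc_flat locg) (loc_descends locg).
  exists h2, (GRing.RMorphism.clone _ _ (qpi (ideal_span s)) _); split=> //.
  - by apply/eqP => e; apply/s1/qpi_eq0; exact: e.
  - exact: qpi_surj.
  - exact: qpi_eq0.
move=> [K [h2 [f [neK fh2 dh2 fs fk]]]].
have [K' eK] := nontrivial_pack neK; subst K.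
have [Q' eQ] := nontrivial_pack neQ; subst Q.
by exists K', Q', h2, f, s, d; split=> //; split=> //; case: rQ.
Qed.

Lemma strongSAC_determinantal_ring (A : comNzRingType) s' t : noetherian A ->
  (forall (m : ideal A) (hm : maximal_ideal m), complete_intersection (localization_at (maximal_prime hm))) ->
  (s'.+1 <= t)%N -> (2 * s'.+1 <= t + 1)%N -> strongSAC (determinantal_ring A s'.+1 t s'.+1).
Proof.
move=> nA ciA st h2; pose N := (s'.+1 * t)%N; pose e := @mxvec_index s'.+1 t.
have einj i j i' j' : e i j = e i' j' -> i = i' /\ j = j'.
  by move=> /cast_ord_inj/enum_rank_inj [].
set R := determinantal_ring _ _ _ _.
pose L : seq {mpoly A[N]} := dets (fun i j => 'X_(e i j)).
pose f : {rmorphism {mpoly A[N]} -> R} := GRing.RMorphism.clone _ _ (qpi (determinantal_ideal A s'.+1 t s'.+1)) _.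
have surj y : exists x, f x = y := qpi_surj y.
have ker x : f x = 0 <-> ideal_span L x.
  by split=> [/qpi_eq0/determinantal_ideal_span|/determinantal_ideal_span h] //; apply/qpi_eq0.
clearbody f; move=> C exC extRC [k extC].
pose f0 : {rmorphism A -> R} := GRing.RMorphism.clone _ _ (f \o @mpolyC N A) _.
(* The elements of [A] splitting [d_0] form an ideal; were it proper, it would lie in a maximal
   ideal [m], but descent from the completion at [m] produces a member outside [m]. *)
pose J := splitup_ideal (dif C 0).
have I0 : J (f0 0) by rewrite rmorph0; apply: ideal_0.
have ID x y : J (f0 x) -> J (f0 y) -> J (f0 (x + y)) by rewrite rmorphD; apply: ideal_D.
have IM a x : J (f0 x) -> J (f0 (a * x)) by rewrite rmorphM; apply: ideal_M.
pose I := Ideal I0 ID IM.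
suff [E hE] : I 1 by exists E; rewrite hE rmorph1 scale1r.
apply: contrapT => nI1; have [m mm sub] := maximal_above nA nI1.
have [K [Q [h [g [s [d [[fh dh] [nQ gQ] reg gs gk]]]]]]] := complete_intersection_cover (ciA m mm).
have loc := locmap_loc (prime_compl (maximal_prime mm)).
have [phi [fphi dphi]] := flat_descends_comp (loc_flat loc) (loc_descends loc) fh dh.
pose Phi : {rmorphism {mpoly A[N]} -> {mpoly K[N]}} := GRing.RMorphism.clone _ _ (map_mpoly phi) _.
have flPhi : flat Phi := flat_mpoly fphi.
have dePhi := @descends_mpoly N _ _ _ _ dphi.
pose LK := map Phi L; pose RK : comPzRingType := quotient (ideal_span LK).
pose f' : {rmorphism {mpoly K[N]} -> RK} := GRing.RMorphism.clone _ _ (qpi (ideal_span LK)) _.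
have surj' y : exists x, f' x = y := qpi_surj y.
have ker' x : f' x = 0 <-> ideal_span LK x := qpi_eq0 _ x.
clearbody f'; have [|Psi PsiE] := surj_lift (p := f) (f := GRing.RMorphism.clone _ _ (f' \o Phi) _) surj.
  move=> x /ker/ideal_spanE [c ->]; apply/ker'; rewrite rmorph_sum; apply: ideal_sum => i _.
  by rewrite rmorphM; apply/ideal_M/ideal_span_mem/map_f/mem_nth.
have flPsi : flat Psi := flat_quotient surj surj' ker ker' PsiE flPhi.
have dePsi := descends_quotient surj surj' ker ker' PsiE dePhi.
have LKE : LK = dets (fun i j => 'X_(e i j)).
  rewrite /LK map_dets; congr dets; apply: funext => i; apply: funext => j; exact: map_mpolyX.
have sRK : strongSAC RK.
  pose idm : {rmorphism {mpoly K[N]} -> {mpoly K[N]}} := GRing.RMorphism.clone _ _ idfun _.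
  have fid : flat idm.
    by apply: (loc_flat (T := mult_one _)); apply: iso_loc => // y; exists y.
  apply: (@strongSAC_determinantal s' t N e K _ RK idm f' einj st h2 fid (global_ci_mpoly N nQ gQ reg gs gk) surj').
  by move=> x; rewrite ker' LKE.
have sp : splitm (map_mx Psi (dif C 0)).
  apply: (sRK (mapc Psi C) (flat_exactc flPsi exC)) => [i|]; first exact: flat_extR.
  by exists k => i ki; apply: flat_ext0 (extC i ki).
have [_ [p [a na ->] ->] spl] := descends_split dePsi sp.
by apply: na; apply: sub; exact: spl.
Qed.

Local Close Scope ring_scope.

Theorem corollary4p11 (s t : nat) (hs : 0 < s) (hst : s <= t)
  (A : comNzRingType) (noethA : noetherian A)
  (ciA : forall (m : ideal A) (hm : maximal_ideal m),
     complete_intersection (localization_at (maximal_prime hm)))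
  (h2s : 2 * s <= t + 1) :
  SAC (determinantal_ring A s t s).
Proof.
case: s hs hst h2s => // s' _ st h2; have [nP _] := mpoly_noeth_gldim (s'.+1 * t) noethA.
apply: SAC_of_strongSAC; last exact: strongSAC_determinantal_ring.
exact: (noeth_surj (f := GRing.RMorphism.clone _ _ (qpi (determinantal_ideal A s'.+1 t s'.+1)) _) (@qpi_surj _ _) nP).
Qed.
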